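(* Let $p\in(1,\infty)$ and let $\gamma\in\mathcal{A}_{\mathrm{clamp}}$ with $P_0=P_1$ and $V_0=V_1$. Then $\gamma$ is a local minimizer of $\mathcal{B}_p$ in $\mathcal{A}_{\mathrm{clamp}}$ if and only if $\gamma$ is either a possibly multiply covered circle or a once covered figure-eight $p$-elastica.
   Context: Let $L>0$ and $P_0,P_1,V_0,V_1\in\mathbf{R}^2$ with $|P_0-P_1|<L$, $|V_0|=|V_1|=1$. Let $$\mathcal{A}_{\mathrm{clamp}}:=\{\gamma\in W^{2,p}(0,L;\mathbf{R}^2) : |\gamma'|\equiv1,\ \gamma(0)=P_0,\ \gamma(L)=P_1,\ \gamma'(0)=V_0,\ \gamma'(L)=V_1\},$$ with the topology induced by the $W^{2,p}$-norm. The $p$-bending energy is $\mathcal{B}_p[\gamma]:=\int_0^L|k|^p\,ds$, where $k$ is the signed curvature. A local minimizer of $\mathcal{B}_p$ in $X$ is an $x\in X$ with $\mathcal{B}_p[x]\le\mathcal{B}_p[x']$ for all $x'$ in some neighborhood of $x$ in $X$. A possibly multiply covered circle is a constant-speed closed curve of length $L$ traversing a round circle $m$ times in one direction, for some integer $m\ge1$ (an $m$-fold circle). Figure-eight $p$-elastica: for $q\in(0,1)$ put $$\mathrm{F}_{1,p}(x,q)=\int_0^x\frac{|\cos\theta|^{1-\frac2p}}{\sqrt{1-q^2\sin^2\theta}}\,d\theta,\qquad \mathrm{E}_{1,p}(x,q)=\int_0^x\sqrt{1-q^2\sin^2\theta}\,|\cos\theta|^{1-\frac2p}\,d\theta,$$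 $\mathrm{K}_{1,p}(q)=\mathrm{F}_{1,p}(\frac\pi2,q)$, $\mathrm{E}_{1,p}(q)=\mathrm{E}_{1,p}(\frac\pi2,q)$, let $\mathrm{am}_{1,p}(\cdot,q)$ be the inverse function of $\mathrm{F}_{1,p}(\cdot,q)$, and let $\mathrm{cn}_p(x,q)=|\cos\mathrm{am}_{1,p}(x,q)|^{\frac2p-1}\cos\mathrm{am}_{1,p}(x,q)$ (understood as $0$ where the cosine vanishes). Define the arclength parametrized curve $$\gamma_w(s,q)=\Big(2\mathrm{E}_{1,p}(\mathrm{am}_{1,p}(s,q),q)-s,\ -q\tfrac{p}{p-1}|\mathrm{cn}_p(s,q)|^{p-2}\mathrm{cn}_p(s,q)\Big),\quad s\in\mathbf{R},$$ where the second component is $0$ where $\mathrm{cn}_p=0$; its signed curvature is $2q\,\mathrm{cn}_p(s,q)$. Let $q^*(p)\in(0,1)$ be the unique solution $q$ of $2\mathrm{E}_{1,p}(q)=\mathrm{K}_{1,p}(q)$. For an integer $m\ge1$, an $m$-fold (or $m$ times covered) closed figure-eight $p$-elastica is a closed curve given, up to similarity and reparametrization, by $s\mapsto\gamma_w(s+s_0,q^*(p))$, $s\in[0,4m\,\mathrm{K}_{1,p}(q^*(p))]$, for some $s_0\in\mathbf{R}$; once covered means $m=1$. *)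

(* Defs.v *)
From mathcomp Require Import all_boot all_order all_algebra.
From mathcomp Require Import all_classical all_reals all_analysis.

Set Implicit Arguments.
Unset Strict Implicit.
Unset Printing Implicit Defensive.
Import Order.TTheory GRing.Theory Num.Theory.
Import numFieldNormedType.Exports.
Local Open Scope classical_set_scope.
Local Open Scope ring_scope.

(* The library norm on R * R is the sup norm; this is the Euclidean one. *)
Definition enorm (R : realType) (v : R * R) : R :=
  Num.sqrt (v.1 ^+ 2 + v.2 ^+ 2).

Definition det2 (R : realType) (v w : R * R) : R := v.1 * w.2 - v.2 * w.1.

(* ** Sobolev curves on the interval (0, L) *)

Definition test_function (R : realType) (L : R) (phi : R -> R) : Prop :=
  [/\ forall t, derivable phi t 1,
      continuous (derive1 phi),
      compact (closure [set t | phi t != 0]) &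
      closure [set t | phi t != 0] `<=` `]0, L[].

(* Test functions range over C^1_c(0, L), as is usual in one dimension
   (Brezis, Functional Analysis, Sobolev Spaces and PDE, Section 8.2). *)
Definition weak_derivative (R : realType) (L : R) (u v : R -> R) : Prop :=
  forall phi : R -> R, test_function L phi ->
    \int[lebesgue_measure]_(t in `]0, L[) (u t * derive1 phi t) =
    - \int[lebesgue_measure]_(t in `]0, L[) (v t * phi t).

Definition Lp_norm (R : realType) (L p : R) (f : R -> R) : \bar R :=
  'N[lebesgue_measure]_p%:E[EFin \o (f \_ `]0%R, L[)]%E.

Definition in_Lp (R : realType) (L p : R) (f : R -> R) : Prop :=
  measurable_fun `]0, L[ f /\ (Lp_norm L p f < +oo)%E.

(* An element u of W^{2,p}(0, L), for 1 < p, is stored as the continuous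
   representatives on [0, L] of u and of its weak derivative u', together with
   a representative of u''.  Continuity on the compact interval makes u and u'
   p-integrable.  The values of these functions outside [0, L], and those of
   u'' on null sets, are irrelevant to every notion below. *)
Record sobolev2 (R : realType) (L p : R) := Sobolev2 {
  sob0 : R -> R;
  sob1 : R -> R;
  sob2 : R -> R;
  sob0_continuous : {within `[0, L], continuous sob0};
  sob1_continuous : {within `[0, L], continuous sob1};
  sob2_Lp : in_Lp L p sob2;
  sob1_weak : weak_derivative L sob0 sob1;
  sob2_weak : weak_derivative L sob1 sob2 }.

(* W^{2,p}(0, L; R^2) *)
Definition curve (R : realType) (L p : R) : Type :=
  (sobolev2 L p * sobolev2 L p)%type.

Definition pos (R : realType) (L p : R) (g : curve L p) (t : R) : R * R :=
  (sob0 g.1 t, sob0 g.2 t).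

Definition vel (R : realType) (L p : R) (g : curve L p) (t : R) : R * R :=
  (sob1 g.1 t, sob1 g.2 t).

Definition acc (R : realType) (L p : R) (g : curve L p) (t : R) : R * R :=
  (sob2 g.1 t, sob2 g.2 t).

(* The W^{2,p}-norm of g - h. *)
Definition W2p_dist (R : realType) (L p : R) (g h : curve L p) : \bar R :=
  (Lp_norm L p (fun t => enorm (pos g t - pos h t)%R) +
   Lp_norm L p (fun t => enorm (vel g t - vel h t)%R) +
   Lp_norm L p (fun t => enorm (acc g t - acc h t)%R))%E.

Definition clamped (R : realType) (L p : R) (P0 P1 V0 V1 : R * R) :
    set (curve L p) :=
  [set g | [/\ forall t, 0 <= t <= L -> enorm (vel g t) = 1,
               pos g 0 = P0, pos g L = P1, vel g 0 = V0 & vel g L = V1]].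

Definition curvature (R : realType) (L p : R) (g : curve L p) (t : R) : R :=
  det2 (vel g t) (acc g t) / enorm (vel g t) ^+ 3.

(* The arclength element is ds = dt for the curves in [clamped]. *)
Definition bending_energy (R : realType) (L p : R) (g : curve L p) : \bar R :=
  (\int[lebesgue_measure]_(t in `]0%R, L[) (`|curvature g t| `^ p)%:E)%E.

Definition local_minimizer (R : realType) (L p : R)
    (E : curve L p -> \bar R) (X : set (curve L p)) (g : curve L p) : Prop :=
  X g /\ exists2 e : R, 0 < e &
    forall h, X h -> (W2p_dist g h < e%:E)%E -> (E g <= E h)%E.

(* ** Circles *)

Definition m_fold_circle (R : realType) (L : R) (m : nat) (c : R -> R * R) :
    Prop :=
  exists (o : R * R) (r a : R) (b : bool),
    [/\ 0 < r, 2 * pi * m%:R * r = L &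
        forall t, 0 <= t <= L ->
          let theta := a + (-1) ^+ b * (2 * pi * m%:R * t / L) in
          c t = o + (r * cos theta, r * sin theta)].

(* ** Figure-eight p-elastica *)

(* \int_0^x f, with the usual sign convention for x < 0 *)
Definition integral0 (R : realType) (f : R -> R) (x : R) : R :=
  if 0 <= x then \int[lebesgue_measure]_(t in `[0, x]) f t
  else - \int[lebesgue_measure]_(t in `[x, 0]) f t.

Definition F1 (R : realType) (p x q : R) : R :=
  integral0 (fun t => `|cos t| `^ (1 - 2 / p)
                      / Num.sqrt (1 - q ^+ 2 * sin t ^+ 2)) x.

Definition E1 (R : realType) (p x q : R) : R :=
  integral0 (fun t => Num.sqrt (1 - q ^+ 2 * sin t ^+ 2)
                      * `|cos t| `^ (1 - 2 / p)) x.

Definition K1c (R : realType) (p q : R) : R := F1 p (pi / 2) q.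

Definition E1c (R : realType) (p q : R) : R := E1 p (pi / 2) q.

(* inverse function of F1 p ^~ q, a bijection of R for 1 < p and 0 < q < 1 *)
Definition am1 (R : realType) (p x q : R) : R :=
  xget 0 [set theta | F1 p theta q = x].

(* In cnp and gamma_w the factors cos _ and cnp _ make the products vanish where
   the base of the power is 0, whatever the sign of the exponent.  In F1 and E1
   the power of |cos t| is 0 at the zeros of cos when p < 2, on a null set. *)
Definition cnp (R : realType) (p x q : R) : R :=
  `|cos (am1 p x q)| `^ (2 / p - 1) * cos (am1 p x q).

Definition gamma_w (R : realType) (p s q : R) : R * R :=
  (2 * E1 p (am1 p s q) q - s,
   - (q * (p / (p - 1)) * (`|cnp p s q| `^ (p - 2) * cnp p s q))).

(* the unique q in (0, 1) with 2 E1c p q = K1c p q *)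
Definition qstar (R : realType) (p : R) : R :=
  xget 0 [set q | 0 < q < 1 /\ 2 * E1c p q = K1c p q].

Definition similarity (R : realType) (T : R * R -> R * R) : Prop :=
  exists2 r : R, 0 < r &
    forall v w, enorm (T v - T w) = r * enorm (v - w).

(* A reparametrization phi is a homeomorphism between the parameter
   intervals. *)
Definition m_fold_figure_eight (R : realType) (L p : R) (m : nat)
    (c : R -> R * R) : Prop :=
  let q := qstar p in
  exists (T : R * R -> R * R) (phi : R -> R) (s0 : R),
    [/\ similarity T,
        {within `[0, L], continuous phi},
        set_bij `[0, L] `[0, 4 * m%:R * K1c p q] phi &
        forall t, 0 <= t <= L -> c t = T (gamma_w p (phi t + s0) q)].

(* Main.v *)
(* Idea.  Writing the velocity as (cos th, sin th), a clamped curve with P0 = P1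
   is an angle th with int cos th = int sin th = 0 and its energy is int |th'|^p.

   A local minimizer satisfies the Euler-Lagrange equation, which says that the
   signed power |k|^(p-2) k of the curvature is an affine function of the
   position; with w this power and b a rotated angle, (b, w) solves a pendulum
   equation.  Without gravity k is constant.  Otherwise the closing condition
   excludes rotating pendulums, and an oscillating one is the curve gamma_w up to
   scaling; closing then forces 2 E = K, and the number n of periods is 1: for
   n > 1, shifting the curvature cyclically within one period keeps the energy
   and the closing condition, hence produces local minimizers whose curvature
   is discontinuous.

   Conversely, nearby clamped curves have the same total rotation.  For circles,
   Jensen's inequality concludes.  For the figure eight the rotation is 0, and any
   closed th of rotation 0 oscillates over a half range u > pi/2; Young's
   inequality bounds the energy below by the action of the pendulum of amplitude
   u.  Substituting sin(x/2) = q sin(phi), the scaled action is log-convex in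
   1/q^2, with a critical point exactly at 2 E = K. *)
From mathcomp Require Import all_boot all_order all_algebra.
From mathcomp Require Import all_classical all_reals all_analysis.
From mathcomp Require Import measurable_realfun ring lra.
Require Import Defs.
Set Implicit Arguments.
Unset Strict Implicit.
Unset Printing Implicit Defensive.
Import Order.TTheory GRing.Theory Num.Theory.
Import numFieldNormedType.Exports.
Local Open Scope classical_set_scope.
Local Open Scope ring_scope.

(** * Integrals on segments and derivatives *)

Section Integral.
Context {R : realType}.
Implicit Types (f g : R -> R) (s t : R).
Notation mu := (@lebesgue_measure R).

(** The closing condition is nonlinear, so a variation of the curvature that is admissible to first
    order leaves the class of closed curves. It is corrected by two fixed variations whose
    coefficients, of second order, solve a fixed point problem; that the constraint is regular rests
    on the fact that a closed curve is not straight. For [p < 2] the energy is not twice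
    differentiable, and the first variation is extracted from convexity and dominated convergence.
    The pendulum has right-hand side [spow (p - 1)^-1], not Lipschitz at 0 for [p > 2], so
    uniqueness comes from the first integral, which makes the equation separable in the angle or in
    the momentum. For [p < 2] the integrands of [F1] and [E1] are unbounded at the zeros of the
    cosine, hence the calculus with isolated singular points. In the converse, nearness only fixes
    the total rotation: circles and figure eights minimize among all closed curves with the same
    boundary angles. A figure eight is given up to a similarity and a homeomorphism of parameters,
    so its unit speed form has to be recovered from distances alone. *)

Definition itg s t f : R := \int[mu]_(x in `[s, t]) f x.
Definition itb s t f : Prop := mu.-integrable `[s, t] (EFin \o f).

Lemma itb_sub s t s' t' f : s <= s' -> t' <= t -> itb s t f -> itb s' t' f.
Proof.
move=> ss tt; apply: integrableS => //.
by apply: subset_itv; rewrite bnd_simp.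
Qed.

Lemma itb_cont s t f : continuous f -> itb s t f.
Proof.
move=> cf; apply: continuous_compact_integrable; first exact: segment_compact.
exact: continuous_subspaceT.
Qed.

Lemma itb_within s t f : {within `[s, t], continuous f} -> itb s t f.
Proof. by move=> cf; apply: continuous_compact_integrable => //; exact: segment_compact. Qed.

Lemma itb_cst s t c : itb s t (fun=> c).
Proof. by apply: itb_cont => x; exact: cvg_cst. Qed.

Lemma itb_meas s t f : itb s t f -> measurable_fun `[s, t] f.
Proof. by move=> /measurable_int/measurable_EFinP. Qed.

Lemma itbD s t f g : itb s t f -> itb s t g -> itb s t (fun x => f x + g x).
Proof. by move=> hf hg; have := integrableD _ hf hg; apply. Qed.

Lemma itbZ s t c f : itb s t f -> itb s t (fun x => c * f x).
Proof. by move=> hf; have := integrableZl _ c hf; apply. Qed.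

Lemma eq_itb s t f g : (forall x, s <= x <= t -> f x = g x) -> itb s t f -> itb s t g.
Proof.
move=> e; apply: eq_integrable => // x; rewrite inE/= in_itv/= => /e.
by rewrite /comp => ->.
Qed.

Lemma itbN s t f : itb s t f -> itb s t (fun x => - f x).
Proof. by move=> /(itbZ (-1)); apply: eq_itb => x _; rewrite mulN1r. Qed.

Lemma itbB s t f g : itb s t f -> itb s t g -> itb s t (fun x => f x - g x).
Proof. by move=> hf hg; apply: itbD => //; exact: itbN. Qed.

Lemma itb_le s t f g : measurable_fun `[s, t] f ->
  (forall x, s <= x <= t -> `|f x| <= g x) -> itb s t g -> itb s t f.
Proof.
move=> mf fg; apply: le_integrable => //; first exact/measurable_EFinP.
move=> x /=; rewrite in_itv/= => /fg h.
by rewrite lee_fin (le_trans h)// ler_norm.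
Qed.

Lemma itb_abs s t f : itb s t f -> itb s t (fun x => `|f x|).
Proof. by move=> hf; have := integrable_abse hf; apply. Qed.

Lemma itbM s t c f g : itb s t f -> measurable_fun `[s, t] g ->
  (forall x, s <= x <= t -> `|g x| <= c) -> itb s t (fun x => g x * f x).
Proof.
move=> hf mg gc; apply: (@itb_le _ _ _ (fun x => c * `|f x|)).
- by apply: measurable_funM => //; exact: itb_meas.
- by move=> x /gc h; rewrite normrM ler_wpM2r.
- by apply/itbZ/itb_abs.
Qed.

Lemma itb_gt s t f : t < s -> itb s t f.
Proof.
move=> ts; apply: (@eq_itb _ _ (fun=> 0)); last exact: itb_cst.
by move=> x /andP[sx xt]; have := lt_le_trans ts (le_trans sx xt); rewrite ltxx.
Qed.

Lemma cont_bounded s t g : continuous g ->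
  exists2 c, 0 <= c & forall x, s <= x <= t -> `|g x| <= c.
Proof.
move=> cg; have [st|ts] := leP s t; last first.
  exists 0 => // x /andP[sx xt].
  by have := lt_le_trans ts (le_trans sx xt); rewrite ltxx.
have cn : {within `[s, t], continuous (fun x => `|g x|)}.
  by apply: continuous_subspaceT => x; apply: (@continuous_comp _ _ _ g (@Num.norm _ R)); [exact: cg|exact: norm_continuous].
have [c cs hc] := EVT_max st cn.
by exists (`|g c|) => // x sx; apply: hc; rewrite in_itv.
Qed.

Lemma cont_measurable s t g : continuous g -> measurable_fun `[s, t] g.
Proof. by move=> cg; apply: measurable_funTS; exact: continuous_measurable_fun. Qed.

Lemma itb_contM s t f g : itb s t f -> continuous g -> itb s t (fun x => g x * f x).
Proof.
move=> hf cg; have [c _ hc] := cont_bounded s t cg.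
by apply: (@itbM _ _ c) => //; exact: cont_measurable.
Qed.

Lemma itgD s t f g : itb s t f -> itb s t g ->
  itg s t (fun x => f x + g x) = itg s t f + itg s t g.
Proof. by move=> hf hg; exact: RintegralD. Qed.

Lemma itgB s t f g : itb s t f -> itb s t g ->
  itg s t (fun x => f x - g x) = itg s t f - itg s t g.
Proof. by move=> hf hg; exact: RintegralB. Qed.

Lemma itgZ s t c f : itb s t f -> itg s t (fun x => c * f x) = c * itg s t f.
Proof. by move=> hf; exact: RintegralZl. Qed.

Lemma itgN s t f : itb s t f -> itg s t (fun x => - f x) = - itg s t f.
Proof.
move=> hf; rewrite -mulN1r -itgZ//; apply: eq_Rintegral => x _.
by rewrite mulN1r.
Qed.

Lemma eq_itg s t f g : (forall x, s <= x <= t -> f x = g x) -> itg s t f = itg s t g.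
Proof. by move=> e; apply: eq_Rintegral => x; rewrite inE/= in_itv/= => /e. Qed.

Lemma le_itg s t f g : itb s t f -> itb s t g ->
  (forall x, s <= x <= t -> f x <= g x) -> itg s t f <= itg s t g.
Proof. by move=> hf hg h; apply: le_Rintegral => // x /=; rewrite in_itv/= => /h. Qed.

Lemma itg_ge0 s t f : (forall x, s <= x <= t -> 0 <= f x) -> 0 <= itg s t f.
Proof. by move=> h; apply: Rintegral_ge0 => // x /=; rewrite in_itv/= => /h. Qed.

Lemma itg_abs s t f : itb s t f -> `|itg s t f| <= itg s t (fun x => `|f x|).
Proof. by move=> hf; exact: le_normr_Rintegral. Qed.

Lemma itg_cst s t c : s <= t -> itg s t (fun=> c) = c * (t - s).
Proof.
move=> st; rewrite /itg Rintegral_cst//; congr (_ * _).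
rewrite [X in fine X](_ : _ = (t - s)%:E)//.
have := lebesgue_measure_itv `[s, t]; rewrite /= lte_fin => ->.
by move: st; rewrite le_eqVlt => /predU1P[->|->]; rewrite ?ltxx ?subrr.
Qed.

Lemma itgxx s f : itg s s f = 0.
Proof. by rewrite /itg set_itv1 Rintegral_set1. Qed.

Lemma itg_split s t r f : s <= t -> t <= r -> itb s r f ->
  itg s r f = itg s t f + itg t r f.
Proof.
move=> st tr hf; have := @Rintegral_itvB R f (BLeft s) (BRight r) t hf.
rewrite !bnd_simp => /(_ st tr); rewrite /itg => /eqP.
rewrite subr_eq => /eqP ->; rewrite addrC; congr (_ + _).
rewrite Rintegral_itv_obnd_cbnd//.
apply: integrableS hf => //; apply: subset_itv; by rewrite bnd_simp.
Qed.

Lemma itg_gt t s f : t < s -> itg s t f = 0.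
Proof. by move=> ts; rewrite /itg set_itv_ge ?Rintegral_set0// bnd_simp -ltNge. Qed.

Lemma itg_bound s t c f : s <= t -> itb s t f -> (forall x, s <= x <= t -> `|f x| <= c) ->
  `|itg s t f| <= c * (t - s).
Proof.
move=> st hf hc; rewrite -itg_cst//; apply: (le_trans (itg_abs hf)).
by apply: le_itg => //; [exact: itb_abs|exact: itb_cst].
Qed.

(** The exceptional set is carried explicitly: several almost everywhere equalities combine by
    taking unions, and off the union they are used by plain rewriting. *)
Definition aeq s t f g : Prop := exists N : set R,
  [/\ measurable N, mu N = 0%E & forall x, s <= x <= t -> ~ N x -> f x = g x].

Lemma aeq_ae s t f g : aeq s t f g ->
  {ae mu, forall x, `[s, t]%classic x -> (f x)%:E = (g x)%:E}.
Proof.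
move=> [N [mN N0 h]]; exists N; split => // x /= hx.
by apply: contrapT => nN; apply: hx; rewrite in_itv/= => sxt; rewrite h.
Qed.

Lemma itg_ae s t f g : itb s t f -> itb s t g -> aeq s t f g -> itg s t f = itg s t g.
Proof.
move=> hf hg /aeq_ae h; rewrite /itg /Rintegral; congr fine.
by apply: ae_eq_integral => //; exact: (measurable_int mu).
Qed.

Lemma itb_ae s t f g : measurable_fun `[s, t] g -> aeq s t f g -> itb s t f -> itb s t g.
Proof.
move=> mg /aeq_ae h hf.
apply/integrableP; split; first exact/measurable_EFinP.
move/integrableP : hf => [mf].
suff -> : (\int[mu]_(x in `[s, t]) `|(EFin \o g) x| = \int[mu]_(x in `[s, t]) `|(EFin \o f) x|)%E by [].
apply: ae_eq_integral => //.
- by apply: measurableT_comp => //; exact/measurable_EFinP.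
- exact: measurableT_comp.
- move: h => [N [mN N0 hN]]; exists N; split => // x /= hx; apply: hN => /= hx2.
  by apply: hx => /hx2[->].
Qed.

Lemma aeq_sym s t f g : aeq s t f g -> aeq s t g f.
Proof. by move=> [N [? ? h]]; exists N; split => // x sx /h ->. Qed.

Lemma eq_aeq s t f g : (forall x, s <= x <= t -> f x = g x) -> aeq s t f g.
Proof. move=> h; by exists set0; split; [exact: measurable0|exact: measure0|move=> x /h]. Qed.

Lemma aeq_trans s t f g h : aeq s t f g -> aeq s t g h -> aeq s t f h.
Proof.
move=> [N [mN N0 hN]] [M [mM M0 hM]]; exists (N `|` M); split.
- exact: measurableU.
- by rewrite null_set_setU.
- by move=> x sx /not_orP[nN nM]; rewrite hN// hM.
Qed.

Lemma aeq_map s t f f' (F : R -> R -> R) : aeq s t f f' ->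
  aeq s t (fun x => F x (f x)) (fun x => F x (f' x)).
Proof. by move=> [N [mN N0 hN]]; exists N; split => // x sx nN; rewrite hN. Qed.

Lemma itg_eq0 s t f : itb s t f -> (forall x, s <= x <= t -> 0 <= f x) ->
  itg s t f = 0 -> aeq s t f (fun=> 0).
Proof.
move=> hf f0 h0.
have h : (\int[mu]_(x in `[s, t]) `|(f x)%:E| = 0)%E.
  transitivity (\int[mu]_(x in `[s, t]) (f x)%:E)%E.
    by apply: eq_integral => x; rewrite inE/= in_itv/= => /f0 h; rewrite ger0_norm.
  rewrite -[LHS]fineK; last exact: integrable_fin_num.
  by congr EFin; exact: h0.
have [N [mN N0 hN]] := proj1 (ae_eq_integral_abs mu (measurable_itv `[s, t]) (measurable_int mu hf)) h.
exists N; split => // x sx nN; apply: contrapT => fx; apply: nN; apply: hN => /= hx.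
by apply: fx; move: hx; rewrite in_itv/= => /(_ sx)[].
Qed.

Lemma aeq_restrict s t f : aeq s t f (f \_ `]s, t[).
Proof.
exists [set s; t]; split.
- by apply: measurableU; exact: measurable_set1.
- rewrite null_set_setU//; exact: lebesgue_measure_set1.
- move=> x /andP[]; rewrite !le_eqVlt patchE => /predU1P[-> + h|sx /predU1P[-> h|xt _]].
  + by exfalso; apply: h; left.
  + by exfalso; apply: h; right.
  + by rewrite mem_set//= in_itv/= sx xt.
Qed.

End Integral.

(** * Continuous induction, mean values and calculus rules on the line *)

Section Continuity.
Context {R : realType}.
Implicit Types (f g u v k : R -> R) (a b s t x y : R).

Lemma cont_ed f x : {for x, continuous f} <->
  forall e, 0 < e -> exists2 d, 0 < d & forall y, `|y - x| < d -> `|f y - f x| < e.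
Proof.
split=> [cf e e0|h].
  have /cvgrPdist_lt/(_ e e0)[d /= d0 hd] := cf.
  exists d => // y yx; rewrite distrC; apply: hd => /=.
  by rewrite distrC.
apply/cvgrPdist_lt => e e0; have [d d0 hd] := h e e0.
exists d => //= y yx; rewrite distrC; apply: hd; by rewrite distrC.
Qed.

(** Continuous induction: the supremum of the [t] with [P a t] satisfies [P] itself by the local
    hypothesis, and could be passed if it were below [b]. It takes the place of partitions and
    compactness wherever a local estimate is additive over intervals. *)
Lemma creep a b (P : R -> R -> Prop) : a <= b ->
  (forall x, a <= x <= b -> exists2 d, 0 < d & forall s t, a <= s -> s <= x ->
     x <= t -> t <= b -> x - d < s -> t < x + d -> P s t) ->
  (forall r s t, a <= r -> r <= s -> s <= t -> t <= b -> P r s -> P s t -> P r t) ->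
  P a b.
Proof.
move=> ab loc tr.
pose S := [set t | a <= t <= b /\ P a t].
have Sa : S a.
  split; first by rewrite lexx ab.
  by have [|d d0] := loc a; [rewrite lexx ab|apply => //; lra].
have ubS : has_ubound S by exists b => t [/andP[]].
have hS : has_sup S by split => //; exists a.
set c := sup S.
have ac : a <= c by apply: ub_le_sup.
have cb : c <= b by apply: ge_sup; [exists a|move=> t [/andP[]]].
have [|d d0 hd] := loc c; first by rewrite ac cb.
have [s [/andP[as_ sb] Ps] sc] := sup_adherent d0 hS.
have sc' : s <= c by apply: ub_le_sup => //; split => //; rewrite as_ sb.
pose t := Num.min b (c + d / 2).
have ct : c <= t by rewrite /t le_min cb/=; lra.
have tb : t <= b by rewrite /t ge_min lexx.
have td : t < c + d by rewrite /t gt_min; apply/orP; right; lra.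
have Pst : P s t by apply: hd.
have Pt : P a t by apply: (tr a s t) => //; exact: le_trans ct.
have : t <= c by apply: ub_le_sup => //; split => //; rewrite tb andbT; exact: le_trans ct.
rewrite /t ge_min => /orP[bc|]; last lra.
by move: Pt; rewrite /t min_l//; lra.
Qed.

(** Nearest point of [[a, b]]. Composition with it turns a function continuous on the segment into
    one continuous on the line, constant on either side. *)
Definition pr a b t := Num.max a (Num.min t b).

Lemma pr_id a b t : a <= t <= b -> pr a b t = t.
Proof. by move=> /andP[at_ tb]; rewrite /pr min_l// max_r. Qed.

Lemma pr_itv a b t : a <= b -> a <= pr a b t <= b.
Proof. by move=> ab; rewrite /pr le_max lexx/= ge_max ab ge_min lexx orbT. Qed.

Lemma pr_lip a b s t : `|pr a b s - pr a b t| <= `|s - t|.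
Proof.
have h1 := ler_norm (s - t); have h2 := ler_norm (- (s - t)).
rewrite normrN in h2.
rewrite ler_norml /pr.
move: h1 h2; set n := `|s - t|; clearbody n => h1 h2.
by case: (leP s b) => ?; case: (leP t b) => ?; apply/andP; split; case: (leP a s) => ?; case: (leP a t) => ?; case: (leP a b) => ?; lra.
Qed.

Lemma cont_pr a b f : a <= b -> {within `[a, b], continuous f} ->
  continuous (fun t => f (pr a b t)).
Proof.
move=> ab /subspace_continuousP cf x; apply/cont_ed => e e0.
have hx : [set` `[a, b]] (pr a b x) by rewrite /= in_itv/=; exact: pr_itv.
have /cvgrPdist_lt/(_ e e0) := cf _ hx.
rewrite near_withinE => -[d /= d0 hd]; exists d => // y yx.
rewrite distrC; apply: hd => /=; last by rewrite in_itv/=; exact: pr_itv.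
by rewrite distrC (le_lt_trans (pr_lip _ _ _ _)).
Qed.

Lemma ivt a b f (v : R) : a <= b -> continuous f ->
  Num.min (f a) (f b) <= v <= Num.max (f a) (f b) -> exists2 c, a <= c <= b & f c = v.
Proof.
move=> ab cf hv; have [c + fc] := IVT ab (continuous_subspaceT cf) hv.
by rewrite in_itv/= => h; exists c.
Qed.

(** By the intermediate value theorem all points between [u s] and [u t] are values of [u] on
    [[s, t]], so [F] is differentiable there and the mean point has the form [u r]. The function [u]
    is merely continuous, as the chain rule for absolutely continuous functions demands. *)
Lemma mvt_range s t u (F F' : R -> R) : s <= t -> continuous u ->
  (forall x, s <= x <= t -> is_derive (u x) 1 F (F' (u x))) ->
  exists2 r, s <= r <= t & F (u t) - F (u s) = F' (u r) * (u t - u s).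
Proof.
move=> st cu dF.
have key a b : a < b -> Num.min (u s) (u t) = a -> Num.max (u s) (u t) = b ->
    exists2 r, s <= r <= t & F b - F a = F' (u r) * (b - a).
  move=> ab ea eb.
  have h x : a <= x <= b -> exists2 r, s <= r <= t & u r = x.
    by rewrite -ea -eb => /(ivt st cu).
  have dr x : x \in `[a, b] -> is_derive x 1 F (F' x).
    by rewrite in_itv/= => /h[r /dF + <-].
  have cF : {within `[a, b], continuous F}.
    apply: derivable_within_continuous => x /dr hx; exact: ex_derive.
  have dr' x : x \in `]a, b[ -> is_derive x 1 F (F' x).
    by move=> xab; apply: dr; apply: subset_itv_oo_cc.
  have [x xab e] := @MVT _ F F' a b ab dr' cF.
  have [|r sr ux] := h x; first by have := subset_itv_oo_cc xab; rewrite in_itv.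
  by exists r => //; rewrite ux.
have [us|us|us] := ltgtP (u s) (u t).
- by apply: key => //; [rewrite min_l// ltW|rewrite max_r// ltW].
- have [|//|//|r sr e] := key (u t) (u s); rewrite ?min_r ?max_l ?ltW//.
  exists r => //; lra.
- by exists s; rewrite ?lexx ?st// us !subrr mulr0.
Qed.

Lemma dcst x (c : R) : is_derive x 1 (fun=> c : R) (0 : R).
Proof. exact: is_derive_cst. Qed.

Lemma did x : is_derive x 1 (fun y => y : R) (1 : R).
Proof. exact: is_derive_id. Qed.

Lemma dD x f g (a b : R) : is_derive x 1 f a -> is_derive x 1 g b ->
  is_derive x 1 (fun y => f y + g y) (a + b).
Proof. by move=> df dg; exact: is_deriveD. Qed.

Lemma dB x f g (a b : R) : is_derive x 1 f a -> is_derive x 1 g b ->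
  is_derive x 1 (fun y => f y - g y) (a - b).
Proof. by move=> df dg; exact: is_deriveB. Qed.

Lemma dN x f (a : R) : is_derive x 1 f a -> is_derive x 1 (fun y => - f y) (- a).
Proof. by move=> df; exact: is_deriveN. Qed.

Lemma dM x f g (a b : R) : is_derive x 1 f a -> is_derive x 1 g b ->
  is_derive x 1 (fun y => f y * g y) (a * g x + f x * b).
Proof.
move=> df dg; have h := @is_deriveM _ _ f g x 1 a b df dg.
by apply: (is_derive_eq h); rewrite /GRing.scale/=; ring.
Qed.

Lemma dZ x f (c a : R) : is_derive x 1 f a -> is_derive x 1 (fun y => c * f y) (c * a).
Proof. by move=> df; apply: (is_derive_eq (dM (dcst x c) df)); rewrite mul0r add0r. Qed.

Lemma dsqr x f (a : R) : is_derive x 1 f a -> is_derive x 1 (fun y => f y ^+ 2) (2 * f x * a).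
Proof. by move=> df; apply: (is_derive_eq (dM df df)); ring. Qed.

Lemma dcomp x f g (a b : R) : is_derive x 1 f a -> is_derive (f x) 1 g b ->
  is_derive x 1 (fun y => g (f y)) (b * a).
Proof. by move=> df dg; exact: (@is_derive1_comp _ g f x b a dg df). Qed.

Lemma dsin x f (a : R) : is_derive x 1 f a -> is_derive x 1 (fun y => sin (f y)) (cos (f x) * a).
Proof. by move=> df; apply: dcomp => //; exact: is_derive_sin. Qed.

Lemma dcos x f (a : R) : is_derive x 1 f a -> is_derive x 1 (fun y => cos (f y)) (- sin (f x) * a).
Proof. by move=> df; apply: dcomp => //; exact: is_derive_cos. Qed.

Lemma dV x f (a : R) : f x != 0 -> is_derive x 1 f a ->
  is_derive x 1 (fun y => (f y)^-1) (- a / f x ^+ 2).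
Proof.
move=> fx df; have h := @is_deriveV _ f x a 1 fx df.
by apply: (is_derive_eq h); rewrite /GRing.scale/=; field.
Qed.

Lemma dsqrt x f (a : R) : 0 < f x -> is_derive x 1 f a ->
  is_derive x 1 (fun y => Num.sqrt (f y)) (a / (2 * Num.sqrt (f x))).
Proof.
move=> fx df; have h := is_derive1_sqrt fx.
by apply: (is_derive_eq (dcomp df h)); rewrite mulrC.
Qed.

Lemma d_cont x f (a : R) : is_derive x 1 f a -> {for x, continuous f}.
Proof. by move=> df; apply/differentiable_continuous/derivable1_diffP; exact: ex_derive. Qed.

Lemma ccst (c : R) : continuous (fun _ : R => c).
Proof. by move=> x; exact: cvg_cst. Qed.

Lemma cid : continuous (fun y : R => y).
Proof. by move=> x; exact: cvg_id. Qed.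

Lemma cD f g : continuous f -> continuous g -> continuous (fun y => f y + g y).
Proof. by move=> cf cg x; apply: cvgD; [exact: cf|exact: cg]. Qed.

Lemma cN f : continuous f -> continuous (fun y => - f y).
Proof. by move=> cf x; apply: cvgN; exact: cf. Qed.

Lemma cB f g : continuous f -> continuous g -> continuous (fun y => f y - g y).
Proof. by move=> cf cg x; apply: cvgB; [exact: cf|exact: cg]. Qed.

Lemma cM f g : continuous f -> continuous g -> continuous (fun y => f y * g y).
Proof. by move=> cf cg x; apply: cvgM; [exact: cf|exact: cg]. Qed.

Lemma cZ (c : R) f : continuous f -> continuous (fun y => c * f y).
Proof. by move=> cf; apply: cM => //; exact: ccst. Qed.

Lemma cX f n : continuous f -> continuous (fun y => f y ^+ n).
Proof.
move=> cf x; apply: (@continuous_comp _ _ _ f (fun y => y ^+ n)); first exact: cf.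
exact: exprn_continuous.
Qed.

Lemma ccomp f g : continuous f -> continuous g -> continuous (fun y => g (f y)).
Proof. by move=> cf cg x; apply: (@continuous_comp _ _ _ f g); [exact: cf|exact: cg]. Qed.

Lemma csin f : continuous f -> continuous (fun y => sin (f y)).
Proof. by move=> cf; apply: ccomp => //; exact: continuous_sin. Qed.

Lemma ccos f : continuous f -> continuous (fun y => cos (f y)).
Proof. by move=> cf; apply: ccomp => //; exact: continuous_cos. Qed.

Lemma csqrt f : continuous f -> continuous (fun y => Num.sqrt (f y)).
Proof. by move=> cf; apply: ccomp => //; exact: sqrt_continuous. Qed.

Lemma cnorm f : continuous f -> continuous (fun y => `|f y|).
Proof. by move=> cf; apply: (ccomp cf); exact: norm_continuous. Qed.

End Continuity.

(** * Absolutely continuous functions *)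

Section AbsolutelyContinuous.
Context {R : realType}.
Implicit Types (f g u v k : R -> R) (a b s t x y : R).

(* [u] is globally continuous; values outside [a, b] carry no information *)
Definition AC a b u k : Prop :=
  [/\ continuous u, measurable_fun setT k, itb a b k &
      forall s t, a <= s -> s <= t -> t <= b -> u t - u s = itg s t k].

Lemma AC_cont a b u k : AC a b u k -> continuous u. Proof. by case. Qed.
Lemma AC_meas a b u k : AC a b u k -> measurable_fun setT k. Proof. by case. Qed.
Lemma AC_itb a b u k : AC a b u k -> itb a b k. Proof. by case. Qed.
Lemma AC_int a b u k : AC a b u k ->
  forall s t, a <= s -> s <= t -> t <= b -> u t - u s = itg s t k.
Proof. by case. Qed.

Lemma AC_itb_sub a b u k s t : AC a b u k -> a <= s -> t <= b -> itb s t k.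
Proof. by move=> [_ _ + _]; move=> h as_ tb; apply: itb_sub h. Qed.

Lemma AC_sub a b u k s t : AC a b u k -> a <= s -> t <= b -> AC s t u k.
Proof.
move=> H as_ tb; split; [exact: AC_cont H|exact: AC_meas H|exact: AC_itb_sub H _ _|].
by move=> x y sx xy yt; apply: (AC_int H) => //; [exact: le_trans sx|exact: le_trans tb].
Qed.

(** The projection [pr] makes the primitive continuous on the whole line, as [AC] asks. *)
Definition prim a b k t := itg a (pr a b t) k.

Lemma prim_E a b k t : a <= t <= b -> prim a b k t = itg a t k.
Proof. by move=> h; rewrite /prim pr_id. Qed.

Lemma AC_prim a b c k : a <= b -> measurable_fun setT k -> itb a b k ->
  AC a b (fun t => c + prim a b k t) k.
Proof.
move=> ab mk ik; split => //.
- move=> x; apply: cvgD; first exact: cvg_cst.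
  apply: (@cont_pr _ a b (fun t => itg a t k)) => //.
  by have := parameterized_integral_continuous ab ik; apply.
- move=> s t as_ st tb; have sb := le_trans st tb; have at_ := le_trans as_ st.
  rewrite !prim_E ?as_ ?sb ?at_ ?tb// (@itg_split _ a s t)//; first by ring.
  exact: itb_sub ik.
Qed.

Lemma AC_eqk a b u k k' : measurable_fun setT k' -> aeq a b k k' ->
  AC a b u k -> AC a b u k'.
Proof.
move=> mk' e [cu mk ik h]; split => //.
  by apply: (itb_ae _ e) => //; exact: measurable_funTS.
move=> s t as_ st tb; rewrite h//; apply: itg_ae.
- exact: itb_sub ik.
- apply: (itb_sub as_ tb); apply: (itb_ae _ e) => //; exact: measurable_funTS.
- have [N [mN N0 hN]] := e; exists N; split => // x /andP[sx xt]; apply: hN.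
  by rewrite (le_trans as_)// (le_trans xt).
Qed.

Lemma AC_eqf a b u v k : continuous v -> (forall t, a <= t <= b -> u t = v t) ->
  AC a b u k -> AC a b v k.
Proof.
move=> cv e [cu mk ik h]; split => // s t as_ st tb.
have sb := le_trans st tb; have at_ := le_trans as_ st.
by rewrite -(e t) ?at_ ?tb// -(e s) ?as_ ?sb// h.
Qed.

Lemma AC_cst a b c : AC a b (fun=> c) (fun=> 0).
Proof.
split; [by move=> x; exact: cvg_cst|exact: measurable_cst|exact: itb_cst|].
by move=> s t _ st _; rewrite subrr itg_cst// mul0r.
Qed.

Lemma AC_D a b u v k l : AC a b u k -> AC a b v l ->
  AC a b (fun t => u t + v t) (fun t => k t + l t).
Proof.
move=> H H'; split.
- by move=> x; apply: cvgD; [exact: (AC_cont H)|exact: (AC_cont H')].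
- by apply: measurable_funD; [exact: (AC_meas H)|exact: (AC_meas H')].
- by apply: itbD; [exact: (AC_itb H)|exact: (AC_itb H')].
- move=> s t as_ st tb; rewrite itgD; [|exact: AC_itb_sub H _ _|exact: AC_itb_sub H' _ _].
  by rewrite -(AC_int H)// -(AC_int H')//; ring.
Qed.

Lemma AC_Z a b c u k : AC a b u k -> AC a b (fun t => c * u t) (fun t => c * k t).
Proof.
move=> H; split.
- by move=> x; apply: cvgM; [exact: cvg_cst|exact: (AC_cont H)].
- by apply: measurable_funM; [exact: measurable_cst|exact: (AC_meas H)].
- exact: itbZ (AC_itb H).
- by move=> s t as_ st tb; rewrite itgZ -?(AC_int H)//; [ring|exact: AC_itb_sub H _ _].
Qed.

Lemma AC_N a b u k : AC a b u k -> AC a b (fun t => - u t) (fun t => - k t).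
Proof.
move=> /(AC_Z (-1)).
by under eq_fun do rewrite mulN1r; under [in X in _ X -> _]eq_fun do rewrite mulN1r.
Qed.

Lemma AC_B a b u v k l : AC a b u k -> AC a b v l ->
  AC a b (fun t => u t - v t) (fun t => k t - l t).
Proof. by move=> H /AC_N; exact: AC_D. Qed.

(** Near each point the mean value theorem bounds the error of the chain rule by a small multiple of
    the integral of [|k|]. This bound is additive over adjacent intervals, so [creep] spreads it,
    and the multiple is arbitrary. *)
Lemma AC_comp a b u k (F F' : R -> R) : AC a b u k -> a <= b ->
  (forall t, a <= t <= b -> is_derive (u t) 1 F (F' (u t))) ->
  continuous (fun t => F (u t)) -> continuous (fun t => F' (u t)) ->
  AC a b (fun t => F (u t)) (fun t => F' (u t) * k t).
Proof.
move=> H ab dF cF cF'; have mk := AC_meas H.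
have ifk : itb a b (fun t => F' (u t) * k t) by apply: itb_contM => //; exact: AC_itb H.
split => //; first by apply: measurable_funM => //; exact: continuous_measurable_fun.
move=> s0 t0 as0 s0t0 t0b.
apply/eqP; rewrite -subr_eq0 -normr_le0; apply/ler_addgt0Pl => e e0; rewrite addr0.
pose I := itg a b (fun x => `|k x|).
have I0 : 0 <= I by apply: itg_ge0 => *; exact: normr_ge0.
(* Chosen so that [2 * e1 * I <= e]; the summand 1 covers [I = 0]. *)
pose e1 := e / (2 * (I + 1)).
have e10 : 0 < e1 by rewrite /e1 divr_gt0//; lra.
pose P s t := `|F (u t) - F (u s) - itg s t (fun x => F' (u x) * k x)| <=
  2 * e1 * itg s t (fun x => `|k x|).
have subI s t x : a <= s -> t <= b -> s <= x <= t -> a <= x <= b.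
  by move=> as_ tb /andP[sx xt]; rewrite (le_trans as_)// (le_trans xt).
have iak s t : a <= s -> t <= b -> itb s t (fun x => `|k x|).
  by move=> as_ tb; apply/itb_abs; exact: AC_itb_sub H _ _.
have : P s0 t0.
  apply: (@creep _ s0 t0 P) => //.
  - move=> x /andP[s0x xt0].
    have /cont_ed/(_ e1 e10)[d d0 hd] := cF' x.
    exists d => // s t s0s sx xt tt0 xds txd.
    have as_ : a <= s by exact: le_trans s0s.
    have tb : t <= b by exact: le_trans t0b.
    have st : s <= t by exact: le_trans xt.
    have [|r /andP[sr rt] e2] := mvt_range st (AC_cont H) (F := F) (F' := F').
      by move=> y /(subI _ _ _ as_ tb)/dF.
    rewrite /P e2 (AC_int H)// -itgZ; last exact: AC_itb_sub H _ _.
    rewrite -itgB; [|by apply: itbZ; exact: AC_itb_sub H _ _|exact: itb_sub ifk].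
    rewrite -itgZ; last exact: iak.
    apply: le_trans (itg_abs _) _.
      by apply: itbB; [apply: itbZ; exact: AC_itb_sub H _ _|exact: itb_sub ifk].
    apply: le_itg.
    + by apply: itb_abs; apply: itbB; [apply: itbZ; exact: AC_itb_sub H _ _|exact: itb_sub ifk].
    + by apply: itbZ; exact: iak.
    + move=> y /andP[sy yt]; rewrite -mulrBl normrM ler_wpM2r//.
      have hr : `|F' (u r) - F' (u x)| < e1.
        by apply: hd; rewrite ltr_norml; apply/andP; split; lra.
      have hy : `|F' (u y) - F' (u x)| < e1.
        by apply: hd; rewrite ltr_norml; apply/andP; split; lra.
      rewrite (_ : F' (u r) - F' (u y) = (F' (u r) - F' (u x)) - (F' (u y) - F' (u x))); last by ring.
      by apply: le_trans (ler_normB _ _) _; lra.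
  - move=> r s t s0r rs st tt0; rewrite /P => h1 h2.
    have ar : a <= r by exact: le_trans s0r.
    have tb : t <= b by exact: le_trans t0b.
    rewrite (@itg_split _ r s t)//; last exact: itb_sub ifk.
    rewrite [X in _ <= _ * X](@itg_split _ r s t)//; last exact: iak.
    rewrite (_ : _ - _ - _ = (F (u s) - F (u r) - itg r s (fun x => F' (u x) * k x)) +
       (F (u t) - F (u s) - itg s t (fun x => F' (u x) * k x))); last by ring.
    by apply: le_trans (ler_normD _ _) _; rewrite mulrDr lerD.
move=> /le_trans; apply.
have hI : itg s0 t0 (fun x => `|k x|) <= I.
  rewrite /I (@itg_split _ a s0 b)//; [|exact: le_trans t0b|exact: iak].
  rewrite (@itg_split _ s0 t0 b)//; last exact: iak.
  have := @itg_ge0 _ a s0 (fun x => `|k x|) (fun x _ => normr_ge0 _).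
  have := @itg_ge0 _ t0 b (fun x => `|k x|) (fun x _ => normr_ge0 _).
  lra.
apply: (@le_trans _ _ (2 * e1 * I)); first by rewrite ler_wpM2l//; lra.
rewrite /e1 [leLHS](_ : _ = e * (I / (I + 1))); last by field; lra.
by apply: ler_piMr; [exact: ltW|rewrite ler_pdivrMr ?mul1r; lra].
Qed.

Lemma AC_C1 a b u k (F F' : R -> R) : AC a b u k -> a <= b ->
  (forall x, is_derive x 1 F (F' x)) -> continuous F' ->
  AC a b (fun t => F (u t)) (fun t => F' (u t) * k t).
Proof.
move=> H ab dF cF'; apply: AC_comp => //.
- move=> t; apply: (@continuous_comp _ _ _ u F); first exact: (AC_cont H).
  apply/differentiable_continuous/derivable1_diffP; exact: ex_derive.
- by move=> t; apply: (@continuous_comp _ _ _ u F'); [exact: (AC_cont H)|exact: cF'].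
Qed.

Lemma AC_sqr a b u k : AC a b u k -> a <= b ->
  AC a b (fun t => u t ^+ 2) (fun t => 2 * u t * k t).
Proof.
move=> H ab; apply: (@AC_C1 _ _ u k (fun x => x ^+ 2) (fun x => 2 * x)) => //.
- by move=> x; apply: (is_derive_eq (dsqr (did x))); rewrite mulr1.
- by apply: cZ; exact: cid.
Qed.

(** Polarization: [u v] is a quarter of [(u + v)^2 - (u - v)^2], so the product rule follows from
    the chain rule for squares. *)
Lemma AC_M a b u v k l : AC a b u k -> AC a b v l -> a <= b ->
  AC a b (fun t => u t * v t) (fun t => k t * v t + u t * l t).
Proof.
move=> H H' ab.
have h1 := AC_sqr (AC_D H H') ab.
have h2 := AC_sqr (AC_B H H') ab.
have := AC_Z (4^-1) (AC_B h1 h2).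
have -> : (fun t => 4^-1 * ((u t + v t) ^+ 2 - (u t - v t) ^+ 2)) = (fun t => u t * v t).
  by apply/funext => t; field.
have -> : (fun t => 4^-1 * (2 * (u t + v t) * (k t + l t) - 2 * (u t - v t) * (k t - l t))) =
  (fun t => k t * v t + u t * l t); last by [].
by apply/funext => t; field.
Qed.

Lemma AC_const a b u : AC a b u (fun=> 0) -> forall t, a <= t <= b -> u t = u a.
Proof.
move=> H t /andP[at_ tb]; apply/eqP; rewrite -subr_eq0 (AC_int H)//.
by rewrite itg_cst// mul0r.
Qed.

Lemma derive_itg a b f x : a < x -> x < b -> itb a b f -> {for x, continuous f} ->
  is_derive x 1 (fun y => itg a y f) (f x).
Proof.
move=> ax xb ifab cf; have [d1 d2] := @continuous_FTC1_closed _ f a x b xb ifab ax cf.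
exact: (DeriveDef d1 (etrans (esym (derive1E _ _)) d2)).
Qed.

(** [F] minus the primitive of [f] is continuous on the closed interval and has zero derivative
    inside. Thus [f] may be unbounded at the end points. *)
Lemma FTC_sing a b F f : a <= b -> itb a b f ->
  (forall x, a < x < b -> {for x, continuous f}) ->
  {within `[a, b], continuous F} ->
  (forall x, a < x < b -> is_derive x 1 F (f x)) ->
  itg a b f = F b - F a.
Proof.
move=> ab ifab cf cF dF.
pose D x := F x - itg a x f.
have [| |c _] := @MVT_segment _ D (fun=> 0) a b ab.
- move=> x; rewrite in_itv/= => xab; have /andP[ax xb] := xab.
  have h1 := dF x xab.
  have h2 := derive_itg ax xb ifab (cf x xab).
  by apply: is_derive_eq; rewrite subrr.
- apply/subspace_continuousP => x hx; apply: cvgB.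
    by move/subspace_continuousP : cF; exact.
  by have /subspace_continuousP := parameterized_integral_continuous ab ifab; exact.
- rewrite /= mul0r => /eqP; rewrite subr_eq0 /D itgxx subr0 => /eqP <-; ring.
Qed.

(** Cutting at [x] leaves two short intervals with singularities at most at their end points, the
    case of [FTC_sing]; [creep] joins the pieces. *)
Lemma AC_isolated a b F f : a <= b -> continuous F -> measurable_fun setT f -> itb a b f ->
  (forall x, a <= x <= b -> exists2 d, 0 < d & forall y, 0 < `|y - x| -> `|y - x| < d ->
     {for y, continuous f} /\ is_derive y 1 F (f y)) ->
  AC a b F f.
Proof.
move=> ab cF mf iff h; split => // s t as_ st tb.
pose P x y := F y - F x = itg x y f.
have : P s t; last by [].
apply: (@creep _ s t P) => //.
- move=> x /andP[sx xt].
  have [|d d0 hd] := h x; first by rewrite (le_trans as_)// (le_trans xt).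
  exists d => // s' t' ss' s'x xt' t't h1 h2.
  have i1 : itb s' x f by apply: itb_sub iff => //; [exact: le_trans ss'|exact: le_trans tb].
  have i2 : itb x t' f.
    by apply: itb_sub iff; [exact: le_trans sx|exact: le_trans tb].
  rewrite /P (@itg_split _ s' x t')//; last first.
    by apply: itb_sub iff; [exact: le_trans ss'|exact: le_trans tb].
  have hy y : s' < y < x \/ x < y < t' -> {for y, continuous f} /\ is_derive y 1 F (f y).
    move=> hh; apply: hd; first by rewrite normr_gt0 subr_eq0; case: hh => /andP[]; lra.
    by rewrite ltr_norml; apply/andP; case: hh => /andP[]; split; lra.
  have e1 : itg s' x f = F x - F s'.
    apply: FTC_sing => //; last by move=> y hh; apply (hy y); left.
      by move=> y hh; apply (hy y); left.
    exact: continuous_subspaceT.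
  have e2 : itg x t' f = F t' - F x.
    apply: FTC_sing => //; last by move=> y hh; apply (hy y); right.
      by move=> y hh; apply (hy y); right.
    exact: continuous_subspaceT.
  rewrite e1 e2.
  ring.
- move=> r x y sr rx xy yt; rewrite /P => h1 h2.
  rewrite (@itg_split _ r x y)// -?h1 -?h2; first by ring.
  by apply: itb_sub iff; [exact: le_trans sr|exact: le_trans tb].
Qed.

Lemma AC_FTC a b F f : a <= b -> continuous f -> (forall x, is_derive x 1 F (f x)) ->
  AC a b F f.
Proof.
move=> ab cf dF; apply: AC_isolated => //.
- move=> x; apply/differentiable_continuous/derivable1_diffP; exact: ex_derive.
- exact: continuous_measurable_fun.
- exact: itb_cont.
- by move=> x _; exists 1 => // y _ _; split; [exact: cf|exact: dF].
Qed.

End AbsolutelyContinuous.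

(** * Uniqueness of the density of an absolutely continuous function *)

Section AbsolutelyContinuousUniqueness.
Context {R : realType}.
Implicit Types (f g u v k : R -> R) (a b s t x y : R).
Notation mu := (@lebesgue_measure R).

Lemma integral0B f s t : (forall x y, itb x y f) -> s <= t ->
  integral0 f t - integral0 f s = itg s t f.
Proof.
move=> hf st; rewrite /integral0 -!/(itg _ _ _).
case: (leP 0 s) => s0; case: (leP 0 t) => t0.
- by rewrite (@itg_split _ 0 s t)//; ring.
- lra.
- by rewrite (@itg_split _ s 0 t)//; lra.
- by rewrite (@itg_split _ s t 0)//; lra.
Qed.

Lemma derive_integral0 f x : (forall y z, itb y z f) -> {for x, continuous f} ->
  is_derive x 1 (integral0 f) (f x).
Proof.
move=> hf cf; pose a := x - 1.
have ax : a < x by rewrite /a; lra.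
have xb : x < x + 1 by lra.
have h := derive_itg ax xb (hf _ _) cf.
have h2 := dD h (dcst x (integral0 f a)); rewrite addr0 in h2.
apply: near_eq_is_derive h2.
have : \forall y \near x, a < y by apply: lt_nbhsr; rewrite /a; lra.
by apply: filterS => y ay; rewrite -(integral0B hf (ltW ay)); ring.
Qed.

Lemma derive_integral0_cont f : continuous f -> forall x, is_derive x 1 (integral0 f) (f x).
Proof.
move=> cf x; apply: derive_integral0; last exact: cf.
by move=> y z; exact: itb_cont.
Qed.

(** Lebesgue differentiation recovers the restriction of [k] almost everywhere as the derivative of
    its primitive, which is locally constant inside the interval. *)
Lemma itg0_aeq a b k : a <= b -> itb a b k ->
  (forall t, a <= t -> t <= b -> itg a t k = 0) -> aeq a b k (fun=> 0).
Proof.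
move=> ab ik h0; pose f := k \_ `[a, b].
have mf : measurable_fun setT f.
  by apply/(measurable_restrictT k (measurable_itv `[a, b])); exact: itb_meas.
have iT : mu.-integrable setT (EFin \o f).
  have h : mu.-integrable (setT `&` `[a, b]) (EFin \o k) by rewrite setTI.
  by move/integrable_restrict : h; rewrite restrict_EFin; apply.
have intf y : mu.-integrable [set` Interval (BLeft a) (BRight y)] (EFin \o f).
  by apply: integrableS iT.
have locf : locally_integrable [set: R] f by apply: integrable_locally.
have [N [mN N0 hN]] := FTC1 intf locf.
have hf : aeq a b f k by apply: eq_aeq => x xab; rewrite /f patchE mem_set//= in_itv.
apply: aeq_trans (aeq_sym hf) _.
exists (N `|` [set a; b]); split.
- apply: measurableU => //; apply: measurableU; exact: measurable_set1.
- by rewrite !null_set_setU//; try exact: lebesgue_measure_set1; apply: measurableU; exact: measurable_set1.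
- move=> x /andP[ax xb] /not_orP[nN /not_orP[/eqP xa /eqP xb']].
  have {}ax : a < x by rewrite lt_neqAle eq_sym xa.
  have {}xb : x < b by rewrite lt_neqAle xb'.
  apply: contrapT => fx; apply: nN; apply: hN => /= hx; apply: fx.
  have [_ <-] := hx ax.
  rewrite derive1E; apply: derive_val.
  apply: (@near_eq_is_derive _ _ _ (fun=> 0)).
  have : \forall y \near x, a < y /\ y < b.
    by near=> y; split; near: y; [exact: lt_nbhsr|exact: lt_nbhsl].
  apply: filterS => y [ay yb]; rewrite -(h0 y (ltW ay) (ltW yb)).
  apply: eq_Rintegral => z; rewrite inE/= in_itv/= => /andP[az zy].
  by rewrite /f patchE mem_set//= in_itv/= az (le_trans zy (ltW yb)).
Unshelve. all: by end_near. Qed.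

Lemma AC_uniq a b u v k l : AC a b u k -> AC a b v l -> a <= b ->
  (forall t, a <= t <= b -> u t = v t) -> aeq a b k l.
Proof.
move=> H H' ab uv.
have h : aeq a b (fun x => k x - l x) (fun=> 0).
  apply: itg0_aeq => //; first by apply: itbB; [exact: (AC_itb H)|exact: (AC_itb H')].
  move=> t at_ tb; rewrite itgB; [|exact: AC_itb_sub H _ _|exact: AC_itb_sub H' _ _].
  by rewrite -(AC_int H)// -(AC_int H')// !uv ?lexx ?ab ?at_ ?tb//; ring.
have [N [mN N0 hN]] := h; exists N; split => // x xab nN.
by apply/eqP; rewrite -subr_eq0 hN.
Qed.

Lemma AC_uniq_cont a b u k l : AC a b u k -> AC a b u l -> a < b ->
  continuous k -> continuous l -> forall t, a <= t <= b -> k t = l t.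
Proof.
move=> H H' ab ck cl t tab; apply/eqP; rewrite -subr_eq0 -normr_le0 leNgt; apply/negP => h.
have cd : continuous (fun x => k x - l x) by exact: cB.
have hint s r : a <= s -> s <= r -> r <= b -> itg s r (fun x => k x - l x) = 0.
  move=> as_ sr rb; rewrite itgB; [|exact: AC_itb_sub H _ _|exact: AC_itb_sub H' _ _].
  by rewrite -(AC_int H)// -(AC_int H')//; ring.
have [d d0 hd] := proj1 (cont_ed _ t) (cd t) _ h.
set c := k t - l t in h hd *.
move: tab => /andP[at_ tb].
(* on a nondegenerate interval around t the difference keeps its sign *)
pose s := Num.max a (t - d / 2); pose r := Num.min b (t + d / 2).
have sr : s < r.
  by rewrite /s /r gt_max !lt_min; apply/andP; split; apply/andP; split; lra.
have as_ : a <= s by rewrite /s le_max lexx.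
have rb : r <= b by rewrite /r ge_min lexx.
have hs : t - d / 2 <= s by rewrite /s le_max lexx orbT.
have hr : r <= t + d / 2 by rewrite /r ge_min lexx orbT.
have sq : 0 < c ^+ 2 by rewrite exprn_even_gt0//= -normr_gt0.
have hpos x : s <= x <= r -> 0 < c * (k x - l x).
  move=> /andP[sx xr].
  have : `|(k x - l x) - c| < `|c| by apply: hd; rewrite ltr_norml; apply/andP; split; lra.
  case: (ltgtP c 0) h sq => c0 h sq.
  - rewrite (ltr0_norm c0) ltr_norml => /andP[_ ?].
    have : k x - l x < 0 by lra.
    by move=> ?; rewrite nmulr_rgt0.
  - rewrite (gtr0_norm c0) ltr_norml => /andP[? _].
    have : k x - l x > 0 by lra.
    by move=> ?; rewrite pmulr_rgt0.
  - by rewrite c0 normr0 ltxx in h.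
have cc : continuous (fun x => c * (k x - l x)) by exact: cZ.
have [|m mi hm] := @EVT_min R (fun x => c * (k x - l x)) s r (ltW sr); first exact: continuous_subspaceT.
have m0 : 0 < c * (k m - l m) by apply: hpos; move: mi; rewrite in_itv.
have : c * (k m - l m) * (r - s) <= 0.
  have e : itg s r (fun x => c * (k x - l x)) = 0.
    by rewrite itgZ; [rewrite hint ?mulr0//; exact: ltW|exact: itb_cont].
  rewrite -(@itg_cst _ s r _ (ltW sr)) -e.
  apply: le_itg; [exact: itb_cst|exact: itb_cont|].
  by move=> x xi; apply: hm; rewrite in_itv.
by rewrite leNgt mulr_gt0// subr_gt0.
Qed.

End AbsolutelyContinuousUniqueness.

(** * Integrability with singular end points *)

Section SingularIntegral.
Context {R : realType}.
Implicit Types (f g u v k : R -> R) (a b s t x y : R).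
Notation mu := (@lebesgue_measure R).

Lemma itb_union a b c f : a <= b -> b <= c -> measurable_fun setT f ->
  itb a b f -> itb b c f -> itb a c f.
Proof.
move=> ab bc mf /integrableP[_ h1] /integrableP[_ h2].
have mf' : measurable_fun setT (EFin \o f) by exact/measurable_EFinP.
have mfa : measurable_fun setT (fun x => `|f x|%:E).
  by apply/measurable_EFinP; exact: measurableT_comp.
apply/integrableP; split; first exact: measurable_funTS.
have -> : `[a, c]%classic = `[a, b] `|` `]b, c].
  by apply: itv_bndbnd_setU; rewrite bnd_simp.
rewrite ge0_integral_setU//=; last 2 first.
- exact: measurable_funTS mfa.
- apply/disj_setPRL => x /=; rewrite !in_itv/= => /andP[bx xc] /andP[ax xb].
  by move: (lt_le_trans bx xb); rewrite ltxx.
apply: lte_add_pinfty => //.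
apply: le_lt_trans h2; apply: ge0_subset_integral => //=.
- exact: measurable_funTS mfa.
- by apply: subset_itv; rewrite bnd_simp.
Qed.

(** On the segments [[a + e n, b - e n]] the integral is a difference of values of [F], which is
    bounded; as [f] is nonnegative, monotone convergence carries the bound to the open interval. *)
Lemma itb_sing a b F f : a < b -> measurable_fun setT f -> continuous F ->
  (forall y, a < y < b -> 0 <= f y) ->
  (forall y, a < y < b -> {for y, continuous f} /\ is_derive y 1 F (f y)) ->
  itb a b f.
Proof.
move=> ab mf cF f0 h.
have mf' : measurable_fun setT (EFin \o f) by exact/measurable_EFinP.
have mfa : measurable_fun setT (fun x => `|f x|%:E).
  by apply/measurable_EFinP; exact: measurableT_comp.
pose e (n : nat) := (b - a) / 2 / n.+1%:R.
have e0 n : 0 < e n by rewrite /e !divr_gt0 ?subr_gt0.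
have e1 n : e n <= (b - a) / 2.
  by rewrite /e ler_pdivrMr// ler_peMr ?ler1n//; lra.
pose S n := `[a + e n, b - e n]%classic.
have SS n x : S n x -> a < x < b.
  by rewrite /S/= in_itv/=; have := e0 n; lra.
have hb n : (\int[mu]_(x in S n) (f x)%:E <= (F (b - e n) - F (a + e n))%:E)%E.
  have := e1 n; have := e0 n => h1 h2.
  have ib : itb (a + e n) (b - e n) f.
    apply: itb_within; apply/subspace_continuousP => x hx.
    apply: cvg_within_filter.
    by have [] := h x (SS n x hx).
  have <- : itg (a + e n) (b - e n) f = F (b - e n) - F (a + e n).
    apply: FTC_sing => //; first lra.
    - by move=> x hx; have [] := h x ltac:(clear -hx h1 h2; lra).
    - exact: continuous_subspaceT.
    - by move=> x hx; have [] := h x ltac:(clear -hx h1 h2; lra).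
  rewrite /itg /Rintegral fineK//; exact: integrable_fin_num.
have [c c0 hc] := cont_bounded a b cF.
have hB n : (\int[mu]_(x in S n) (f x)%:E <= (2 * c)%:E)%E.
  apply: le_trans (hb n) _; rewrite lee_fin.
  have h1 := hc (b - e n) ltac:(have := e1 n; have := e0 n; lra).
  have h2 := hc (a + e n) ltac:(have := e1 n; have := e0 n; lra).
  have := ler_norm (F (b - e n)).
  have := ler_norm (- F (a + e n)); rewrite normrN; lra.
have nd : nondecreasing_seq S.
  move=> m n mn; apply/subsetPset; apply: subset_itv; rewrite bnd_simp.
    by rewrite lerD2l /e ler_pM2l ?lef_pV2 ?posrE ?ler_nat// divr_gt0// subr_gt0.
  by rewrite lerD2l lerN2 /e ler_pM2l ?lef_pV2 ?posrE ?ler_nat// divr_gt0// subr_gt0.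
have := @ge0_nondecreasing_set_cvg_integral _ (measurableTypeR R) R S (EFin \o f)
  (@lebesgue_measure R) nd
  (fun n => measurable_itv _) (fun n => measurable_funS measurableT (@subsetT _ _) mf')
  (fun n x Sx => f0 x (SS n x Sx)).
have -> : \bigcup_i S i = `]a, b[%classic.
  apply/seteqP; split => x; first by move=> [n _ /SS]; rewrite /= in_itv.
  rewrite /= in_itv/= => /andP[ax xb].
  have m0 : 0 < Num.min (x - a) (b - x) by rewrite lt_min !subr_gt0 ax.
  have [n _ hn] : \forall n \near \oo, e n < Num.min (x - a) (b - x).
    near=> n.
    have -> : e n = (b - a) / 2 * n.+1%:R^-1 by [].
    rewrite -ltr_pdivlMl; last by rewrite divr_gt0// subr_gt0.
    near: n; apply: near_infty_natSinv_lt (PosNum _).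
    by rewrite mulr_gt0// invr_gt0 divr_gt0// subr_gt0.
  exists n => //; have := hn n (leqnn _); rewrite /S/= in_itv/= lt_min; lra.
move=> hcv.
have hle : (\int[mu]_(x in `]a, b[) (f x)%:E <= (2 * c)%:E)%E.
  rewrite -(cvg_lim (@ereal_hausdorff R) hcv).
  apply: lime_le; first by apply/cvg_ex; eexists; exact: hcv.
  by apply: nearW.
apply/integrableP; split; first exact: measurable_funTS.
rewrite (@integral_itv_bndoo _ _ _ _ true false); last first.
  exact: measurable_funTS mfa.
apply: (@le_lt_trans _ _ (2 * c)%:E); last exact: ltry.
apply: le_trans hle; rewrite le_eqVlt; apply/orP; left; apply/eqP.
by apply: eq_integral => x; rewrite inE/= in_itv/= => hx; rewrite ger0_norm// f0.
Unshelve. all: by end_near. Qed.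

End SingularIntegral.

(** * Signed powers *)

Section SignedPower.
Context {R : realType}.
Implicit Types (r s x y p : R).

(** The factor [x] gives the value 0 at 0 for every exponent; for [r > 0] the functions [spow r] and
    [spow r^-1] are inverse to each other. *)
Definition spow r x := `|x| `^ (r - 1) * x.

Lemma spow0 r : spow r 0 = 0. Proof. by rewrite /spow mulr0. Qed.

Lemma spow_ge0 r x : 0 < r -> 0 <= x -> spow r x = x `^ r.
Proof. by move=> r0 x0; rewrite /spow ger0_norm// mulrC mulr_powRB1. Qed.

Lemma spowN r x : spow r (- x) = - spow r x.
Proof. by rewrite /spow normrN mulrN. Qed.

Lemma spow_le0 r x : 0 < r -> x <= 0 -> spow r x = - (- x) `^ r.
Proof. by move=> r0 x0; rewrite -spow_ge0// ?oppr_ge0// spowN opprK. Qed.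

Lemma norm_spow r x : 0 < r -> `|spow r x| = `|x| `^ r.
Proof.
by move=> r0; rewrite /spow normrM (ger0_norm (powR_ge0 _ _)) mulrC mulr_powRB1.
Qed.

Lemma spow1 x : spow 1 x = x.
Proof. by rewrite /spow subrr powRr0 mul1r. Qed.

Lemma spow_pos r x : 0 < x -> 0 < spow r x.
Proof. by move=> x0; apply: mulr_gt0 => //; apply: powR_gt0; rewrite normr_gt0 gt_eqF. Qed.

Lemma spow_neg r x : x < 0 -> spow r x < 0.
Proof. by move=> x0; rewrite -oppr_gt0 -spowN spow_pos// oppr_gt0. Qed.

Lemma spow_eq0 r x : (spow r x == 0) = (x == 0).
Proof.
have [x0|x0|->] := ltgtP x 0; last by rewrite spow0 eqxx.
- by rewrite lt_eqF// spow_neg.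
- by rewrite gt_eqF// spow_pos.
Qed.

Lemma spow_comp r s x : 0 < r -> 0 < s -> spow s (spow r x) = spow (r * s) x.
Proof.
move=> r0 s0; wlog x0 : x / 0 <= x => [h|].
  have [/h//|x0] := leP 0 x.
  by apply: oppr_inj; rewrite -!spowN h// oppr_ge0 ltW.
by rewrite !spow_ge0 ?mulr_gt0 ?powR_ge0// powRrM.
Qed.

Lemma spowM r x y : spow r (x * y) = spow r x * spow r y.
Proof. by rewrite /spow normrM powRM//; ring. Qed.

Lemma ltr_spow r x y : 0 < r -> x < y -> spow r x < spow r y.
Proof.
move=> r0 xy.
have [x0|x0] := leP 0 x.
  have y0 : 0 < y by exact: le_lt_trans xy.
  by rewrite !spow_ge0// ?gt0_ltr_powR// ?nnegrE// ltW.
have [y0|y0] := leP 0 y.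
  by apply: (@lt_le_trans _ _ 0); [exact: spow_neg|rewrite spow_ge0// powR_ge0].
by rewrite !spow_le0// ?ltW// ltrN2 gt0_ltr_powR// ?nnegrE ?oppr_ge0 ?ltrN2// ltW.
Qed.

Lemma ler_spow r x y : 0 < r -> x <= y -> spow r x <= spow r y.
Proof. by move=> r0; rewrite le_eqVlt => /predU1P[->//|/(ltr_spow r0)/ltW]. Qed.

Lemma dpowR r x : 0 < x -> is_derive x 1 (fun y => y `^ r) (r * x `^ (r - 1)).
Proof.
move=> x0; have xi : x \in `]0, +oo[ by rewrite in_itv/= andbT.
apply: DeriveDef; first exact: derivable_powR.
by rewrite -derive1E powR_derive1.
Qed.

Lemma near_ball x (P : R -> Prop) d : 0 < d -> (forall y, `|y - x| < d -> P y) ->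
  \forall y \near x, P y.
Proof. by move=> d0 h; exists d => //= y yx; apply: h; rewrite distrC. Qed.

Lemma dspow r x : 0 < r -> x != 0 -> is_derive x 1 (spow r) (r * `|x| `^ (r - 1)).
Proof.
move=> r0; rewrite neq_lt => /orP[x0|x0].
  have nx : 0 < - x by rewrite oppr_gt0.
  have h := dN (dcomp (dN (did x)) (dpowR r nx)).
  rewrite ltr0_norm//; apply: near_eq_is_derive (is_derive_eq h _); last by rewrite /=; ring.
  apply: (@near_ball _ _ (- x)) => // y; rewrite ltr_norml => /andP[h1 h2].
  by rewrite spow_le0//; lra.
rewrite gtr0_norm//; apply: near_eq_is_derive (dpowR r x0).
apply: (@near_ball _ _ x) => // y; rewrite ltr_norml => /andP[h1 h2].
by rewrite spow_ge0//; lra.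
Qed.

Lemma cspow r : 0 < r -> continuous (spow r).
Proof.
move=> r0 x; have [->|x0] := eqVneq x 0; last exact: d_cont (dspow r0 x0).
apply/cont_ed => e e0; exists (e `^ r^-1); first exact: powR_gt0.
move=> y; rewrite spow0 !subr0 norm_spow// => ye.
rewrite -[ltRHS](@powRr1 _ e) ?ltW// -(mulVf (lt0r_neq0 r0)) powRrM.
by apply: gt0_ltr_powR => //; rewrite nnegrE ?powR_ge0.
Qed.

Lemma cnpow r : 0 < r -> continuous (fun x : R => `|x| `^ r).
Proof. by move=> r0; under eq_fun do rewrite -norm_spow//; apply: cnorm; exact: cspow. Qed.

Lemma dnpow r x : 1 < r -> is_derive x 1 (fun y => `|y| `^ r) (r * spow (r - 1) x).
Proof.
move=> r1; have r0 : 0 < r by lra.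
have r10 : 0 < r - 1 by lra.
have [->|x0] := eqVneq x 0; last first.
  have [xn|xp|/eqP] := ltgtP x 0; last by rewrite (negbTE x0).
  - have h := dN (dspow r0 x0).
    rewrite /spow; apply: near_eq_is_derive (is_derive_eq h _); last first.
      by rewrite -mulr_powRB1// ltr0_norm//; ring.
    apply: (@near_ball _ _ (- x)); first by lra.
    move=> y; rewrite ltr_norml => /andP[h1 h2].
    by rewrite spow_le0 ?opprK ?ltr0_norm//; lra.
  - have h := dspow r0 x0.
    rewrite /spow; apply: near_eq_is_derive (is_derive_eq h _); last first.
      by rewrite -mulr_powRB1// gtr0_norm//; ring.
    apply: (@near_ball _ _ x) => //.
    move=> y; rewrite ltr_norml => /andP[h1 h2].
    by rewrite spow_ge0 ?gtr0_norm//; lra.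
rewrite spow0 mulr0.
(* At 0 the difference quotient is [spow (r - 1)] itself, continuous with value 0. *)
apply/is_derive1_caratheodory; exists (spow (r - 1)); split.
- move=> z; rewrite normr0 powR0 ?gt_eqF// !subr0 /spow.
  rewrite -mulrA -(@mulr_powRB1 _ `|z| r)// -(@mulr_powRB1 _ `|z| (r - 1))//.
  have -> : z * z = `|z| * `|z| by rewrite -normrM ger0_norm// -expr2 sqr_ge0.
  ring.
- exact: cspow.
- by rewrite spow0.
Qed.

(** The graph lies above its tangents because the derivative [p * spow (p - 1)] is increasing. This
    one inequality yields the first variation of the energy, the case of circles and Young's
    inequality for the figure eight. *)
Lemma convex_npow p x y : 1 < p ->
  `|x| `^ p + p * spow (p - 1) x * (y - x) <= `|y| `^ p.
Proof.
move=> p1; have p10 : 0 < p - 1 by lra.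
have dF (z : R) : is_derive z 1 (fun y : R => `|y| `^ p) (p * spow (p - 1) z) by exact: dnpow.
have cF a b : {within `[a, b], continuous (fun y : R => `|y| `^ p)}.
  by apply: continuous_subspaceT; apply: cnpow; lra.
have [xy|yx|->] := ltgtP x y; last by rewrite subrr mulr0 addr0.
- have [c + e] := @MVT R (fun y => `|y| `^ p) (fun z => p * spow (p - 1) z) x y xy (fun z _ => dF z) (cF x y).
  rewrite in_itv/= => /andP[xc cy].
  have -> : `|y| `^ p = `|x| `^ p + p * spow (p - 1) c * (y - x) by rewrite -e; ring.
  rewrite lerD2l ler_pM2r ?subr_gt0// ler_pM2l ?ler_spow//; lra.
- have [c + e] := @MVT R (fun y => `|y| `^ p) (fun z => p * spow (p - 1) z) y x yx (fun z _ => dF z) (cF y x).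
  rewrite in_itv/= => /andP[yc cx].
  have -> : `|y| `^ p = `|x| `^ p + p * spow (p - 1) c * (y - x) by lra.
  rewrite lerD2l ler_nM2r ?subr_lt0// ler_pM2l ?ler_spow//; lra.
Qed.

Lemma norm_powD p x y : 0 <= p -> `|x + y| `^ p <= 2 `^ p * (`|x| `^ p + `|y| `^ p).
Proof.
move=> p0; wlog xy : x y / `|x| <= `|y| => [h|].
  have [/h//|/ltW/h] := leP `|x| `|y|; by rewrite addrC [X in _ * X]addrC.
apply: (@le_trans _ _ ((2 * `|y|) `^ p)).
  by apply: ge0_ler_powR => //; rewrite ?nnegrE ?mulr_ge0//; have := ler_normD x y; lra.
by rewrite powRM// ler_wpM2l ?powR_ge0// lerDr powR_ge0.
Qed.

Lemma le_1_npow p x : 1 <= p -> `|x| <= 1 + `|x| `^ p.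
Proof.
move=> p1; have [x1|x1] := leP `|x| 1; first by have := powR_ge0 `|x| p; lra.
by apply: (@le_trans _ _ (`|x| `^ p)); [exact: le1r_powR (ltW _) _|rewrite lerDr].
Qed.

Lemma le_npow r s x : 0 <= r -> r <= s -> `|x| `^ r <= 1 + `|x| `^ s.
Proof.
move=> r0 rs; have [x1|x1] := leP `|x| 1.
  have : `|x| `^ r <= 1.
    have -> : 1 = (1 : R) `^ r by rewrite powR1.
    by apply: ge0_ler_powR => //; rewrite nnegrE.
  by have := powR_ge0 `|x| s; lra.
by apply: (@le_trans _ _ (`|x| `^ s)); [apply: ler_powR => //; exact: ltW|rewrite lerDr].
Qed.

End SignedPower.

(** * Sobolev curves and their tangential angles *)

Section Lp.
Context {R : realType}.
Implicit Types (f g k : R -> R) (L p e : R).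
Notation mu := (@lebesgue_measure R).

Lemma meas_oo_restr L f : measurable_fun `]0%R, L[ f -> measurable_fun setT (f \_ `]0%R, L[).
Proof. by move=> mf; apply/(measurable_restrictT f (measurable_itv `]0%R, L[)). Qed.

Lemma restr_oo L f t : 0 < t < L -> (f \_ `]0, L[) t = f t.
Proof. by move=> h; rewrite patchE mem_set//= in_itv. Qed.

Lemma meas_npow (D : set R) p k : measurable_fun D k ->
  measurable_fun D (fun t => `|k t| `^ p).
Proof.
move=> mk; apply: (measurableT_comp (measurable_powR _)) => //.
exact: measurableT_comp.
Qed.

Lemma int_oo L f : itb 0 L f ->
  (\int[mu]_(t in `]0%R, L[) (f t)%:E = (itg 0 L f)%:E)%E.
Proof.
move=> hf; have [L0|L0] := leP L 0.
  rewrite set_itv_ge ?bnd_simp -?leNgt// integral_set0.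
  move: L0; rewrite le_eqVlt => /predU1P[->|L0]; first by rewrite itgxx.
  by rewrite itg_gt.
have mf := itb_meas hf.
have mEf : measurable_fun `[0, L] (EFin \o f) by exact/measurable_EFinP.
have mS (A : set R) : A `<=` `[0, L] -> measurable_fun A (EFin \o f).
  by move=> h; apply: measurable_funS mEf.
rewrite integral_itv_bndo_bndc; last by apply: mS; apply: subset_itv_oo_cc.
rewrite integral_itv_obnd_cbnd; last by apply: mS; apply: subset_itv; rewrite bnd_simp.
by rewrite /itg /Rintegral fineK//; exact: integrable_fin_num.
Qed.

Lemma Rint_oo L f : itb 0 L f -> \int[mu]_(t in `]0, L[) f t = itg 0 L f.
Proof. by move=> hf; rewrite {1}/Rintegral int_oo. Qed.

Lemma oo_itb L f : 0 < L -> measurable_fun setT f -> (forall t, 0 < t < L -> 0 <= f t) ->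
  (\int[mu]_(t in `]0%R, L[) (f t)%:E < +oo)%E -> itb 0 L f.
Proof.
move=> L0 mf f0 hf.
have mEf (A : set R) : measurable_fun A (EFin \o f).
  by apply/measurable_EFinP; exact: measurable_funTS.
apply/integrableP; split; first exact: mEf.
rewrite [X in (X < _)%E](_ : _ = \int[mu]_(x in `]0%R, L[) (f x)%:E)%E//.
transitivity (\int[mu]_(x in `]0%R, L[) `|(EFin \o f) x|)%E.
  rewrite -integral_itv_obnd_cbnd; last by apply: measurableT_comp => //; exact: mEf.
  by rewrite -integral_itv_bndo_bndc//; apply: measurableT_comp => //; exact: mEf.
apply: eq_integral => x; rewrite inE/= in_itv/= => /f0 h.
by rewrite ger0_norm.
Qed.

Lemma Lp_normE L p f : p != 0 ->
  Lp_norm L p f = ((\int[mu]_(t in `]0%R, L[) (`|f t| `^ p)%:E) `^ p^-1)%E.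
Proof.
move=> p0; rewrite /Lp_norm unlock /Lnorm; congr (_ `^ _)%E.
rewrite [RHS]integral_mkcond; apply: eq_integral => x _.
rewrite /= !patchE; case: ifPn => // _.
by rewrite normr0 powR0.
Qed.

Lemma Lp_norm_fin L p f : 0 < L -> 1 < p -> measurable_fun `]0%R, L[ f ->
  (Lp_norm L p f < +oo)%E -> itb 0 L (fun t => `|(f \_ `]0, L[) t| `^ p).
Proof.
move=> L0 p1 mf; have p0 : p != 0 by rewrite gt_eqF//; lra.
rewrite Lp_normE// => h; apply: oo_itb => //.
- by apply: meas_npow; exact: meas_oo_restr.
- rewrite ltey; apply/negP => /eqP e; move: h; apply/negP.
  rewrite -leNgt leye_eq; apply/eqP; apply: eqy_poweR; first by rewrite invr_gt0; lra.
  rewrite -e; apply: eq_integral => x; rewrite inE/= in_itv/= => hx.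
  by rewrite restr_oo.
Qed.

Lemma Lp_norm_eq L p f : 0 < L -> 1 < p -> itb 0 L (fun t => `|(f \_ `]0, L[) t| `^ p) ->
  Lp_norm L p f = (itg 0 L (fun t => `|(f \_ `]0, L[) t| `^ p) `^ p^-1)%:E.
Proof.
move=> L0 p1 h; rewrite Lp_normE ?gt_eqF//; last lra.
have e : (\int[mu]_(t in `]0%R, L[) (`|f t| `^ p)%:E = (itg 0 L (fun t => `|(f \_ `]0, L[) t| `^ p))%:E)%E.
  rewrite -(int_oo h); apply: eq_integral => x; rewrite inE/= in_itv/= => hx.
  by rewrite restr_oo.
rewrite e; exact: poweR_EFin.
Qed.

Lemma Lp_norm_ge0 L p f : (0 <= Lp_norm L p f)%E.
Proof. exact: Lnorm_ge0. Qed.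

Lemma Lp_norm_lt_itg L p f e : 0 < L -> 1 < p -> 0 <= e -> measurable_fun `]0%R, L[ f ->
  (Lp_norm L p f < e%:E)%E ->
  itb 0 L (fun t => `|(f \_ `]0, L[) t| `^ p) /\
  itg 0 L (fun t => `|(f \_ `]0, L[) t| `^ p) < e `^ p.
Proof.
move=> L0 p1 e0 mf h.
have hi : itb 0 L (fun t => `|(f \_ `]0, L[) t| `^ p).
  by apply: Lp_norm_fin => //; exact: lt_trans (ltry e).
split => //; move: h; rewrite Lp_norm_eq// lte_fin => h.
set I := itg _ _ _ in h *.
have I0 : 0 <= I by apply: itg_ge0 => x _; exact: powR_ge0.
have p0 : p != 0 by rewrite gt_eqF//; lra.
rewrite -[ltLHS](powRr1 I0) -(mulVf p0) powRrM gt0_ltr_powR//; last by rewrite nnegrE powR_ge0.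
by lra.
Qed.

Lemma npow_itb L p k : 0 <= L -> 1 < p -> measurable_fun setT k ->
  itb 0 L (fun t => `|k t| `^ p) -> itb 0 L k.
Proof.
move=> L0 p1 mk h; apply: (@itb_le _ _ _ _ (fun t => 1 + `|k t| `^ p)).
- exact: measurable_funTS.
- by move=> t _; apply: le_1_npow; exact: ltW.
- by apply: itbD => //; exact: itb_cst.
Qed.

End Lp.

(** * Functions with a weak derivative are primitives *)

Section Sobolev.
Context {R : realType}.
Implicit Types (u v f g k : R -> R) (L p s t x y : R).
Notation mu := (@lebesgue_measure R).

Lemma test_function_AC L phi : 0 <= L -> test_function L phi ->
  [/\ AC 0 L phi (derive1 phi), phi 0 = 0 & phi L = 0].
Proof.
move=> L0 [dphi cphi _ sphi]; split.
- by apply: AC_FTC => // x; apply: DeriveDef; rewrite ?derive1E.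
- apply/eqP; apply: contrapT => /negP h.
  have /sphi : closure [set t | phi t != 0] 0 by exact: subset_closure.
  by rewrite /= in_itv/= ltxx.
- apply/eqP; apply: contrapT => /negP h.
  have /sphi : closure [set t | phi t != 0] L by exact: subset_closure.
  by rewrite /= in_itv/= ltxx andbF.
Qed.

Lemma AC_weak L u v : 0 < L -> AC 0 L u v -> weak_derivative L u v.
Proof.
move=> L0 H phi tphi; have [Hphi p0 pL] := test_function_AC (ltW L0) tphi.
have HM := AC_M H Hphi (ltW L0).
have := AC_int HM (lexx 0) (ltW L0) (lexx L).
have i1 : itb 0 L (fun t => u t * derive1 phi t).
  by apply: itb_contM; [exact: AC_itb Hphi|exact: AC_cont H].
have i2 : itb 0 L (fun t => v t * phi t).
  have := itb_contM (AC_itb H) (AC_cont Hphi).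
  by apply: eq_itb => x _; rewrite mulrC.
rewrite itgD// p0 pL !mulr0 subrr !Rint_oo// => /esym/eqP.
by rewrite addrC addr_eq0 => /eqP.
Qed.

Definition tent c d x : R := Num.max 0 (d - `|x - c|).

Lemma tent_cont c d : continuous (tent c d).
Proof.
have -> : tent c d = fun x => (d - `|x - c| + `|d - `|x - c| |) / 2.
  apply/funext => x; rewrite /tent; set y := d - _.
  by case: (leP 0 y) => y0; [rewrite ger0_norm//|rewrite ltr0_norm//]; lra.
have h : continuous (fun x => d - `|x - c|).
  by apply: cB; [exact: ccst|apply: cnorm; apply: cB; [exact: cid|exact: ccst]].
apply: (@cM _ (fun x => d - `|x - c| + `|d - `|x - c| |) (fun=> 2^-1)); last exact: ccst.
by apply: cD => //; exact: cnorm.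
Qed.

Lemma tent_ge0 c d x : 0 <= tent c d x.
Proof. by rewrite /tent le_max lexx. Qed.

Lemma tent_out c d x : d <= `|x - c| -> tent c d x = 0.
Proof. by move=> h; rewrite /tent max_l// subr_le0. Qed.

Lemma itg0_tent c d s t : s <= t -> (forall x, s <= x <= t -> d <= `|x - c|) ->
  itg s t (tent c d) = 0.
Proof.
move=> st h; rewrite (@eq_itg _ _ _ _ (fun=> 0)) ?itg_cst ?mul0r//.
by move=> x /h; exact: tent_out.
Qed.

(** The difference of the two primitives, at equally displaced arguments, has derivative 0. Equality
    of the masses is what gives [bump] a compact support. *)
Lemma itg_tent_shift c c' d : 0 <= d ->
  itg (c - d) (c + d) (tent c d) = itg (c' - d) (c' + d) (tent c' d).
Proof.
move=> d0.
have hi a x y : itb x y (tent a d) by apply: itb_cont; exact: tent_cont.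
pose G x := integral0 (tent c d) (c + x) - integral0 (tent c' d) (c' + x).
have dG x : is_derive x 1 G 0.
  have h a : is_derive x 1 (fun y => integral0 (tent a d) (a + y)) (tent a d (a + x)).
    have h1 := dD (dcst x a) (did x); rewrite add0r in h1.
    have h2 := derive_integral0_cont (@tent_cont a d) (a + x).
    by apply: (is_derive_eq (dcomp h1 h2)); rewrite mulr1.
  apply: (is_derive_eq (dB (h c) (h c'))).
  by rewrite /tent !(addrC _ x) !addrK subrr.
have := is_derive_0_is_cst d (- d) dG; rewrite /G => h.
rewrite -!integral0B//; lra.
Qed.

Lemma tent_mass c d : 0 < d -> 0 < itg (c - d) (c + d) (tent c d).
Proof.
move=> d0.
have hi x y : itb x y (tent c d) by apply: itb_cont; exact: tent_cont.
apply: (@lt_le_trans _ _ (itg (c - d / 2) (c + d / 2) (fun=> d / 2))).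
  rewrite itg_cst; last lra.
  by rewrite mulr_gt0//; lra.
rewrite (@itg_split _ (c - d) (c - d / 2) (c + d))//; [|lra|lra].
rewrite (@itg_split _ (c - d / 2) (c + d / 2) (c + d))//; [|lra|lra].
have h1 := @itg_ge0 _ (c - d) (c - d / 2) (tent c d) (fun x _ => tent_ge0 _ _ _).
have h2 := @itg_ge0 _ (c + d / 2) (c + d) (tent c d) (fun x _ => tent_ge0 _ _ _).
suff : itg (c - d / 2) (c + d / 2) (fun=> d / 2) <= itg (c - d / 2) (c + d / 2) (tent c d) by lra.
apply: le_itg => //; first exact: itb_cst.
move=> x /andP[x1 x2]; rewrite /tent le_max; apply/orP; right.
have : `|x - c| <= d / 2 by rewrite ler_norml; apply/andP; split; lra.
lra.
Qed.

(** Primitive of the difference of two tents: a test function whose derivative compares averages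
    near [s] and near [t]. The last term normalizes the value at 0. *)
Definition bump s t d x : R := integral0 (tent s d) x - integral0 (tent t d) x
  - (integral0 (tent s d) 0 - integral0 (tent t d) 0).

Lemma dbump s t d x : is_derive x 1 (bump s t d) (tent s d x - tent t d x).
Proof.
have h c := derive_integral0_cont (@tent_cont c d) x.
by apply: (is_derive_eq (dB (dB (h s) (h t)) (dcst x _))); rewrite subr0.
Qed.

Lemma bump_test L s t d : 0 < d -> s <= t -> 0 < s - d -> t + d < L ->
  test_function L (bump s t d).
Proof.
move=> d0 st sd td.
have hi c x y : itb x y (tent c d) by apply: itb_cont; exact: tent_cont.
have out x : ~ (s - d <= x <= t + d) -> bump s t d x = 0.
  move=> hx; rewrite /bump.
  have [x1|x1] := ltP x (s - d).
    have [x0|x0] := leP x 0.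
      have e c : s <= c -> integral0 (tent c d) 0 - integral0 (tent c d) x = 0.
        move=> sc; rewrite integral0B// itg0_tent// => y /andP[y1 y2].
        by rewrite distrC ger0_norm; lra.
      by have := e s (lexx s); have := e t st; lra.
    have e c : s <= c -> integral0 (tent c d) x - integral0 (tent c d) 0 = 0.
      move=> sc; rewrite integral0B ?ltW// itg0_tent ?ltW// => y /andP[y1 y2].
      by rewrite distrC ger0_norm; lra.
    by have := e s (lexx s); have := e t st; lra.
  have {}hx : t + d < x by rewrite ltNge; apply/negP => h; apply: hx; rewrite x1 h.
  have e c : s <= c -> c <= t -> integral0 (tent c d) x - integral0 (tent c d) 0
      = itg (c - d) (c + d) (tent c d).
    move=> sc ct; rewrite integral0B//; last lra.
    rewrite (@itg_split _ 0 (c - d))//; [|lra|lra].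
    rewrite (@itg_split _ (c - d) (c + d) x)//; [|lra|lra].
    rewrite itg0_tent; [|lra|move=> y /andP[y1 y2]; rewrite distrC ger0_norm; lra].
    rewrite [X in _ + (_ + X)]itg0_tent; [lra|lra|move=> y /andP[y1 y2]; rewrite ger0_norm; lra].
  have := e s (lexx s) st; have := e t st (lexx t).
  by have := itg_tent_shift s t (ltW d0); lra.
have cl : closure [set x | bump s t d x != 0] `<=` `[s - d, t + d].
  have e : closed [set` `[s - d, t + d]] by exact: itv_closed.
  move/closure_id : e => e.
  rewrite e; apply: closure_subset => x /= /eqP h; rewrite in_itv/=.
  by apply: contrapT => h'; apply: h; exact: out.
split.
- by move=> x; apply: ex_derive; exact: dbump.
- have -> : derive1 (bump s t d) = fun x => tent s d x - tent t d x.
    by apply/funext => x; rewrite derive1E; apply: derive_val; exact: dbump.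
  by apply: cB; exact: tent_cont.
- by apply: subclosed_compact cl; [exact: closed_closure|exact: segment_compact].
- by move=> x /cl /=; rewrite !in_itv/= => /andP[h1 h2]; apply/andP; split; lra.
Qed.

Lemma itg_tent_full L c d : 0 <= d -> 0 <= c - d -> c + d <= L ->
  itg 0 L (tent c d) = itg (c - d) (c + d) (tent c d).
Proof.
move=> d0 h1 h2.
have hi x y : itb x y (tent c d) by apply: itb_cont; exact: tent_cont.
rewrite (@itg_split _ 0 (c - d))//; [|lra].
rewrite (@itg_split _ (c - d) (c + d) L)//; [|lra].
rewrite itg0_tent; [|lra|move=> y /andP[y1 y2]; rewrite distrC ger0_norm; lra].
rewrite [X in _ + (_ + X)]itg0_tent; [lra|lra|move=> y /andP[y1 y2]; rewrite ger0_norm; lra].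
Qed.

(** The lemma of du Bois-Reymond. Testing with [bump] shows that the averages of [h] against the two
    tents coincide; as the tents shrink these averages tend to [h s] and [h t]. *)
Lemma dubois L (h : R -> R) : 0 < L -> continuous h ->
  (forall phi, test_function L phi -> itg 0 L (fun t => h t * derive1 phi t) = 0) ->
  forall s t, 0 < s -> s < t -> t < L -> h s = h t.
Proof.
move=> L0 ch H s t s0 st tL; apply/eqP; rewrite -subr_eq0 -normr_le0.
apply/ler_addgt0Pl => e e0; rewrite addr0.
have e20 : 0 < e / 2 by lra.
have [d1 d10 hd1] := proj1 (cont_ed _ s) (ch s) _ e20.
have [d2 d20 hd2] := proj1 (cont_ed _ t) (ch t) _ e20.
(* Small enough for the continuity of [h] at both points and for both tents to lie inside []0,
   L[]. *)
pose d := Num.min (Num.min d1 d2) (Num.min s (L - t)) / 2.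
have [dd1 dd2 dds ddt] : [/\ d <= d1 / 2, d <= d2 / 2, d <= s / 2 & d <= (L - t) / 2].
  by rewrite /d !ler_pM2r// !ge_min !lexx !orbT.
have d0 : 0 < d by rewrite /d divr_gt0// !lt_min d10 d20 s0; lra.
have [sd1 sd2 td1 td2] : [/\ 0 < s - d, s + d < L, 0 < t - d & t + d < L] by split; lra.
have [dl1 dl2] : d < d1 /\ d < d2 by split; lra.
have h0 := H _ (@bump_test L s t d d0 (ltW st) ltac:(lra) ltac:(lra)).
have hi c : itb 0 L (tent c d) by apply: itb_cont; exact: tent_cont.
have hhi c : itb 0 L (fun x => h x * tent c d x).
  by apply: itb_cont; apply: cM => //; exact: tent_cont.
have e1 : itg 0 L (fun x => h x * tent s d x) = itg 0 L (fun x => h x * tent t d x).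
  apply/eqP; rewrite -subr_eq0 -itgB//; apply/eqP; rewrite -[RHS]h0; apply: eq_itg => x _.
  by rewrite derive1E (@derive_val _ _ _ _ _ _ _ (dbump s t d x)); ring.
have est c (e' : R) : 0 < c - d -> c + d < L -> 0 < e' ->
    (forall x, `|x - c| < d -> `|h x - h c| < e') ->
    `|itg 0 L (fun x => h x * tent c d x) - h c * itg 0 L (tent c d)| <= e' * itg 0 L (tent c d).
  move=> c1 c2 e'0 hc.
  rewrite -!itgZ// -itgB//; last exact: itbZ.
  have ii : itb 0 L (fun x => h x * tent c d x - h c * tent c d x).
    by apply: itbB => //; exact: itbZ.
  apply: (le_trans (itg_abs ii)); apply: le_itg; [exact: itb_abs|exact: itbZ|].
  move=> x _; rewrite -mulrBl normrM (ger0_norm (tent_ge0 _ _ _)).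
  have [xc|xc] := ltP `|x - c| d; first by rewrite ler_wpM2r ?tent_ge0// ltW// hc.
  by rewrite tent_out// !mulr0.
have m0 := tent_mass s d0.
have ms : itg 0 L (tent s d) = itg (s - d) (s + d) (tent s d).
  exact: itg_tent_full (ltW d0) (ltW sd1) (ltW sd2).
have mt : itg 0 L (tent t d) = itg (s - d) (s + d) (tent s d).
  rewrite (itg_tent_full (ltW d0) (ltW td1) (ltW td2)); exact: (itg_tent_shift t s (ltW d0)).
have es : forall x, `|x - s| < d -> `|h x - h s| < e / 2 by move=> x hx; apply: hd1; exact: lt_trans dl1.
have et : forall x, `|x - t| < d -> `|h x - h t| < e / 2 by move=> x hx; apply: hd2; exact: lt_trans dl2.
have k1 := est s _ sd1 sd2 e20 es.
have k2 := est t _ td1 td2 e20 et.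
rewrite ms in k1; rewrite mt in k2; rewrite e1 in k1.
set I := itg _ _ _ in m0 k1 k2; set J := itg 0 L _ in k1 k2.
rewrite -(ler_pM2r m0) -[X in _ * X](gtr0_norm m0) -normrM.
rewrite (_ : (h s - h t) * I = (J - h t * I) - (J - h s * I)); last by ring.
by apply: le_trans (ler_normB _ _) _; lra.
Qed.

(** [u] and the primitive of [v] have the same weak derivative, so [dubois] makes their difference
    constant. *)
Lemma weak_AC L u v : 0 < L -> {within `[0, L], continuous u} ->
  measurable_fun setT v -> itb 0 L v -> weak_derivative L u v ->
  AC 0 L (fun t => u (pr 0 L t)) v.
Proof.
move=> L0 cu mv iv w.
have cu' : continuous (fun t => u (pr 0 L t)) by apply: cont_pr => //; exact: ltW.
have HV := AC_prim 0 (ltW L0) mv iv.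
set V := fun t => _ in HV.
pose h t := u (pr 0 L t) - V t.
have ch : continuous h by apply: cB => //; exact: AC_cont HV.
have hh : forall s t, 0 < s -> s < t -> t < L -> h s = h t.
  apply: dubois => // phi tphi.
  have [Hphi p0 pL] := test_function_AC (ltW L0) tphi.
  have i1 : itb 0 L (fun t => u (pr 0 L t) * derive1 phi t).
    by apply: itb_contM => //; exact: AC_itb Hphi.
  have i2 : itb 0 L (fun t => V t * derive1 phi t).
    by apply: itb_contM; [exact: AC_itb Hphi|exact: AC_cont HV].
  have i3 : itb 0 L (fun t => v t * phi t).
    have := itb_contM iv (AC_cont Hphi).
    by apply: eq_itb => x _; rewrite mulrC.
  have -> : (fun t => h t * derive1 phi t) =
      (fun t => u (pr 0 L t) * derive1 phi t - V t * derive1 phi t).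
    by apply/funext => t; rewrite /h mulrBl.
  rewrite itgB//.
  have e1 := w phi tphi.
  have e2 := AC_weak L0 HV tphi.
  rewrite Rint_oo// in e2; rewrite e2 -e1 -Rint_oo//.
  apply/eqP; rewrite subr_eq0; apply/eqP; apply: eq_Rintegral => x.
  by rewrite inE/= in_itv/= => /andP[x1 x2]; rewrite pr_id// !ltW.
have hc : forall s t, 0 <= s -> s <= t -> t <= L -> h s = h t.
  (* by continuity up to the end points *)
  have key x : 0 <= x <= L -> h x = h (L / 2).
    move=> /andP[x0 xL]; apply/eqP; rewrite -subr_eq0 -normr_le0.
    apply/ler_addgt0Pl => e e0; rewrite addr0.
    have [d d0 hd] := proj1 (cont_ed _ x) (ch x) _ e0.
    pose d' := Num.min d L / 4.
    have d'0 : 0 < d' by rewrite /d' divr_gt0// lt_min d0.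
    have [k1 k2] : d' <= d / 4 /\ d' <= L / 4 by rewrite /d' !ler_pM2r// !ge_min !lexx !orbT.
    pose y := if x <= L / 2 then x + d' else x - d'.
    have hy : 0 < y < L by rewrite /y; case: ifPn; rewrite -?ltNge => ?; apply/andP; split; lra.
    have yd : `|y - x| < d.
      by rewrite /y; case: ifPn => _; rewrite ltr_norml; apply/andP; split; lra.
    have -> : h (L / 2) = h y.
      move: hy => /andP[y1 y2]; have [h1|h1|->//] := ltgtP y (L / 2).
        by apply/esym/hh => //; lra.
      by apply: hh => //; lra.
    by rewrite distrC ltW// hd.
  move=> s t s0 st tL; rewrite !key//; first by rewrite (le_trans s0).
  by rewrite s0 (le_trans st).
split => // s t s0 st tL.
have := hc s t s0 st tL; rewrite /h.
by have := AC_int HV s0 st tL; lra.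
Qed.

End Sobolev.

(** * Tangential angle and curvature of a Sobolev curve *)

Section Tangent.
Context {R : realType}.
Implicit Types (u v f g k : R -> R) (L p s t x y : R).
Notation mu := (@lebesgue_measure R).

Lemma measurable_maxE (D : set R) f g : measurable_fun D f -> measurable_fun D g ->
  measurable_fun D (fun x => Num.max (f x) (g x)).
Proof. by move=> mf mg; exact: measurable_maxr. Qed.

Definition ale s t f g : Prop := exists N : set R,
  [/\ measurable N, mu N = 0%E & forall x, s <= x <= t -> ~ N x -> f x <= g x].

(** Replacing [g] by the maximum turns an almost everywhere bound into one that holds everywhere, at
    the price of a modification on a null set; the ordinary comparison lemmas then apply. *)
Lemma ale_max s t f g : ale s t f g -> aeq s t g (fun x => Num.max (f x) (g x)).
Proof.
by move=> [N [mN N0 h]]; exists N; split => // x sx nN; rewrite max_r// h.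
Qed.

Lemma itb_ale s t f g : measurable_fun `[s, t] f -> ale s t f g ->
  (forall x, s <= x <= t -> 0 <= f x) -> itb s t g -> itb s t f.
Proof.
move=> mf h f0 ig; apply: (@itb_le _ _ _ _ (fun x => Num.max (f x) (g x))) => //.
- by move=> x sx; rewrite ger0_norm ?f0// le_max lexx.
- apply: (itb_ae _ (ale_max h) ig).
  by apply: measurable_maxE => //; exact: itb_meas.
Qed.

Lemma le_itg_ae s t f g : itb s t f -> itb s t g -> ale s t f g -> itg s t f <= itg s t g.
Proof.
move=> hf hg h.
have im : itb s t (fun x => Num.max (f x) (g x)).
  apply: (itb_ae _ (ale_max h) hg).
  by apply: measurable_maxE; exact: itb_meas.
rewrite (itg_ae hg im (ale_max h)); apply: le_itg => // x _.
by rewrite le_max lexx.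
Qed.

Lemma Lp_norm_lt_ae L p f G (e : R) : 0 < L -> 1 < p -> 0 < e -> measurable_fun setT f ->
  ale 0 L (fun t => `|f t|) G -> itb 0 L (fun t => `|G t| `^ p) ->
  itg 0 L (fun t => `|G t| `^ p) < e `^ p -> (Lp_norm L p f < e%:E)%E.
Proof.
move=> L0 p1 e0 mf [N [mN N0 h]] iG hG.
have p0 : p != 0 by rewrite gt_eqF//; lra.
have fG : ale 0 L (fun t => `|(f \_ `]0, L[) t| `^ p) (fun t => `|G t| `^ p).
  exists N; split => // x xL nN; apply: ge0_ler_powR; rewrite ?nnegrE//; first lra.
  rewrite patchE; case: ifPn => _; last by rewrite normr0.
  by rewrite (le_trans (h _ xL nN))// ler_norm.
have iF : itb 0 L (fun t => `|(f \_ `]0, L[) t| `^ p).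
  apply: (itb_ale _ fG _ iG); last by move=> x _; exact: powR_ge0.
  apply: measurable_funTS; apply: meas_npow; apply: meas_oo_restr.
  exact: measurable_funTS.
rewrite Lp_norm_eq// lte_fin.
have e1 : e = (e `^ p) `^ p^-1 by rewrite -powRrM mulfV// powRr1// ltW.
have hI := le_lt_trans (le_itg_ae iF iG fG) hG.
have pV : 0 < p^-1 by rewrite invr_gt0 (lt_trans _ p1).
rewrite e1; apply: (gt0_ltr_powR pV _ _ hI); rewrite nnegrE ?powR_ge0//.
by apply: itg_ge0 => x _; exact: powR_ge0.
Qed.

Lemma eq_Lp_norm L p f g : (forall t, 0 < t < L -> f t = g t) -> Lp_norm L p f = Lp_norm L p g.
Proof.
move=> e; rewrite /Lp_norm; congr Lnorm; apply/funext => t /=.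
by rewrite !patchE; case: ifPn => //; rewrite inE/= in_itv/= => /e ->.
Qed.

Lemma enorm_le (v : R * R) : enorm v <= `|v.1| + `|v.2|.
Proof.
rewrite /enorm -[leRHS]ger0_norm ?addr_ge0// -sqrtr_sqr ler_sqrt ?sqr_ge0//.
rewrite sqrrD !real_normK ?num_real//.
have : 0 <= `|v.1| * `|v.2| by rewrite mulr_ge0.
by rewrite -mulr_natl; lra.
Qed.

Lemma enorm_ge1 (v : R * R) : `|v.1| <= enorm v.
Proof. by rewrite /enorm -sqrtr_sqr ler_sqrt ?lerDl ?addr_ge0 ?sqr_ge0. Qed.

Lemma enorm_ge2 (v : R * R) : `|v.2| <= enorm v.
Proof. by rewrite /enorm -sqrtr_sqr ler_sqrt ?lerDr ?addr_ge0 ?sqr_ge0. Qed.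

Lemma enorm1 (v : R * R) : enorm v = 1 -> v.1 ^+ 2 + v.2 ^+ 2 = 1.
Proof.
rewrite /enorm => h; rewrite -[LHS]sqr_sqrtr ?h ?expr1n//.
by rewrite addr_ge0// sqr_ge0.
Qed.

Lemma polar (x y : R) : x ^+ 2 + y ^+ 2 = 1 ->
  exists a, [/\ - pi <= a, a <= pi, x = cos a & y = sin a].
Proof.
move=> xy.
have x1 : -1 <= x <= 1.
  have : 0 <= y ^+ 2 by exact: sqr_ge0.
  by move=> y0; apply/andP; split; nra.
have c := acosK x1.
have s : sin (acos x) = Num.sqrt (1 - x ^+ 2) by exact: sin_acos.
have s2 : sin (acos x) = `|y| by rewrite s -xy addrC addKr sqrtr_sqr.
have a0 := acos_ge0 x1; have api := acos_lepi x1; have pi0 := pi_ge0 R.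
have [y0|y0] := leP 0 y.
  by exists (acos x); rewrite c s2 ger0_norm//; split => //; lra.
exists (- acos x); rewrite cosN sinN c s2 ltr0_norm// opprK; split => //; lra.
Qed.

(** [S0], [S1] and [S2] are versions of the stored representatives with controlled values outside
    the interval: the functions are continued by constants and the second derivative by 0, which
    gives the global continuity and measurability in [AC]. *)
Definition S0 L p (s : sobolev2 L p) t := sob0 s (pr 0 L t).
Definition S1 L p (s : sobolev2 L p) t := sob1 s (pr 0 L t).
Definition S2 L p (s : sobolev2 L p) := sob2 s \_ `]0, L[.

Lemma S2_meas L p (s : sobolev2 L p) : measurable_fun setT (S2 s).
Proof. by have [h _] := sob2_Lp s; exact: meas_oo_restr. Qed.

Lemma S2_npow L p (s : sobolev2 L p) : 0 < L -> 1 < p -> itb 0 L (fun t => `|S2 s t| `^ p).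
Proof. by move=> L0 p1; have [h1 h2] := sob2_Lp s; exact: Lp_norm_fin. Qed.

Lemma S1_AC L p (s : sobolev2 L p) : 0 < L -> 1 < p -> AC 0 L (S1 s) (S2 s).
Proof.
move=> L0 p1; apply: weak_AC => //.
- exact: sob1_continuous.
- exact: S2_meas.
- by apply: npow_itb (S2_npow s L0 p1) => //; [exact: ltW|exact: S2_meas].
- move=> phi tphi; rewrite (sob2_weak s tphi); congr (- _).
  by apply: eq_Rintegral => x; rewrite inE/= in_itv/= => hx; rewrite /S2 restr_oo.
Qed.

Lemma S0_AC L p (s : sobolev2 L p) : 0 < L -> AC 0 L (S0 s) (S1 s).
Proof.
move=> L0.
have cS1 : continuous (S1 s) by apply: cont_pr (ltW L0) _; exact: sob1_continuous.
apply: weak_AC => //.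
- exact: sob0_continuous.
- exact: continuous_measurable_fun.
- exact: itb_cont.
- move=> phi tphi; rewrite (sob1_weak s tphi); congr (- _).
  apply: eq_Rintegral => x; rewrite inE/= in_itv/= => /andP[x0 xL].
  by rewrite /S1 pr_id// !ltW.
Qed.

(** [th] is a lift of the velocity to angles; since the curve then has unit speed, [k] is a version
    of its signed curvature. *)
Definition tangent L p (g : curve L p) (th k : R -> R) : Prop :=
  AC 0 L th k /\ forall t, 0 <= t <= L -> vel g t = (cos (th t), sin (th t)).

Lemma AC_cos L th k : 0 <= L -> AC 0 L th k ->
  AC 0 L (fun t => cos (th t)) (fun t => - sin (th t) * k t).
Proof.
move=> L0 H; apply: (AC_C1 H L0 (F := cos) (F' := fun x => - sin x)).
by apply: cN; exact: continuous_sin.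
Qed.

Lemma AC_sin L th k : 0 <= L -> AC 0 L th k ->
  AC 0 L (fun t => sin (th t)) (fun t => cos (th t) * k t).
Proof.
move=> L0 H; apply: (AC_C1 H L0 (F := sin) (F' := cos)).
exact: continuous_cos.
Qed.

(** The lift is the primitive of the curvature [x1 y2 - y1 x2]. Its direction and the velocity have
    an inner product with zero derivative, equal to 1 at the start, and unit vectors with inner
    product 1 coincide. *)
Lemma exists_tangent L p (g : curve L p) (a : R) : 0 < L -> 1 < p ->
  (forall t, 0 <= t <= L -> enorm (vel g t) = 1) -> vel g 0 = (cos a, sin a) ->
  exists th k, tangent g th k /\ th 0 = a.
Proof.
move=> L0 p1 g1 g0; have L0' := ltW L0.
have Hx := S1_AC g.1 L0 p1; have Hy := S1_AC g.2 L0 p1.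
set x1 := S1 g.1 in Hx; set y1 := S1 g.2 in Hy; set x2 := S2 _ in Hx; set y2 := S2 _ in Hy.
have xy t : 0 <= t <= L -> x1 t ^+ 2 + y1 t ^+ 2 = 1.
  by move=> tL; have := enorm1 (g1 t tL); rewrite /= /x1 /y1 /S1 pr_id.
pose k t := x1 t * y2 t + - y1 t * x2 t.
have cx := AC_cont Hx; have cy := AC_cont Hy.
have mk : measurable_fun setT k.
  apply: measurable_funD; apply: measurable_funM;
    [exact: continuous_measurable_fun|exact: S2_meas| |exact: S2_meas].
  by apply: continuous_measurable_fun; exact: cN.
have ik : itb 0 L k.
  apply: itbD; apply: itb_contM; [exact: (AC_itb Hy)|by []|exact: (AC_itb Hx)|exact: cN].
have HT := AC_prim a L0' mk ik.
set th := fun t => _ in HT.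
have th0 : th 0 = a by rewrite /th prim_E ?lexx// itgxx addr0.
exists th, k; split => //; split => // t tL.
(* Differentiating [|vel|^2 = 1]: velocity and acceleration are orthogonal almost everywhere. *)
have m0 : aeq 0 L (fun t => x1 t * x2 t + y1 t * y2 t) (fun=> 0).
  have h := AC_D (AC_sqr Hx L0') (AC_sqr Hy L0').
  have [N [mN N0 hN]] := AC_uniq h (AC_cst 0 L 1) L0' xy.
  by exists N; split => // s sL /(hN _ sL); lra.
have HC := AC_D (AC_M Hx (AC_cos L0' HT) L0') (AC_M Hy (AC_sin L0' HT) L0').
have HC0 : AC 0 L (fun t => x1 t * cos (th t) + y1 t * sin (th t)) (fun=> 0).
  apply: AC_eqk HC; first exact: measurable_cst.
  have [N [mN N0 hN]] := m0; exists N; split => // s sL nN.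
  have m := hN s sL nN; have e := xy s sL.
  have ex : x2 s = - y1 s * k s.
    have -> : x2 s = x2 s * (x1 s ^+ 2 + y1 s ^+ 2) - x1 s * (x1 s * x2 s + y1 s * y2 s).
      by rewrite m e; ring.
    by rewrite /k; ring.
  have ey : y2 s = x1 s * k s.
    have -> : y2 s = y2 s * (x1 s ^+ 2 + y1 s ^+ 2) - y1 s * (x1 s * x2 s + y1 s * y2 s).
      by rewrite m e; ring.
    by rewrite /k; ring.
  by rewrite [in X in X * cos _]ex [in X in X * sin _ ]ey; ring.
have e1 : x1 t * cos (th t) + y1 t * sin (th t) = 1.
  rewrite (AC_const HC0 tL) th0.
  have : vel g 0 = (x1 0, y1 0) by rewrite /x1 /y1 /S1 pr_id// lexx.
  by rewrite g0 => -[<- <-]; rewrite -!expr2 cos2Dsin2.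
have e2 := xy t tL; have e3 := cos2Dsin2 (th t).
have hx : x1 t = cos (th t).
  apply/eqP; rewrite -subr_eq0 -sqrf_eq0; apply/eqP.
  have := sqr_ge0 (x1 t - cos (th t)); have := sqr_ge0 (y1 t - sin (th t)); nra.
have hy : y1 t = sin (th t).
  apply/eqP; rewrite -subr_eq0 -sqrf_eq0; apply/eqP.
  have := sqr_ge0 (x1 t - cos (th t)); have := sqr_ge0 (y1 t - sin (th t)); nra.
by rewrite -hx -hy /x1 /y1 /S1 pr_id.
Qed.

Lemma tangent_acc L p (g : curve L p) th k : 0 < L -> 1 < p -> tangent g th k ->
  aeq 0 L (S2 g.1) (fun t => - sin (th t) * k t) /\ aeq 0 L (S2 g.2) (fun t => cos (th t) * k t).
Proof.
move=> L0 p1 [H hv]; have L0' := ltW L0; split.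
- apply: AC_uniq (S1_AC g.1 L0 p1) (AC_cos L0' H) L0' _ => t tL.
  by have := hv t tL; rewrite /S1 pr_id// => -[].
- apply: AC_uniq (S1_AC g.2 L0 p1) (AC_sin L0' H) L0' _ => t tL.
  by have := hv t tL; rewrite /S1 pr_id// => -[].
Qed.

Lemma tangent_npow L p (g : curve L p) th k : 0 < L -> 1 < p -> tangent g th k ->
  itb 0 L (fun t => `|k t| `^ p).
Proof.
move=> L0 p1 T; have [h1 h2] := tangent_acc L0 p1 T; have [H _] := T.
have p0 : 0 <= p by lra.
apply: (@itb_ale _ _ _ (fun t => 2 `^ p * (`|S2 g.1 t| `^ p + `|S2 g.2 t| `^ p))).
- by apply: measurable_funTS; apply: meas_npow; exact: AC_meas H.
- have [N [mN N0 hN]] := h1; have [M [mM M0 hM]] := h2.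
  exists (N `|` M); split; [exact: measurableU|by rewrite null_set_setU|].
  move=> x xL /not_orP[nN nM]; rewrite hN// hM//.
  (* [|sin| + |cos|] dominates [sin^2 + cos^2 = 1], so the two components of the acceleration
     together control [|k|]. *)
  have h : `|k x| <= `| `|- sin (th x) * k x| + `|cos (th x) * k x| |.
    rewrite (ger0_norm (addr_ge0 _ _))// !normrM -mulrDl normrN.
    rewrite -[leLHS]mul1r ler_wpM2r// -(cos2Dsin2 (th x)) addrC.
    apply: lerD; rewrite -real_normK ?num_real// expr2 ler_piMr//.
      exact: sin_max.
    exact: cos_max.
  apply: (@le_trans _ _ (`| `|- sin (th x) * k x| + `|cos (th x) * k x| | `^ p)).
    by apply: ge0_ler_powR => //; rewrite nnegrE.
  by apply: le_trans (norm_powD _ _ p0) _; rewrite !normr_id.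
- by move=> x _; exact: powR_ge0.
- apply: itbZ; apply: itbD; exact: S2_npow.
Qed.

Lemma tangent_energy L p (g : curve L p) th k : 0 < L -> 1 < p -> tangent g th k ->
  bending_energy g = (itg 0 L (fun t => `|k t| `^ p))%:E.
Proof.
move=> L0 p1 T; have [[N [mN N0 hN]] [M [mM M0 hM]]] := tangent_acc L0 p1 T; have [H hv] := T.
have ik := tangent_npow L0 p1 T.
rewrite /bending_energy.
pose c t := S1 g.1 t * S2 g.2 t - S1 g.2 t * S2 g.1 t.
have cE t : 0 <= t <= L -> S1 g.1 t = cos (th t) /\ S1 g.2 t = sin (th t).
  by move=> tL; have := hv t tL; rewrite /S1 !pr_id// => -[].
have ck : aeq 0 L (fun t => `|k t| `^ p) (fun t => `|c t| `^ p).
  exists (N `|` M); split; [exact: measurableU|by rewrite null_set_setU|].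
  move=> x xL /not_orP[nN nM]; rewrite /c hN// hM//; have [-> ->] := cE x xL.
  congr (`|_| `^ _); transitivity ((cos (th x) ^+ 2 + sin (th x) ^+ 2) * k x); last ring.
  by rewrite cos2Dsin2 mul1r.
have L0' := ltW L0.
have mc : measurable_fun setT c.
  by apply: measurable_funB; apply: measurable_funM; try exact: S2_meas;
    apply: continuous_measurable_fun; exact: (AC_cont (S1_AC _ L0 p1)).
have ic : itb 0 L (fun t => `|c t| `^ p).
  by apply: itb_ae ck ik; apply: measurable_funTS; exact: meas_npow.
rewrite (_ : itg 0 L _ = itg 0 L (fun t => `|c t| `^ p)); last exact: itg_ae.
rewrite -(int_oo ic); apply: eq_integral => x; rewrite inE/= in_itv/= => hx.
have xL : 0 <= x <= L by case/andP: hx => ? ?; rewrite !ltW.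
rewrite /curvature /det2 /=; congr (_%:E); congr (`|_| `^ _).
rewrite [enorm _](_ : _ = 1); last first.
  by rewrite (hv x xL) /enorm/= cos2Dsin2 sqrtr1.
by rewrite expr1n divr1 /c /S1 /S2 !restr_oo// pr_id.
Qed.

Lemma tangent_pos L p (g : curve L p) th k t : 0 < L -> 1 < p -> tangent g th k ->
  0 <= t <= L ->
  pos g t = pos g 0 + (itg 0 t (fun s => cos (th s)), itg 0 t (fun s => sin (th s))).
Proof.
move=> L0 p1 [H hv] tL; have [t0 tL'] := andP tL.
have h1 := AC_int (S0_AC g.1 L0) (lexx 0) t0 tL'.
have h2 := AC_int (S0_AC g.2 L0) (lexx 0) t0 tL'.
have e0 : pr 0 L 0 = 0 by rewrite pr_id// lexx ltW.
have et : pr 0 L t = t by rewrite pr_id.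
rewrite /S0 e0 et in h1 h2.
rewrite /pos; apply: injective_projections => /=.
  have -> : itg 0 t (fun s => cos (th s)) = itg 0 t (S1 g.1).
    apply: eq_itg => s /andP[s0 st].
    have sL : 0 <= s <= L by rewrite s0 (le_trans st).
    by have := hv s sL; rewrite /S1 pr_id// => -[].
  by rewrite -h1 subrKC.
have -> : itg 0 t (fun s => sin (th s)) = itg 0 t (S1 g.2).
  apply: eq_itg => s /andP[s0 st].
  have sL : 0 <= s <= L by rewrite s0 (le_trans st).
  by have := hv s sL; rewrite /S1 pr_id// => -[].
by rewrite -h2 subrKC.
Qed.

Lemma exists_sobolev L p (x : R) u k : 0 < L -> 1 < p -> AC 0 L u k ->
  itb 0 L (fun t => `|k t| `^ p) ->
  exists s : sobolev2 L p, [/\ sob0 s 0 = x, sob1 s = u & sob2 s = k].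
Proof.
move=> L0 p1 H ik; have L0' := ltW L0; have cu := AC_cont H.
have HP := AC_prim x L0' (continuous_measurable_fun cu) (itb_cont 0 L cu).
set U := fun t => _ in HP.
have mk := AC_meas H.
have kLp : in_Lp L p k.
  split; first exact: measurable_funTS.
  have mr : measurable_fun setT (k \_ `]0, L[) by apply: meas_oo_restr; exact: measurable_funTS.
  rewrite Lp_norm_eq ?ltry//.
  apply: itb_ae ik; first by apply: measurable_funTS; exact: meas_npow.
  have [N [mN N0 hN]] := aeq_restrict 0 L k.
  by exists N; split => // y yL nN; rewrite hN.
exists (@Sobolev2 _ L p U u k (continuous_subspaceT (AC_cont HP)) (continuous_subspaceT cu) kLp
  (AC_weak L0 HP) (AC_weak L0 H)).
by split => //=; rewrite /U prim_E ?lexx// itgxx addr0.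
Qed.

Lemma exists_curve L p (P : R * R) th k : 0 < L -> 1 < p -> AC 0 L th k ->
  itb 0 L (fun t => `|k t| `^ p) ->
  exists g : curve L p, tangent g th k /\ pos g 0 = P.
Proof.
move=> L0 p1 H ik; have L0' := ltW L0; have mk := AC_meas H; have ct := AC_cont H.
have bnd (c : R -> R) : continuous c -> (forall x, `|c x| <= 1) ->
    itb 0 L (fun t => `|c t * k t| `^ p).
  move=> cc c1; apply: itb_le ik.
    apply: measurable_funTS; apply: meas_npow; apply: measurable_funM => //.
    exact: continuous_measurable_fun.
  move=> x _; rewrite ger0_norm ?powR_ge0//; apply: ge0_ler_powR; rewrite ?nnegrE//; first lra.
  by rewrite normrM ler_piMl.
have [|s1 [h1 h2 h3]] := exists_sobolev P.1 L0 p1 (AC_cos L0' H).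
  by apply: bnd; [apply: cN; exact: csin|move=> x; rewrite normrN sin_max].
have [|s2 [k1 k2 k3]] := exists_sobolev P.2 L0 p1 (AC_sin L0' H).
  by apply: bnd; [exact: ccos|move=> x; exact: cos_max].
exists (s1, s2); split; last by rewrite /pos/= h1 k1 -surjective_pairing.
by split => // t _; rewrite /vel /= h2 k2.
Qed.

End Tangent.

(** * Uniformly close curvatures give close curves *)

Section Nearness.
Context {R : realType}.
Implicit Types (u v f g k th : R -> R) (L p s t x y e d : R).
Notation mu := (@lebesgue_measure R).

Lemma lip_of_deriv (F F' : R -> R) x y : (forall z : R, is_derive z 1 F (F' z)) ->
  (forall z, `|F' z| <= 1) -> `|F x - F y| <= `|x - y|.
Proof.
move=> dF F1; wlog xy : x y / x < y => [h|].
  have [/h//|/h|->] := ltgtP x y; last by rewrite !subrr.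
  by rewrite distrC [in leRHS]distrC.
have cF : {within `[x, y], continuous F}.
  by apply: continuous_subspaceT => z; exact: d_cont (dF z).
have [c _ e] := @MVT R F F' x y xy (fun z _ => dF z) cF.
by rewrite distrC e distrC normrM ler_piMl.
Qed.

Lemma cos_lip x y : `|cos x - cos y| <= `|x - y|.
Proof.
apply: (@lip_of_deriv cos (fun z => - sin z)) => z.
by rewrite normrN sin_max.
Qed.

Lemma sin_lip x y : `|sin x - sin y| <= `|x - y|.
Proof.
apply: (@lip_of_deriv sin cos) => z; exact: cos_max.
Qed.

Lemma AC_diff_bound L u v k l d : AC 0 L u k -> AC 0 L v l -> u 0 = v 0 ->
  (forall t, 0 <= t <= L -> `|k t - l t| <= d) ->
  forall t, 0 <= t <= L -> `|u t - v t| <= d * L.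
Proof.
move=> H H' uv kl t /andP[t0 tL].
have i1 := AC_itb_sub H (lexx 0) tL; have i2 := AC_itb_sub H' (lexx 0) tL.
have -> : u t - v t = itg 0 t (fun x => k x - l x).
  by rewrite itgB// -(AC_int H)// -(AC_int H')// uv; ring.
have d0 : 0 <= d by apply: le_trans (kl 0 _) => //; rewrite lexx (le_trans t0).
apply: (@le_trans _ _ (d * (t - 0))); last by rewrite subr0 ler_wpM2l.
apply: itg_bound => //; first exact: itbB.
by move=> x /andP[x0 xt]; apply: kl; rewrite x0 (le_trans xt).
Qed.

Lemma small_scale p (M e : R) : 1 < p -> 0 <= M -> 0 < e -> exists2 d, 0 < d & d `^ p * M < e `^ p.
Proof.
move=> p1 M0 e0; exists (e * (M + 1) `^ (- p^-1)).
  by rewrite mulr_gt0// powR_gt0//; lra.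
rewrite powRM ?powR_ge0 ?ltW// -powRrM mulNr mulVf; last by rewrite gt_eqF//; lra.
rewrite powR_inv1; last lra.
rewrite -mulrA gtr_pMr ?powR_gt0// mulrC ltr_pdivrMr; lra.
Qed.

Lemma pair_sub (a b : R * R) : a - b = (a.1 - b.1, a.2 - b.2). Proof. by []. Qed.

Lemma measurable_enorm (f g : R -> R) : measurable_fun setT f -> measurable_fun setT g ->
  measurable_fun setT (fun t => enorm (f t, g t)).
Proof.
move=> mf mg; rewrite /enorm /=.
apply: (measurableT_comp (continuous_measurable_fun (@sqrt_continuous R))).
by apply: measurable_funD; apply: measurable_funX.
Qed.

(** Curves with the same initial data and curvatures within [d] differ in position, velocity and
    acceleration by at most [d * G], where [G] is a fixed function with integrable power; then [d]
    is scaled down until each of the three norms is below [e / 3]. *)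
Lemma near_curve L p (g : curve L p) th k e : 0 < L -> 1 < p -> tangent g th k -> 0 < e ->
  exists2 d, 0 < d & forall th' k' (h : curve L p), tangent h th' k' -> th' 0 = th 0 ->
    pos h 0 = pos g 0 -> (forall t, 0 <= t <= L -> `|k' t - k t| <= d) ->
    (W2p_dist g h < e%:E)%E.
Proof.
move=> L0 p1 T e0; have [H hv] := T; have L0' := ltW L0; have ik := tangent_npow L0 p1 T.
have mk := AC_meas H.
(* The angles differ by at most [d * L] and the positions by at most [d * L^2] in each coordinate;
   the accelerations bring in the factor [1 + L * |k|], hence the shape of [G]. *)
pose C := 2 * (1 + L + L ^+ 2).
pose G t := C * (1 + L * `|k t|).
have C0 : 0 <= C by rewrite /C mulr_ge0// addr_ge0 ?sqr_ge0//; lra.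
have G0 t : 0 <= G t by rewrite /G mulr_ge0// addr_ge0// mulr_ge0.
have GC t : C <= G t by rewrite /G ler_peMr// lerDl mulr_ge0.
have mG : measurable_fun setT G.
  apply: measurable_funM; first exact: measurable_cst.
  apply: measurable_funD; first exact: measurable_cst.
  apply: measurable_funM; first exact: measurable_cst.
  exact: measurableT_comp.
have iG : itb 0 L (fun t => `|G t| `^ p).
  apply: (@itb_le _ _ _ _ (fun t => C `^ p * (2 `^ p * (1 + L `^ p * `|k t| `^ p)))).
  - by apply: measurable_funTS; exact: meas_npow.
  - move=> t _; rewrite ger0_norm ?powR_ge0// /G normrM powRM// (ger0_norm C0).
    apply: ler_wpM2l; first exact: powR_ge0.
    apply: le_trans (norm_powD _ _ (ltW (lt_trans ltr01 p1))) _.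
    by rewrite normr1 powR1 normrM normr_id powRM// (gtr0_norm L0).
  - by do 2 apply: itbZ; apply: itbD; [exact: itb_cst|exact: itbZ].
pose M := itg 0 L (fun t => `|G t| `^ p).
have M0 : 0 <= M by apply: itg_ge0 => x _; exact: powR_ge0.
have e30 : 0 < e / 3 by lra.
have [d d0 hd] := small_scale p1 M0 e30.
exists d => // th' k' h T' th0 ph kk; have [H' hv'] := T'.
have dth := AC_diff_bound H' H th0 kk.
have cth := AC_cont H; have cth' := AC_cont H'.
have hnorm f1 : measurable_fun setT f1 -> ale 0 L (fun t => `|f1 t|) (fun t => d * G t) ->
    (Lp_norm L p f1 < (e / 3)%:E)%E.
  have eG : (fun t => `|d * G t| `^ p) = (fun t => d `^ p * `|G t| `^ p).
    by apply/funext => t; rewrite normrM powRM// (gtr0_norm d0).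
  move=> mf hf; apply: (Lp_norm_lt_ae L0 p1 e30 mf hf).
    by rewrite eG; exact: itbZ.
  by rewrite eG itgZ.
have dpos t : 0 <= t <= L -> enorm (pos g t - pos h t) <= d * C.
  move=> tL; have [t0 tL'] := andP tL.
  rewrite (tangent_pos L0 p1 T tL) (tangent_pos L0 p1 T' tL) ph.
  apply: le_trans (enorm_le _) _ => /=.
  have ii (c : R -> R) th1 : continuous c -> continuous th1 -> itb 0 t (fun s => c (th1 s)).
    by move=> cc ct; apply: itb_cont; exact: ccomp.
  have key (c : R -> R) : continuous c -> (forall x y, `|c x - c y| <= `|x - y|) ->
     `|itg 0 t (fun s => c (th s)) - itg 0 t (fun s => c (th' s))| <= d * L * L.
    move=> cc lc; rewrite -itgB; [|exact: ii|exact: ii].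
    apply: (@le_trans _ _ (d * L * (t - 0))); last first.
      by rewrite subr0 ler_wpM2l// mulr_ge0// ltW.
    apply: itg_bound => //; first by apply: itbB; exact: ii.
    move=> x /andP[x0 xt]; apply: le_trans (lc _ _) _; rewrite distrC; apply: dth.
    by rewrite x0 (le_trans xt).
  have k1 := key _ (@continuous_cos R) cos_lip.
  have k2 := key _ (@continuous_sin R) sin_lip.
  have E (a b c : R) : a + b - (a + c) = b - c by ring.
  rewrite !E.
  apply: le_trans (lerD k1 k2) _; rewrite /C.
  have : 0 <= d * (1 + L) by rewrite mulr_ge0//; lra.
  by rewrite expr2; lra.
have dvel t : 0 <= t <= L -> enorm (vel g t - vel h t) <= d * C.
  move=> tL; rewrite hv// hv'//; apply: le_trans (enorm_le _) _ => /=.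
  have k0 := dth t tL; rewrite distrC in k0.
  have k1 := le_trans (cos_lip (th t) (th' t)) k0.
  have k2 := le_trans (sin_lip (th t) (th' t)) k0.
  apply: le_trans (lerD k1 k2) _; rewrite /C.
  have : 0 <= d * (1 + L ^+ 2) by rewrite mulr_ge0// ?addr_ge0 ?sqr_ge0// ltW.
  lra.
have pS0 (s : sobolev2 L p) t : 0 < t < L -> sob0 s t = S0 s t.
  by move=> /andP[t0 tL]; rewrite /S0 pr_id// !ltW.
have pS1 (s : sobolev2 L p) t : 0 < t < L -> sob1 s t = S1 s t.
  by move=> /andP[t0 tL]; rewrite /S1 pr_id// !ltW.
have mS0 (s : sobolev2 L p) : measurable_fun setT (S0 s).
  by apply: continuous_measurable_fun; exact: AC_cont (S0_AC s L0).
have mS1 (s : sobolev2 L p) : measurable_fun setT (S1 s).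
  by apply: continuous_measurable_fun; exact: AC_cont (S1_AC s L0 p1).
have n1 : (Lp_norm L p (fun t => enorm (pos g t - pos h t)%R) < (e / 3)%:E)%E.
  rewrite (@eq_Lp_norm _ _ _ _ (fun t => enorm (S0 g.1 t - S0 h.1 t, S0 g.2 t - S0 h.2 t))); last first.
    by move=> t tL; rewrite pair_sub /= !pS0.
  apply: hnorm.
    by apply: measurable_enorm; apply: measurable_funB; exact: mS0.
  exists set0; split; [exact: measurable0|exact: measure0|move=> t tL _].
  rewrite ger0_norm ?sqrtr_ge0//; apply: (@le_trans _ _ (d * C)).
    by have := dpos t tL; rewrite pair_sub /= /S0 pr_id.
  by rewrite ler_wpM2l// ltW.
have n2 : (Lp_norm L p (fun t => enorm (vel g t - vel h t)%R) < (e / 3)%:E)%E.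
  rewrite (@eq_Lp_norm _ _ _ _ (fun t => enorm (S1 g.1 t - S1 h.1 t, S1 g.2 t - S1 h.2 t))); last first.
    by move=> t tL; rewrite pair_sub /= !pS1.
  apply: hnorm.
    by apply: measurable_enorm; apply: measurable_funB; exact: mS1.
  exists set0; split; [exact: measurable0|exact: measure0|move=> t tL _].
  rewrite ger0_norm ?sqrtr_ge0//; apply: (@le_trans _ _ (d * C)).
    by have := dvel t tL; rewrite pair_sub /= /S1 pr_id.
  by rewrite ler_wpM2l// ltW.
have n3 : (Lp_norm L p (fun t => enorm (acc g t - acc h t)%R) < (e / 3)%:E)%E.
  rewrite (@eq_Lp_norm _ _ _ _ (fun t => enorm (S2 g.1 t - S2 h.1 t, S2 g.2 t - S2 h.2 t))); last first.
    by move=> t tL; rewrite pair_sub /= /S2 !restr_oo.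
  apply: hnorm.
    by apply: measurable_enorm; apply: measurable_funB; exact: S2_meas.
  have [[N1 [mN1 N10 hN1]] [N2 [mN2 N20 hN2]]] := tangent_acc L0 p1 T.
  have [[N3 [mN3 N30 hN3]] [N4 [mN4 N40 hN4]]] := tangent_acc L0 p1 T'.
  exists ((N1 `|` N2) `|` (N3 `|` N4)); split.
  - by apply: measurableU; exact: measurableU.
  - by rewrite !null_set_setU//; exact: measurableU.
  - move=> t tL /not_orP[/not_orP[nN1 nN2] /not_orP[nN3 nN4]].
    rewrite hN1// hN2// hN3// hN4// ger0_norm ?sqrtr_ge0//.
    apply: le_trans (enorm_le _) _ => /=.
    have k0 := dth t tL; have kt := kk t tL.
    have b (c : R -> R) : (forall x y, `|c x - c y| <= `|x - y|) -> (forall x, `|c x| <= 1) ->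
        `|c (th t) * k t - c (th' t) * k' t| <= d * (1 + L * `|k t|).
      move=> lc c1.
      rewrite (_ : _ - _ = (c (th t) - c (th' t)) * k t + c (th' t) * (k t - k' t)); last by ring.
      apply: le_trans (ler_normD _ _) _; rewrite !normrM.
      have b1 : `|c (th t) - c (th' t)| * `|k t| <= d * L * `|k t|.
        by rewrite ler_wpM2r// (le_trans (lc _ _))// distrC.
      have b2 : `|c (th' t)| * `|k t - k' t| <= d.
        by rewrite distrC; apply: le_trans kt; rewrite ler_piMl.
      by rewrite mulrDr mulr1 mulrA; lra.
    have b1 := b _ cos_lip (@cos_max R).
    have b2 : `|- sin (th t) * k t - - sin (th' t) * k' t| <= d * (1 + L * `|k t|).
      apply: (b (fun x => - sin x)); last by move=> x; rewrite normrN sin_max.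
      move=> x y; rewrite (_ : _ - _ = sin y - sin x); last by ring.
      by rewrite [leLHS]distrC; exact: sin_lip.
    apply: le_trans (lerD b2 b1) _; rewrite /G mulrCA /C.
    have w0 : 0 <= d * (1 + L * `|k t|).
      by rewrite mulr_ge0// ?ltW// ltr_pwDl// mulr_ge0.
    have : 0 <= (L + L ^+ 2) * (d * (1 + L * `|k t|)).
      by rewrite mulr_ge0// addr_ge0// sqr_ge0.
    lra.
rewrite /W2p_dist (_ : e%:E = ((e / 3)%:E + (e / 3)%:E + (e / 3)%:E)%E); last first.
  by rewrite -!EFinD; congr EFin; field.
by apply: lteD => //; exact: lteD.
Qed.

(** Competitors with uniformly close curvature suffice both for the Euler-Lagrange equation and for
    the shift of the curvature, so the necessity part can forget the Sobolev distance and work with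
    angles alone. *)
Lemma local_min_angle L p (P V : R * R) (g : curve L p) th k :
  0 < L -> 1 < p -> tangent g th k ->
  local_minimizer (@bending_energy R L p) (clamped P P V V) g ->
  exists2 d, 0 < d & forall th' k', AC 0 L th' k' -> th' 0 = th 0 -> th' L = th L ->
    itg 0 L (fun t => cos (th' t)) = 0 -> itg 0 L (fun t => sin (th' t)) = 0 ->
    (forall t, 0 <= t <= L -> `|k' t - k t| <= d) ->
    itg 0 L (fun t => `|k t| `^ p) <= itg 0 L (fun t => `|k' t| `^ p).
Proof.
move=> L0 p1 T [[g1 g0 gL v0 vL] [e e0 he]]; have ik := tangent_npow L0 p1 T.
have [d d0 hd] := near_curve L0 p1 T e0.
exists d; first exact: d0.
move=> th' k' H' th0 thL hc hs kk.
have ik' : itb 0 L (fun t => `|k' t| `^ p).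
  apply: (@itb_le _ _ _ _ (fun t => 2 `^ p * (`|k t| `^ p + d `^ p))).
  - by apply: measurable_funTS; apply: meas_npow; exact: AC_meas H'.
  - move=> t tL; rewrite ger0_norm ?powR_ge0//.
    have -> : k' t = k t + (k' t - k t) by ring.
    apply: le_trans (norm_powD _ _ _) _; first lra.
    rewrite ler_wpM2l ?powR_ge0// lerD2l.
    by apply: ge0_ler_powR; rewrite ?nnegrE ?kk// ltW// (lt_trans ltr01).
  - by apply: itbZ; apply: itbD => //; exact: itb_cst.
have [h [T' ph]] := exists_curve P L0 p1 H' ik'.
have hv' := T'.2; have hv := T.2.
have oL : 0 <= L <= L by apply/andP; split; [exact: ltW|exact: lexx].
have o0 : 0 <= (0 : R) <= L by apply/andP; split; [exact: lexx|exact: ltW].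
have Xh : clamped P P V V h.
  split => //.
  - by move=> t tL; rewrite hv'// /enorm /= cos2Dsin2 sqrtr1.
  - rewrite (tangent_pos L0 p1 T' oL) ph hc hs.
    by rewrite [P]surjective_pairing; congr pair; rewrite /= addr0.
  - by rewrite hv'// th0 -hv.
  - by rewrite hv'// thL -hv.
have := he h Xh (hd th' k' h T' th0 (etrans ph (esym g0)) kk).
by rewrite (tangent_energy L0 p1 T) (tangent_energy L0 p1 T') lee_fin.
Qed.

End Nearness.

(** * The Euler-Lagrange equation *)

Section Closing.
Context {R : realType}.
Implicit Types (u v f g k th w : R -> R) (L p s t x y e d a b q : R).
Notation mu := (@lebesgue_measure R).

Lemma eq_ler x y : x = y -> x <= y. Proof. by move=> ->. Qed.

Lemma lip_cont f q : (forall x y, `|f x - f y| <= q * `|x - y|) -> continuous f.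
Proof.
move=> h x; apply/cont_ed => e e0; exists (e / (`|q| + 1)).
  by rewrite divr_gt0// ltr_wpDl.
move=> y; rewrite ltr_pdivlMr ?ltr_wpDl// => hy.
apply: le_lt_trans (h y x) _; apply: le_lt_trans hy.
by rewrite mulrC ler_wpM2l// (le_trans (ler_norm q))// lerDl.
Qed.

(* a contraction of the interval has a fixed point, here by the IVT *)
Lemma fix1 e q f : 0 <= e -> (forall x, `|x| <= e -> `|f x| <= e) ->
  (forall x y, `|x| <= e -> `|y| <= e -> `|f x - f y| <= q * `|x - y|) ->
  exists2 b, `|b| <= e & b = f b.
Proof.
move=> e0 fe fl; have ee : - e <= e by lra.
have he b : `|pr (- e) e b| <= e by rewrite ler_norml; exact: pr_itv.
have c : continuous (fun b => pr (- e) e b - f (pr (- e) e b)).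
  apply: (@lip_cont _ (1 + `|q|)) => x y.
  rewrite (_ : _ - _ - _ = (pr (- e) e x - pr (- e) e y) - (f (pr (- e) e x) - f (pr (- e) e y))); last by ring.
  apply: le_trans (ler_normB _ _) _; rewrite mulrDl mul1r; apply: lerD; first exact: pr_lip.
  apply: le_trans (fl _ _ (he x) (he y)) _.
  apply: le_trans (ler_wpM2r (normr_ge0 _) (ler_norm q)) _.
  by rewrite ler_wpM2l// pr_lip.
have pe : pr (- e) e e = e by rewrite pr_id// ee lexx.
have pN : pr (- e) e (- e) = - e by rewrite pr_id// ee lexx.
have [] := ivt (v := 0) ee c.
  rewrite pe pN ge_min le_max.
  have := fe e; have := fe (- e); rewrite normrN ger0_norm// !ler_norml => /(_ (lexx _))/andP[h1 h2] /(_ (lexx _))/andP[h3 h4].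
  by apply/andP; split; apply/orP; [left|right]; lra.
move=> b bi h; exists (pr (- e) e b) => //.
by apply/eqP; rewrite -subr_eq0 h.
Qed.

(** Two nested uses of the one-dimensional case: [b = G a b] is solved for each [a], and the
    solution is inserted into [F]. *)
Lemma fix2 e (F G : R -> R -> R) : 0 <= e ->
  (forall a b, `|a| <= e -> `|b| <= e -> `|F a b| <= e /\ `|G a b| <= e) ->
  (forall a b a' b', `|a| <= e -> `|b| <= e -> `|a'| <= e -> `|b'| <= e ->
     `|F a b - F a' b'| <= 4^-1 * (`|a - a'| + `|b - b'|) /\
     `|G a b - G a' b'| <= 4^-1 * (`|a - a'| + `|b - b'|)) ->
  exists a b, [/\ `|a| <= e, `|b| <= e, a = F a b & b = G a b].
Proof.
move=> e0 FG lip.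
have : forall a, exists b, `|a| <= e -> `|b| <= e /\ b = G a b.
  move=> a; have [ae|ae] := leP `|a| e; last by exists 0.
  have [|x y xe ye|b be eb] := @fix1 e 4^-1 (G a) e0; last by exists b.
    by move=> x xe; apply: (FG a x ae xe).2.
  by have := (lip a x a y ae xe ae ye).2; rewrite subrr normr0 add0r.
move=> /choice[B hB].
(* The constant [1 / 4] makes [B] Lipschitz with constant [1 / 3]; hence so is [F a (B a)], and
   [1 / 2] is enough. *)
have [||a ae ea] := @fix1 e 2^-1 (fun a => F a (B a)) e0.
- by move=> x xe; have [h _] := hB x xe; apply: (FG _ _ xe h).1.
- move=> x y xe ye; have [h1 h2] := hB x xe; have [h3 h4] := hB y ye.
  have [l1 l2] := lip x (B x) y (B y) xe h1 ye h3.
  rewrite -h2 -h4 in l2.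
  have := normr_ge0 (x - y); lra.
- by have [h1 h2] := hB a ae; exists a, (B a).
Qed.

Lemma lip_on_ball (F F' : R -> R) m x y : (forall z : R, is_derive z 1 F (F' z)) ->
  (forall z, `|z| <= m -> `|F' z| <= m) -> `|x| <= m -> `|y| <= m ->
  `|F x - F y| <= m * `|x - y|.
Proof.
move=> dF F1; wlog xy : x y / x < y => [h|] xm ym.
  have [xy|yx|->] := ltgtP x y; last by rewrite !subrr normr0 mulr0.
    exact: h.
  by rewrite distrC [in leRHS]distrC h.
have cF : {within `[x, y], continuous F}.
  by apply: continuous_subspaceT => z; exact: d_cont (dF z).
have [c + e] := @MVT R F F' x y xy (fun z _ => dF z) cF.
rewrite in_itv/= => /andP[xc cy].
rewrite distrC e distrC normrM distrC ler_wpM2r// F1//.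
by move: xm ym; rewrite !ler_norml => /andP[? ?] /andP[? ?]; apply/andP; split; lra.
Qed.

(** The remainder of the first-order expansion has a derivative bounded by its argument, hence by
    [m] on the ball. The Lipschitz form serves twice: it gives a contraction and, with [y = 0], a
    quadratic bound. *)
Lemma cos_taylor a m x y : `|x| <= m -> `|y| <= m ->
  `|(cos (a + x) - cos a + sin a * x) - (cos (a + y) - cos a + sin a * y)| <= m * `|x - y|.
Proof.
move=> xm ym.
apply: (@lip_on_ball (fun x => cos (a + x) - cos a + sin a * x) (fun x => - sin (a + x) + sin a)) => // z.
  have h := dB (dcos (dD (dcst z a) (did z))) (dcst z (cos a)).
  by apply: (is_derive_eq (dD h (dZ (sin a) (did z)))); ring.
move=> zm; apply: le_trans zm; rewrite addrC distrC.
by apply: le_trans (sin_lip _ _) _; rewrite [a + z]addrC addrK.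
Qed.

Lemma sin_taylor a m x y : `|x| <= m -> `|y| <= m ->
  `|(sin (a + x) - sin a - cos a * x) - (sin (a + y) - sin a - cos a * y)| <= m * `|x - y|.
Proof.
move=> xm ym.
apply: (@lip_on_ball (fun x => sin (a + x) - sin a - cos a * x) (fun x => cos (a + x) - cos a)) => // z.
  have h := dB (dsin (dD (dcst z a) (did z))) (dcst z (sin a)).
  by apply: (is_derive_eq (dB h (dZ (cos a) (did z)))); ring.
move=> zm; apply: le_trans zm.
by apply: le_trans (cos_lip _ _) _; rewrite [a + z]addrC addrK.
Qed.

Definition bounded_meas f : Prop :=
  measurable_fun setT f /\ exists M, forall x, `|f x| <= M.

Lemma bm_itb s t f : bounded_meas f -> itb s t f.
Proof.
move=> [mf [M hM]]; apply: (@itb_le _ _ _ _ (fun=> M)) => //; last exact: itb_cst.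
exact: measurable_funTS.
Qed.

Lemma by_parts0 L u k v l : 0 <= L -> AC 0 L u k -> AC 0 L v l -> u 0 = 0 -> u L = 0 ->
  itb 0 L (fun t => k t * v t) -> itb 0 L (fun t => u t * l t) ->
  itg 0 L (fun t => u t * l t) = - itg 0 L (fun t => k t * v t).
Proof.
move=> L0 H H' u0 uL i1 i2.
have := AC_int (AC_M H H' L0) (lexx 0) L0 (lexx L).
by rewrite u0 uL !mul0r subrr itgD// => /esym/eqP; rewrite addrC addr_eq0 => /eqP.
Qed.

Definition closed_curve L th : Prop :=
  itg 0 L (fun t => cos (th t)) = 0 /\ itg 0 L (fun t => sin (th t)) = 0.

(* [n] is a variation of the curvature, [x] and [y] the first order change of the end point *)
Definition paired L th n x y : Prop :=
  [/\ bounded_meas n, itg 0 L n = 0,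
      itg 0 L (fun t => n t * prim 0 L (fun s => cos (th s)) t) = x &
      itg 0 L (fun t => n t * prim 0 L (fun s => sin (th s)) t) = y].

Lemma AC_prim0 L k : 0 <= L -> measurable_fun setT k -> itb 0 L k -> AC 0 L (prim 0 L k) k.
Proof.
move=> L0 mk ik; have := AC_prim 0 L0 mk ik.
by under [X in AC _ _ X]eq_fun do rewrite add0r.
Qed.

Lemma AC_prim_cont L f : 0 <= L -> continuous f -> AC 0 L (prim 0 L f) f.
Proof.
by move=> L0 cf; apply: AC_prim0 => //; [exact: continuous_measurable_fun|exact: itb_cont].
Qed.

Lemma prim0 L n : 0 <= L -> prim 0 L n 0 = 0.
Proof. by move=> L0; rewrite prim_E ?lexx// itgxx. Qed.

Lemma primL L n : 0 <= L -> prim 0 L n L = itg 0 L n.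
Proof. by move=> L0; rewrite prim_E// lexx L0. Qed.

Lemma prim_bounds L n0 n1 n2 : 0 <= L -> bounded_meas n0 -> bounded_meas n1 -> bounded_meas n2 ->
  exists2 K, 1 <= K & forall t, 0 <= t <= L ->
    [/\ `|prim 0 L n0 t| <= K, `|prim 0 L n1 t| <= K & `|prim 0 L n2 t| <= K].
Proof.
move=> L0 b0 b1 b2.
have h n : bounded_meas n -> exists2 c, 0 <= c & forall x, 0 <= x <= L -> `|prim 0 L n x| <= c.
  by move=> bn; apply: cont_bounded; exact: AC_cont (AC_prim0 L0 bn.1 (bm_itb 0 L bn)).
have [M0 p0 h0] := h _ b0; have [M1 p1 h1] := h _ b1; have [M2 p2 h2] := h _ b2.
exists (1 + M0 + M1 + M2); first by clear -p0 p1 p2; lra.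
move=> t tL; have q0 := h0 t tL; have q1 := h1 t tL; have q2 := h2 t tL.
split; clear -p0 p1 p2 q0 q1 q2; lra.
Qed.

(** Integration by parts turns the linear part of the change of the end point into [a] and [- b]:
    the variation [n0] contributes nothing and [n1], [n2] are dual to the two coordinates. Closing
    up therefore means that [a] is minus the integral of the cosine remainder and [b] the integral
    of the sine remainder. The right-hand sides are quadratically small and contracting, so [fix2]
    applies. *)
Lemma closing L th k n0 n1 n2 : 0 < L -> AC 0 L th k -> closed_curve L th ->
  paired L th n0 0 0 -> paired L th n1 0 1 -> paired L th n2 1 0 ->
  exists C, exists2 e0, 0 < e0 & forall e, 0 < e -> e <= e0 -> exists a b,
    [/\ `|a| <= C * e ^+ 2, `|b| <= C * e ^+ 2 &
    forall th', (forall t, 0 <= t <= L ->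
        th' t = th t + (e * prim 0 L n0 t + (a * prim 0 L n1 t + b * prim 0 L n2 t))) ->
      closed_curve L th'].
Proof.
move=> L0 H Hcl D0 D1 D2; have L0' := ltW L0.
have cth := AC_cont H.
have [bn0 _ _ _] := D0; have [bn1 _ _ _] := D1; have [bn2 _ _ _] := D2.
have HP n : bounded_meas n -> AC 0 L (prim 0 L n) n.
  by move=> bn; apply: AC_prim0 => //; [exact: bn.1|exact: bm_itb].
have [K K1 bK] := prim_bounds L0' bn0 bn1 bn2.
have bK0 t : 0 <= t <= L -> `|prim 0 L n0 t| <= K by move=> /bK[].
have bK1 t : 0 <= t <= L -> `|prim 0 L n1 t| <= K by move=> /bK[].
have bK2 t : 0 <= t <= L -> `|prim 0 L n2 t| <= K by move=> /bK[].
pose om e a b t := e * prim 0 L n0 t + (a * prim 0 L n1 t + b * prim 0 L n2 t).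
have com e a b : continuous (om e a b).
  apply: cD; first exact: cZ (AC_cont (HP _ bn0)).
  by apply: cD; apply: cZ; [exact: AC_cont (HP _ bn1)|exact: AC_cont (HP _ bn2)].
(* [rc] and [rs] are the remainders of cosine and sine after their linear terms in the total
   variation [om]. *)
pose rc e a b t := cos (th t + om e a b t) - cos (th t) + sin (th t) * om e a b t.
pose rs e a b t := sin (th t + om e a b t) - sin (th t) - cos (th t) * om e a b t.
have irc e a b : itb 0 L (rc e a b).
  apply: itb_cont; apply: cD; last by apply: cM => //; exact: csin.
  by apply: cB; apply: ccos => //; exact: cD.
have irs e a b : itb 0 L (rs e a b).
  apply: itb_cont; apply: cB; last by apply: cM => //; exact: ccos.
  by apply: cB; apply: csin => //; exact: cD.
(* The variation is at most [3 * K * e] when [a] and [b] are at most [e]; its square, integrated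
   over the length, gives this constant. *)
pose C := 9 * K ^+ 2 * L.
have K2 : 1 <= K ^+ 2 by rewrite -[leLHS](expr1n _ 2) lerXn2r ?nnegrE//; lra.
have C0 : 0 < C by rewrite /C !mulr_gt0//; lra.
have ombound e a b t : 0 <= e -> `|a| <= e -> `|b| <= e -> 0 <= t <= L -> `|om e a b t| <= 3 * K * e.
  move=> e0 ae be tL; rewrite /om.
  apply: le_trans (ler_normD _ _) _; rewrite normrM (ger0_norm e0).
  have h1 : `|a * prim 0 L n1 t + b * prim 0 L n2 t| <= e * K + e * K.
    by apply: le_trans (ler_normD _ _) _; rewrite !normrM; apply: lerD; apply: ler_pM => //; [exact: bK1|exact: bK2].
  have h2 : e * `|prim 0 L n0 t| <= e * K by rewrite ler_wpM2l// bK0.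
  lra.
have omdiff e a b a' b' t : 0 <= t <= L -> `|om e a b t - om e a' b' t| <= K * (`|a - a'| + `|b - b'|).
  move=> tL; rewrite (_ : _ - _ = (a - a') * prim 0 L n1 t + (b - b') * prim 0 L n2 t); last by rewrite /om; ring.
  apply: le_trans (ler_normD _ _) _; rewrite !normrM mulrDr.
  by apply: lerD; rewrite mulrC ler_wpM2r//; [exact: bK1|exact: bK2].
have Rlip e a b a' b' (r : R -> R -> R -> R -> R) : 0 <= e ->
    (forall e a b, itb 0 L (r e a b)) ->
    (forall t m, `|om e a b t| <= m -> `|om e a' b' t| <= m ->
       `|r e a b t - r e a' b' t| <= m * `|om e a b t - om e a' b' t|) ->
    `|a| <= e -> `|b| <= e -> `|a'| <= e -> `|b'| <= e ->
    `|itg 0 L (r e a b) - itg 0 L (r e a' b')| <= 3 * K ^+ 2 * L * e * (`|a - a'| + `|b - b'|).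
  move=> e0 ir hr ae be ae' be'; rewrite -itgB//.
  apply: (@le_trans _ _ (3 * K * e * (K * (`|a - a'| + `|b - b'|)) * (L - 0))); last first.
    by rewrite subr0 expr2; apply: eq_ler; ring.
  apply: itg_bound => //; first exact: itbB.
  move=> t tL; apply: le_trans (hr t (3 * K * e) _ _) _; [exact: ombound|exact: ombound|].
  by rewrite ler_wpM2l ?omdiff// mulr_ge0//; lra.
have Rsz e a b (r : R -> R -> R -> R -> R) : 0 <= e ->
    (forall e a b, itb 0 L (r e a b)) ->
    (forall t m, `|om e a b t| <= m -> `|r e a b t| <= m * `|om e a b t|) ->
    `|a| <= e -> `|b| <= e -> `|itg 0 L (r e a b)| <= C * e ^+ 2.
  move=> e0 ir hr ae be.
  apply: (@le_trans _ _ (3 * K * e * (3 * K * e) * (L - 0))); last first.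
    by rewrite subr0 /C !expr2; apply: eq_ler; ring.
  apply: itg_bound => // t tL; apply: le_trans (hr t (3 * K * e) _) _; first exact: ombound.
  by rewrite ler_wpM2l ?ombound// !mulr_ge0//; lra.
have tc e a b a' b' t m : `|om e a b t| <= m -> `|om e a' b' t| <= m ->
   `|rc e a b t - rc e a' b' t| <= m * `|om e a b t - om e a' b' t| by exact: cos_taylor.
have ts e a b a' b' t m : `|om e a b t| <= m -> `|om e a' b' t| <= m ->
   `|rs e a b t - rs e a' b' t| <= m * `|om e a b t - om e a' b' t| by exact: sin_taylor.
have tc0 e a b t m : `|om e a b t| <= m -> `|rc e a b t| <= m * `|om e a b t|.
  move=> hm; have m0' : `|(0 : R)| <= m by rewrite normr0 (le_trans _ hm).
  by have := cos_taylor (th t) hm m0'; rewrite addr0 subrr mulr0 addr0 !subr0.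
have ts0 e a b t m : `|om e a b t| <= m -> `|rs e a b t| <= m * `|om e a b t|.
  move=> hm; have m0' : `|(0 : R)| <= m by rewrite normr0 (le_trans _ hm).
  by have := sin_taylor (th t) hm m0'; rewrite addr0 subrr mulr0 !subr0.
(* Below this threshold [C * e <= 1], so the ball of radius [e] is mapped into itself, and
   [3 * K^2 * L * e <= 1 / 4], the contraction constant of [fix2]. *)
exists C; exists (1 / (12 * K ^+ 2 * L + C)).
  by rewrite divr_gt0// addr_gt0// !mulr_gt0//; lra.
move=> e e0; rewrite ler_pdivlMr; last by rewrite addr_gt0// !mulr_gt0//; lra.
move=> he; have e0' := ltW e0.
have w1 : 0 < K ^+ 2 * L by rewrite mulr_gt0//; lra.
have Ce : C * e <= 1.
  by have := mulr_gt0 e0 w1; rewrite mulrC; lra.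
have Ke : 3 * K ^+ 2 * L * e <= 4^-1.
  by have := mulr_gt0 e0 C0; lra.
have Ce2 : C * e ^+ 2 <= e by rewrite expr2 mulrA ler_piMl.
have [a b ae be|a b a' b' ae be ae' be'|a [b [ae be ea eb]]] :=
    @fix2 e (fun a b => - itg 0 L (rc e a b)) (fun a b => itg 0 L (rs e a b)) e0'.
- rewrite normrN; split; apply: le_trans Ce2.
    exact: (Rsz e a b rc e0' irc (fun t => tc0 e a b t) ae be).
  exact: (Rsz e a b rs e0' irs (fun t => ts0 e a b t) ae be).
- have nn : 0 <= `|a - a'| + `|b - b'| by rewrite addr_ge0.
  split.
    rewrite -opprD normrN; apply: le_trans (Rlip e a b a' b' rc e0' irc (fun t => tc e a b a' b' t) ae be ae' be') _.
    by rewrite ler_wpM2r.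
  apply: le_trans (Rlip e a b a' b' rs e0' irs (fun t => ts e a b a' b' t) ae be ae' be') _.
  by rewrite ler_wpM2r.
exists a, b; split.
- by rewrite ea normrN; exact: (Rsz e a b rc e0' irc (fun t => tc0 e a b t) ae be).
- by rewrite eb; exact: (Rsz e a b rs e0' irs (fun t => ts0 e a b t) ae be).
move=> th' hth'.
have Hom : AC 0 L (om e a b) (fun t => e * n0 t + (a * n1 t + b * n2 t)).
  by apply: AC_D; [exact: AC_Z (HP _ bn0)|apply: AC_D; [exact: AC_Z (HP _ bn1)|exact: AC_Z (HP _ bn2)]].
have [_ z0 x0 y0] := D0; have [_ z1 x1 y1] := D1; have [_ z2 x2 y2] := D2.
have om0 : om e a b 0 = 0 by rewrite /om !prim0// !mulr0 !addr0.
have omL : om e a b L = 0 by rewrite /om !primL// z0 z1 z2 !mulr0 !addr0.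
set X := prim 0 L (fun s => cos (th s)) in x0 x1 x2.
set Y := prim 0 L (fun s => sin (th s)) in y0 y1 y2.
have HX : AC 0 L X (fun t => cos (th t)) by apply: AC_prim_cont => //; exact: ccos.
have HY : AC 0 L Y (fun t => sin (th t)) by apply: AC_prim_cont => //; exact: csin.
have [hc hs] := Hcl.
have inX n Z z : bounded_meas n -> AC 0 L Z z -> itb 0 L (fun t => n t * Z t).
  move=> bn HZ; have := itb_contM (bm_itb 0 L bn) (AC_cont HZ).
  by apply: eq_itb => t _; rewrite mulrC.
have nom Z z : AC 0 L Z z -> itb 0 L (fun t => (e * n0 t + (a * n1 t + b * n2 t)) * Z t) /\
   itg 0 L (fun t => (e * n0 t + (a * n1 t + b * n2 t)) * Z t) =
   e * itg 0 L (fun t => n0 t * Z t) + (a * itg 0 L (fun t => n1 t * Z t) + b * itg 0 L (fun t => n2 t * Z t)).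
  move=> HZ; have i0 := inX _ _ _ bn0 HZ; have i1 := inX _ _ _ bn1 HZ; have i2 := inX _ _ _ bn2 HZ.
  rewrite (_ : (fun t => _) = (fun t => e * (n0 t * Z t) + (a * (n1 t * Z t) + b * (n2 t * Z t)))); last first.
    by apply/funext => t; ring.
  split; first by apply: itbD; [exact: itbZ|apply: itbD; exact: itbZ].
  by rewrite !itgD ?itgZ//; try apply: itbD; exact: itbZ.
have [iX eX] := nom _ _ HX; have [iY eY] := nom _ _ HY.
have ic : itb 0 L (fun t => om e a b t * cos (th t)) by apply: itb_cont; apply: cM => //; exact: ccos.
have is_ : itb 0 L (fun t => om e a b t * sin (th t)) by apply: itb_cont; apply: cM => //; exact: csin.
have bX := by_parts0 L0' Hom HX om0 omL iX ic.
have bY := by_parts0 L0' Hom HY om0 omL iY is_.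
rewrite eX x0 x1 x2 in bX; rewrite eY y0 y1 y2 in bY.
split.
- rewrite (@eq_itg _ _ _ _ (fun t => rc e a b t + cos (th t) - om e a b t * sin (th t))); last first.
    by move=> t tL; rewrite hth'// /rc -/(om e a b t); ring.
  rewrite itgB//; last first.
    by apply: itbD => //; apply: itb_cont; exact: ccos.
  rewrite itgD ?hc//; last by apply: itb_cont; exact: ccos.
  by rewrite bY; move: (itg 0 L (rc e a b)) ea => I ->; ring.
- rewrite (@eq_itg _ _ _ _ (fun t => rs e a b t + sin (th t) + om e a b t * cos (th t))); last first.
    by move=> t tL; rewrite hth'// /rs -/(om e a b t); ring.
  rewrite itgD//; last first.
    by apply: itbD => //; apply: itb_cont; exact: csin.
  rewrite itgD ?hs//; last by apply: itb_cont; exact: csin.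
  by rewrite bX; move: (itg 0 L (rs e a b)) eb => I ->; ring.
Qed.

End Closing.

(* Unification otherwise unfolds these constants. *)
Local Opaque itg cos sin.

(** * Regularity of the closing constraint *)

Section EulerLagrange.
Context {R : realType}.
Implicit Types (u v f g k th w : R -> R) (L p s t x y e d a b q : R).
Notation mu := (@lebesgue_measure R).

Lemma dct s t (f_ : nat -> R -> R) f G : (forall n, measurable_fun setT (f_ n)) ->
  measurable_fun setT f -> itb s t G ->
  (forall x, s <= x <= t -> f_ n x @[n --> \oo] --> f x) ->
  (forall n x, s <= x <= t -> `|f_ n x| <= G x) ->
  itg s t (f_ n) @[n --> \oo] --> itg s t f.
Proof.
move=> mf_ mf iG cf fG.
have iD (n : nat) : itb s t (f_ n) by apply: itb_le iG; [exact: measurable_funTS|exact: fG].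
have h1 : {ae mu, forall x, `[s, t]%classic x -> (fun n => (f_ n x)%:E) @ \oo --> (f x)%:E}.
  apply: aeW => x xs; apply: cvg_EFin; first exact: nearW.
  by apply: cf; move: xs; rewrite /= in_itv.
have h2 : {ae mu, forall x n, `[s, t]%classic x -> (`|(f_ n x)%:E| <= (G x)%:E)%E}.
  by apply: aeW => x n; rewrite /= in_itv/= => /fG h; rewrite lee_fin.
have h3 n : measurable_fun `[s, t] (fun x => (f_ n x)%:E).
  by apply/measurable_EFinP; exact: measurable_funTS.
have h4 : measurable_fun `[s, t] (fun x => (f x)%:E).
  by apply/measurable_EFinP; exact: measurable_funTS.
have [i1 _ h] := @dominated_convergence _ _ R mu _ (measurable_itv `[s, t]) (fun n x => (f_ n x)%:E) (fun x => (f x)%:E) (fun x => (G x)%:E) h3 h4 h1 iG h2.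
have -> : itg s t f = fine (\int[mu]_(x in `[s, t]) (f x)%:E)%E by [].
apply: (fine_cvg (f := fun n => (\int[mu]_(x in `[s, t]) (f_ n x)%:E)%E)).
rewrite fineK; first exact: h.
exact: integrable_fin_num.
Qed.

Definition locmin p L th k : Prop :=
  exists2 d, 0 < d & forall th' k', AC 0 L th' k' -> th' 0 = th 0 -> th' L = th L ->
    closed_curve L th' -> (forall t, 0 <= t <= L -> `|k' t - k t| <= d) ->
    itg 0 L (fun t => `|k t| `^ p) <= itg 0 L (fun t => `|k' t| `^ p).

Lemma itg0_zero L f : 0 < L -> continuous f -> itg 0 L f = 0 ->
  exists2 t, 0 <= t <= L & f t = 0.
Proof.
move=> L0 cf f0.
have cF : {within `[0, L], continuous (integral0 f)}.
  by apply: continuous_subspaceT => z; exact: d_cont (derive_integral0_cont cf z).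
have [c + e] := @MVT R (integral0 f) f 0 L L0 (fun z _ => derive_integral0_cont cf z) cF.
rewrite in_itv/= => /andP[c0 cL]; exists c; first by rewrite !ltW.
move: e; rewrite integral0B ?f0 ?ltW//; last by move=> ? ?; exact: itb_cont.
by rewrite subr0 => /esym/eqP; rewrite mulf_eq0 [L == 0]gt_eqF// orbF => /eqP.
Qed.

Lemma cont_aeq0 L f : 0 < L -> continuous f -> aeq 0 L f (fun=> 0) ->
  forall t, 0 <= t <= L -> f t = 0.
Proof.
move=> L0 cf f0 t tL.
have H := AC_prim_cont (ltW L0) cf.
have H0 : AC 0 L (prim 0 L f) (fun=> 0) by apply: AC_eqk f0 H; exact: measurable_cst.
by apply: (AC_uniq_cont H H0 L0 cf _ tL); exact: ccst.
Qed.

(** [a sin - b cos] has zero mean along a closed curve, so it vanishes at some point. There both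
    this and [a cos + b sin] are 0, and the sum of their squares is [a^2 + b^2]. *)
Lemma closed_not_straight L th k a b : 0 < L -> AC 0 L th k -> closed_curve L th ->
  (forall t, 0 <= t <= L -> a * cos (th t) + b * sin (th t) = 0) -> a = 0 /\ b = 0.
Proof.
move=> L0 H [hc hs] h; have ct := AC_cont H.
have i1 : itb 0 L (fun t => a * sin (th t)) by apply: itb_cont; apply: cZ; exact: csin.
have i2 : itb 0 L (fun t => b * cos (th t)) by apply: itb_cont; apply: cZ; exact: ccos.
have [||t tL e] := @itg0_zero L (fun t => a * sin (th t) - b * cos (th t)) L0.
- by apply: cB; apply: cZ; [exact: csin|exact: ccos].
- rewrite itgB// !itgZ ?hc ?hs; [ring|by apply: itb_cont; exact: ccos|by apply: itb_cont; exact: csin].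
have e2 := h t tL; have e3 := cos2Dsin2 (th t).
have : a ^+ 2 + b ^+ 2 = 0.
  transitivity ((a ^+ 2 + b ^+ 2) * (cos (th t) ^+ 2 + sin (th t) ^+ 2)); first by rewrite e3 mulr1.
  transitivity ((a * cos (th t) + b * sin (th t)) ^+ 2 + (a * sin (th t) - b * cos (th t)) ^+ 2); first ring.
  by rewrite e e2; ring.
move/eqP; rewrite paddr_eq0 ?sqr_ge0// !sqrf_eq0 => /andP[/eqP -> /eqP ->].
by [].
Qed.

Lemma prim_bm L f : 0 < L -> continuous f -> bounded_meas (prim 0 L f).
Proof.
move=> L0 cf; have H := AC_prim_cont (ltW L0) cf; have c := AC_cont H.
split; first exact: continuous_measurable_fun.
have [M _ hM] := cont_bounded 0 L c; exists M => x.
have hx := pr_itv x (ltW L0).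
by have := hM _ hx; rewrite /prim pr_id.
Qed.

Lemma bm_cst (c : R) : bounded_meas (fun _ : R => c).
Proof. by split; [exact: measurable_cst|exists `|c|]. Qed.

Lemma bmD f g : bounded_meas f -> bounded_meas g -> bounded_meas (fun x => f x + g x).
Proof.
move=> [mf [M hM]] [mg [N hN]]; split; first exact: measurable_funD.
by exists (M + N) => x; apply: le_trans (ler_normD _ _) _; exact: lerD.
Qed.

Lemma bmZ (c : R) f : bounded_meas f -> bounded_meas (fun x => c * f x).
Proof.
move=> [mf [M hM]]; split; first by apply: measurable_funM => //; exact: measurable_cst.
by exists (`|c| * M) => x; rewrite normrM ler_wpM2l.
Qed.

Lemma bmM f g : bounded_meas f -> bounded_meas g -> bounded_meas (fun x => f x * g x).
Proof.
move=> [mf [M hM]] [mg [N hN]]; split; first exact: measurable_funM.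
by exists (M * N) => x; rewrite normrM ler_pM.
Qed.

Lemma itg_lin2 L (a b : R) f g : bounded_meas f -> bounded_meas g ->
  itg 0 L (fun t => a * f t + b * g t) = a * itg 0 L f + b * itg 0 L g.
Proof.
move=> bf bg; have h1 := bm_itb 0 L bf; have h2 := bm_itb 0 L bg.
by rewrite (itgD (itbZ a h1) (itbZ b h2)) (itgZ a h1) (itgZ b h2).
Qed.

(** The required coefficients solve a linear system whose matrix is the Gram matrix of [x] and [y],
    definite by hypothesis. *)
Lemma gram_dual L (x y : R -> R) : bounded_meas x -> bounded_meas y ->
  (forall a b : R, itg 0 L (fun t => (a * x t + b * y t) * (a * x t + b * y t)) = 0 -> a = 0 /\ b = 0) ->
  forall r s : R, exists a b : R, itg 0 L (fun t => (a * x t + b * y t) * x t) = r /\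
    itg 0 L (fun t => (a * x t + b * y t) * y t) = s.
Proof.
move=> bx by_ pos.
have [A eA] : exists A, A = itg 0 L (fun t => x t * x t) := ex_intro _ _ erefl.
have [B eB] : exists B, B = itg 0 L (fun t => x t * y t) := ex_intro _ _ erefl.
have [D eD] : exists D, D = itg 0 L (fun t => y t * y t) := ex_intro _ _ erefl.
have ex_ a b : itg 0 L (fun t => (a * x t + b * y t) * x t) = a * A + b * B.
  rewrite eA eB -(itg_lin2 L a b (bmM bx bx) (bmM bx by_)).
  by apply: eq_itg => t _; ring.
have ey a b : itg 0 L (fun t => (a * x t + b * y t) * y t) = a * B + b * D.
  rewrite eB eD -(itg_lin2 L a b (bmM bx by_) (bmM by_ by_)).
  by apply: eq_itg => t _; ring.
have quad a b : itg 0 L (fun t => (a * x t + b * y t) * (a * x t + b * y t)) =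
    a * (a * A + b * B) + b * (a * B + b * D).
  have b0 : bounded_meas (fun t => a * x t + b * y t) by apply: bmD; exact: bmZ.
  rewrite -ex_ -ey -(itg_lin2 L a b (bmM b0 bx) (bmM b0 by_)).
  by apply: eq_itg => t _; ring.
clear eA eB eD.
have D0 : D != 0.
  apply/eqP => h; have [|_ /eqP] := pos 0 1; last by rewrite oner_eq0.
  by rewrite quad h; ring.
pose det := A * D - B * B.
have det0 : det != 0.
  (* At [(D, - B)] the quadratic form equals [D * det], so a zero determinant contradicts
     definiteness. *)
  apply/eqP => h; have [|/eqP] := pos D (- B); last by rewrite (negbTE D0).
  rewrite quad; transitivity (D * det); [rewrite /det; ring|by rewrite h mulr0].
move=> r s; exists ((D * r - B * s) / det), ((A * s - B * r) / det).
rewrite ex_ ey; split.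
- by transitivity (r * (det / det)); [rewrite /det; ring|rewrite divff// mulr1].
- by transitivity (s * (det / det)); [rewrite /det; ring|rewrite divff// mulr1].
Qed.

(** With the means removed, combinations of the two functions automatically have mean 0, and
    independence modulo constants becomes definiteness of the Gram matrix. Adding the constants back
    does not change the pairings with a function of mean 0. *)
Lemma centered_dual L (X Y : R -> R) : 0 < L -> bounded_meas X -> bounded_meas Y ->
  (forall a b c : R, (forall t, 0 <= t <= L -> a * X t + b * Y t + c = 0) -> a = 0 /\ b = 0) ->
  continuous X -> continuous Y ->
  forall r s : R, exists n, [/\ bounded_meas n, itg 0 L n = 0,
    itg 0 L (fun t => n t * X t) = r & itg 0 L (fun t => n t * Y t) = s].
Proof.
move=> L0 bX bY ind cX cY r s.
have Ln0 : L != 0 by rewrite gt_eqF.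
have center (f : R -> R) : bounded_meas f -> continuous f -> exists c (x : R -> R),
    [/\ forall t, x t = f t + c, bounded_meas x, continuous x & itg 0 L x = 0].
  move=> bf cf; exists (- (itg 0 L f / L)), (fun t => f t + - (itg 0 L f / L)); split => //.
  - by apply: bmD => //; exact: bm_cst.
  - by apply: cD => //; exact: ccst.
  - rewrite (itgD (bm_itb 0 L bf) (itb_cst 0 L _)) itg_cst ?ltW// subr0 mulNr divfK// subrr.
    by [].
have [c [x [hx bx cx x0]]] := center X bX cX.
have [d [y [hy by_ cy y0]]] := center Y bY cY.
have pos a b : itg 0 L (fun t => (a * x t + b * y t) * (a * x t + b * y t)) = 0 -> a = 0 /\ b = 0.
  move=> h.
  have bz : bounded_meas (fun t => a * x t + b * y t) by apply: bmD; exact: bmZ.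
  have cz : continuous (fun t => a * x t + b * y t) by exact: (cD (cZ cx) (cZ cy)).
  apply: (ind a b (a * c + b * d)) => t tL.
  transitivity (a * x t + b * y t); first by rewrite hx hy; ring.
  apply: (cont_aeq0 L0 cz _ tL).
  have [|N [mN N0 hN]] := itg_eq0 (bm_itb 0 L (bmM bz bz)) _ h.
    by move=> u _; rewrite -expr2 sqr_ge0.
  by exists N; split => // u uL /(hN _ uL)/eqP; rewrite -expr2 sqrf_eq0 => /eqP.
have [a [b [e1 e2]]] := gram_dual bx by_ pos r s.
pose n t := a * x t + b * y t.
have bn : bounded_meas n by apply: bmD; exact: bmZ.
have n0 : itg 0 L n = 0 by rewrite (itg_lin2 L a b bx by_) x0 y0 !mulr0 addr0.
have {}e1 : itg 0 L (fun t => n t * x t) = r := e1.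
have {}e2 : itg 0 L (fun t => n t * y t) = s := e2.
exists n; clearbody n; split => //.
- transitivity (1 * itg 0 L (fun t => n t * X t) + c * itg 0 L n).
    by rewrite n0 mulr0 addr0 mul1r.
  rewrite -(itg_lin2 L 1 c (bmM bn bX) bn) -e1; apply: eq_itg => t _.
  by rewrite hx mulrDr mul1r [c * _]mulrC.
- transitivity (1 * itg 0 L (fun t => n t * Y t) + d * itg 0 L n).
    by rewrite n0 mulr0 addr0 mul1r.
  rewrite -(itg_lin2 L 1 d (bmM bn bY) bn) -e2; apply: eq_itg => t _.
  by rewrite hy mulrDr mul1r [d * _]mulrC.
Qed.

(** The end point map is a submersion: a relation between the two coordinates and the constants
    would, after differentiation, put the closed curve on a line. *)
Lemma dual_variations L th k : 0 < L -> AC 0 L th k -> closed_curve L th ->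
  forall r s : R, exists n, paired L th n r s.
Proof.
move=> L0 H Hc; have ct := AC_cont H; have L0' := ltW L0.
have HX := AC_prim_cont L0' (ccos ct); have HY := AC_prim_cont L0' (csin ct).
apply: (centered_dual L0); [exact: prim_bm L0 (ccos ct)|exact: prim_bm L0 (csin ct)| |exact: AC_cont HX|exact: AC_cont HY].
move=> a b c h.
have Hz := AC_D (AC_D (AC_Z a HX) (AC_Z b HY)) (AC_cst 0 L c).
have Hz0 := AC_eqf (AC_cont Hz) (fun t tL => esym (h t tL)) (AC_cst 0 L 0).
apply: (closed_not_straight L0 H Hc) => t tL.
have := AC_uniq_cont Hz Hz0 L0 _ _ tL; rewrite addr0; apply; last exact: ccst.
exact: (cD (cD (cZ (ccos ct)) (cZ (csin ct))) (@ccst _ 0)).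
Qed.

End EulerLagrange.

(** * First variation and Lagrange multipliers *)

Section EulerLagrangeEquation.
Context {R : realType}.
Implicit Types (u v f g k th w n : R -> R) (L p s t x y e d a b q : R).
Notation mu := (@lebesgue_measure R).

Lemma meas_spow r k : 0 < r -> measurable_fun setT k -> measurable_fun setT (fun t => spow r (k t)).
Proof.
move=> r0 mk; apply: (measurableT_comp _ mk); apply: continuous_measurable_fun.
exact: cspow.
Qed.

Lemma cvg_spow r (u_ : nat -> R) (l : R) : 0 < r -> u_ n @[n --> \oo] --> l ->
  spow r (u_ n) @[n --> \oo] --> spow r l.
Proof. by move=> r0 h; apply: continuous_cvg => //; exact: cspow. Qed.

Lemma itb_spow p L k : 1 < p -> measurable_fun setT k -> itb 0 L (fun t => `|k t| `^ p) ->
  itb 0 L (fun t => spow (p - 1) (k t)).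
Proof.
move=> p1 mk ik; have p10 : 0 < p - 1 by lra.
apply: (@itb_le _ _ _ _ (fun t => 1 + `|k t| `^ p)).
- by apply: measurable_funTS; exact: meas_spow.
- by move=> t _; rewrite norm_spow//; apply: le_npow; lra.
- by apply: itbD => //; exact: itb_cst.
Qed.

Lemma npow_itbD p L k n : 1 < p -> measurable_fun setT k -> itb 0 L (fun t => `|k t| `^ p) ->
  bounded_meas n -> itb 0 L (fun t => `|k t + n t| `^ p).
Proof.
move=> p1 mk ik [mn [M hM]].
apply: (@itb_le _ _ _ _ (fun t => 2 `^ p * (`|k t| `^ p + M `^ p))).
- by apply: measurable_funTS; apply: meas_npow; exact: measurable_funD.
- move=> t _; rewrite ger0_norm ?powR_ge0//; apply: le_trans (norm_powD _ _ _) _; first lra.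
  rewrite ler_wpM2l ?powR_ge0// lerD2l; have h := hM t.
  by apply: ge0_ler_powR => //; rewrite ?nnegrE// ?(le_trans _ h)//; lra.
- by apply: itbZ; apply: itbD => //; exact: itb_cst.
Qed.

Lemma itb_bmM s t f g : itb s t f -> bounded_meas g -> itb s t (fun x => f x * g x).
Proof.
move=> hf [mg [M hM]].
have h : itb s t (fun x => g x * f x) by apply: (itbM hf (c := M)) => //; exact: measurable_funTS.
by apply: eq_itb h => x _; rewrite mulrC.
Qed.

(** The tangent inequality is taken at the perturbed point [k + e n], where its sign is the useful
    one for a minimizer: the energy difference is at most [p * e] times the integral in the
    conclusion. *)
Lemma energy_step p L k n e : 1 < p -> measurable_fun setT k -> itb 0 L (fun t => `|k t| `^ p) ->
  bounded_meas n -> 0 < e ->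
  itg 0 L (fun t => `|k t| `^ p) <= itg 0 L (fun t => `|k t + e * n t| `^ p) ->
  0 <= itg 0 L (fun t => spow (p - 1) (k t + e * n t) * n t).
Proof.
move=> p1 mk ik bn e0 h.
have ben : bounded_meas (fun t => e * n t) by exact: bmZ.
have mk' : measurable_fun setT (fun t => k t + e * n t) by apply: measurable_funD => //; exact: ben.1.
have ik' := npow_itbD p1 mk ik ben.
have isn := itb_bmM (itb_spow p1 mk' ik') bn.
have : itg 0 L (fun t => `|k t + e * n t| `^ p + (- (p * e)) * (spow (p - 1) (k t + e * n t) * n t))
    <= itg 0 L (fun t => `|k t| `^ p).
  apply: le_itg => //; first by apply: itbD => //; exact: itbZ.
  move=> t _; have := convex_npow (k t + e * n t) (k t) p1.
  rewrite opprD addrA subrr sub0r; move: (spow _ _) => S; clear; lra.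
rewrite itgD//; last exact: itbZ.
rewrite itgZ// => h2.
have := le_trans h2 h.
rewrite gerDl mulNr oppr_le0.
by rewrite pmulr_rge0// mulr_gt0// (lt_trans ltr01).
Qed.

(** The closed competitors have curvature [k + e r], where [r] tends to [n0] boundedly because the
    corrections are of second order. The inequality of [energy_step] passes to the limit by
    dominated convergence. *)
Lemma EL_ge0 p L th k n0 : 0 < L -> 1 < p -> AC 0 L th k -> itb 0 L (fun t => `|k t| `^ p) ->
  closed_curve L th -> locmin p L th k -> paired L th n0 0 0 ->
  0 <= itg 0 L (fun t => spow (p - 1) (k t) * n0 t).
Proof.
move=> L0 p1 H ik Hc [d d0 hd] D0; have L0' := ltW L0; have mk := AC_meas H.
have p10 : 0 < p - 1 by lra.
have [n1 D1] := dual_variations L0 H Hc 0 1.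
have [n2 D2] := dual_variations L0 H Hc 1 0.
have [C [e0 e00 hcl]] := closing L0 H Hc D0 D1 D2.
have [b0 i0 _ _] := D0; have [b1 i1 _ _] := D1; have [b2 i2 _ _] := D2.
have [B [B1 hB0 hB1 hB2]] : exists B, [/\ 1 <= B, forall x, `|n0 x| <= B, forall x, `|n1 x| <= B & forall x, `|n2 x| <= B].
  have [M0 h0] := b0.2; have [M1 h1] := b1.2; have [M2 h2] := b2.2.
  exists (1 + `|M0| + `|M1| + `|M2|).
  have := normr_ge0 M0; have := normr_ge0 M1; have := normr_ge0 M2.
  have := ler_norm M0; have := ler_norm M1; have := ler_norm M2.
  clear -h0 h1 h2 => *; split; first lra.
  - by move=> x; have := h0 x; lra.
  - by move=> x; have := h1 x; lra.
  - by move=> x; have := h2 x; lra.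
pose C' := `|C|; have C'0 : 0 <= C' by exact: normr_ge0.
pose B' := B + 2 * C' * B.
have B'1 : 1 <= B'.
  have := mulr_ge0 C'0 (le_trans ler01 B1); rewrite /B'.
  clear -B1 C'0; lra.
pose r a b t := n0 t + (a * n1 t + b * n2 t).
have br a b : bounded_meas (r a b) by apply: bmD => //; apply: bmD; exact: bmZ.
have rB a b e t : 0 <= e -> e <= 1 -> `|a| <= C' * e -> `|b| <= C' * e -> `|r a b t| <= B'.
  move=> e0_ e1 ha hb.
  have Ce : C' * e <= C' by rewrite ler_piMr.
  have ha' := le_trans ha Ce; have hb' := le_trans hb Ce.
  apply: le_trans (ler_normD _ _) _; rewrite /B'; apply: lerD => //.
  apply: le_trans (ler_normD _ _) _; rewrite !normrM.
  have q1 : `|a| * `|n1 t| <= C' * B by apply: ler_pM.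
  have q2 : `|b| * `|n2 t| <= C' * B by apply: ler_pM.
  clear -q1 q2; lra.
(* Three demands: the range of [closing], the bound [B'] on [r], which is stated for [e <= 1], and
   [e * B' <= d] to stay in the neighbourhood where [k] is minimal. *)
pose E := Num.min e0 (Num.min 1 (d / B')).
have dB : 0 < d / B' by rewrite divr_gt0//; clear -B'1; lra.
have E0 : 0 < E by rewrite /E !lt_min e00 ltr01 dB.
have [E1 E2 E3] : [/\ E <= e0, E <= 1 & E <= d / B'].
  by rewrite /E !ge_min !lexx !orbT.
have step e : 0 < e -> e <= E -> exists ab : R * R,
    [/\ `|ab.1| <= C' * e, `|ab.2| <= C' * e &
     0 <= itg 0 L (fun t => spow (p - 1) (k t + e * r ab.1 ab.2 t) * r ab.1 ab.2 t)].
  move=> e_0 eE; have [a [b [ha hb hcab]]] := hcl e e_0 (le_trans eE E1).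
  have e_n0 : e != 0 by rewrite gt_eqF.
  (* Divided by [e], the correcting coefficients are still of order [e], so they disappear in the
     limit. *)
  have red c : `|c| <= C * e ^+ 2 -> `|c / e| <= C' * e.
    move=> hc; rewrite normrM normfV (gtr0_norm e_0) ler_pdivrMr// -mulrA -expr2.
    by apply: le_trans hc _; rewrite ler_wpM2r ?sqr_ge0// ler_norm.
  have {}ha := red a ha; have {}hb := red b hb.
  exists (a / e, b / e); split => //=.
  apply: (@energy_step p L k (r (a / e) (b / e)) e) => //.
  have Hth' : AC 0 L (fun t => th t + (e * prim 0 L n0 t + (a * prim 0 L n1 t + b * prim 0 L n2 t)))
      (fun t => k t + (e * n0 t + (a * n1 t + b * n2 t))).
    have HP n : bounded_meas n -> AC 0 L (prim 0 L n) n.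
      by move=> bn; apply: AC_prim0 => //; [exact: bn.1|exact: bm_itb].
    by apply: AC_D => //; apply: AC_D; [|apply: AC_D]; apply: AC_Z; exact: HP.
  have ek : (fun t => k t + (e * n0 t + (a * n1 t + b * n2 t))) = (fun t => k t + e * r (a / e) (b / e) t).
    apply/funext => t; rewrite /r; congr (_ + _); rewrite mulrDr; congr (_ + _).
    by field.
  rewrite ek in Hth'.
  apply: (hd _ _ Hth').
  - by rewrite !prim0// !mulr0 !addr0.
  - by rewrite !primL// i0 i1 i2 !mulr0 !addr0.
  - exact: hcab.
  - move=> t _; rewrite addrC addKr normrM (gtr0_norm e_0).
    apply: (@le_trans _ _ (e * B')).
      apply: (ler_wpM2l (ltW e_0)).
      by apply: (rB _ _ e) => //; [exact: ltW|exact: le_trans E2].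
    rewrite -ler_pdivlMr; first exact: le_trans E3.
    by clear -B'1; lra.
pose e_ (m : nat) : R := E * harmonic m.
have e_pos m : 0 < e_ m by rewrite mulr_gt0// harmonic_gt0.
have e_E m : e_ m <= E.
  apply: ler_piMr; first exact: ltW.
  by rewrite /harmonic/= invf_le1 ?ltr0n// ler1n.
have [c hc] := choice (fun m => step (e_ m) (e_pos m) (e_E m)).
have e_0 : e_ m @[m --> \oo] --> 0.
  by rewrite -[X in _ --> X](mulr0 E); apply: cvgMr; exact: cvg_harmonic.
have sq (a_ : nat -> R) : (forall m, `|a_ m| <= C' * e_ m) -> a_ m @[m --> \oo] --> 0.
  move=> ha; apply/norm_cvg0P.
  apply: (@squeeze_cvgr _ _ _ _ (fun=> 0) (fun m => C' * e_ m)).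
  - by apply: nearW => m; rewrite normr_ge0 ha.
  - exact: cvg_cst.
  - by rewrite -[X in _ --> X](mulr0 C'); apply: cvgMr.
have a0 := sq (fun m => (c m).1) (fun m => let: And3 h _ _ := hc m in h).
have b0' := sq (fun m => (c m).2) (fun m => let: And3 _ h _ := hc m in h).
have lim : itg 0 L (fun t => spow (p - 1) (k t + e_ m * r (c m).1 (c m).2 t) * r (c m).1 (c m).2 t)
    @[m --> \oo] --> itg 0 L (fun t => spow (p - 1) (k t) * n0 t).
  apply: (@dct _ 0 L (fun m t => spow (p - 1) (k t + e_ m * r (c m).1 (c m).2 t) * r (c m).1 (c m).2 t)
     _ (fun t => (1 + 2 `^ p * (`|k t| `^ p + B' `^ p)) * B')).
  - move=> m; apply: measurable_funM; last exact: (br _ _).1.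
    by apply: meas_spow => //; apply: measurable_funD => //; exact: (bmZ _ (br _ _)).1.
  - by apply: measurable_funM; [exact: meas_spow|exact: b0.1].
  - have : itb 0 L (fun t => B' * (1 + 2 `^ p * (`|k t| `^ p + B' `^ p))).
      by apply: itbZ; apply: itbD; [exact: itb_cst|apply: itbZ; apply: itbD => //; exact: itb_cst].
    by apply: eq_itb => t _; rewrite mulrC.
  - move=> t _.
    have hr : r (c m).1 (c m).2 t @[m --> \oo] --> n0 t.
      rewrite -[X in _ --> X](addr0 (n0 t)); apply: cvgD; first exact: cvg_cst.
      rewrite -[X in _ --> X](addr0 0); apply: cvgD.
        by rewrite -[X in _ --> X](mul0r (n1 t)); apply: cvgMl.
      by rewrite -[X in _ --> X](mul0r (n2 t)); apply: cvgMl.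
    have hk : k t + e_ m * r (c m).1 (c m).2 t @[m --> \oo] --> k t.
      rewrite -[X in _ --> X](addr0 (k t)); apply: cvgD; first exact: cvg_cst.
      by rewrite -[X in _ --> X](mul0r (n0 t)); apply: cvgM.
    by apply: cvgM; [exact: cvg_spow|exact: hr].
  - move=> m t _; have [h1 h2 _] := hc m.
    have hr : `|r (c m).1 (c m).2 t| <= B'.
      by apply: (rB _ _ (e_ m)) => //; [exact: ltW|exact: le_trans E2].
    have her : `|e_ m * r (c m).1 (c m).2 t| <= B'.
      rewrite normrM (gtr0_norm (e_pos m)); apply: le_trans hr.
      by rewrite ler_piMl// (le_trans (e_E m)).
    rewrite normrM norm_spow//; apply: ler_pM => //.
    apply: le_trans (@le_npow _ (p - 1) p _ _ _) _; [exact: ltW|clear; lra|].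
    rewrite lerD2l; apply: le_trans (norm_powD _ _ _) _; first exact: le_trans ler01 (ltW p1).
    rewrite ler_wpM2l ?powR_ge0// lerD2l; apply: ge0_ler_powR => //.
    + exact: le_trans ler01 (ltW p1).
    + by rewrite nnegrE (le_trans ler01).
apply: (cvgr_to_ge lim).
by apply: nearW => m; have [_ _] := hc m.
Qed.

Lemma EL_eq0 p L th k n0 : 0 < L -> 1 < p -> AC 0 L th k -> itb 0 L (fun t => `|k t| `^ p) ->
  closed_curve L th -> locmin p L th k -> paired L th n0 0 0 ->
  itg 0 L (fun t => spow (p - 1) (k t) * n0 t) = 0.
Proof.
move=> L0 p1 H ik Hc Hm D0; have mk := AC_meas H.
have h1 := EL_ge0 L0 p1 H ik Hc Hm D0.
have [bn z x y] := D0.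
have ib f : bounded_meas f -> itb 0 L (fun t => spow (p - 1) (k t) * f t).
  by move=> bf; apply: itb_bmM => //; exact: itb_spow.
have iN f : bounded_meas f -> itb 0 L f by exact: bm_itb.
have D0' : paired L th (fun t => (-1) * n0 t) 0 0.
  have e f : bounded_meas f -> itg 0 L (fun t => n0 t * f t) = 0 -> itg 0 L (fun t => (-1) * n0 t * f t) = 0.
    move=> bf h; transitivity ((-1) * itg 0 L (fun t => n0 t * f t)); last by rewrite h mulr0.
    rewrite -itgZ; last by apply: iN; exact: bmM.
    by apply: eq_itg => t _; rewrite mulrA.
  split.
  - exact: bmZ.
  - by rewrite itgZ ?z ?mulr0//; exact: iN.
  - by apply: e => //; apply: prim_bm L0 (ccos (AC_cont H)).
  - by apply: e => //; apply: prim_bm L0 (csin (AC_cont H)).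
have h2 := EL_ge0 L0 p1 H ik Hc Hm D0'.
have e : itg 0 L (fun t => spow (p - 1) (k t) * (-1 * n0 t)) = - itg 0 L (fun t => spow (p - 1) (k t) * n0 t).
  rewrite -itgN; last exact: ib.
  by apply: eq_itg => t _; rewrite mulN1r mulrN.
rewrite e oppr_ge0 in h2.
by apply/eqP; rewrite eq_le h1 h2.
Qed.

(** The fundamental lemma with multipliers: subtracting its mean and multiples of [n1] and [n2]
    makes an arbitrary bounded [n] admissible, and so [P - Q], with [Q] the affine candidate, is
    orthogonal to all bounded functions. *)
Lemma affine_of_orthogonal L P X Y n1 n2 : 0 < L -> measurable_fun setT P -> itb 0 L P ->
  bounded_meas X -> bounded_meas Y ->
  [/\ bounded_meas n1, itg 0 L n1 = 0, itg 0 L (fun t => n1 t * X t) = 0 & itg 0 L (fun t => n1 t * Y t) = 1] ->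
  [/\ bounded_meas n2, itg 0 L n2 = 0, itg 0 L (fun t => n2 t * X t) = 1 & itg 0 L (fun t => n2 t * Y t) = 0] ->
  (forall n, bounded_meas n -> itg 0 L n = 0 -> itg 0 L (fun t => n t * X t) = 0 ->
     itg 0 L (fun t => n t * Y t) = 0 -> itg 0 L (fun t => P t * n t) = 0) ->
  exists c0 c1 c2, aeq 0 L P (fun t => c0 + (c1 * X t + c2 * Y t)).
Proof.
move=> L0 mP iP bX bY [b1 i1 x1 y1] [b2 i2 x2 y2] orth.
have Ln0 : L != 0 by rewrite gt_eqF.
(* The multipliers are the pairings of [P] with the dual variations; [c0] gives [P] and the affine
   candidate the same mean. *)
pose c1 := itg 0 L (fun t => P t * n2 t); pose c2 := itg 0 L (fun t => P t * n1 t).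
pose c0 := (itg 0 L P - c1 * itg 0 L X - c2 * itg 0 L Y) / L.
exists c0, c1, c2.
pose Q t := c0 + (c1 * X t + c2 * Y t).
have bQ : bounded_meas Q by apply: bmD; [exact: bm_cst|apply: bmD; exact: bmZ].
have lin4 (a b c : R) f g h k : itb 0 L f -> itb 0 L g -> itb 0 L h -> itb 0 L k ->
    itg 0 L (fun t => f t + (a * g t + (b * h t + c * k t))) =
    itg 0 L f + (a * itg 0 L g + (b * itg 0 L h + c * itg 0 L k)).
  move=> hf hg hh hk; have hg' := itbZ a hg; have hh' := itbZ b hh; have hk' := itbZ c hk.
  by rewrite (itgD hf (itbD hg' (itbD hh' hk'))) (itgD hg' (itbD hh' hk')) (itgD hh' hk') !itgZ.
have key n : bounded_meas n -> itg 0 L (fun t => (P t - Q t) * n t) = 0.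
  move=> bn.
  have [m em] : exists m, m = itg 0 L n / L := ex_intro _ _ erefl.
  have [al eal] : exists a, a = itg 0 L (fun t => n t * Y t) - m * itg 0 L Y := ex_intro _ _ erefl.
  have [be ebe] : exists a, a = itg 0 L (fun t => n t * X t) - m * itg 0 L X := ex_intro _ _ erefl.
  pose n0 t := n t + (- m * 1 + (- al * n1 t + - be * n2 t)).
  have bn0 : bounded_meas n0.
    by apply: bmD => //; apply: bmD; [exact: bmZ (bm_cst 1)|apply: bmD; exact: bmZ].
  have im : itg 0 L n = m * L by rewrite em divfK.
  have q0 : itg 0 L n0 = 0.
    rewrite (lin4 _ _ _ _ _ _ _ (bm_itb 0 L bn) (itb_cst 0 L 1) (bm_itb 0 L b1) (bm_itb 0 L b2)).
    by rewrite i1 i2 itg_cst ?ltW// im; ring.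
  have qZ Z : bounded_meas Z -> itg 0 L (fun t => n0 t * Z t) =
      itg 0 L (fun t => n t * Z t) + (- m * itg 0 L Z + (- al * itg 0 L (fun t => n1 t * Z t) + - be * itg 0 L (fun t => n2 t * Z t))).
    move=> bZ; rewrite -(lin4 _ _ _ _ _ _ _ (bm_itb 0 L (bmM bn bZ)) (bm_itb 0 L bZ) (bm_itb 0 L (bmM b1 bZ)) (bm_itb 0 L (bmM b2 bZ))).
    by apply: eq_itg => t _; rewrite /n0; ring.
  have qX : itg 0 L (fun t => n0 t * X t) = 0 by rewrite qZ// x1 x2 ebe; ring.
  have qY : itg 0 L (fun t => n0 t * Y t) = 0 by rewrite qZ// y1 y2 eal; ring.
  have := orth n0 bn0 q0 qX qY.
  rewrite (@eq_itg _ _ _ _ (fun t => P t * n t + (- m * P t + (- al * (P t * n1 t) + - be * (P t * n2 t))))); last first.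
    by move=> t _; rewrite /n0; ring.
  rewrite (lin4 _ _ _ _ _ _ _ (itb_bmM iP bn) iP (itb_bmM iP b1) (itb_bmM iP b2)) -/c1 -/c2 => h.
  transitivity (itg 0 L (fun t => P t * n t - Q t * n t)); first by apply: eq_itg => t _; rewrite mulrBl.
  rewrite itgB; [|exact: itb_bmM|exact: bm_itb (bmM bQ bn)].
  have -> : itg 0 L (fun t => Q t * n t) = c0 * (m * L) + (c1 * itg 0 L (fun t => n t * X t) + c2 * itg 0 L (fun t => n t * Y t)).
    have := lin4 c0 c1 c2 _ _ _ _ (itb_cst 0 L 0) (bm_itb 0 L bn) (bm_itb 0 L (bmM bn bX)) (bm_itb 0 L (bmM bn bY)).
    rewrite (itg_cst 0 (ltW L0)) mul0r add0r im => <-.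
    by apply: eq_itg => t _; rewrite /Q; ring.
  have -> : c0 * (m * L) = m * (itg 0 L P - c1 * itg 0 L X - c2 * itg 0 L Y).
    by rewrite /c0; field.
  move: h; rewrite eal ebe; move: (itg 0 L (fun t => P t * n t)) => I h.
  by rewrite -[RHS]h; ring.
have mv : measurable_fun setT (fun t => P t - Q t) by apply: measurable_funB => //; exact: bQ.1.
have d1 x : 0 < 1 + `|x| by rewrite ltr_pwDl.
have cn : continuous (fun x : R => x / (1 + `|x|)).
  apply: (@cM _ (fun x => x) (fun x => (1 + `|x|)^-1)); first exact: cid.
  move=> x; apply: cvgV; first by rewrite gt_eqF.
  by apply: (@cD _ (fun=> 1) (fun x => `|x|)); [exact: ccst|exact: (cnorm (@cid _))].
(* [P] is integrable but possibly unbounded, so the test function is a bounded multiple of [P - Q]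
   with the same sign. *)
have bn : bounded_meas (fun t => (P t - Q t) / (1 + `|P t - Q t|)).
  split; first exact: (measurableT_comp (continuous_measurable_fun cn) mv).
  exists 1 => t; rewrite normrM normfV (gtr0_norm (d1 _)) ler_pdivrMr// mul1r.
  by rewrite lerDr.
have h0 := key _ bn.
have iv : itb 0 L (fun t => P t - Q t) by apply: itbB => //; exact: bm_itb.
have [|N [mN N0 hN]] := itg_eq0 (itb_bmM iv bn) _ h0.
  move=> t _; rewrite mulrA; apply: divr_ge0; last exact: ltW.
  by rewrite -expr2 sqr_ge0.
exists N; split => // t tL nN; have /eqP := hN t tL nN.
have dn0 : (1 + `|P t - Q t|)^-1 != 0 by rewrite invr_eq0 gt_eqF.
by rewrite !mulf_eq0 (negbTE dn0) orbF orbb subr_eq0 => /eqP.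
Qed.

Lemma EL_affine p L th k : 0 < L -> 1 < p -> AC 0 L th k -> itb 0 L (fun t => `|k t| `^ p) ->
  closed_curve L th -> locmin p L th k ->
  exists c0 c1 c2, aeq 0 L (fun t => spow (p - 1) (k t))
    (fun t => c0 + (c1 * prim 0 L (fun s => cos (th s)) t + c2 * prim 0 L (fun s => sin (th s)) t)).
Proof.
move=> L0 p1 H ik Hc Hm; have mk := AC_meas H.
have p10 : 0 < p - 1 by lra.
have [n1 D1] := dual_variations L0 H Hc 0 1.
have [n2 D2] := dual_variations L0 H Hc 1 0.
have bX := prim_bm L0 (ccos (AC_cont H)); have bY := prim_bm L0 (csin (AC_cont H)).
apply: (affine_of_orthogonal L0 (meas_spow p10 mk) (itb_spow p1 mk ik) bX bY D1 D2).
by move=> n bn i0 x0 y0; apply: (EL_eq0 L0 p1 H ik Hc Hm).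
Qed.

End EulerLagrangeEquation.

(** * The pendulum equation and its conserved energy *)

Section Pendulum.
Context {R : realType}.
Implicit Types (f g k th w b : R -> R) (L p s t x y e d a q lam A : R).
Notation mu := (@lebesgue_measure R).

(** [w] stands for [spow (p - 1) k]; inverting the signed power, the first condition says that the
    angle [b] has derivative [k]. *)
Definition pendulum p lam L b w : Prop :=
  AC 0 L b (fun t => spow (p - 1)^-1 (w t)) /\ AC 0 L w (fun t => - lam * sin (b t)).

Lemma cos1_eq0 x : cos x = 1 -> `|x| < 2 * pi -> x = 0.
Proof.
move=> cx xpi; apply/eqP; rewrite -normr_le0 leNgt; apply/negP => x0.
have : 0 < sin (`|x| / 2).
  by apply: sin_gt0_pi; apply/andP; split; lra.
have : cos `|x| = 1 by rewrite cos_norm.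
have -> : `|x| = `|x| / 2 + `|x| / 2 by lra.
rewrite cosD -!expr2 cos2sin2 (_ : (`|x| / 2 + `|x| / 2) / 2 = `|x| / 2); last lra.
move=> h1 h2.
have h3 : sin (`|x| / 2) ^+ 2 = 0 by lra.
by move/eqP : h3; rewrite sqrf_eq0 => /eqP h3; rewrite h3 ltxx in h2.
Qed.

Lemma conj_exp p : 1 < p -> p / (p - 1) - 1 = (p - 1)^-1.
Proof. by move=> p1; field; lra. Qed.

(** The derivative of [|w|^(p/(p-1))] contains the signed power of order [p/(p-1) - 1 = 1/(p-1)],
    which is exactly [b']; so it cancels against the derivative of the potential. *)
Lemma first_integral p lam L b w : 0 < L -> 1 < p -> pendulum p lam L b w ->
  exists A, forall t, 0 <= t <= L -> (p - 1) / p * `|w t| `^ (p / (p - 1)) = A + lam * cos (b t).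
Proof.
move=> L0 p1 [Hb Hw]; have L0' := ltW L0.
have p10 : 0 < p - 1 by lra.
have q1 : 1 < p / (p - 1) by rewrite ltr_pdivlMr// mul1r; lra.
pose q := p / (p - 1).
have H1 : AC 0 L (fun t => `|w t| `^ q) (fun t => q * spow (q - 1) (w t) * (- lam * sin (b t))).
  apply: (AC_C1 Hw L0' (F := fun x => `|x| `^ q) (F' := fun x => q * spow (q - 1) x)).
    by move=> x; exact: dnpow.
  by apply: cZ; apply: cspow; rewrite subr_gt0.
have H2 := AC_B (AC_Z ((p - 1) / p) H1) (AC_Z lam (AC_cos L0' Hb)).
have H3 : AC 0 L (fun t => (p - 1) / p * `|w t| `^ q - lam * cos (b t)) (fun=> 0).
  apply: AC_eqk H2; first exact: measurable_cst.
  apply: eq_aeq => t _; rewrite /q conj_exp//.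
  move: (spow _ _) (sin _) => S s; field.
  by rewrite !gt_eqF//; lra.
exists ((p - 1) / p * `|w 0| `^ q - lam * cos (b 0)) => t tL.
by rewrite -(AC_const H3 tL); ring.
Qed.

Lemma pendulum_cont p lam L b w : 1 < p -> pendulum p lam L b w ->
  [/\ continuous b, continuous w & continuous (fun t => spow (p - 1)^-1 (w t))].
Proof.
move=> p1 [Hb Hw]; split; [exact: AC_cont Hb|exact: AC_cont Hw|].
by apply: ccomp; [exact: AC_cont Hw|apply: cspow; rewrite invr_gt0; lra].
Qed.

(* Away from the zeros of [w], [sg w * sin b] has derivative [cos b * |b'|];
   at these zeros both sides vanish. *)
Lemma integral_cos_speed p lam L b w : 0 < L -> 1 < p -> pendulum p lam L b w ->
  (forall t, 0 <= t <= L -> w t = 0 -> sin (b t) = 0) ->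
  itg 0 L (fun t => cos (b t) * `|spow (p - 1)^-1 (w t)|) =
  Num.sg (w L) * sin (b L) - Num.sg (w 0) * sin (b 0).
Proof.
move=> L0 p1 Hp hz; have [cb cw cv] := pendulum_cont p1 Hp; have [Hb Hw] := Hp.
have L0' := ltW L0.
set v := fun t => spow (p - 1)^-1 (w t) in cv Hb *.
have r0 : 0 < (p - 1)^-1 by rewrite invr_gt0; lra.
have ci : continuous (fun t => cos (b t) * `|v t|).
  by apply: cM; [exact: ccos|exact: cnorm].
have iv s t : itb s t (fun t => cos (b t) * `|v t|) by exact: itb_cont.
pose S t := Num.sg (w t) * sin (b t).
suff h e : 0 < e -> `|S L - S 0 - itg 0 L (fun t => cos (b t) * `|v t|)| <= e * (L - 0).
  apply/eqP; rewrite eq_sym -subr_eq0 -normr_le0; apply/ler_addgt0Pl => e e0; rewrite addr0.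
  have := h (e / L) (divr_gt0 e0 L0); by rewrite subr0 divfK// gt_eqF.
move=> e0; pose P s t := `|S t - S s - itg s t (fun t => cos (b t) * `|v t|)| <= e * (t - s).
have : P 0 L; last by [].
apply: (@creep _ 0 L P) => //.
- move=> x /andP[x0 xL]; have xL' : 0 <= x <= L by rewrite x0 xL.
  (* Near a zero of [w] the speed is below [e / 3] and [sin b] vanishes at [x], so the two boundary
     terms and the integral are each at most [e / 3 * (t - s)]. Elsewhere the sign of [w] is locally
     constant and the identity is exact. *)
  have [wx|wx] := eqVneq (w x) 0.
    have e3 : 0 < e / 3 by rewrite divr_gt0.
    have [d d0 hd] := proj1 (cont_ed _ x) (cv x) _ e3.
    exists d => // s t s0 sx xt tL xs tx.
    have st : s <= t by exact: le_trans xt.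
    have vb y : s <= y <= t -> `|v y| <= e / 3.
      move=> /andP[sy yt]; have := hd y; rewrite {2}/v wx spow0 subr0 => h.
      by apply/ltW/h; rewrite ltr_norml; apply/andP; clear -sy yt xs tx; split; lra.
    have Sb y : s <= y <= t -> `|S y| <= e / 3 * (t - s).
      move=> /andP[sy yt]; apply: (@le_trans _ _ `|sin (b y) - sin (b x)|).
        rewrite (hz x xL' wx) subr0 /S normrM.
        by rewrite ler_piMl// normr_sg lern1 leq_b1.
      apply: le_trans (sin_lip _ _) _.
      have [xy|yx] := leP x y.
        rewrite (AC_int Hb) //; [|exact: le_trans tL].
        apply: (@le_trans _ _ (e / 3 * (y - x))).
          apply: itg_bound => //; first exact: itb_cont.
          by move=> z /andP[xz zy]; apply: vb; rewrite (le_trans sx xz) (le_trans zy yt).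
        by apply: (ler_wpM2l (ltW e3)); clear -sx yt; lra.
      have yx' := ltW yx.
      rewrite distrC (AC_int Hb)//; [|exact: le_trans s0 sy].
      apply: (@le_trans _ _ (e / 3 * (x - y))).
        apply: itg_bound => //; first exact: itb_cont.
        by move=> z /andP[xz zy]; apply: vb; rewrite (le_trans sy xz) (le_trans zy xt).
      by apply: (ler_wpM2l (ltW e3)); clear -sy xt; lra.
    have I : `|itg s t (fun t => cos (b t) * `|v t|)| <= e / 3 * (t - s).
      apply: itg_bound => // y sy; rewrite normrM normr_id.
      by apply: le_trans (vb y sy); rewrite ler_piMl// cos_max.
    have S1_ := Sb s; have S2_ := Sb t; rewrite !lexx st in S1_ S2_.
    rewrite /P; apply: le_trans (ler_normB _ _) _.
    have := ler_normB (S t) (S s); have := S1_ isT; have := S2_ isT.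
    by clear -I; lra.
  have w0 : 0 < `|w x| by rewrite normr_gt0.
  have [d d0 hd] := proj1 (cont_ed _ x) (cw x) _ w0.
  exists d => // s t s0 sx xt tL xs tx.
  have st : s <= t by exact: le_trans xt.
  have sgE y : s <= y <= t -> Num.sg (w y) = Num.sg (w x).
    move=> /andP[sy yt]; have /hd : `|y - x| < d by rewrite ltr_norml; apply/andP; split; lra.
    have [wn|wp|we] := ltgtP (w x) 0.
    - rewrite (ltr0_norm wn) ltr_norml => /andP[_ h].
      have wy : w y < 0 by lra.
      by rewrite !ltr0_sg.
    - rewrite (gtr0_norm wp) ltr_norml => /andP[h _].
      have wy : 0 < w y by lra.
      by rewrite !gtr0_sg.
    - by rewrite we eqxx in wx.
  have Hs := AC_sin L0' Hb.
  have : S t - S s - itg s t (fun t => cos (b t) * `|v t|) = 0.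
    rewrite /S (sgE t) ?st ?lexx// (sgE s) ?st ?lexx//.
    rewrite -mulrBr (AC_int Hs)// -itgZ; last exact: AC_itb_sub Hs _ _.
    apply/eqP; rewrite subr_eq0; apply/eqP; apply: eq_itg => y sy.
    rewrite -(sgE y sy) mulrCA; congr (_ * _).
    rewrite /v /spow normrM (ger0_norm (powR_ge0 _ _)) mulrCA; congr (_ * _).
    by rewrite normrEsg.
  by rewrite /P => ->; rewrite normr0 mulr_ge0 ?subr_ge0// ltW.
- move=> r s t r0' rs st tL; rewrite /P => h1 h2.
  rewrite (@itg_split _ r s t)//.
  rewrite (_ : _ - _ - _ = (S s - S r - itg r s (fun t => cos (b t) * `|v t|)) +
     (S t - S s - itg s t (fun t => cos (b t) * `|v t|))); last by ring.
  apply: le_trans (ler_normD _ _) _.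
  by move: h1 h2; clear; lra.
Qed.

(** By [integral_cos_speed] and the equal end data, [cos b * |b'|] has integral 0. Energy
    conservation makes [|b'|] an increasing function [H] of [cos b], and closing allows [H 0] to be
    subtracted: the nonnegative function [cos b * (H (cos b) - H 0)] has integral 0. Hence
    [cos b = 0] throughout, and the closed curve would be straight. *)
Lemma no_rotation p lam A L b w : 0 < L -> 1 < p -> 0 < lam -> lam <= A ->
  pendulum p lam L b w -> closed_curve L b -> sin (b L) = sin (b 0) -> w L = w 0 ->
  (forall t, 0 <= t <= L -> (p - 1) / p * `|w t| `^ (p / (p - 1)) = A + lam * cos (b t)) ->
  False.
Proof.
move=> L0 p1 lam0 lA Hp Hc bL wL hA; have [cb cw cv] := pendulum_cont p1 Hp; have [Hb Hw] := Hp.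
have p10 : 0 < p - 1 by lra.
have p0 : 0 < p by lra.
have q0 : 0 < p / (p - 1) by rewrite divr_gt0.
have pp : 0 < p / (p - 1) by [].
(* When [lam <= A], the momentum can vanish only at the top position [cos b = -1]. *)
have hz t : 0 <= t <= L -> w t = 0 -> sin (b t) = 0.
  move=> tL wt; have := hA t tL; rewrite wt normr0 powR0 ?gt_eqF// mulr0 => h.
  have c1 : cos (b t) = -1.
    have := cos_geN1 (b t) => h1; apply/eqP; rewrite eq_le h1 andbT.
    by rewrite leNgt; apply/negP => h2; have := mulr_gt0 lam0 (_ : 0 < cos (b t) + 1); rewrite mulrDr mulr1; lra.
  by apply/eqP; rewrite -sqrf_eq0 sin2cos2 c1 sqrrN expr1n subrr.
have e0 := integral_cos_speed L0 p1 Hp hz.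
rewrite bL wL subrr in e0.
pose H c := (p / (p - 1) * (A + lam * c)) `^ p^-1.
have Aw t : 0 <= t <= L -> p / (p - 1) * (A + lam * cos (b t)) = `|w t| `^ (p / (p - 1)).
  by move=> tL; rewrite -hA//; field; rewrite !gt_eqF.
have speed t : 0 <= t <= L -> `|spow (p - 1)^-1 (w t)| = H (cos (b t)).
  move=> tL; rewrite norm_spow ?invr_gt0// /H Aw// -powRrM; congr (_ `^ _).
  by field; rewrite !gt_eqF.
have H0 : forall t, 0 <= t <= L -> cos (b t) * (`|spow (p - 1)^-1 (w t)| - H 0) = 0.
  have cf : continuous (fun t => cos (b t) * (`|spow (p - 1)^-1 (w t)| - H 0)).
    by apply: cM; [exact: ccos|apply: cB; [exact: cnorm|exact: ccst]].
  apply: (cont_aeq0 L0 cf); apply: itg_eq0; first exact: itb_cont.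
    move=> t tL; rewrite speed//.
    have c1 := cos_geN1 (b t).
    have pos c : -1 <= c -> 0 <= p / (p - 1) * (A + lam * c).
      move=> hc; apply: mulr_ge0; first exact: ltW.
      by have := ler_wpM2l (ltW lam0) hc; rewrite mulrN1; clear -lA; lra.
    have N10 : -1 <= 0 :> R by lra.
    have i0 : 0 <= p^-1 by rewrite invr_ge0 ltW.
    have [c0|c0] := leP 0 (cos (b t)).
      apply: mulr_ge0 => //; rewrite subr_ge0 /H; apply: ge0_ler_powR => //.
      - by rewrite nnegrE; exact: pos.
      - by rewrite nnegrE; exact: pos.
      - by rewrite ler_pM2l// lerD2l mulr0; apply: mulr_ge0 => //; exact: ltW.
    rewrite nmulr_rge0// subr_le0 /H; apply: ge0_ler_powR => //.
    - by rewrite nnegrE; exact: pos.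
    - by rewrite nnegrE; exact: pos.
    - by rewrite ler_pM2l// lerD2l mulr0 pmulr_rle0//; exact: ltW.
  have [hc _] := Hc.
  transitivity (itg 0 L (fun t => cos (b t) * `|spow (p - 1)^-1 (w t)| - H 0 * cos (b t))).
    by apply: eq_itg => t _; ring.
  rewrite itgB; [|by apply: itb_cont; apply: cM; [exact: ccos|exact: cnorm]|
    by apply: itb_cont; apply: cZ; exact: ccos].
  by rewrite e0 itgZ ?hc ?mulr0 ?subrr//; apply: itb_cont; exact: ccos.
have [//|/eqP] := @closed_not_straight _ L b _ 1 0 L0 Hb Hc _; last by rewrite oner_eq0.
move=> t tL; rewrite mul1r mul0r addr0.
have /eqP := H0 t tL; rewrite mulf_eq0 => /orP[/eqP//|].
rewrite speed// subr_eq0 /H => /eqP h.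
have inj := @powR_injective R p^-1; rewrite invr_gt0 in inj.
have hh : p / (p - 1) * (A + lam * cos (b t)) = p / (p - 1) * (A + lam * 0).
  apply: inj h => //; rewrite nnegrE ?Aw ?powR_ge0// mulr0 addr0 mulr_ge0//; lra.
have : lam * cos (b t) = 0.
  by have := mulfI (lt0r_neq0 q0) hh; rewrite mulr0 addr0; lra.
by move/eqP; rewrite mulf_eq0 gt_eqF//= => /eqP.
Qed.

(** Closing makes [cos b] vanish somewhere, whence [0 <= A], and [A = 0] would force [cos b = 0]
    everywhere. For [A < lam] the energy keeps [cos b >= - A / lam > -1], a barrier that a
    continuous angle starting in [[- pi, pi]] cannot cross. The end angles agree because they differ
    by less than [2 pi]. *)
Lemma pendulum_range p lam A L b w : 0 < L -> 1 < p -> 0 < lam ->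
  pendulum p lam L b w -> closed_curve L b -> sin (b L) = sin (b 0) -> cos (b L) = cos (b 0) ->
  w L = w 0 -> - pi <= b 0 -> b 0 <= pi ->
  (forall t, 0 <= t <= L -> (p - 1) / p * `|w t| `^ (p / (p - 1)) = A + lam * cos (b t)) ->
  [/\ 0 < A, A < lam, forall t, 0 <= t <= L -> `|b t| <= acos (- (A / lam)) & b L = b 0].
Proof.
move=> L0 p1 lam0 Hp Hc bL bcL wL b0 b0' hA; have [cb cw cv] := pendulum_cont p1 Hp; have [Hb Hw] := Hp.
have Al : A < lam.
  by rewrite ltNge; apply/negP => h; exact: (no_rotation L0 p1 lam0 h Hp Hc bL wL hA).
have p10 : 0 < p - 1 by lra.
have pos t : 0 <= t <= L -> 0 <= A + lam * cos (b t).
  by move=> tL; rewrite -hA// mulr_ge0 ?powR_ge0// divr_ge0; lra.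
have [hc _] := Hc.
have A0 : 0 < A.
  have [t tL ct] := itg0_zero L0 (ccos cb) hc.
  have := pos t tL; rewrite ct mulr0 addr0 le_eqVlt => /predU1P[A0|//].
  have h0 : forall t, 0 <= t <= L -> cos (b t) = 0.
    apply: (cont_aeq0 L0 (ccos cb)); apply: itg_eq0 => //; first by apply: itb_cont; exact: ccos.
    by move=> s /pos; rewrite -A0 add0r pmulr_rge0.
  have [|/eqP] := @closed_not_straight _ L b _ 1 0 L0 Hb Hc; last by rewrite oner_eq0.
  by move=> s sL; rewrite h0// mulr0 mul0r addr0.
have Al1 : A / lam < 1 by rewrite ltr_pdivrMr// mul1r.
have Al0 : 0 < A / lam by rewrite divr_gt0.
have ai : -1 <= - (A / lam) <= 1 by apply/andP; split; lra.
pose u := acos (- (A / lam)).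
have cu : cos u = - (A / lam) by exact: acosK.
have u0 : 0 <= u by exact: acos_ge0.
have upi : u < pi by apply: acos_ltpi; apply/andP; split; lra.
have cosb t : 0 <= t <= L -> cos u <= cos (b t).
  move=> tL; rewrite cu -(ler_pM2l lam0) mulrN mulrCA divff ?gt_eqF// mulr1.
  by have := pos t tL; lra.
have small t : 0 <= t <= L -> `|b t| <= pi -> `|b t| <= u.
  move=> tL h; rewrite leNgt; apply/negP => ub.
  have : cos `|b t| < cos u by rewrite ltr_cos// in_itv/= ?normr_ge0 ?u0 ?(ltW upi).
  by rewrite cos_norm ltNge cosb.
have ob : `|b 0| <= u.
  by apply: small; [rewrite lexx ltW|rewrite ler_norml; apply/andP; split; lra].
have hr t : 0 <= t <= L -> `|b t| <= u.
  move=> tL; have [t0 tL'] := andP tL; rewrite leNgt; apply/negP => ub.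
  pose v := Num.min `|b t| pi.
  have uv : u < v by rewrite lt_min ub upi.
  have [|s /andP[s0 st] e] := @ivt _ 0 t (fun t => `|b t|) v t0 (cnorm cb).
    have bb : `|b 0| <= `|b t| by rewrite (le_trans ob)// ltW.
    rewrite min_l// max_r// (le_trans ob (ltW uv)) /v ge_min lexx.
    by [].
  have sL : 0 <= s <= L by rewrite s0 (le_trans st).
  have := small s sL; rewrite e => h.
  have : v <= u by apply: h; rewrite /v ge_min lexx orbT.
  by rewrite leNgt uv.
split => //.
have hb0 := ob; have hbL : `|b L| <= u by apply: hr; rewrite lexx ltW.
apply/eqP; rewrite -subr_eq0; apply/eqP; apply: cos1_eq0.
  by rewrite cosB bL bcL -!expr2 cos2Dsin2.
by apply: le_lt_trans (ler_normB _ _) _; lra.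
Qed.

End Pendulum.

(** * Constant curvature or an oscillating pendulum *)

Section Dichotomy.
Context {R : realType}.
Implicit Types (f g k th w b : R -> R) (L p s t x y e d a q lam A : R).

Lemma polar_radius (x y : R) : x ^+ 2 + y ^+ 2 != 0 ->
  exists r a, [/\ 0 < r, x = r * cos a & y = r * sin a].
Proof.
move=> h; have h0 : 0 < x ^+ 2 + y ^+ 2 by rewrite lt_neqAle eq_sym h addr_ge0 ?sqr_ge0.
pose r := Num.sqrt (x ^+ 2 + y ^+ 2).
have r0 : 0 < r by rewrite sqrtr_gt0.
have rn0 : r != 0 by rewrite gt_eqF.
have r2 : r ^+ 2 = x ^+ 2 + y ^+ 2 by rewrite sqr_sqrtr// ltW.
have [|a [_ _ xa ya]] := @polar R (x / r) (y / r).
  by rewrite !expr_div_n -mulrDl r2 divff.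
exists r, a; split => //.
- by rewrite -xa mulrCA divff// mulr1.
- by rewrite -ya mulrCA divff// mulr1.
Qed.

Lemma closed_rotation L th b al : (forall t, 0 <= t <= L ->
    cos (b t) = cos (th t - al) /\ sin (b t) = sin (th t - al)) ->
  continuous th -> closed_curve L th -> closed_curve L b.
Proof.
move=> h ct [hc hs].
have ic : itb 0 L (fun t => cos (th t)) by apply: itb_cont; exact: ccos.
have is_ : itb 0 L (fun t => sin (th t)) by apply: itb_cont; exact: csin.
split.
- transitivity (itg 0 L (fun t => cos al * cos (th t) + sin al * sin (th t))).
    by apply: eq_itg => t /h[-> _]; rewrite cosB; ring.
  by rewrite (itgD (itbZ _ ic) (itbZ _ is_)) !itgZ// hc hs; ring.
- transitivity (itg 0 L (fun t => cos al * sin (th t) - sin al * cos (th t))).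
    by apply: eq_itg => t /h[_ ->]; rewrite sinB; ring.
  by rewrite (itgB (itbZ _ is_) (itbZ _ ic)) !itgZ// hc hs; ring.
Qed.

(** The multiplier vector [(c1, c2)] decides: if it is zero, the power of the curvature is constant;
    otherwise its direction is that of gravity, and measuring the angle from it gives the
    pendulum. *)
Lemma dichotomy L p th k : 0 < L -> 1 < p -> AC 0 L th k -> itb 0 L (fun t => `|k t| `^ p) ->
  closed_curve L th -> locmin p L th k ->
  cos (th L) = cos (th 0) -> sin (th L) = sin (th 0) ->
  (exists c, AC 0 L th (fun=> c)) \/
  (exists al b w lam A, pendulum p lam L b w /\ [/\ 0 < A, A < lam,
     forall t, 0 <= t <= L -> cos (b t) = cos (th t - al) /\ sin (b t) = sin (th t - al),
     forall t, 0 <= t <= L -> (p - 1) / p * `|w t| `^ (p / (p - 1)) = A + lam * cos (b t) &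
     [/\ forall t, 0 <= t <= L -> `|b t| <= acos (- (A / lam)),
     b L = b 0, w L = w 0, closed_curve L b & AC 0 L th (fun t => spow (p - 1)^-1 (w t))]]).
Proof.
move=> L0 p1 H ik Hc Hm cL sL; have L0' := ltW L0.
have p10 : 0 < p - 1 by lra.
have r0 : 0 < (p - 1)^-1 by rewrite invr_gt0.
have ct := AC_cont H; have [hc hs] := Hc.
have [c0 [c1 [c2 hE]]] := EL_affine L0 p1 H ik Hc Hm.
have HX := AC_prim_cont L0' (ccos ct); have HY := AC_prim_cont L0' (csin ct).
pose w t := c0 + (c1 * prim 0 L (fun s => cos (th s)) t + c2 * prim 0 L (fun s => sin (th s)) t).
have Hw0 : AC 0 L w (fun t => 0 + (c1 * cos (th t) + c2 * sin (th t))).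
  by apply: AC_D; [exact: AC_cst|apply: AC_D; exact: AC_Z].
(* Inverting the signed power exhibits a continuous version of the curvature, which the shift
   argument relies on. *)
have Hth : AC 0 L th (fun t => spow (p - 1)^-1 (w t)).
  apply: AC_eqk H.
    by apply: continuous_measurable_fun; apply: ccomp; [exact: AC_cont Hw0|exact: cspow].
  have [N [mN N0 hN]] := hE; exists N; split => // t tL nN.
  by rewrite /w -(hN t tL nN) spow_comp// divff ?spow1// gt_eqF.
have w00 : w 0 = c0 by rewrite /w !prim0// !mulr0 !addr0.
have wL : w L = w 0 by rewrite w00 /w !primL// hc hs !mulr0 !addr0.
have [cc|cc] := eqVneq (c2 ^+ 2 + c1 ^+ 2) 0.
  left; exists (spow (p - 1)^-1 c0).
  move/eqP : cc; rewrite paddr_eq0 ?sqr_ge0// !sqrf_eq0 => /andP[/eqP c20 /eqP c10].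
  have -> : (fun=> spow (p - 1)^-1 c0) = (fun t => spow (p - 1)^-1 (w t)); last exact: Hth.
  by apply/funext => t; rewrite /w c10 c20 !mul0r !addr0.
(* The polar form of [(- c2, c1)], chosen so that [c1 cos th + c2 sin th = - lam sin (th - al)]. *)
right; have [lam [al [lam0 e2 e1]]] : exists r a, [/\ 0 < r, c2 = - (r * cos a) & c1 = r * sin a].
  have [|r [a [r0' h1 h2]]] := @polar_radius (- c2) c1; first by rewrite sqrrN.
  by exists r, a; split => //; rewrite -h1 opprK.
have [|b0 [b0l b0r cb0 sb0]] := @polar R (cos (th 0 - al)) (sin (th 0 - al)).
  exact: cos2Dsin2.
(* [b] differs from [th - al] by a multiple of [2 pi] that brings its initial value into
   [[- pi, pi]]. *)
pose b t := (b0 - th 0) + th t.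
have rot t : cos (b t) = cos (th t - al) /\ sin (b t) = sin (th t - al).
  have -> : b t = (th t - al) + (b0 - (th 0 - al)) by rewrite /b; ring.
  have ec : cos (b0 - (th 0 - al)) = 1 by rewrite cosB -cb0 -sb0 -!expr2 cos2Dsin2.
  have es : sin (b0 - (th 0 - al)) = 0 by rewrite sinB -cb0 -sb0; ring.
  by split; [rewrite cosD|rewrite sinD]; rewrite ec es; ring.
have Hb : AC 0 L b (fun t => spow (p - 1)^-1 (w t)).
  have := AC_D (AC_cst 0 L (b0 - th 0)) Hth.
  by under [X in AC _ _ _ X -> _]eq_fun do rewrite add0r.
have Hw : AC 0 L w (fun t => - lam * sin (b t)).
  have -> : (fun t => - lam * sin (b t)) = (fun t => 0 + (c1 * cos (th t) + c2 * sin (th t))) => //.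
  by apply/funext => t; rewrite (rot t).2 sinB e1 e2; ring.
have Hp : pendulum p lam L b w by [].
have [A hA] := first_integral L0 p1 Hp.
have Hcb : closed_curve L b by apply: (closed_rotation (al := al) _ ct Hc) => t _; exact: rot.
have b00 : b 0 = b0 by rewrite /b; ring.
have sbL : sin (b L) = sin (b 0).
  by rewrite (rot L).2 (rot 0).2 !sinB cL sL.
have cbL : cos (b L) = cos (b 0).
  by rewrite (rot L).1 (rot 0).1 !cosB cL sL.
have [|| A0 Al hb bL] := pendulum_range L0 p1 lam0 Hp Hcb sbL cbL wL _ _ hA; rewrite ?b00//.
by exists al, b, w, lam, A; split => //; split => //; split => //.
Qed.

Lemma cos_periodn x (m : nat) : cos (x + 2 * pi * m%:R) = cos x.
Proof.
have -> : 2 * pi * m%:R = (pi *+ 2) *+ m :> R by rewrite -mulr_natr -[pi *+ 2]mulr_natr; ring.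
exact: (periodicn (@cosD2pi R)).
Qed.

Lemma sin_periodn x (m : nat) : sin (x + 2 * pi * m%:R) = sin x.
Proof.
have -> : 2 * pi * m%:R = (pi *+ 2) *+ m :> R by rewrite -mulr_natr -[pi *+ 2]mulr_natr; ring.
exact: (periodicn (@sinD2pi R)).
Qed.

Lemma cos_eq1 x : cos x = 1 -> exists m : nat, `|x| = 2 * pi * m%:R.
Proof.
move=> cx; have pi0 := pi_gt0 R; have p2 : 0 < 2 * pi :> R by rewrite mulr_gt0.
pose m := Num.truncn (`|x| / (2 * pi)).
have /andP[h1 h2] : m%:R <= `|x| / (2 * pi) < m.+1%:R.
  by apply: truncn_itv; rewrite divr_ge0// ltW.
rewrite ler_pdivlMr// in h1; rewrite ltr_pdivrMr// -natr1 mulrDl mul1r in h2.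
exists m; apply/eqP; rewrite -subr_eq0; apply/eqP; apply: cos1_eq0.
  by rewrite -(cos_periodn _ m) subrK cos_norm.
rewrite ger0_norm; [rewrite ltrBlDr addrC mulrC; exact: h2|].
by rewrite subr_ge0 mulrC.
Qed.

Lemma circle_case L p (g : curve L p) th c : 0 < L -> 1 < p -> tangent g th (fun=> c) ->
  closed_curve L th -> cos (th L) = cos (th 0) -> sin (th L) = sin (th 0) ->
  exists m : nat, (1 <= m)%N /\ m_fold_circle L m (pos g).
Proof.
move=> L0 p1 T [hc hs] cL sL; have L0' := ltW L0; have pi0 := pi_gt0 R.
have [H _] := T.
have thE t : 0 <= t <= L -> th t = th 0 + c * t.
  by move=> /andP[t0 tL]; have := AC_int H (lexx 0) t0 tL; rewrite itg_cst// subr0 => <-; ring.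
have oL : 0 <= L <= L by rewrite L0' lexx.
have c0 : c != 0.
  apply/eqP => c0.
  have cth t : 0 <= t <= L -> th t = th 0 by move=> /thE ->; rewrite c0 mul0r addr0.
  have hc' : cos (th 0) = 0.
    apply: (mulIf (lt0r_neq0 L0)); rewrite mul0r -[RHS]hc -[X in _ * X]subr0 -itg_cst//; apply/esym.
    by apply: eq_itg => t /cth ->.
  have hs' : sin (th 0) = 0.
    apply: (mulIf (lt0r_neq0 L0)); rewrite mul0r -[RHS]hs -[X in _ * X]subr0 -itg_cst//; apply/esym.
    by apply: eq_itg => t /cth ->.
  have := cos2Dsin2 (th 0); rewrite hc' hs' expr0n/= addr0 => /eqP.
  by rewrite eq_sym oner_eq0.
have [|m hm] := @cos_eq1 (c * L).
  have -> : c * L = th L - th 0 by rewrite (thE L oL); ring.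
  by rewrite cosB cL sL -!expr2 cos2Dsin2.
have m1 : (1 <= m)%N.
  rewrite lt0n; apply/eqP => m0; move/eqP : hm.
  by rewrite m0 mulr0 normr_eq0 mulf_eq0 (negbTE c0) (gt_eqF L0).
exists m; split => //.
have hcm : 2 * pi * m%:R = `|c| * L by rewrite -hm normrM (gtr0_norm L0).
pose sg : R := Num.sg c.
have sg2 : sg * sg = 1 by rewrite /sg -expr2 sqr_sg c0.
have sgc : sg * `|c| = c by rewrite normrEsg -/sg mulrA sg2 mul1r.
pose a := th 0 - sg * (pi / 2).
have sgv : sg = 1 \/ sg = -1.
  rewrite /sg; have [cn|cp|/eqP] := ltgtP c 0; last by rewrite (negbTE c0).
    by right; rewrite ltr0_sg.
  by left; rewrite gtr0_sg.
have ca x : cos (x - sg * (pi / 2)) = sg * sin x.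
  rewrite cosB; have [->|->] := sgv.
    by rewrite mul1r cos_pihalf sin_pihalf; ring.
  by rewrite mulN1r cosN sinN cos_pihalf sin_pihalf; ring.
have sa x : sin (x - sg * (pi / 2)) = - (sg * cos x).
  rewrite sinB; have [->|->] := sgv.
    by rewrite mul1r cos_pihalf sin_pihalf; ring.
  by rewrite mulN1r cosN sinN cos_pihalf sin_pihalf; ring.
have rc : sg * `|c|^-1 = c^-1.
  rewrite -[in RHS]sgc invfM; congr (_ * _).
  by apply: (mulfI (_ : sg != 0)); [rewrite sgr_eq0|rewrite sg2 divff// sgr_eq0].
(* The centre of curvature at the initial point, the radius [1 / |c|], and a polar angle lagging or
   leading the tangent by a quarter turn according to the sign of [c]. *)
exists (pos g 0 - (c^-1 * sin (th 0), - (c^-1 * cos (th 0)))), (`|c|^-1), a, (c < 0).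
split.
- by rewrite invr_gt0 normr_gt0.
- by rewrite hcm mulrAC divff ?mul1r// normr_eq0.
move=> t tL; have [t0 tL'] := andP tL.
rewrite (tangent_pos L0 p1 T tL).
have eth : a + (-1) ^+ (c < 0)%R * (2 * pi * m%:R * t / L) = th t - sg * (pi / 2).
  rewrite (thE t tL) hcm /a -[in RHS]sgc /sg.
  have -> : (-1) ^+ (c < 0)%R = Num.sg c :> R.
    by rewrite (neqr0_sign c0).
  by field; rewrite gt_eqF.
cbv zeta; rewrite eth ca sa.
have HT := AC_sub H (lexx 0) tL'.
have i1 : itg 0 t (fun s => cos (th s)) = c^-1 * sin (th t) - c^-1 * sin (th 0).
  have := AC_int (AC_sin L0' H) (lexx 0) t0 tL'.
  have -> : itg 0 t (fun s => cos (th s) * c) = c * itg 0 t (fun s => cos (th s)).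
    rewrite -itgZ; last by apply: itb_cont; apply: ccos; exact: AC_cont H.
    by apply: eq_itg => s _; rewrite mulrC.
  by rewrite -mulrBr => ->; rewrite mulrA mulVf// mul1r.
have i2 : itg 0 t (fun s => sin (th s)) = - (c^-1 * cos (th t)) + c^-1 * cos (th 0).
  have := AC_int (AC_cos L0' H) (lexx 0) t0 tL'.
  have -> : itg 0 t (fun s => - sin (th s) * c) = - c * itg 0 t (fun s => sin (th s)).
    rewrite -itgZ; last by apply: itb_cont; apply: csin; exact: AC_cont H.
    by apply: eq_itg => s _; ring.
  move=> h; have -> : - (c^-1 * cos (th t)) + c^-1 * cos (th 0) = - c^-1 * (cos (th t) - cos (th 0)) by ring.
  by rewrite h mulrA mulrNN mulVf// mul1r.
rewrite i1 i2; apply: injective_projections => /=.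
  by rewrite [_^-1 * (sg * _)]mulrCA [sg * (_ * _)]mulrA rc; ring.
have -> : `|c|^-1 * - (sg * cos (th t)) = - ((sg * `|c|^-1) * cos (th t)) by ring.
by rewrite rc; ring.
Qed.

End Dichotomy.

(** * The reference elastica *)

Section Singular.
Context {R : realType}.
Implicit Types (f g u v k : R -> R) (a b s t x y : R).

Lemma cos_isolated x : exists2 d : R, 0 < d &
  forall y, 0 < `|y - x| -> `|y - x| < d -> cos y != 0.
Proof.
have [c0|c0] := eqVneq (cos x) 0; last first.
  have h0 : 0 < `|cos x| by rewrite normr_gt0.
  have [d d0 hd] := proj1 (cont_ed _ x) (continuous_cos (x:=x)) _ h0.
  exists d => // y _ /hd; apply: contraTneq => ->; by rewrite sub0r normrN ltxx.
exists pi; first exact: pi_gt0.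
have s0 : sin x != 0.
  apply/eqP => s0; have := cos2Dsin2 x; rewrite c0 s0 expr0n/= addr0 => /eqP.
  by rewrite eq_sym oner_eq0.
move=> y; rewrite normr_gt0 => y0 yd.
have -> : y = x + (y - x) by ring.
rewrite cosD c0 mul0r sub0r oppr_eq0 mulf_neq0//.
move: yd; rewrite ltr_norml => /andP[h1 h2].
case: (ltgtP (y - x) 0) y0 => // h _.
- rewrite -oppr_eq0 -sinN; apply: lt0r_neq0; apply: sin_gt0_pi; lra.
- by apply: lt0r_neq0; apply: sin_gt0_pi; rewrite h.
Qed.

Definition cpow (r t : R) : R := `|cos t| `^ r.

Lemma meas_cpow r : measurable_fun setT (cpow r).
Proof.
apply: meas_npow; exact: continuous_measurable_fun (@continuous_cos R).
Qed.

Lemma near_eq_cont f g x d : 0 < d -> (forall y, `|y - x| < d -> f y = g y) ->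
  {for x, continuous f} -> {for x, continuous g}.
Proof.
move=> d0 e /cont_ed cf; apply/cont_ed => z /cf[d' d'0 h].
exists (Num.min d d'); first by rewrite lt_min d0.
move=> y; rewrite lt_min => /andP[yd /h].
by rewrite -!e// subrr normr0.
Qed.

Lemma cont_cpow r x : cos x != 0 -> {for x, continuous (cpow r)}.
Proof.
move=> cx; have [c0|c0] := ltP 0 (cos x).
  have h : is_derive x 1 (fun y => cos y `^ r) _ := dcomp (is_derive_cos x) (dpowR r c0).
  have [d d0 hd] := proj1 (cont_ed _ x) (continuous_cos (x:=x)) _ c0.
  apply: near_eq_cont d0 _ (d_cont h) => y /hd; rewrite ltr_norml => /andP[hh _].
  by rewrite /cpow gtr0_norm//; lra.
have {}c0 : 0 < - cos x by rewrite oppr_gt0 lt_neqAle cx.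
have h : is_derive x 1 (fun y => (- cos y) `^ r) _ := dcomp (dN (is_derive_cos x)) (dpowR r c0).
have [d d0 hd] := proj1 (cont_ed _ x) (continuous_cos (x:=x)) _ c0.
apply: near_eq_cont d0 _ (d_cont h) => y /hd; rewrite ltr_norml => /andP[_ hh].
by rewrite /cpow ltr0_norm//; lra.
Qed.

(** Near a zero [x] of the cosine, [sin x * sin y >= 1 / 2], so [|cos y|^r] is dominated by
    [2 sin x sin y |cos y|^r]. The latter has an explicit continuous primitive, a multiple of
    [spow (r + 1) (cos y)], and [itb_sing] applies on each side of [x]. *)
Lemma itb_cpow r s t : -1 < r -> itb s t (cpow r).
Proof.
move=> r1; have [st|ts] := leP s t; last exact: itb_gt.
have mc := meas_cpow r.
pose P a b := itb a b (cpow r).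
have : P s t; last by [].
apply: (@creep _ s t P) => //; last first.
  by move=> a b c _ ab bc _; exact: itb_union.
move=> x _; have [cx|cx] := eqVneq (cos x) 0; last first.
  have h0 : 0 < `|cos x| by rewrite normr_gt0.
  have [d d0 hd] := proj1 (cont_ed _ x) (continuous_cos (x:=x)) _ h0.
  exists d => // a b _ ax xb _ da bd; apply: itb_within.
  apply/subspace_continuousP => y; rewrite /= in_itv/= => /andP[ay yb].
  apply: cvg_within_filter; apply: cont_cpow.
  have : `|y - x| < d by rewrite ltr_norml; lra.
  by move=> /hd; apply: contraTneq => ->; rewrite sub0r normrN ltxx.
have [d1 d10 hd1] := cos_isolated x.
have s1 : sin x ^+ 2 = 1 by have := cos2Dsin2 x; rewrite cx expr0n/= add0r.
have [d2 d20 hd2] := proj1 (cont_ed _ x) (continuous_sin (x:=x)) (1/2) ltac:(lra).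
have sxn : `|sin x| = 1.
  by apply/eqP; rewrite -(@eqrXn2 _ 2)// ?real_normK ?num_real// s1 expr1n.
have hs y : `|y - x| < d2 -> 1 / 2 <= sin x * sin y.
  move=> /hd2 h; have : sin x * sin y = 1 + sin x * (sin y - sin x) by rewrite -s1; ring.
  have e2 : `|sin x * (sin y - sin x)| = `|sin y - sin x| by rewrite normrM sxn mul1r.
  move: h; rewrite -e2 ltr_norml => /andP[h1 h2] e.
  by rewrite e; lra.
pose G y := - 2 * sin x / (r + 1) * spow (r + 1) (cos y).
pose g y := 2 * sin x * sin y * cpow r y.
have cG : continuous G by apply: cZ; apply: ccomp (@continuous_cos R) _; apply: cspow; lra.
have mg : measurable_fun setT g.
  by apply: measurable_funM => //; apply: continuous_measurable_fun;
    apply: cZ; exact: continuous_sin.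
have dG y : 0 < `|y - x| -> `|y - x| < d1 -> {for y, continuous g} /\ is_derive y 1 G (g y).
  move=> h1 h2; have cy := hd1 y h1 h2; split.
    apply: cvgM; last exact: cont_cpow.
    by apply: cvgM; [exact: cvg_cst|exact: continuous_sin].
  have rr : 0 < r + 1 by lra.
  have := dZ (- 2 * sin x / (r + 1)) (dcomp (is_derive_cos y) (dspow rr cy)).
  move=> h; apply: (is_derive_eq h); rewrite addrK /g /cpow; field; lra.
pose d := Num.min d1 d2.
have piece a b : a <= b -> x - d < a -> b < x + d -> b <= x \/ x <= a -> itb a b (cpow r).
  rewrite /d => ab da bd hx; have {da}[da1 da2] : x - d1 < a /\ x - d2 < a.
    move: da; case: (leP d1 d2); lra.
  have {bd}[bd1 bd2] : b < x + d1 /\ b < x + d2 by move: bd; case: (leP d1 d2); lra.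
  move: ab; rewrite le_eqVlt => /predU1P[<-|ab].
    by apply: (@eq_itb _ a a (fun=> cpow r a)); [move=> z hz; congr cpow; lra|exact: itb_cst].
  apply: (@itb_le _ _ _ _ g); first exact: measurable_funTS.
    move=> y hy; rewrite ger0_norm ?powR_ge0//.
    have := @hs y ltac:(rewrite ltr_norml; lra).
    rewrite /g => h; rewrite ler_peMl ?powR_ge0//; lra.
  apply: (itb_sing ab mg cG) => y hy.
    have := @hs y ltac:(rewrite ltr_norml; lra).
    rewrite /g => h; rewrite mulr_ge0 ?powR_ge0//; lra.
  apply: dG; last by rewrite ltr_norml; lra.
  by rewrite normr_gt0 subr_eq0; case: hx; lra.
exists d; first by rewrite /d lt_min d10.
move=> a b _ ax xb _ da bd; apply: (itb_union ax xb mc).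
- by apply: piece => //; [lra|left].
- by apply: piece => //; [lra|right].
Qed.

End Singular.

(** * Primitives with isolated singular points *)

Section Primitive.
Context {R : realType}.
Implicit Types (f : R -> R) (a b s t x y : R).

Lemma cont_integral0 f : measurable_fun setT f -> (forall x y, itb x y f) ->
  continuous (integral0 f).
Proof.
move=> mf hf x.
have xx : x - 1 <= x + 1 by lra.
have := AC_cont (AC_prim (integral0 f (x - 1)) xx mf (hf _ _)) => h.
apply: near_eq_cont (ltr01 : (0:R) < 1) _ (h x) => y; rewrite ltr_norml => /andP[h1 h2].
by rewrite prim_E; [rewrite -(integral0B hf); [ring|lra]|lra].
Qed.

Lemma integral00 f : integral0 f 0 = 0.
Proof. by rewrite /integral0 lexx; exact: (itgxx 0 f). Qed.

(* A continuous function is constant as soon as its derivative vanishes off a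
   set of isolated points. *)
Lemma const_cos_isolated (F : R -> R) : continuous F ->
  (forall y : R, cos y != 0 -> is_derive y 1 F 0) -> forall x : R, F x = F 0.
Proof.
move=> cF dF x.
pose a := Num.min 0 x; pose b := Num.max 0 x.
have [a0 ax b0 xb] : [/\ a <= 0, a <= x, 0 <= b & x <= b].
  by rewrite /a /b !ge_min !le_max !lexx !orbT.
have H : AC a b F (fun=> 0).
  apply: AC_isolated (le_trans a0 b0) cF (measurable_cst _) (itb_cst _ _ _) _.
  move=> z _; have [d d0 hd] := cos_isolated z.
  exists d => // y h1 h2; split; first exact: cvg_cst.
  exact: dF (hd y h1 h2).
have -> := AC_const H (t := x); last by rewrite ax.
by rewrite (AC_const H (t := 0))// a0.
Qed.

End Primitive.

(** * The elliptic integrals and the amplitude function *)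

Section Amplitude.
Context {R : realType}.
Context (p q : R) (p1 : 1 < p) (q0 : 0 <= q) (q1 : q < 1).
Implicit Types (f : R -> R) (a b s t x y : R).

Definition Del (k x : R) : R := Num.sqrt (1 - k ^+ 2 * sin x ^+ 2).

Definition dF1 x : R := cpow (1 - 2 / p) x / Del q x.

Definition dE1 x : R := Del q x * cpow (1 - 2 / p) x.

Lemma Del2_gt0 x : 0 < 1 - q ^+ 2 * sin x ^+ 2.
Proof.
have h1 : q ^+ 2 < 1 by rewrite expr_lt1.
have h2 := sqr_ge0 (cos x); have h3 := sqr_ge0 (sin x); have h4 := cos2Dsin2 x.
have h5 : q ^+ 2 * sin x ^+ 2 <= q ^+ 2 * 1.
  by apply: ler_wpM2l; [exact: sqr_ge0|lra].
lra.
Qed.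

Lemma Del_gt0 x : 0 < Del q x. Proof. by rewrite sqrtr_gt0 Del2_gt0. Qed.

Lemma Del_sqr x : Del q x ^+ 2 = 1 - q ^+ 2 * sin x ^+ 2.
Proof. by rewrite sqr_sqrtr// ltW// Del2_gt0. Qed.

Lemma cont_Del : continuous (Del q).
Proof. by apply: csqrt; apply: cB; [exact: ccst|apply: cZ; apply: cX; exact: continuous_sin]. Qed.

Lemma cont_DelV : continuous (fun x => (Del q x)^-1).
Proof.
move=> x; apply: cvgV; [by rewrite gt_eqF// Del_gt0|exact: cont_Del].
Qed.

Lemma dDel x : is_derive x 1 (Del q) (- q ^+ 2 * sin x * cos x / Del q x).
Proof.
have h := @dsqrt _ x (fun x => 1 - q ^+ 2 * sin x ^+ 2) _ (Del2_gt0 x)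
  (dB (dcst x 1) (dZ (q ^+ 2) (dsqr (is_derive_sin x)))).
apply: (is_derive_eq h); rewrite -/(Del q x); field.
by rewrite gt_eqF// Del_gt0.
Qed.

Lemma a_gt : -1 < 1 - 2 / p.
Proof. 
have p0 : 0 < p by exact: lt_trans p1.
have h : 2 / p < 2 by rewrite ltr_pdivrMr// ltr_pMr.
by lra.
 Qed.

Lemma itb_dF1 s t : itb s t dF1.
Proof.
have h := itb_contM (itb_cpow s t a_gt) cont_DelV.
by apply: eq_itb h => x _; rewrite mulrC.
Qed.

Lemma itb_dE1 s t : itb s t dE1.
Proof. exact: itb_contM (itb_cpow s t a_gt) cont_Del. Qed.

Lemma meas_dF1 : measurable_fun setT dF1.
Proof. apply: measurable_funM (meas_cpow _) (continuous_measurable_fun cont_DelV). Qed.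

Lemma meas_dE1 : measurable_fun setT dE1.
Proof. exact: measurable_funM (continuous_measurable_fun cont_Del) (meas_cpow _). Qed.

Lemma cont_dF1 x : cos x != 0 -> {for x, continuous dF1}.
Proof. by move=> cx; apply: cvgM; [exact: cont_cpow|exact: cont_DelV]. Qed.

Lemma cont_dE1 x : cos x != 0 -> {for x, continuous dE1}.
Proof. by move=> cx; apply: cvgM; [exact: cont_Del|exact: cont_cpow]. Qed.

Lemma F1E x : F1 p x q = integral0 dF1 x. Proof. by []. Qed.
Lemma E1E x : E1 p x q = integral0 dE1 x. Proof. by []. Qed.

Lemma dF1_gt0 x : cos x != 0 -> 0 < dF1 x.
Proof. by move=> cx; rewrite divr_gt0 ?Del_gt0// /cpow powR_gt0// normr_gt0. Qed.

Lemma dF1_ge0 x : 0 <= dF1 x.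
Proof. by rewrite divr_ge0 ?powR_ge0// ltW// Del_gt0. Qed.

Lemma cont_F1 : continuous (F1 p ^~ q).
Proof. exact: cont_integral0 meas_dF1 itb_dF1. Qed.

Lemma cont_E1 : continuous (E1 p ^~ q).
Proof. exact: cont_integral0 meas_dE1 itb_dE1. Qed.

Lemma derive_F1 x : cos x != 0 -> is_derive x 1 (F1 p ^~ q) (dF1 x).
Proof. by move=> cx; apply: derive_integral0 itb_dF1 (cont_dF1 cx). Qed.

Lemma derive_E1 x : cos x != 0 -> is_derive x 1 (E1 p ^~ q) (dE1 x).
Proof. by move=> cx; apply: derive_integral0 itb_dE1 (cont_dE1 cx). Qed.

Lemma F1_le s t : s <= t -> F1 p s q <= F1 p t q.
Proof.
move=> st; rewrite -subr_ge0 !F1E (integral0B itb_dF1)//.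
by apply: itg_ge0 => x _; exact: dF1_ge0.
Qed.

(** Equal values would make the nondecreasing function constant on [[s, t]], yet this interval
    contains points with nonzero cosine, where the derivative is positive. *)
Lemma F1_lt s t : s < t -> F1 p s q < F1 p t q.
Proof.
move=> st; rewrite lt_neqAle F1_le ?andbT; last exact: ltW.
apply/eqP => e.
have [d d0 hd] := cos_isolated s.
pose m := Num.min (t - s) d.
have m0 : 0 < m by rewrite lt_min subr_gt0 st.
have [mt md] : m <= t - s /\ m <= d by rewrite /m !ge_min !lexx orbT.
pose y := s + m / 2.
have cy : cos y != 0.
  apply: hd; rewrite /y (_ : s + _ - s = m / 2) ?gtr0_norm; try lra; ring.
have h := derive_F1 cy.
have h0 : is_derive y 1 (F1 p ^~ q) 0.
  apply: near_eq_is_derive (dcst y (F1 p s q)).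
  apply: (@near_ball _ y _ (m / 2)); first lra.
  move=> z; rewrite ltr_norml /y => /andP[h1 h2].
  by apply/eqP; rewrite eq_le; apply/andP; split; [|rewrite e]; apply: F1_le; lra.
have := dF1_gt0 cy.
by rewrite -(@derive_val _ _ _ _ _ _ _ h) (@derive_val _ _ _ _ _ _ _ h0) ltxx.
Qed.

Lemma F1_inj s t : F1 p s q = F1 p t q -> s = t.
Proof.
by move=> e; case: (ltgtP s t) => // /F1_lt; rewrite e ltxx.
Qed.

Lemma F10 : F1 p 0 q = 0. Proof. by rewrite F1E integral00. Qed.
Lemma E10 : E1 p 0 q = 0. Proof. by rewrite E1E integral00. Qed.

Lemma dF1N x : dF1 (- x) = dF1 x.
Proof. by rewrite /dF1 /cpow /Del cosN sinN sqrrN. Qed.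

Lemma dF1D x : dF1 (x + pi) = dF1 x.
Proof. by rewrite /dF1 /cpow /Del cosDpi sinDpi sqrrN normrN. Qed.

Lemma dE1N x : dE1 (- x) = dE1 x.
Proof. by rewrite /dE1 /cpow /Del cosN sinN sqrrN. Qed.

Lemma dE1D x : dE1 (x + pi) = dE1 x.
Proof. by rewrite /dE1 /cpow /Del cosDpi sinDpi sqrrN normrN. Qed.

(** Parity and periodicity of the integrand give zero derivatives off the zeros of the cosine. The
    increment over a period is [F pi], and evaluating at [- pi / 2] identifies it as
    [2 * F (pi / 2)]. *)
Lemma odd_shift (F f : R -> R) : continuous F -> F 0 = 0 ->
  (forall y : R, cos y != 0 -> is_derive y 1 F (f y)) ->
  (forall y, f (- y) = f y) -> (forall y, f (y + pi) = f y) ->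
  forall x, F (- x) = - F x /\ F (x + pi) = F x + 2 * F (pi / 2).
Proof.
move=> cF F0 dF fN fD.
have hodd x : F (- x) = - F x.
  have := @const_cos_isolated _ (fun y => F y + F (- y)).
  move=> /(_ _ _ x); rewrite oppr0 F0 addr0 => h.
  apply/eqP; rewrite -subr_eq0 opprK addrC; apply/eqP; apply: h.
  - by apply: cD => //; apply: ccomp => //; apply: cN; exact: cid.
  - move=> y cy; apply: (is_derive_eq (dD (dF y cy) (dcomp (dN (did y)) (dF (- y) _)))).
      by rewrite cosN.
    by rewrite fN; ring.
have hs x : F (x + pi) - F x = F pi.
  have := @const_cos_isolated _ (fun y => F (y + pi) - F y).
  move=> /(_ _ _ x); rewrite add0r F0 subr0; apply.
  - by apply: cB => //; apply: ccomp => //; apply: cD; [exact: cid|exact: ccst].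
  - move=> y cy; apply: (is_derive_eq (dB (dcomp (dD (did y) (dcst y pi)) (dF (y + pi) _)) (dF y cy))).
      by rewrite cosDpi oppr_eq0.
    by rewrite fD; ring.
move=> x; split => //.
have := hs (- (pi / 2)); rewrite hodd (_ : - (pi / 2) + pi = pi / 2); last by field.
by have := hs x; lra.
Qed.

Lemma F1N x : F1 p (- x) q = - F1 p x q.
Proof. by have [] := @odd_shift _ _ cont_F1 F10 derive_F1 dF1N dF1D x. Qed.

Lemma F1D x : F1 p (x + pi) q = F1 p x q + 2 * K1c p q.
Proof. by have [] := @odd_shift _ _ cont_F1 F10 derive_F1 dF1N dF1D x. Qed.

Lemma E1N x : E1 p (- x) q = - E1 p x q.
Proof. by have [] := @odd_shift _ _ cont_E1 E10 derive_E1 dE1N dE1D x. Qed.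

Lemma E1D x : E1 p (x + pi) q = E1 p x q + 2 * E1c p q.
Proof. by have [] := @odd_shift _ _ cont_E1 E10 derive_E1 dE1N dE1D x. Qed.

Lemma K1c_gt0 : 0 < K1c p q.
Proof. by rewrite /K1c -F10; apply: F1_lt; rewrite divr_gt0 ?pi_gt0. Qed.

Lemma F1Dn x n : F1 p (x + pi *+ n) q = F1 p x q + 2 * n%:R * K1c p q.
Proof.
elim: n => [|n IH]; first by rewrite mulr0n addr0 mulr0 mul0r addr0.
by rewrite mulrSr addrA F1D IH -natr1; ring.
Qed.

Lemma E1Dn x n : E1 p (x + pi *+ n) q = E1 p x q + 2 * n%:R * E1c p q.
Proof.
elim: n => [|n IH]; first by rewrite mulr0n addr0 mulr0 mul0r addr0.
by rewrite mulrSr addrA E1D IH -natr1; ring.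
Qed.

Lemma F1_surj s : exists x, F1 p x q = s.
Proof.
have K0 := K1c_gt0.
pose n := (Num.truncn (`|s| / (2 * K1c p q))).+1.
have hn : `|s| <= 2 * n%:R * K1c p q.
  rewrite mulrAC -ler_pdivrMl; last lra.
  rewrite mulrC; apply: ltW; exact: truncnS_gt.
have e := F1Dn 0 n; rewrite F10 !add0r in e.
have [||x _ hx] := @ivt _ (- (pi *+ n)) (pi *+ n) (F1 p ^~ q) s _ cont_F1.
- have : 0 <= pi *+ n :> R by rewrite mulrn_wge0// ltW// pi_gt0.
  lra.
- rewrite F1N e; move: hn; rewrite ler_norml => /andP[h1 h2].
  by rewrite ge_min le_max h1 h2 orbT.
- by exists x.
Qed.

Lemma F1_am s : F1 p (am1 p s q) q = s.
Proof.
have [x hx] := F1_surj s.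
exact: (@xgetPex _ 0 [set x | F1 p x q = s] (ex_intro _ x hx)).
Qed.

Lemma am_F1 x : am1 p (F1 p x q) q = x.
Proof. by apply: F1_inj; rewrite F1_am. Qed.

Lemma am_lt s t : s < t -> am1 p s q < am1 p t q.
Proof.
move=> st; rewrite ltNge; apply/negP => /F1_le; rewrite !F1_am.
by rewrite leNgt st.
Qed.

Lemma am_shift s n : am1 p (s + 2 * n%:R * K1c p q) q = am1 p s q + pi *+ n.
Proof. by apply: F1_inj; rewrite F1_am F1Dn F1_am. Qed.

Lemma cont_am : continuous (am1 p ^~ q).
Proof.
move=> s; apply/cont_ed => e e0; pose x := am1 p s q.
have h1 : F1 p (x - e) q < s by rewrite -[ltRHS]F1_am; apply: F1_lt; rewrite /x; lra.
have h2 : s < F1 p (x + e) q by rewrite -[ltLHS]F1_am; apply: F1_lt; rewrite /x; lra.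
exists (Num.min (s - F1 p (x - e) q) (F1 p (x + e) q - s)).
  by rewrite lt_min !subr_gt0 h1.
move=> y; rewrite lt_min !ltr_norml => /andP[/andP[h3 _] /andP[_ h4]].
have h5 : F1 p (x - e) q < y by lra.
have h6 : y < F1 p (x + e) q by lra.
move: (am_lt h5) (am_lt h6); rewrite !am_F1 -/x => h7 h8; apply/andP; split; lra.
Qed.

Lemma derive_am s : cos (am1 p s q) != 0 ->
  is_derive s 1 (am1 p ^~ q) (dF1 (am1 p s q))^-1.
Proof.
move=> cx; have h := @is_derive_inverse R (F1 p ^~ q) (am1 p ^~ q) _ (am1 p s q) _ _ (derive_F1 cx).
rewrite F1_am in h; apply: h; last by rewrite gt_eqF// dF1_gt0.
- by apply: near_ball ltr01 _ => x _; exact: am_F1.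
- by apply: near_ball ltr01 _ => x _; exact: cont_F1.
Qed.

(** [am1] has derivative [1 / dF1] wherever the cosine is nonzero, so the weight cancels; the
    remaining parameters are isolated and [AC_isolated] crosses them. *)
Lemma AC_am a b (G g : R -> R) : a <= b -> continuous G -> continuous g ->
  (forall x, cos x != 0 -> is_derive x 1 G (g x * dF1 x)) ->
  AC a b (fun s => G (am1 p s q)) (fun s => g (am1 p s q)).
Proof.
move=> ab cG cg dG.
have cga : continuous (fun s => g (am1 p s q)) := ccomp cont_am cg.
have cGa : continuous (fun s => G (am1 p s q)) := ccomp cont_am cG.
apply: (@AC_isolated _ a b _ (fun s => g (am1 p s q)) ab cGa
  (continuous_measurable_fun cga) (itb_cont _ _ cga)).
move=> x _; have [d d0 hd] := cos_isolated (am1 p x q).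
have [e e0 he] := proj1 (cont_ed _ x) (cont_am (x:=x)) _ d0.
exists e => // y yx ye; split; first exact: cga.
have cy : cos (am1 p y q) != 0.
  apply: hd (he y ye).
  rewrite normr_gt0 subr_eq0; apply/eqP => h; move: yx; rewrite normr_gt0 subr_eq0.
  by rewrite -[y]F1_am h F1_am eqxx.
apply: (is_derive_eq (dcomp (derive_am cy) (dG _ cy))).
by rewrite mulfK// gt_eqF// dF1_gt0.
Qed.

End Amplitude.

(** * Tangent angle, curvature and period of the reference curve *)

Section Reference.
Context {R : realType}.
Context (p q : R) (p1 : 1 < p) (q0 : 0 < q) (q1 : q < 1).
Implicit Types (f : R -> R) (a b s t x y : R).

Let q0' : 0 <= q := ltW q0.
Local Notation am := (fun s => am1 p s q).

(* tangent angle of [gamma_w] *)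
Definition thw p q s : R := 2 * asin (q * sin (am1 p s q)).

(** Exponent [2 / p] gives [cnp], the curvature divided by [2 * q]; exponent [2 - 2 / p] gives its
    signed power of order [p - 1], the momentum of the pendulum. *)
Definition cosp (r k p s : R) : R := spow r (cos (am1 p s k)).

Lemma exponent_gt0 : 0 < p. Proof. exact: lt_trans p1. Qed.
Let r := 2 - 2 / p.
Let p10 : 0 < p - 1. Proof. by rewrite subr_gt0. Qed.

Lemma conj_two_gt0 : 0 < 2 - 2 / p. Proof. by have := a_gt p1; lra. Qed.

Lemma qsin_bnd x : -1 < q * sin x < 1.
Proof.
rewrite -ltr_norml normrM (gtr0_norm q0).
apply: le_lt_trans q1; rewrite ler_piMr// ler_norml; apply/andP; split.
- exact: sin_geN1.
- exact: sin_le1.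
Qed.

Lemma qsin_bnd' x : -1 <= q * sin x <= 1.
Proof. by have /andP[/ltW -> /ltW ->] := qsin_bnd x. Qed.

Lemma sin_half_thw s : sin (thw p q s / 2) = q * sin (am s).
Proof.
rewrite /thw mulrAC divff ?mul1r// asinK// in_itv/=; exact: qsin_bnd'.
Qed.

Lemma cos_half_thw s : cos (thw p q s / 2) = Del q (am s).
Proof.
rewrite /thw mulrAC divff ?mul1r// cos_asin; last exact: qsin_bnd'.
by rewrite exprMn.
Qed.

Lemma double_cos x : cos x = 1 - 2 * sin (x / 2) ^+ 2.
Proof.
have -> : cos x = cos (x / 2 + x / 2) by congr cos; field.
by rewrite cosD; have := cos2Dsin2 (x / 2); rewrite !expr2; lra.
Qed.

Lemma double_sin x : sin x = 2 * sin (x / 2) * cos (x / 2).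
Proof.
have -> : sin x = sin (x / 2 + x / 2) by congr sin; field.
by rewrite sinD; ring.
Qed.

Lemma cos_thw s : cos (thw p q s) = 1 - 2 * q ^+ 2 * sin (am s) ^+ 2.
Proof. by rewrite double_cos sin_half_thw exprMn mulrA. Qed.

Lemma sin_thw s : sin (thw p q s) = 2 * q * sin (am s) * Del q (am s).
Proof. by rewrite double_sin sin_half_thw cos_half_thw mulrA. Qed.

Lemma thw_bnd s : - pi < thw p q s < pi.
Proof.
have /andP[h1 h2] := qsin_bnd (am s).
have h3 := @asin_gtNpi2 _ (q * sin (am s)); rewrite h1 (ltW h2) in h3.
have h4 := @asin_ltpi2 _ (q * sin (am s)); rewrite h2 (ltW h1) in h4.
move: (h3 isT) (h4 isT) => h5 h6.
by rewrite /thw; lra.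
Qed.

Lemma spow_cpow x : cos x != 0 -> spow (2 / p) (cos x) * cpow (1 - 2 / p) x = cos x.
Proof.
move=> cx; rewrite /spow /cpow mulrAC -powRD; last by rewrite normr_eq0 cx implybT.
by rewrite (_ : 2 / p - 1 + (1 - 2 / p) = 0) ?powRr0 ?mul1r//; ring.
Qed.

Lemma AC_derive (U k : R -> R) : (forall a b, a <= b -> AC a b U k) -> continuous k ->
  forall x : R, is_derive x 1 U (k x).
Proof.
move=> H ck x.
have h := dD (derive_integral0_cont ck x) (dcst x (U (x - 1) - integral0 k (x - 1))).
rewrite addr0 in h; apply: near_eq_is_derive h.
apply: (@near_ball _ x _ 1) => // y; rewrite ltr_norml => /andP[h1 h2].
have xy : x - 1 <= y by lra.
have e := @integral0B _ k (x - 1) y (fun x y => itb_cont x y ck) xy.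
have e' := AC_int (H (x - 1) y xy) (lexx _) xy (lexx _).
rewrite addrCA e -e'; ring.
Qed.

(** The amplitude itself need not be differentiable where its cosine vanishes, but a continuous
    density makes the composite differentiable everywhere. *)
Lemma derive_am_comp (G g : R -> R) : continuous G -> continuous g ->
  (forall x : R, cos x != 0 -> is_derive x 1 G (g x * dF1 p q x)) ->
  forall s : R, is_derive s 1 (fun s => G (am s)) (g (am s)).
Proof.
move=> cG cg dG; apply: AC_derive; last exact: (ccomp (cont_am p1 q0' q1) cg).
by move=> a b ab; exact: AC_am.
Qed.

Lemma cont_asinq : continuous (fun x => 2 * asin (q * sin x)).
Proof.
apply: cZ => x; apply: (@continuous_comp _ _ _ (fun x => q * sin x) asin).
  by apply: cZ; exact: continuous_sin.
exact: continuous_asin (qsin_bnd x).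
Qed.

Lemma cont_thw : continuous (thw p q).
Proof. exact: (ccomp (cont_am p1 q0' q1) cont_asinq). Qed.

Lemma cont_cosp r' : 0 < r' -> continuous (cosp r' q p).
Proof.
move=> r0; apply: (ccomp (f := fun s => cos (am s)) _ (cspow r0)).
exact: ccos (cont_am p1 q0' q1).
Qed.

Lemma two_div_gt0 : 0 < 2 / p. Proof. by rewrite divr_gt0 ?exponent_gt0. Qed.

Lemma derive_thw s : is_derive s 1 (thw p q) (2 * q * cosp (2 / p) q p s).
Proof.
apply: (@derive_am_comp (fun x => 2 * asin (q * sin x)) (fun x => 2 * q * spow (2 / p) (cos x))).
- exact: cont_asinq.
- by apply: cZ; apply: ccomp; [exact: continuous_cos|exact: cspow two_div_gt0].
- move=> x cx; have h := dZ 2 (dcomp (dZ q (is_derive_sin x)) (is_derive1_asin (qsin_bnd x))).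
  apply: (is_derive_eq h); rewrite /dF1 -[in LHS](spow_cpow cx) exprMn -/(Del q x); ring.
Qed.

Lemma derive_cosp s : is_derive s 1 (cosp (2 - 2 / p) q p) (- ((2 - 2 / p) / (2 * q)) * sin (thw p q s)).
Proof.
have h := @derive_am_comp (fun x => spow r (cos x)) (fun x => - r * sin x * Del q x).
rewrite sin_thw (_ : _ * _ = - r * sin (am s) * Del q (am s)); last by rewrite /r; field; rewrite !gt_eqF// exponent_gt0.
apply: h.
- by apply: ccomp; [exact: continuous_cos|exact: cspow conj_two_gt0].
- by apply: cM; [apply: cZ; exact: continuous_sin|exact: cont_Del].
- move=> x cx; apply: (is_derive_eq (dcomp (is_derive_cos x) (dspow conj_two_gt0 cx))).
  rewrite /dF1 /cpow (_ : 2 - 2 / p - 1 = 1 - 2 / p); last by ring.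
  rewrite /r; field; rewrite !gt_eqF// ?exponent_gt0//; exact: Del_gt0.
Qed.

(** Writing [s] as [F1 p (am1 p s q) q] makes the component a function of the amplitude; its density
    is [2 * Del^2 - 1], the cosine of the doubled angle. With [derive_gamma2] this shows that
    [gamma_w] has unit speed and tangent angle [thw]. *)
Lemma derive_gamma1 s : is_derive s 1 (fun s => (gamma_w p s q).1) (cos (thw p q s)).
Proof.
have h := @derive_am_comp (fun x => 2 * E1 p x q - F1 p x q) (fun x => 1 - 2 * q ^+ 2 * sin x ^+ 2).
rewrite cos_thw.
have -> : (fun s => (gamma_w p s q).1) = (fun s => 2 * E1 p (am s) q - F1 p (am s) q).
  by apply/funext => t; rewrite /gamma_w/= F1_am.
apply: h.
- by apply: cB; [apply: cZ; exact: cont_E1|exact: cont_F1].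
- by apply: cB; [exact: ccst|apply: cZ; apply: cX; exact: continuous_sin].
- move=> x cx; have hd : is_derive x 1 (fun x => 2 * E1 p x q - F1 p x q) _ :=
    dB (dZ 2 (derive_E1 q p1 cx)) (derive_F1 p1 q0' q1 cx).
  apply: (is_derive_eq hd).
  have D0 := Del_gt0 q0' q1 x; have D2 := Del_sqr q0' q1 x.
  rewrite (_ : 1 - 2 * _ * _ = 2 * Del q x ^+ 2 - 1); last by rewrite D2; ring.
  by rewrite /dE1 /dF1; field; rewrite gt_eqF.
Qed.

Lemma gamma2E s : (gamma_w p s q).2 = - (q * (p / (p - 1))) * cosp (2 - 2 / p) q p s.
Proof.
rewrite /gamma_w/= mulNr; congr (- (_ * _)).
have := @spow_comp _ (2 / p) (p - 1) (cos (am s)) two_div_gt0 p10.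
rewrite {1}/spow (_ : p - 1 - 1 = p - 2); last by ring.
rewrite (_ : 2 / p * (p - 1) = 2 - 2 / p); last by field; rewrite gt_eqF// exponent_gt0.
by move=> ->.
Qed.

Lemma derive_gamma2 s : is_derive s 1 (fun s => (gamma_w p s q).2) (sin (thw p q s)).
Proof.
have -> : (fun s => (gamma_w p s q).2) = fun s => - (q * (p / (p - 1))) * cosp (2 - 2 / p) q p s.
  by apply/funext => t; rewrite gamma2E.
apply: (is_derive_eq (dZ _ (derive_cosp s))).
by field; rewrite !gt_eqF ?exponent_gt0 ?q0 ?subr_gt0.
Qed.

Lemma cosp_cosp s : spow (p - 1) (cosp (2 / p) q p s) = cosp (2 - 2 / p) q p s.
Proof.
rewrite /cosp spow_comp ?two_div_gt0//.
by congr spow; field; rewrite gt_eqF// exponent_gt0.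
Qed.

Lemma thw_shift s n : thw p q (s + 4 * n%:R * K1c p q) = thw p q s /\
  (forall r', cosp r' q p (s + 4 * n%:R * K1c p q) = cosp r' q p s).
Proof.
rewrite /thw /cosp (_ : 4 * n%:R = 2 * (2 * n)%N%:R); last by rewrite natrM; ring.
rewrite am_shift// (_ : pi *+ _ = 2 * pi * n%:R).
  by rewrite cos_periodn sin_periodn.
by rewrite mulnC mulrnA -mulr_natr -[pi *+ n]mulr_natr; ring.
Qed.

(** The drift over a period, proportional to [2 E - K], is the only obstruction to closing up. *)
Lemma gamma_shift s n : (gamma_w p (s + 4 * n%:R * K1c p q) q).1 =
  (gamma_w p s q).1 + 4 * n%:R * (2 * E1c p q - K1c p q).
Proof.
rewrite /gamma_w/=.
have -> : am1 p (s + 4 * n%:R * K1c p q) q = am s + pi *+ (2 * n).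
  by rewrite -am_shift//; congr (am1 p (s + _) q); rewrite natrM; ring.
by rewrite E1Dn// natrM; ring.
Qed.

(** The angle determines the sine of the amplitude and the momentum its cosine, so the two
    amplitudes differ by a multiple of [2 pi]. *)
Lemma period_only s s' : s < s' -> thw p q s' = thw p q s ->
  cosp (2 - 2 / p) q p s' = cosp (2 - 2 / p) q p s ->
  exists2 n, (0 < n)%N & s' = s + 4 * n%:R * K1c p q.
Proof.
move=> ss' e1 e2.
have sE : sin (am s') = sin (am s).
  have qn : q != 0 by rewrite gt_eqF.
  by apply: (mulfI qn); have h1 := sin_half_thw s; have h2 := sin_half_thw s'; rewrite -h1 -h2 e1.
have cE : cos (am s') = cos (am s).
  case: (ltgtP (cos (am s')) (cos (am s))) => // h.
    by have := ltr_spow conj_two_gt0 h; rewrite -!/(cosp _ _ _ _) e2 ltxx.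
  by have := ltr_spow conj_two_gt0 h; rewrite -!/(cosp _ _ _ _) e2 ltxx.
have ca : cos (am s' - am s) = 1.
  by rewrite cosB cE sE -!expr2 cos2Dsin2.
have [n hn] := cos_eq1 ca.
have am_gt : 0 < am s' - am s by rewrite subr_gt0; exact: am_lt.
rewrite (gtr0_norm am_gt) in hn.
exists n.
  by case: n hn => // hn; move: am_gt; rewrite hn mulr0 ltxx.
have e : am s' = am s + pi *+ (2 * n).
  have -> : pi *+ (2 * n) = 2 * pi * n%:R :> R.
    by rewrite mulnC mulrnA -mulr_natr -[pi *+ n]mulr_natr; ring.
  by rewrite -hn; ring.
have := F1Dn p1 q0' q1 (am s) (2 * n)%N.
rewrite -e !F1_am// natrM => ->; ring.
Qed.

(** The hypothesis is the equation of an energy level. In the coordinates [C] and [S] the level is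
    the unit circle, and its polar angle is the amplitude. *)
Lemma reference_exists b w : - pi <= b <= pi -> sin (b / 2) ^+ 2 + q ^+ 2 * `|w| `^ (p / (p - 1)) = q ^+ 2 ->
  exists2 s, thw p q s = b & cosp (2 - 2 / p) q p s = w.
Proof.
move=> bpi hw.
pose S := sin (b / 2) / q; pose C := spow (p / (p - 1) / 2) w.
have e0 : 0 < p / (p - 1) / 2 by rewrite !divr_gt0 ?exponent_gt0.
have CS : C ^+ 2 + S ^+ 2 = 1.
  have -> : C ^+ 2 = `|w| `^ (p / (p - 1)).
    rewrite -real_normK ?num_real// norm_spow// -powR_mulrn ?powR_ge0// -powRrM.
    by congr (_ `^ _); field; rewrite gt_eqF// p10.
  rewrite /S expr_div_n; apply: (mulfI (_ : q ^+ 2 != 0)); first by rewrite expf_neq0// gt_eqF.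
  rewrite mulr1 mulrDr -[RHS]hw addrC; congr (_ + _).
  by field; rewrite gt_eqF.
have [x [_ _ cx sx]] : exists x, [/\ - pi <= x, x <= pi, cos x = C & sin x = S].
  by have [x [? ? ? ?]] := polar CS; exists x.
exists (F1 p x q).
- rewrite /thw am_F1// sx /S (mulrC q) divfK ?gt_eqF// sinK; first by field.
  by rewrite in_itv/=; lra.
- rewrite /cosp am_F1// cx /C spow_comp ?conj_two_gt0//.
  rewrite (_ : _ * _ = 1) ?spow1//; field; rewrite !gt_eqF ?exponent_gt0//.
Qed.

End Reference.

(** * Uniqueness for the pendulum *)

Section Uniqueness.
Context {R : realType}.
Implicit Types (a b s t x y : R).

Lemma nonzero_inj (G g : R -> R) : (forall x : R, is_derive x 1 G (g x)) ->
  (forall x, g x != 0) -> forall x y, G x = G y -> x = y.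
Proof.
move=> dG g0; suff h x y : x <= y -> G x = G y -> x = y.
  move=> x y e; case: (leP x y) => [xy|/ltW xy]; first exact: h.
  by apply/esym; exact: h.
move=> xy e; have [r _] := @mvt_range _ x y (fun y => y) G g xy (@cid R) (fun z _ => dG z).
rewrite e subrr => /esym/eqP; rewrite mulf_eq0 (negbTE (g0 _))/= subr_eq0 => /eqP.
by move=> ->.
Qed.

(* The primitive of [1 / Phi] measures time along both solutions. *)
Lemma separable_uniq a b x d0 (Phi u1 u2 k1 k2 : R -> R) : a <= x <= b -> 0 < d0 ->
  AC a b u1 k1 -> AC a b u2 k2 -> continuous Phi -> u1 x = u2 x -> Phi (u1 x) != 0 ->
  (forall t, a <= t <= b -> `|t - x| < d0 -> k1 t = Phi (u1 t) /\ k2 t = Phi (u2 t)) ->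
  exists2 d, 0 < d & forall t, a <= t <= b -> `|t - x| < d -> u1 t = u2 t.
Proof.
move=> /andP[ax xb] d00 H1 H2 cP e12 P0 hk.
pose v := u1 x.
have aP0 : 0 < `|Phi v| by rewrite normr_gt0.
have [e e0 he] := proj1 (cont_ed _ v) (cP v) _ aP0.
(* Clamping the argument to a neighbourhood of [v] keeps the function away from 0 on the whole line,
   so that its inverse has a global primitive. *)
pose Ph := fun y => Phi (pr (v - e / 2) (v + e / 2) y).
have le_ : v - e / 2 <= v + e / 2 by lra.
have cPh : continuous Ph by apply: cont_pr => //; exact: continuous_subspaceT.
have Ph0 y : Ph y != 0.
  have := pr_itv y le_; set z := pr _ _ _ => /andP[h1 h2].
  have : `|z - v| < e by rewrite ltr_norml; apply/andP; split; lra.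
  by move=> /he; rewrite /Ph -/z; apply: contraTneq => ->; rewrite sub0r normrN ltxx.
have cV : continuous (fun y => (Ph y)^-1) by move=> y; apply: cvgV; [exact: Ph0|exact: cPh].
have dG := derive_integral0_cont cV.
set G := integral0 _ in dG.
have Ginj := nonzero_inj dG (fun x => invr_neq0 (Ph0 x)).
have e20 : 0 < e / 2 by lra.
have [d1 d10 hd1] := proj1 (cont_ed _ x) (AC_cont H1 (x := x)) _ e20.
have [d2 d20 hd2] := proj1 (cont_ed _ x) (AC_cont H2 (x := x)) _ e20.
pose d := Num.min d0 (Num.min d1 d2).
exists d; first by rewrite /d !lt_min d00 d10.
have key (u k : R -> R) (t : R) s r : AC a b u k -> a <= s -> s <= r -> r <= b ->
    (forall y, s <= y <= r -> `|u y - v| < e / 2 /\ k y = Phi (u y)) ->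
    G (u r) - G (u s) = r - s.
  move=> H as_ sr rb h.
  have := AC_int (AC_C1 (AC_sub H as_ rb) sr dG cV) (lexx s) sr (lexx r).
  move=> ->; rewrite -[RHS]mul1r -(@itg_cst _ s r 1 sr); apply: eq_itg => y sy.
  have [h1 ->] := h y sy.
  have <- : Ph (u y) = Phi (u y).
    by rewrite /Ph pr_id//; move: h1; rewrite ltr_norml; lra.
  by rewrite mulVf.
move=> t tab; rewrite /d !lt_min => /and3P[t0 t1 t2].
have near y : Num.min x t <= y <= Num.max x t ->
    [/\ a <= y <= b, `|y - x| < d0, `|y - x| < d1 & `|y - x| < d2].
  move=> hy; have hxy : `|y - x| <= `|t - x|.
    move: hy; clear; case: (leP x t) => xt /andP[hy1 hy2].
      by rewrite !ger0_norm; lra.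
    by rewrite !ler0_norm; lra.
  split; try exact: le_lt_trans hxy _.
  by move: hy tab ax xb; clear; case: (leP x t) => xt /andP[hy1 hy2]; lra.
have all (u k : R -> R) : AC a b u k ->
    (forall y, Num.min x t <= y <= Num.max x t -> `|u y - v| < e / 2 /\ k y = Phi (u y)) ->
    G (u t) = G (u x) + (t - x).
  move=> H; case: (leP x t) => xt h.
    by rewrite -(key u k 0 x t)//; [ring|case/andP: tab].
  have := key u k 0 t x H _ (ltW xt) xb h.
  by case/andP: tab => at_ _ /(_ at_); clear; lra.
apply: Ginj; rewrite (all _ _ H1) ?(all _ _ H2) ?e12//.
- by move=> y /near[yab h0 h1 h2]; split; [rewrite /v e12; exact: hd2|have [] := hk y yab h0].
- by move=> y /near[yab h0 h1 h2]; split; [exact: hd1|have [] := hk y yab h0].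
Qed.

Lemma eq_ccos_small x y : cos x = cos y -> sin x = sin y -> `|x - y| < 2 * pi -> x = y.
Proof.
move=> c s h; apply/eqP; rewrite -subr_eq0; apply/eqP; apply: cos1_eq0 => //.
by rewrite cosB c s -!expr2 cos2Dsin2.
Qed.

(** For [p > 2] the signed power is not Lipschitz at [w = 0]. The common first integral eliminates
    one unknown locally: where [w = 0], the bound [|A| < lam] gives [sin b != 0] and an equation for
    [w] alone; where [w != 0], an equation for [b] alone. In each case the right-hand side is
    nonzero and the variables separate. *)
Lemma pendulum_uniq p lam A L (b1 w1 b2 w2 : R -> R) : 0 < L -> 1 < p -> 0 < lam -> `|A| < lam ->
  pendulum p lam L b1 w1 -> pendulum p lam L b2 w2 ->
  (forall t, 0 <= t <= L -> (p - 1) / p * `|w1 t| `^ (p / (p - 1)) = A + lam * cos (b1 t)) ->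
  (forall t, 0 <= t <= L -> (p - 1) / p * `|w2 t| `^ (p / (p - 1)) = A + lam * cos (b2 t)) ->
  b1 0 = b2 0 -> w1 0 = w2 0 ->
  forall t, 0 <= t <= L -> b1 t = b2 t /\ w1 t = w2 t.
Proof.
move=> L0 p1 lam0 Alam [Hb1 Hw1] [Hb2 Hw2] l1 l2 eb ew.
have p0 : 0 < p by lra.
have p10 : 0 < p - 1 by lra.
have q0 : 0 < p / (p - 1) by rewrite divr_gt0.
(* Agreement at the left end propagates to the right; stated as an implication it composes over
   adjacent intervals. *)
pose P s t := b1 s = b2 s /\ w1 s = w2 s -> forall r, s <= r <= t -> b1 r = b2 r /\ w1 r = w2 r.
suff h : P 0 L by exact: h.
apply: (@creep _ 0 L P); [exact: ltW| |]; last first.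
  move=> r s t _ rs st _ h1 h2 hr z /andP[rz zt].
  have [zs|sz] := leP z s; first by apply: h1 => //; rewrite rz.
  by apply: h2; [apply: h1 => //; rewrite rs lexx|rewrite (ltW sz)].
(* If the solutions differ at [x] they differ nearby, and the implication holds vacuously. *)
move=> x x0L; have [ee|ne] := pselect (b1 x = b2 x /\ w1 x = w2 x); last first.
  have [ne'|ne'] : b1 x - b2 x != 0 \/ w1 x - w2 x != 0.
    case: (eqVneq (b1 x - b2 x) 0) => [h1|]; last by left.
    case: (eqVneq (w1 x - w2 x) 0) => [h2|]; last by right.
    by case: ne; split; apply/eqP; rewrite -subr_eq0 ?h1 ?h2.
  - have h0 : 0 < `|b1 x - b2 x| by rewrite normr_gt0.
    have [d d0 hd] := proj1 (cont_ed _ x) (cB (AC_cont Hb1) (AC_cont Hb2) (x := x)) _ h0.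
    exists d => // s t _ sx xt _ ds td [e _]; exfalso.
    have := hd s; rewrite e subrr sub0r normrN ltxx => h.
    by have /h : `|s - x| < d; [rewrite ltr_norml; apply/andP; split; lra|].
  - have h0 : 0 < `|w1 x - w2 x| by rewrite normr_gt0.
    have [d d0 hd] := proj1 (cont_ed _ x) (cB (AC_cont Hw1) (AC_cont Hw2) (x := x)) _ h0.
    exists d => // s t _ sx xt _ ds td [_ e]; exfalso.
    have := hd s; rewrite e subrr sub0r normrN ltxx => h.
    by have /h : `|s - x| < d; [rewrite ltr_norml; apply/andP; split; lra|].
have [eb' ew'] := ee.
suff [d d0 hd] : exists2 d, 0 < d & forall t, 0 <= t <= L -> `|t - x| < d ->
    b1 t = b2 t /\ w1 t = w2 t.
  exists d => // s t s0 sx xt tL ds td _ r /andP[sr rt]; apply: hd.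
    by apply/andP; split; lra.
  by rewrite ltr_norml; apply/andP; split; lra.
have [w0|w0] := eqVneq (w1 x) 0.
- (* turning point: the angle is a function of w *)
  have lx := l1 x x0L; rewrite w0 normr0 powR0 ?gt_eqF// mulr0 in lx.
  have sb : sin (b1 x) != 0.
    apply/eqP => s0; have := cos2Dsin2 (b1 x); rewrite s0 expr0n/= addr0 => /eqP.
    rewrite sqrf_eq1 => /orP[] /eqP c1; move: lx; rewrite c1 => lx;
      by move: Alam; rewrite ltr_norml => /andP[]; lra.
  pose sg := Num.sg (sin (b1 x)).
  pose Phi y := - lam * (sg * Num.sqrt (1 - (lam^-1 * ((p - 1) / p * `|y| `^ (p / (p - 1)) - A)) ^+ 2)).
  have cPhi : continuous Phi.
    apply: cZ; apply: cZ; apply: csqrt; apply: cB; first exact: ccst.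
    by apply: cX; apply: cZ; apply: cB; [apply: cZ; exact: cnpow|exact: ccst].
  have s0 : 0 < `|sin (b1 x)| by rewrite normr_gt0.
  have sgn (y : R) : `|y - sin (b1 x)| < `|sin (b1 x)| -> y = sg * `|y|.
    rewrite /sg; case: (ltgtP (sin (b1 x)) 0) sb => // h _.
      rewrite (ltr0_norm h) ltr_norml ltr0_sg// => /andP[_ h2].
      by rewrite ltr0_norm; lra.
    rewrite (gtr0_norm h) ltr_norml gtr0_sg// => /andP[h2 _].
    by rewrite gtr0_norm; lra.
  have [d1 d10 hd1] := proj1 (cont_ed _ x) (csin (AC_cont Hb1) (x := x)) _ s0.
  have [d2 d20 hd2] := proj1 (cont_ed _ x) (csin (AC_cont Hb2) (x := x)) _ s0.
  have form b w : (p - 1) / p * `|w| `^ (p / (p - 1)) = A + lam * cos b ->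
      `|sin b - sin (b1 x)| < `|sin (b1 x)| -> - lam * sin b = Phi w :> R.
    move=> hl /sgn h; rewrite /Phi {1}h hl (addrC A) addrK mulKf ?gt_eqF//.
    by rewrite -sin2cos2 sqrtr_sqr.
  have [| | |d d0 hd] := @separable_uniq 0 L x (Num.min d1 d2) Phi _ _ _ _ x0L _ Hw1 Hw2 cPhi ew'.
  + by rewrite lt_min d10.
  + rewrite -(form (b1 x) _ (l1 x x0L)) ?subrr ?normr0//.
    by rewrite mulf_neq0// oppr_eq0 gt_eqF.
  + move=> t t0L; rewrite lt_min => /andP[/hd1 h1 /hd2 h2]; split.
      exact: form (l1 t t0L) h1.
    by apply: form (l2 t t0L) _; move: h2; rewrite /= -eb'.
  have pi0 := pi_gt0 R.
  have [d3 d30 hd3] := proj1 (cont_ed _ x) (AC_cont Hb1 (x := x)) _ pi0.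
  have [d4 d40 hd4] := proj1 (cont_ed _ x) (AC_cont Hb2 (x := x)) _ pi0.
  exists (Num.min d (Num.min (Num.min d1 d2) (Num.min d3 d4))).
    by rewrite !lt_min d0 d10 d20 d30.
  move=> t t0L; rewrite !lt_min => /andP[h /andP[/andP[/hd1 h1 /hd2 h2] /andP[/hd3 h3 /hd4 h4]]].
  have ewt := hd t t0L h; split => //.
  have hc : cos (b1 t) = cos (b2 t).
    have := l1 t t0L; rewrite ewt l2// => /addrI/(mulfI _).
    by rewrite gt_eqF// => /(_ isT).
  apply: eq_ccos_small => //.
    have f1 := form (b1 t) (w1 t) (l1 t t0L) h1.
    rewrite /= -eb' in h2; have f2 := form (b2 t) (w2 t) (l2 t t0L) h2.
    by rewrite ewt -f2 in f1; apply: (mulfI _) f1; rewrite oppr_eq0 gt_eqF.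
  rewrite (_ : b1 t - b2 t = (b1 t - b1 x) - (b2 t - b2 x)); last by rewrite eb'; ring.
  by apply: le_lt_trans (ler_normB _ _) _; rewrite mulr_natl mulr2n ltrD.
- (* away from turning points w is a function of the angle *)
  have w0' : 0 < `|w1 x| by rewrite normr_gt0.
  pose sg := Num.sg (w1 x).
  pose W y := sg * `|p / (p - 1) * (A + lam * cos y)| `^ ((p - 1) / p).
  have cW : continuous W.
    apply: cZ; apply: (ccomp (f := fun y => p / (p - 1) * (A + lam * cos y)) _ (cnpow _)).
      by apply: cZ; apply: cD; [exact: ccst|apply: cZ; exact: continuous_cos].
    by rewrite divr_gt0.
  have sgn (y : R) : `|y - w1 x| < `|w1 x| -> y = sg * `|y|.
    rewrite /sg; case: (ltgtP (w1 x) 0) w0 => // h _.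
      rewrite (ltr0_norm h) ltr_norml ltr0_sg// => /andP[_ h2].
      by rewrite ltr0_norm; lra.
    rewrite (gtr0_norm h) ltr_norml gtr0_sg// => /andP[h2 _].
    by rewrite gtr0_norm; lra.
  have form b w : (p - 1) / p * `|w| `^ (p / (p - 1)) = A + lam * cos b ->
      `|w - w1 x| < `|w1 x| -> w = W b :> R.
    move=> hl /sgn h; rewrite /W -hl {1}h; congr (_ * _).
    rewrite mulrA (_ : p / (p - 1) * ((p - 1) / p) = 1) ?mul1r; last by field; lra.
    rewrite (ger0_norm (powR_ge0 _ _)) -powRrM (_ : _ * _ = 1) ?powRr1//.
    by field; lra.
  have [d1 d10 hd1] := proj1 (cont_ed _ x) (AC_cont Hw1 (x := x)) _ w0'.
  have [d2 d20 hd2] := proj1 (cont_ed _ x) (AC_cont Hw2 (x := x)) _ w0'.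
  have cPhi : continuous (fun y => spow (p - 1)^-1 (W y)).
    by apply: ccomp => //; apply: cspow; rewrite invr_gt0.
  have [| | |d d0 hd] := @separable_uniq 0 L x (Num.min d1 d2) _ _ _ _ _ x0L _ Hb1 Hb2 cPhi eb'.
  + by rewrite lt_min d10.
  + rewrite -(form (b1 x) _ (l1 x x0L)) ?subrr ?normr0//.
    by rewrite spow_eq0.
  + move=> t t0L; rewrite lt_min => /andP[/hd1 h1 /hd2 h2]; split.
      by rewrite -(form _ _ (l1 t t0L) h1).
    by rewrite -(form _ _ (l2 t t0L))//; move: h2; rewrite /= -ew'.
  exists (Num.min d (Num.min d1 d2)); first by rewrite !lt_min d0 d10.
  move=> t t0L; rewrite !lt_min => /andP[h /andP[/hd1 h1 /hd2 h2]].
  have ebt := hd t t0L h; split => //.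
  rewrite (form _ _ (l1 t t0L) h1) (form _ _ (l2 t t0L)) ?ebt//.
  by move: h2; rewrite /= -ew'.
Qed.

End Uniqueness.

(** * Oscillating pendulums are rescaled reference curves *)

Section Identification.
Context {R : realType}.
Implicit Types (p q nu lam A L s t x : R).

Section Scaled.
Context (p q nu s0 : R) (p1 : 1 < p) (q0 : 0 < q) (q1 : q < 1) (nu0 : 0 < nu).

(** The reference curve has curvature [2 * q * cnp]; run at parameter speed [nu / (2 * q)] its angle
    has derivative [nu * cnp], so [nu] is the amplitude of the curvature. [momw] is the signed power
    of order [p - 1] of [curw], and [lamw] the gravity produced by the scaling. *)
Definition par q nu s0 t : R := nu / (2 * q) * t + s0.
Definition angw p q nu s0 t : R := thw p q (par q nu s0 t).
Definition momw p q nu s0 t : R := nu `^ (p - 1) * cosp (2 - 2 / p) q p (par q nu s0 t).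
Definition curw p q nu s0 t : R := nu * cosp (2 / p) q p (par q nu s0 t).
Definition lamw p q nu : R := nu `^ p * (2 - 2 / p) / (4 * q ^+ 2).

Let p0 : 0 < p := lt_trans ltr01 p1.
Let p10 : 0 < p - 1. Proof. by rewrite subr_gt0. Qed.
Let pV : p != 0. Proof. by rewrite gt_eqF. Qed.
Let qV : q != 0. Proof. by rewrite gt_eqF. Qed.
Let p1V : p - 1 != 0. Proof. by rewrite gt_eqF. Qed.

Lemma cont_par : continuous (par q nu s0).
Proof. by apply: cD; [apply: cZ; exact: cid|exact: ccst]. Qed.

Lemma dpar x : is_derive x 1 (par q nu s0) (nu / (2 * q)).
Proof. by apply: (is_derive_eq (dD (dZ _ (did x)) (dcst x s0))); ring. Qed.

Lemma derive_par (U : R -> R) k x : is_derive (par q nu s0 x) 1 U k ->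
  is_derive x 1 (fun t => U (par q nu s0 t)) (k * (nu / (2 * q))).
Proof. by move=> h; exact: dcomp (dpar x) h. Qed.

Lemma cont_angw : continuous (angw p q nu s0).
Proof. exact: ccomp cont_par (cont_thw p1 q0 q1). Qed.

Lemma cont_curw : continuous (curw p q nu s0).
Proof. by apply: cZ; exact: ccomp cont_par (cont_cosp p1 q0 q1 (two_div_gt0 p1)). Qed.

Lemma derive_angw (x : R) : is_derive x 1 (angw p q nu s0) (curw p q nu s0 x).
Proof.
apply: (is_derive_eq (derive_par (derive_thw p1 q0 q1 _))).
by rewrite /curw; field.
Qed.

Lemma nu_pow : nu `^ p = nu * nu `^ (p - 1).
Proof. by rewrite -[in RHS](@powRr1 _ nu (ltW nu0)) -powRrM ?mul1r -powRD ?addrNK// ?gt_eqF ?implybT// addrC subrK. Qed.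

Lemma derive_momw (x : R) :
  is_derive x 1 (momw p q nu s0) (- lamw p q nu * sin (angw p q nu s0 x)).
Proof.
apply: (is_derive_eq (dZ _ (derive_par (derive_cosp p1 q0 q1 _)))).
by rewrite /lamw nu_pow -/(angw p q nu s0 x); field; rewrite pV qV.
Qed.

Lemma curw_momw t : spow (p - 1)^-1 (momw p q nu s0 t) = curw p q nu s0 t.
Proof.
rewrite /momw -cosp_cosp// spowM spow_comp ?invr_gt0// mulfV// spow1 /curw.
by rewrite spow_ge0 ?invr_gt0 ?powR_ge0// -powRrM mulfV// powRr1// ltW.
Qed.

Lemma ref_pendulum L : 0 < L -> pendulum p (lamw p q nu) L (angw p q nu s0) (momw p q nu s0).
Proof.
move=> L0; split.
  have -> : (fun t => spow (p - 1)^-1 (momw p q nu s0 t)) = curw p q nu s0.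
    by apply/funext => t; exact: curw_momw.
  by apply: AC_FTC (ltW L0) cont_curw derive_angw.
apply: AC_FTC (ltW L0) _ derive_momw.
by apply: cZ; apply: csin; exact: cont_angw.
Qed.

Lemma ref_level t : (p - 1) / p * `|momw p q nu s0 t| `^ (p / (p - 1)) =
  - lamw p q nu * (1 - 2 * q ^+ 2) + lamw p q nu * cos (angw p q nu s0 t).
Proof.
have e1 : `|cosp (2 - 2 / p) q p (par q nu s0 t)| `^ (p / (p - 1)) =
    1 - sin (am1 p (par q nu s0 t) q) ^+ 2.
  rewrite /cosp norm_spow ?conj_two_gt0// -powRrM (_ : _ * _ = 2); last by field; rewrite pV p1V.
  rewrite powR_mulrn// real_normK ?num_real//.
  by rewrite -(cos2Dsin2 (am1 p (par q nu s0 t) q)) addrK.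
rewrite /momw normrM powRM// ger0_norm ?powR_ge0// e1 -powRrM.
rewrite (_ : (p - 1) * (p / (p - 1)) = p); last by field.
rewrite /angw cos_thw// /lamw; field; by rewrite pV qV.
Qed.

Lemma AC_ref (U k : R -> R) a b : a <= b -> continuous k ->
  (forall s : R, is_derive s 1 U (k s)) ->
  AC a b (fun t => U (par q nu s0 t)) (fun t => k (par q nu s0 t) * (nu / (2 * q))).
Proof.
move=> ab ck dU; apply: AC_FTC => //.
  by move=> x; apply: cvgM; [exact: ccomp cont_par ck x|exact: cvg_cst].
by move=> x; apply: derive_par; exact: dU.
Qed.

Lemma itg_ref (U k : R -> R) a b : a <= b -> continuous k ->
  (forall s : R, is_derive s 1 U (k s)) ->
  itg a b (fun t => k (par q nu s0 t)) = (nu / (2 * q))^-1 * (U (par q nu s0 b) - U (par q nu s0 a)).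
Proof.
move=> ab ck dU; have H := AC_ref ab ck dU.
have e : itg a b (fun t => k (par q nu s0 t) * (nu / (2 * q))) =
    nu / (2 * q) * itg a b (fun t => k (par q nu s0 t)).
  rewrite -itgZ; last by apply: itb_cont; exact: ccomp cont_par ck.
  by apply: eq_itg => x _; rewrite mulrC.
rewrite (AC_int H (lexx a) ab (lexx b)) e.
by rewrite mulKf// gt_eqF// divr_gt0// mulr_gt0.
Qed.

Lemma itg_cos_angw a b : a <= b -> itg a b (fun t => cos (angw p q nu s0 t)) =
  (nu / (2 * q))^-1 * ((gamma_w p (par q nu s0 b) q).1 - (gamma_w p (par q nu s0 a) q).1).
Proof.
move=> ab; exact: (@itg_ref (fun s => (gamma_w p s q).1) (fun s => cos (thw p q s)) _ _ ab
  (ccos (cont_thw p1 q0 q1)) (derive_gamma1 p1 q0 q1)).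
Qed.

Lemma itg_sin_angw a b : a <= b -> itg a b (fun t => sin (angw p q nu s0 t)) =
  (nu / (2 * q))^-1 * ((gamma_w p (par q nu s0 b) q).2 - (gamma_w p (par q nu s0 a) q).2).
Proof.
move=> ab; exact: (@itg_ref (fun s => (gamma_w p s q).2) (fun s => sin (thw p q s)) _ _ ab
  (csin (cont_thw p1 q0 q1)) (derive_gamma2 p1 q0 q1)).
Qed.

End Scaled.

(** Energy level and gravity determine [q] and [nu], the initial state determines [s0], and
    uniqueness does the rest. Equal end states make [L] a whole number of periods. *)
Lemma identification p lam L A (b w : R -> R) : 0 < L -> 1 < p -> pendulum p lam L b w ->
  0 < A -> A < lam -> (forall t, 0 <= t <= L -> `|b t| <= acos (- (A / lam))) ->
  (forall t, 0 <= t <= L -> (p - 1) / p * `|w t| `^ (p / (p - 1)) = A + lam * cos (b t)) ->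
  b L = b 0 -> w L = w 0 -> closed_curve L b ->
  exists q nu s0 (n : nat), [/\ 0 < q < 1, 0 < nu, (0 < n)%N,
    2 * E1c p q = K1c p q & nu / (2 * q) * L = 4 * n%:R * K1c p q /\
    forall t, 0 <= t <= L -> b t = angw p q nu s0 t /\ w t = momw p q nu s0 t].
Proof.
move=> L0 p1 Hp A0 Al hb hl bL wL [hcos _].
have lam0 : 0 < lam by exact: lt_trans Al.
have p0 : 0 < p by exact: lt_trans p1.
have p10 : 0 < p - 1 by rewrite subr_gt0.
have pV : p != 0 by rewrite gt_eqF.
have p1V : p - 1 != 0 by rewrite gt_eqF.
have r0 := conj_two_gt0 p1; have rV : 2 - 2 / p != 0 by rewrite gt_eqF.
have m01 : 0 < A / lam < 1 by rewrite divr_gt0//= ltr_pdivrMr// mul1r.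
(* Solves [A = lam * (2 * q^2 - 1)], the level of the reference pendulum in [ref_level]; [nu] below
   solves [lamw p q nu = lam]. *)
pose q := Num.sqrt ((1 + A / lam) / 2).
have q2 : q ^+ 2 = (1 + A / lam) / 2 by rewrite sqr_sqrtr//; lra.
have q0 : 0 < q by rewrite sqrtr_gt0; lra.
have q1 : q < 1 by rewrite -(@ltr_pXn2r _ 2) ?nnegrE ?ltW// q2 expr1n; lra.
have qV : q != 0 by rewrite gt_eqF.
pose nu := (4 * q ^+ 2 * lam / (2 - 2 / p)) `^ p^-1.
have X0 : 0 < 4 * q ^+ 2 * lam / (2 - 2 / p).
  by rewrite divr_gt0//; apply: mulr_gt0 => //; rewrite mulr_gt0// exprn_gt0.
have nu0 : 0 < nu by rewrite powR_gt0.
have nup : nu `^ p = 4 * q ^+ 2 * lam / (2 - 2 / p).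
  by rewrite -powRrM mulVf// powRr1// ltW.
have rE : 2 - 2 / p = 2 * (p - 1) / p by field.
have lamE : lamw p q nu = lam by rewrite /lamw nup rE; field; rewrite pV p1V qV.
have AE : - lamw p q nu * (1 - 2 * q ^+ 2) = A.
  by rewrite lamE q2; field; rewrite gt_eqF.
have b0L : (0 : R) <= 0 <= L by rewrite lexx ltW.
have [s0 hs1 hs2] : exists2 s0, thw p q s0 = b 0 & cosp (2 - 2 / p) q p s0 = w 0 / nu `^ (p - 1).
  apply: reference_exists => //.
    have h1 := hb 0 b0L; have h2 := @acos_lepi _ (- (A / lam)).
    have {}h2 : acos (- (A / lam)) <= pi by apply: h2; lra.
    by rewrite -ler_norml; exact: le_trans h2.
  rewrite normrM powRM// normfV (ger0_norm (powR_ge0 _ _)) -powRN -powRrM.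
  rewrite (_ : - (p - 1) * (p / (p - 1)) = - p); last by field.
  rewrite powRN nup.
  have := hl 0 b0L; rewrite double_cos => h.
  have -> : `|w 0| `^ (p / (p - 1)) = p / (p - 1) * (A + lam * (1 - 2 * sin (b 0 / 2) ^+ 2)).
    by rewrite -h; field; rewrite pV p1V.
  have -> : A = lam * (2 * q ^+ 2 - 1) by rewrite -AE lamE; ring.
  rewrite rE; field.
  by rewrite pV p1V qV gt_eqF.
have npV : nu `^ (p - 1) != 0 by rewrite gt_eqF// powR_gt0.
have par0 : par q nu s0 0 = s0 by rewrite /par mulr0 add0r.
have huniq t : 0 <= t <= L -> b t = angw p q nu s0 t /\ w t = momw p q nu s0 t.
  apply: (@pendulum_uniq _ p lam A L) => //.
  - by rewrite gtr0_norm.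
  - by rewrite -lamE; exact: ref_pendulum.
  - by move=> t' _; rewrite -lamE -{1}AE; exact: ref_level.
  - by rewrite /angw par0 hs1.
  - by rewrite /momw par0 hs2 mulrC divfK.
have Ll : (0 : R) <= L <= L by rewrite lexx ltW.
have [bL1 wL1] := huniq L Ll; have [b01 w01] := huniq 0 b0L.
have cL0 : 0 < nu / (2 * q) * L by rewrite mulr_gt0// divr_gt0// mulr_gt0.
have [n n0 hn] : exists2 n, (0 < n)%N & par q nu s0 L = s0 + 4 * n%:R * K1c p q.
  apply: period_only => //.
  - by rewrite /par ltrDr.
  - by rewrite -/(angw p q nu s0 L) -bL1 bL b01 /angw par0.
  - apply: (mulfI npV); rewrite -[LHS]/(momw p q nu s0 L) -wL1 wL w01.
    by rewrite /momw par0.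
exists q, nu, s0, n; split => //.
- by rewrite q0 q1.
(* The first closing condition says that the drift over [n] periods vanishes, and [n] is
   positive. *)
- have : itg 0 L (fun t => cos (angw p q nu s0 t)) = 0.
    by rewrite -[RHS]hcos; apply: eq_itg => t /huniq[->].
  rewrite itg_cos_angw// ?ltW// par0 hn gamma_shift//.
  rewrite addrAC subrr add0r => /eqP; rewrite !mulf_eq0 invr_eq0 mulf_eq0 invr_eq0.
  rewrite (gt_eqF nu0) mulf_eq0 pnatr_eq0 (negbTE qV) !pnatr_eq0/=.
  by rewrite gtn_eqF//= subr_eq0 => /eqP.
- by split => //; move: hn; rewrite /par addrC => /addrI.
Qed.

End Identification.

(** * Uniqueness of the modulus and tools for the shift *)

Section FigureEight.
Context {R : realType}.
Implicit Types (f g k u : R -> R) (p q nu lam A L s t x y : R).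

Lemma itg_pos s t y f : s < y < t -> itb s t f -> (forall x, s <= x <= t -> 0 <= f x) ->
  {for y, continuous f} -> 0 < f y -> 0 < itg s t f.
Proof.
move=> /andP[sy yt] fi f0 cf fy.
have [d d0 hd] := proj1 (cont_ed _ y) cf (f y / 2) ltac:(lra).
pose e := Num.min (d / 2) (Num.min (y - s) (t - y)).
have [e0 ed es et] : [/\ 0 < e, e <= d / 2, e <= y - s & e <= t - y].
  by rewrite /e !lt_min !ge_min !lexx !orbT; split => //; rewrite !subr_gt0 sy yt !andbT; lra.
have m1 : s <= y - e by lra.
have m2 : y - e <= y + e by lra.
have m3 : y + e <= t by lra.
rewrite (@itg_split _ s (y - e) t)//; last exact: le_trans m3.
rewrite (@itg_split _ (y - e) (y + e) t)//; last by apply: itb_sub fi.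
have h1 : 0 <= itg s (y - e) f.
  by apply: itg_ge0 => x hx; apply: f0; lra.
have h2 : 0 <= itg (y + e) t f.
  by apply: itg_ge0 => x hx; apply: f0; lra.
have h3 : f y / 2 * ((y + e) - (y - e)) <= itg (y - e) (y + e) f.
  rewrite -itg_cst//; apply: le_itg; [exact: itb_cst|by apply: itb_sub fi|].
  move=> x hx; have := hd x; rewrite !ltr_norml => h.
  have /h : - d < x - y < d by lra.
  by lra.
have h4 : 0 < f y / 2 * ((y + e) - (y - e)) by rewrite mulr_gt0//; lra.
by lra.
Qed.

Lemma Del_lt q q' x : 0 <= q -> q < q' -> q' < 1 -> sin x != 0 -> Del q' x < Del q x.
Proof.
move=> q0 qq q1 sx.
have s0 : 0 < sin x ^+ 2 by rewrite exprn_even_gt0.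
have h : q ^+ 2 < q' ^+ 2 by rewrite ltr_pXn2r ?nnegrE//; lra.
have q'0 : 0 <= q' by lra.
by rewrite /Del ltr_sqrt ?(Del2_gt0 q0)//; [rewrite ltrD2l ltrN2 ltr_pM2r|lra].
Qed.

Lemma Del_le q q' x : 0 <= q -> q < q' -> q' < 1 -> Del q' x <= Del q x.
Proof.
move=> q0 qq q1; have [s0|s0] := eqVneq (sin x) 0; last exact: ltW (Del_lt q0 qq q1 s0).
by rewrite /Del s0 expr0n/= !mulr0.
Qed.

(** The integrand is the weight times [2 * Del - 1 / Del], which increases with [Del], and [Del]
    decreases in [q], strictly where the sine is nonzero; [pi / 4] is such a point with positive
    weight. This makes the root defining [qstar] unique. *)
Lemma EK_decreasing p q q' : 1 < p -> 0 <= q -> q < q' -> q' < 1 ->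
  2 * E1c p q' - K1c p q' < 2 * E1c p q - K1c p q.
Proof.
move=> p1 q0 qq q1.
have q'0 : 0 <= q' by lra.
have q1' : q < 1 by lra.
have pi0 := pi_gt0 R; have pi2 : 0 <= pi / 2 :> R by lra.
pose f q x := 2 * dE1 p q x - dF1 p q x.
have itf r : 0 <= r -> r < 1 -> itb 0 (pi / 2) (f r).
  by move=> r0 r1; apply: itbB; [apply: itbZ; exact: itb_dE1|exact: itb_dF1].
have e r : 0 <= r -> r < 1 -> 2 * E1c p r - K1c p r = itg 0 (pi / 2) (f r).
  move=> r0 r1; rewrite itgB; [|by apply: itbZ; exact: itb_dE1|exact: itb_dF1].
  rewrite itgZ; last exact: itb_dE1.
  rewrite -(integral0B (itb_dE1 r p1) pi2) -(integral0B (itb_dF1 p1 r0 r1) pi2).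
  by rewrite !integral00 !subr0.
rewrite !e// -subr_gt0 -itgB; [|exact: itf|exact: itf].
have g r x : 0 <= r -> r < 1 -> f r x = cpow (1 - 2 / p) x * (2 * Del r x - (Del r x)^-1).
  by move=> r0 r1; rewrite /f /dE1 /dF1; ring.
have gd x : Del q' x < Del q x -> 2 * Del q' x - (Del q' x)^-1 < 2 * Del q x - (Del q x)^-1.
  move=> h; have D0 := Del_gt0 q'0 q1 x; have D1 := Del_gt0 q0 q1' x.
  have : (Del q x)^-1 < (Del q' x)^-1 by rewrite ltf_pV2.
  by move: h; clear; lra.
have gl x : 2 * Del q' x - (Del q' x)^-1 <= 2 * Del q x - (Del q x)^-1.
  have := Del_le x q0 qq q1; rewrite le_eqVlt => /predU1P[->|/gd/ltW//].
  exact: lexx.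
have c4 : 0 < cos (pi / 4) :> R by apply: cos_gt0_pihalf; lra.
have s4 : 0 < sin (pi / 4) :> R by apply: sin_gt0_pi; lra.
have c4' : cos (pi / 4) != 0 :> R by rewrite gt_eqF.
apply: (@itg_pos _ _ (pi / 4)).
- by lra.
- by apply: itbB; exact: itf.
- by move=> x _; rewrite !g// -mulrBr mulr_ge0 ?powR_ge0// subr_ge0.
- apply: cvgB; (apply: cvgB; [apply: cvgM; [exact: cvg_cst|exact: cont_dE1]|exact: cont_dF1]).
- rewrite !g// -mulrBr mulr_gt0 ?subr_gt0//; first by rewrite powR_gt0// normr_gt0.
  by apply: gd; apply: Del_lt => //; rewrite gt_eqF.
Qed.

Lemma qstarE p q : 1 < p -> 0 < q < 1 -> 2 * E1c p q = K1c p q -> qstar p = q.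
Proof.
move=> p1 /andP[q0 q1] e; apply: xget_unique; first by rewrite /= q0 q1.
move=> y /= [/andP[y0 y1] ey]; case: (ltgtP y q) => // h.
- by have := EK_decreasing p1 (ltW y0) h q1; rewrite e ey !subrr ltxx.
- by have := EK_decreasing p1 (ltW q0) h y1; rewrite e ey !subrr ltxx.
Qed.

Lemma itg_shift f e s t : s <= t -> continuous f ->
  itg s t (fun x => f (x + e)) = itg (s + e) (t + e) f.
Proof.
move=> st cf.
have h1 := AC_int (AC_FTC (lerD st (lexx e)) cf (derive_integral0_cont cf)).
rewrite -(h1 (s + e) (t + e))// ?lerD2r//.
have cfe : continuous (fun x => f (x + e)).
  by apply: (ccomp (f := fun x => x + e) _ cf); apply: cD; [exact: cid|exact: ccst].
have d (x : R) : is_derive x 1 (fun x => integral0 f (x + e)) (f (x + e)).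
  apply: (is_derive_eq (dcomp (dD (did x) (dcst x e)) (derive_integral0_cont cf _))).
  by ring.
by have := AC_int (AC_FTC st cfe d) (lexx s) st (lexx t) => <-.
Qed.

Lemma itg_period f l e : 0 <= l -> 0 <= e -> continuous f -> (forall x, f (x + l) = f x) ->
  itg e (l + e) f = itg 0 l f.
Proof.
move=> l0 e0 cf fl.
have h : itg l (l + e) f = itg 0 e f.
  have := itg_shift l e0 cf; rewrite add0r (addrC e) => <-.
  by apply: eq_itg => x _; rewrite fl.
have ic s t : itb s t f by exact: itb_cont.
have h1 := itg_split e0 (_ : e <= l + e) (ic 0 (l + e)).
have h2 := itg_split l0 (_ : l <= l + e) (ic 0 (l + e)).
have {}h1 := h1 ltac:(lra); have {}h2 := h2 ltac:(lra).
by move: h1; rewrite h2 h; lra.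
Qed.

Lemma unif_cont f a b e : a <= b -> continuous f -> 0 < e ->
  exists2 d, 0 < d & forall x, a <= x <= b -> forall y, `|y - x| < d -> `|f y - f x| < e.
Proof.
move=> ab cf e0.
pose P s t := exists2 d, 0 < d & forall x, s <= x <= t -> forall y, `|y - x| < d -> `|f y - f x| < e.
have : P a b; last by [].
apply: (@creep _ a b P) => //.
- move=> x _; have [d d0 hd] := proj1 (cont_ed _ x) (cf x) (e / 2) ltac:(lra).
  exists (d / 2); first lra.
  move=> s t _ sx xt _ ds td; exists (d / 2); first lra.
  move=> z /andP[sz zt] y; rewrite ltr_norml => /andP[h1 h2].
  have hz : `|z - x| < d by rewrite ltr_norml; apply/andP; split; lra.
  have hy : `|y - x| < d by rewrite ltr_norml; apply/andP; split; lra.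
  rewrite (_ : f y - f z = (f y - f x) - (f z - f x)); last by ring.
  by have := ler_normB (f y - f x) (f z - f x); have := hd z hz; have := hd y hy; clear; lra.
- move=> r s t _ rs st _ [d1 d10 h1] [d2 d20 h2].
  exists (Num.min d1 d2); first by rewrite lt_min d10.
  move=> x /andP[rx xt] y; rewrite lt_min => /andP[y1 y2].
  by case: (leP x s) => xs; [apply: h1|apply: h2] => //; rewrite ?rx// (ltW xs).
Qed.

Lemma AC_glue a c b u k : a <= c -> c <= b -> AC a c u k -> AC c b u k -> AC a b u k.
Proof.
move=> ac cb [cu mk i1 h1] [_ _ i2 h2].
have ib : itb a b k by exact: itb_union i1 i2.
split => // s t as_ st tb.
case: (leP t c) => tc; first exact: h1.
case: (leP c s) => cs; first exact: h2.
have sc := ltW cs; have ct := ltW tc.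
rewrite (@itg_split _ s c t)//; last by apply: itb_sub ib.
by rewrite -h1// -h2//; ring.
Qed.

End FigureEight.

(** * Local minimizers are circles or figure eights *)

Section SingleCover.
Context {R : realType}.
Implicit Types (f g k u : R -> R) (p q nu lam A L s t x y : R).

Lemma itb_npow_near p L k k' d : 0 < p -> measurable_fun setT k' ->
  itb 0 L (fun t => `|k t| `^ p) -> (forall t, 0 <= t <= L -> `|k' t - k t| <= d) ->
  itb 0 L (fun t => `|k' t| `^ p).
Proof.
move=> p0 mk' ik hk.
apply: (@itb_le _ _ _ _ (fun t => 2 `^ p * (`|k t| `^ p + `|d| `^ p))).
- by apply: measurable_funTS; exact: meas_npow.
- move=> t /hk h; rewrite ger0_norm ?powR_ge0// -[X in `|X|](subrKC (k t)).
  apply: le_trans (norm_powD _ _ (ltW p0)) _; apply: ler_wpM2l; first exact: powR_ge0.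
  rewrite lerD2l; apply: ge0_ler_powR; rewrite ?nnegrE//; first exact: ltW.
  exact: le_trans h (ler_norm d).
- by apply: itbZ; apply: itbD => //; exact: itb_cst.
Qed.

(** The uniform bound in [locmin] depends on the chosen version of the curvature. A competitor near
    [k0] becomes one near [k] by adding [k - k0], which is zero almost everywhere. *)
Lemma locmin_ae p L th k k0 : 0 < L -> 1 < p -> AC 0 L th k -> AC 0 L th k0 ->
  itb 0 L (fun t => `|k t| `^ p) -> locmin p L th k -> locmin p L th k0.
Proof.
move=> L0 p1 H H0 ik [d d0 hd]; have L0' := ltW L0.
have p0 : 0 < p by exact: lt_trans p1.
have e := AC_uniq H H0 L0' (fun t _ => erefl).
have npow_ae k1 k2 : measurable_fun setT k2 -> aeq 0 L k1 k2 -> itb 0 L (fun t => `|k1 t| `^ p) ->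
    itb 0 L (fun t => `|k2 t| `^ p) /\ itg 0 L (fun t => `|k1 t| `^ p) = itg 0 L (fun t => `|k2 t| `^ p).
  move=> mk2 e2 i1; have e3 := aeq_map (fun _ y => `|y| `^ p) e2.
  have i2 : itb 0 L (fun t => `|k2 t| `^ p).
    by apply: (itb_ae _ e3 i1); apply: measurable_funTS; exact: meas_npow.
  by split; [exact: i2|exact: (itg_ae i1 i2 e3)].
have [i0 E0] := npow_ae k k0 (AC_meas H0) e ik.
exists d; first exact: d0.
move=> th' k' H' e0 eL hc hk.
have i' := itb_npow_near p0 (AC_meas H') i0 hk.
pose k2 t := k' t + (k t - k0 t).
have mk2 : measurable_fun setT k2.
  by apply: measurable_funD; [exact: (AC_meas H')|apply: measurable_funB; [exact: (AC_meas H)|exact: (AC_meas H0)]].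
have e2 : aeq 0 L k' k2.
  have [N [mN N0 hN]] := e; exists N; split; [exact: mN|exact: N0|move=> x hx nN].
  rewrite /k2 (hN x hx nN) subrr addr0; exact: erefl.
have [_ E2] := npow_ae k' k2 mk2 e2 i'.
rewrite -E0 E2; apply: hd e0 eL hc _; first exact: AC_eqk mk2 e2 H'.
move=> t ht; have -> : k2 t - k t = k' t - k0 t by rewrite /k2; ring.
exact: hk.
Qed.

(** Constant curvature on an interval makes the momentum constant, so the sine of the angle is 0 and
    the angle, lying in []- pi, pi[], is 0. Then its derivative vanishes as well, and both sine and
    cosine of the amplitude would be 0. *)
Lemma curw_nonconst p q nu s0 e : 1 < p -> 0 < q -> q < 1 -> 0 < nu -> 0 < e ->
  exists2 t, 0 < t < e & curw p q nu s0 t != curw p q nu s0 0.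
Proof.
move=> p1 q0 q1 nu0 e0; apply: contrapT => hn.
have hc t : 0 < t < e -> curw p q nu s0 t = curw p q nu s0 0.
  by move=> ht; apply: contrapT => /eqP h; apply: hn; exists t.
have near0 (F : R -> R) c t : (forall y, 0 < y < e -> F y = c) -> 0 < t < e -> is_derive t 1 F 0.
  move=> hF /andP[t0 te]; apply: near_eq_is_derive (dcst t c).
  apply: (@near_ball _ t _ (Num.min t (e - t))); first by rewrite lt_min t0 subr_gt0.
  move=> y; rewrite lt_min !ltr_norml => /andP[/andP[h1 _] /andP[_ h2]].
  by apply/esym; apply: hF; apply/andP; split; lra.
have p10 : 0 < p - 1 by rewrite subr_gt0.
have mc t : 0 < t < e -> momw p q nu s0 t = spow (p - 1) (curw p q nu s0 0).
  move=> /hc <-; rewrite -curw_momw// spow_comp ?invr_gt0// mulVf ?gt_eqF// spow1//.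
have lam0 : 0 < lamw p q nu.
  by rewrite /lamw divr_gt0// mulr_gt0 ?powR_gt0 ?conj_two_gt0 ?exprn_gt0.
have sin0 t : 0 < t < e -> sin (angw p q nu s0 t) = 0.
  move=> ht; have h1 := near0 _ _ _ mc ht; have h2 := derive_momw s0 p1 q0 q1 nu0 t.
  have := @derive_val _ _ _ _ _ _ _ h2; rewrite (@derive_val _ _ _ _ _ _ _ h1) => /esym/eqP.
  by rewrite mulf_eq0 oppr_eq0 (gt_eqF lam0) => /eqP.
have ang0 t : 0 < t < e -> angw p q nu s0 t = 0.
  move=> /sin0 h; have := thw_bnd p q0 q1 (par q nu s0 t).
  rewrite -/(angw p q nu s0 t) => /andP[h1 h2].
  case: (ltgtP (angw p q nu s0 t) 0) => // h3.
    have := @sin_gt0_pi _ (- angw p q nu s0 t); rewrite sinN h oppr0 ltxx => hh.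
    by apply/eqP; rewrite -[_ == _]negbK; apply/negP => _; have /hh : 0 < - angw p q nu s0 t < pi by lra.
  by have := @sin_gt0_pi _ (angw p q nu s0 t); rewrite h ltxx h2 h3 => /(_ isT).
have he : 0 < e / 2 < e by lra.
have h1 := near0 _ _ _ ang0 he; have h2 := derive_angw nu s0 p1 q0 q1 (e / 2).
have := @derive_val _ _ _ _ _ _ _ h2; rewrite (@derive_val _ _ _ _ _ _ _ h1) => /esym/eqP.
rewrite mulf_eq0 (gt_eqF nu0) /cosp spow_eq0/= => /eqP c0.
have := sin0 _ he; rewrite /angw sin_thw// => /eqP.
rewrite !mulf_eq0 pnatr_eq0 (gt_eqF q0) (gt_eqF (Del_gt0 (ltW q0) q1 _)) orbF/= => /eqP s00.
by have := cos2Dsin2 (am1 p (par q nu s0 (e / 2)) q); rewrite c0 s00 !expr0n/= addr0 => /eqP; rewrite eq_sym oner_eq0.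
Qed.

Lemma closed_period p q nu s0 (n : nat) l c : 1 < p -> 0 < q -> q < 1 -> 0 < nu ->
  2 * E1c p q = K1c p q -> 0 <= l -> nu / (2 * q) * l = 4 * n%:R * K1c p q ->
  itg c (c + l) (fun t => cos (angw p q nu s0 t)) = 0 /\
  itg c (c + l) (fun t => sin (angw p q nu s0 t)) = 0.
Proof.
move=> p1 q0 q1 nu0 EK l0 hl.
have cl : c <= c + l by rewrite lerDl.
have e : par q nu s0 (c + l) = par q nu s0 c + 4 * n%:R * K1c p q.
  by rewrite /par mulrDr hl; ring.
rewrite (itg_cos_angw s0 p1 q0 q1 nu0 cl) (itg_sin_angw s0 p1 q0 q1 nu0 cl) e; split.
  by rewrite (gamma_shift p1 q0 q1) EK subrr mulr0 addr0 subrr mulr0.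
rewrite !(gamma2E q p1); have [_ ->] := thw_shift p1 q0 q1 (par q nu s0 c) n.
by rewrite subrr mulr0.
Qed.

Lemma itg_rotate (u : R -> R) a b c : continuous u -> itg a b (fun t => cos (u t)) = 0 ->
  itg a b (fun t => sin (u t)) = 0 ->
  itg a b (fun t => cos (u t + c)) = 0 /\ itg a b (fun t => sin (u t + c)) = 0.
Proof.
move=> cu h1 h2; have i1 : itb a b (fun t => cos (u t)) by apply: itb_cont; exact: ccos.
have i2 : itb a b (fun t => sin (u t)) by apply: itb_cont; exact: csin.
split.
  transitivity (itg a b (fun t => cos c * cos (u t) - sin c * sin (u t))).
    by apply: eq_itg => t _; rewrite cosD; ring.
  by rewrite (itgB (itbZ _ i1) (itbZ _ i2)) (itgZ _ i1) (itgZ _ i2) h1 h2 !mulr0 subrr.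
transitivity (itg a b (fun t => cos c * sin (u t) + sin c * cos (u t))).
  by apply: eq_itg => t _; rewrite sinD; ring.
by rewrite (itgD (itbZ _ i2) (itbZ _ i1)) (itgZ _ i1) (itgZ _ i2) h1 h2 !mulr0 addr0.
Qed.

(** For [n > 1] the first period [[0, l]] is a proper part of [[0, L]], and shifting the curvature
    there leaves a junction at [l]. The competitor is so close that it inherits minimality, so by
    [dichotomy] its curvature has a continuous version; but the one-sided values at [l] are [K e]
    and [K 0], and [e] is chosen to make them different. *)
Lemma single_cover p q nu s0 (n : nat) L th : 0 < L -> 1 < p -> 0 < q -> q < 1 -> 0 < nu ->
  2 * E1c p q = K1c p q -> (0 < n)%N -> nu / (2 * q) * L = 4 * n%:R * K1c p q ->
  AC 0 L th (curw p q nu s0) -> locmin p L th (curw p q nu s0) -> n = 1%N.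
Proof.
move=> L0 p1 q0 q1 nu0 EK n0 cL H [d d0 hd].
have p0 : 0 < p by exact: lt_trans p1.
have L0' := ltW L0.
case: (ltngtP n 1) => // [|n1]; first by rewrite ltnS leqNgt n0.
exfalso.
have n0R : 0 < n%:R :> R by rewrite ltr0n.
have n1R : 1 < n%:R :> R by rewrite ltr1n.
pose l := L / n%:R.
have l0 : 0 < l by rewrite divr_gt0.
have lL : l < L by rewrite ltr_pdivrMr// ltr_pMr.
have l0' := ltW l0; have lL' := ltW lL.
have cl4 : nu / (2 * q) * l = 4 * 1%:R * K1c p q.
  by rewrite /l mulrA cL; field; rewrite gt_eqF.
have parl t : par q nu s0 (t + l) = par q nu s0 t + 4 * 1%:R * K1c p q.
  by rewrite /par mulrDr cl4; ring.
have Kl t : curw p q nu s0 (t + l) = curw p q nu s0 t.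
  by rewrite /curw parl; have [_ ->] := thw_shift p1 q0 q1 (par q nu s0 t) 1.
have al t : angw p q nu s0 (t + l) = angw p q nu s0 t.
  by rewrite /angw parl; have [-> _] := thw_shift p1 q0 q1 (par q nu s0 t) 1.
have eBL : angw p q nu s0 L = angw p q nu s0 0.
  rewrite /angw -[X in par q nu s0 X]add0r.
  have -> : par q nu s0 (0 + L) = par q nu s0 0 + 4 * n%:R * K1c p q.
    by rewrite /par mulrDr cL; ring.
  by have [-> _] := thw_shift p1 q0 q1 (par q nu s0 0) n.
have closedB c := closed_period s0 c p1 q0 q1 nu0 EK l0' cl4.
have closedL := closed_period s0 0 p1 q0 q1 nu0 EK L0' cL.
have cK : continuous (curw p q nu s0) by exact: cont_curw.
have cB' : continuous (angw p q nu s0) by exact: cont_angw.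
have dB' (x : R) : is_derive x 1 (angw p q nu s0) (curw p q nu s0 x) by exact: derive_angw.
have hne e : 0 < e -> exists2 t, 0 < t < e & curw p q nu s0 t != curw p q nu s0 0.
  exact: curw_nonconst.
(* From here on the explicit formulas are hidden; periodicity, closing over each period and
   nonconstancy are all that the shift needs. *)
move: H hd Kl al eBL closedB closedL cK cB' dB' hne.
move: (curw p q nu s0) (angw p q nu s0) => K B {parl}.
move=> H hd Kl al eBL closedB closedL cK cB' dB' hne.
have d2 : 0 < d / 2 by lra.
have [e1 e10 he1] := unif_cont l0' cK d2.
have [e /andP[e0 ee1] ne] := hne e1 e10.
have e0' := ltW e0.
have thB t : 0 <= t <= L -> th t = B t + (th 0 - B 0).
  move=> /andP[t0 tL]; have h1 := AC_int H (lexx 0) t0 tL.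
  have h2 := AC_int (AC_FTC L0' cK dB') (lexx 0) t0 tL.
  by rewrite -h1 in h2; lra.
(* The projections freeze each term outside its own interval, so that one formula gives the shifted
   angle on [[0, l]] and the original one afterwards. *)
pose th' t := B (pr 0 l t + e) - B e + (B (pr l L t) - B l) + th 0.
pose k' t := if t <= l then K (t + e) else K t.
have cKe : continuous (fun t => K (t + e)).
  by apply: (ccomp (f := fun x => x + e) _ cK); apply: cD; [exact: cid|exact: ccst].
have mk' : measurable_fun setT k'.
  apply: measurable_fun_ifT; [|exact: continuous_measurable_fun|exact: continuous_measurable_fun].
  by apply: measurable_fun_ler; [exact: measurable_id|exact: measurable_cst].
have Bl : B (l + e) = B e by rewrite addrC al.
have prl t : 0 <= t <= l -> pr l L t = l.
  by move=> /andP[t0 tl]; rewrite /pr max_l// ge_min tl.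
have prl2 t : l <= t <= L -> pr 0 l t = l.
  by move=> /andP[lt tL]; rewrite /pr min_r// max_r.
have th'1 t : 0 <= t <= l -> th' t = B (t + e) + (th 0 - B e).
  by move=> ht; rewrite /th' (prl t ht) pr_id//; ring.
have th'2 t : l <= t <= L -> th' t = th t.
  move=> ht; rewrite /th' (prl2 t ht) pr_id// Bl -[B l]al -[B (l + l)]al (thB t); last first.
    by case/andP: ht => h1 h2; rewrite h2 (le_trans l0').
  by rewrite !al -{1}[l]add0r al; ring.
have cth' : continuous th'.
  have cb1 : continuous (fun t => B (t + e)).
    by apply: (ccomp (f := fun x => x + e) _ cB'); apply: cD; [exact: cid|exact: ccst].
  apply: cD; last exact: ccst.
  apply: cD.
    apply: cB; last exact: ccst.
    by apply: (@cont_pr _ 0 l (fun t => B (t + e))) => //; exact: continuous_subspaceT.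
  by apply: cB; [apply: cont_pr => //; exact: continuous_subspaceT|exact: ccst].
have H' : AC 0 L th' k'.
  apply: (@AC_glue _ 0 l L) => //.
    have h : AC 0 l (fun t => B (t + e) + (th 0 - B e)) (fun t => K (t + e)).
      apply: (AC_FTC l0' cKe) => x.
      apply: (is_derive_eq (dD (dcomp (dD (did x) (dcst x e)) (dB' _)) (dcst x (th 0 - B e)))).
      by ring.
    apply: (@AC_eqk _ _ _ _ (fun t => K (t + e))) => //.
      by apply: eq_aeq => x /andP[_ xl]; rewrite /k' xl.
    by apply: AC_eqf h => // t /th'1.
  have h : AC l L th K by apply: AC_sub H _ _.
  apply: (@AC_eqk _ _ _ _ K) => //.
    exists [set l]; split; [exact: measurable_set1|exact: lebesgue_measure_set1|].
    move=> x /andP[lx _] /= xl; rewrite /k' leNgt lt_neqAle lx andbT.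
    by rewrite eq_sym; case: eqP.
  by apply: AC_eqf h => // t /th'2.
have th'0 : th' 0 = th 0 by rewrite th'1 ?lexx// add0r; ring.
have th'L : th' L = th L by rewrite th'2 ?lL' ?lexx.
have kk t : 0 <= t <= L -> `|k' t - K t| <= d / 2.
  move=> /andP[t0 tL]; rewrite /k'; case: ifP => tl; last by rewrite subrr normr0 ltW.
  by apply: ltW; apply: he1; rewrite ?t0// addrAC subrr add0r gtr0_norm.
have E : itg 0 L (fun t => `|k' t| `^ p) = itg 0 L (fun t => `|K t| `^ p).
  pose f t := `|K t| `^ p.
  have cf : continuous f by apply: (ccomp (f := K) _ (cnpow p0)).
  have ik' : itb 0 L (fun t => `|k' t| `^ p).
    by apply: (itb_npow_near p0 mk' (itb_cont 0 L cf) kk).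
  have E1' : itg 0 l (fun t => `|k' t| `^ p) = itg 0 l f.
    transitivity (itg 0 l (fun t => f (t + e))).
      by apply: eq_itg => x /andP[_ xl]; rewrite /k' xl.
    rewrite (itg_shift e l0' cf) add0r; apply: itg_period => // x.
    by rewrite /f Kl.
  have E2' : itg l L (fun t => `|k' t| `^ p) = itg l L f.
    apply: itg_ae.
    - exact: (itb_sub l0' (lexx L) ik').
    - exact: (itb_cont l L cf).
    - exists [set l]; split; [exact: measurable_set1|exact: lebesgue_measure_set1|].
      move=> x /andP[lx _] /= xl; rewrite /k' leNgt lt_neqAle lx andbT.
      by rewrite eq_sym; case: eqP.
  by rewrite (itg_split l0' lL' ik') (itg_split l0' lL' (itb_cont 0 L cf)) E1' E2'.
have hcl : itg 0 L (fun t => cos (th' t)) = itg l L (fun t => cos (B t + (th 0 - B 0))) /\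
    itg 0 L (fun t => sin (th' t)) = itg l L (fun t => sin (B t + (th 0 - B 0))).
  have [h1 h2] := closedB e.
  have cBe : continuous (fun t => B (t + e)).
    by apply: (ccomp (f := fun x => x + e) _ cB'); apply: cD; [exact: cid|exact: ccst].
  have [] := @itg_rotate (fun t => B (t + e)) 0 l (th 0 - B e) cBe.
  - by rewrite (itg_shift e l0' (ccos cB')) add0r addrC.
  - by rewrite (itg_shift e l0' (csin cB')) add0r addrC.
  move=> g1 g2.
  have hB t : l <= t <= L -> th' t = B t + (th 0 - B 0).
    by move=> ht; rewrite (th'2 t ht) thB//; case/andP: ht => q1' q2'; rewrite q2' (le_trans l0').
  have i1 : itb 0 L (fun t => cos (th' t)) := itb_cont 0 L (ccos cth').
  have i2 : itb 0 L (fun t => sin (th' t)) := itb_cont 0 L (csin cth').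
  have j1 : itg 0 l (fun t => cos (th' t)) = 0.
    by rewrite -[RHS]g1; apply: eq_itg => t /th'1 ->.
  have j2 : itg 0 l (fun t => sin (th' t)) = 0.
    by rewrite -[RHS]g2; apply: eq_itg => t /th'1 ->.
  rewrite (itg_split l0' lL' i1) (itg_split l0' lL' i2) j1 j2 !add0r.
  by split; apply: eq_itg => t /hB ->.
have closedlL : itg l L (fun t => cos (B t)) = 0 /\ itg l L (fun t => sin (B t)) = 0.
  have [h1 h2] := closedL; have [g1 g2] := closedB 0.
  rewrite add0r in h1 h2; rewrite add0r in g1 g2.
  rewrite (itg_split l0' lL' (itb_cont 0 L (ccos cB'))) g1 add0r in h1.
  by rewrite (itg_split l0' lL' (itb_cont 0 L (csin cB'))) g2 add0r in h2.
have [cl1 cl2] := closedlL.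
have [r1 r2] := itg_rotate (th 0 - B 0) cB' cl1 cl2.
have hcl' : closed_curve L th' by split; [rewrite hcl.1|rewrite hcl.2].
(* Equal energies, and a distance of at most [d / 2] from [K], leave a neighbourhood of radius
   [d / 2] around the competitor. *)
have lm' : locmin p L th' k'.
  exists (d / 2); first exact: d2.
  move=> th2 k2 H2 h0 hL hc hk; rewrite E; apply: hd H2 _ _ hc _.
  - by rewrite h0.
  - by rewrite hL.
  - move=> t tL; rewrite (_ : k2 t - K t = (k2 t - k' t) + (k' t - K t)); last by ring.
    apply: le_trans (ler_normD _ _) _.
    by have := hk t tL; have := kk t tL; clear; lra.
have thL : th' L = th' 0.
  by rewrite th'L th'0 (thB L) ?lexx ?L0'// eBL; ring.
have ik' : itb 0 L (fun t => `|k' t| `^ p).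
  apply: (itb_npow_near p0 mk' _ kk).
  by apply: itb_cont; apply: (ccomp (f := K) _ (cnpow p0)).
have [kap ckap Hk] : exists2 kap : R -> R, continuous kap & AC 0 L th' kap.
  have [[c hc]|[al0 [b0 [w [lam [A [Hp [_ _ _ _ [_ _ _ _ hw]]]]]]]]] :=
    dichotomy L0 p1 H' ik' hcl' lm' ltac:(by rewrite thL) ltac:(by rewrite thL).
    by exists (fun=> c); [exact: ccst|exact: hc].
  by exists (fun t => spow (p - 1)^-1 (w t)); [have [_ _] := pendulum_cont p1 Hp|exact: hw].
have a1 : K (l + e) = kap l.
  have h1 : AC 0 l (fun t => B (t + e) + (th 0 - B e)) (fun t => K (t + e)).
    apply: (AC_FTC l0' cKe) => x.
    apply: (is_derive_eq (dD (dcomp (dD (did x) (dcst x e)) (dB' _)) (dcst x (th 0 - B e)))).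
    by ring.
  have h2 : AC 0 l (fun t => B (t + e) + (th 0 - B e)) kap.
    by apply: AC_eqf (AC_cont h1) _ (AC_sub Hk (lexx 0) lL') => t /th'1.
  by apply: (AC_uniq_cont h1 h2 l0 cKe ckap); rewrite l0' lexx.
have a2 : K l = kap l.
  have h1 : AC l L th K by apply: AC_sub H _ _.
  have h2 : AC l L th kap.
    by apply: AC_eqf (AC_cont H) _ (AC_sub Hk l0' (lexx L)) => t /th'2.
  by apply: (AC_uniq_cont h1 h2 lL cK ckap); rewrite lL' lexx.
move: a1; rewrite -a2 -{2}[l]add0r Kl addrC Kl => /eqP.
by rewrite (negbTE ne).
Qed.

End SingleCover.

(** * From the angle back to the curve *)

Section Necessity.
Context {R : realType}.
Implicit Types (k : R -> R) (p q nu L s t x y : R).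

Definition affine_similarity (P : R * R) (rho be : R) (o v : R * R) : R * R :=
  (P.1 + rho * (cos be * (v.1 - o.1) - sin be * (v.2 - o.2)),
   P.2 + rho * (sin be * (v.1 - o.1) + cos be * (v.2 - o.2))).

Lemma similarity_affine P rho be o : 0 < rho -> similarity (@affine_similarity P rho be o).
Proof.
move=> r0; exists rho => // v w; rewrite /affine_similarity /enorm /=.
have e : rho = Num.sqrt (rho ^+ 2) by rewrite sqrtr_sqr gtr0_norm.
rewrite [in RHS]e -sqrtrM ?sqr_ge0//; congr Num.sqrt.
have := cos2Dsin2 be; set c := cos be; set s := sin be => cs.
transitivity (rho ^+ 2 * ((c ^+ 2 + s ^+ 2) * ((v.1 - w.1) ^+ 2 + (v.2 - w.2) ^+ 2))).
  by ring.
by rewrite cs mul1r.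
Qed.

Lemma pos_angle p L (g : curve L p) th k q nu s0 be : 0 < L -> 1 < p -> 0 < q -> q < 1 -> 0 < nu ->
  tangent g th k -> (forall t, 0 <= t <= L -> th t = angw p q nu s0 t + be) ->
  forall t, 0 <= t <= L ->
  pos g t = affine_similarity (pos g 0) ((nu / (2 * q))^-1) be (gamma_w p s0 q)
    (gamma_w p (par q nu s0 t) q).
Proof.
move=> L0 p1 q0 q1 nu0 T hth t tL; have /andP[t0 tL'] := tL.
rewrite (tangent_pos L0 p1 T tL).
have cB : continuous (angw p q nu s0) by exact: cont_angw.
have i1 := itb_cont 0 t (ccos cB); have i2 := itb_cont 0 t (csin cB).
have e1 := itg_cos_angw s0 p1 q0 q1 nu0 t0; have e2 := itg_sin_angw s0 p1 q0 q1 nu0 t0.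
have par0 : par q nu s0 0 = s0 by rewrite /par mulr0 add0r.
rewrite par0 in e1 e2.
have -> : itg 0 t (fun s => cos (th s)) =
    cos be * itg 0 t (fun s => cos (angw p q nu s0 s)) - sin be * itg 0 t (fun s => sin (angw p q nu s0 s)).
  rewrite -(itgZ _ i1) -(itgZ _ i2) -(itgB (itbZ _ i1) (itbZ _ i2)); apply: eq_itg => s /andP[h1 h2].
  by rewrite hth ?h1 ?(le_trans h2)// cosD; ring.
have -> : itg 0 t (fun s => sin (th s)) =
    sin be * itg 0 t (fun s => cos (angw p q nu s0 s)) + cos be * itg 0 t (fun s => sin (angw p q nu s0 s)).
  rewrite -(itgZ _ i1) -(itgZ _ i2) -(itgD (itbZ _ i1) (itbZ _ i2)); apply: eq_itg => s /andP[h1 h2].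
  by rewrite hth ?h1 ?(le_trans h2)// sinD; ring.
rewrite e1 e2 /affine_similarity; move: (gamma_w _ _ _) (gamma_w _ _ _) (nu / _) => a b c.
by apply: injective_projections => /=; ring.
Qed.

Lemma figure_eight_of_angle p L (g : curve L p) th k q nu s0 be : 0 < L -> 1 < p ->
  0 < q < 1 -> 0 < nu -> 2 * E1c p q = K1c p q -> nu / (2 * q) * L = 4 * K1c p q ->
  tangent g th k -> (forall t, 0 <= t <= L -> th t = angw p q nu s0 t + be) ->
  m_fold_figure_eight L p 1 (pos g).
Proof.
move=> L0 p1 q01 nu0 EK cL T hth; have [q0 q1] := andP q01.
rewrite /m_fold_figure_eight (qstarE p1 q01 EK).
have c0 : 0 < nu / (2 * q) by rewrite divr_gt0// mulr_gt0.
exists (affine_similarity (pos g 0) ((nu / (2 * q))^-1) be (gamma_w p s0 q)),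
  (fun t => nu / (2 * q) * t), s0; split.
- by apply: similarity_affine; rewrite invr_gt0.
- by apply: continuous_subspaceT; apply: cZ; exact: cid.
- rewrite mulr1 -cL; move: (nu / (2 * q)) c0 => c c0; split.
  + move=> x /=; rewrite !in_itv/= => /andP[x0 xL].
    by rewrite (mulr_ge0 (ltW c0) x0)/= ler_pM2l.
  + by move=> x y _ _ /mulfI; apply; rewrite gt_eqF.
  + move=> y /=; rewrite in_itv/= => /andP[y0 yL]; exists (y / c).
      by rewrite /= in_itv/= (divr_ge0 y0 (ltW c0))/= ler_pdivrMr// mulrC.
    by rewrite mulrC divfK// gt_eqF.
- by move=> t tL; rewrite (pos_angle L0 p1 q0 q1 nu0 T hth tL).
Qed.

Lemma clamped_tangent p L P V (g : curve L p) : 0 < L -> 1 < p -> clamped P P V V g ->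
  exists th k, [/\ tangent g th k, closed_curve L th, cos (th L) = cos (th 0) & sin (th L) = sin (th 0)].
Proof.
move=> L0 p1 [g1 g0 gL v0 vL]; have L0' := ltW L0.
have i0 : (0 : R) <= 0 <= L by rewrite lexx L0'.
have iL : (0 : R) <= L <= L by rewrite lexx L0'.
have [th [k T]] : exists th k, tangent g th k.
  have hV := g1 0 i0.
  have [a [_ _ a1 a2]] := polar (enorm1 hV).
  have av : vel g 0 = (cos a, sin a) by rewrite -a1 -a2 -surjective_pairing.
  have [th [k [T _]]] := exists_tangent L0 p1 g1 av.
  by exists th, k.
exists th, k; have [_ hv] := T.
have e0 := hv 0 i0; have eL := hv L iL; rewrite v0 in e0; rewrite vL e0 in eL.
case: eL => e1 e2.
split => //.
have := tangent_pos L0 p1 T iL; rewrite g0 gL => /eqP.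
by rewrite -subr_eq0 opprD addNKr oppr_eq0 => /eqP[h1 h2]; split.
Qed.

Lemma necessity p L P V (g : curve L p) : 0 < L -> 1 < p ->
  local_minimizer (@bending_energy R L p) (clamped P P V V) g ->
  (exists m : nat, (1 <= m)%N /\ m_fold_circle L m (pos g)) \/ m_fold_figure_eight L p 1 (pos g).
Proof.
move=> L0 p1 M; have [hg _] := M; have L0' := ltW L0.
have [th [k [T hc cL sL]]] := clamped_tangent L0 p1 hg.
have [H hv] := T; have ik := tangent_npow L0 p1 T.
have lm : locmin p L th k.
  have [d d0 hd] := local_min_angle L0 p1 T M.
  exists d; first exact: d0.
  by move=> th' k' H' e0 eL [h1 h2] hk; exact: (hd th' k' H' e0 eL h1 h2 hk).
have [[c Hc]|[al [b [w [lam [A [Hp [A0 Al hb hl [hbd bL wL hcb Hw]]]]]]]]] :=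
  dichotomy L0 p1 H ik hc lm cL sL.
  by left; apply: (circle_case L0 p1 (conj Hc hv)).
right.
have [q [nu [s0 [n [/andP[q0 q1] nu0 n0 EK [cL' hbw]]]]]] :=
  identification L0 p1 Hp A0 Al hbd hl bL wL hcb.
have ck : continuous (curw p q nu s0) by exact: cont_curw.
(* The given curvature is replaced by its continuous version, for which the shift is uniformly
   small. *)
have Hk : AC 0 L th (curw p q nu s0).
  apply: (AC_eqk (continuous_measurable_fun ck) _ Hw).
  by apply: eq_aeq => t tL; rewrite (hbw t tL).2 curw_momw.
have n1 := single_cover L0 p1 q0 q1 nu0 EK n0 cL' Hk (locmin_ae L0 p1 H Hk ik lm).
apply: (figure_eight_of_angle (th := th) (k := k) (q := q) (nu := nu) (s0 := s0)
  (be := th 0 - angw p q nu s0 0)) => //.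
- by rewrite q0 q1.
- by rewrite cL' n1 mulr1.
- move=> t /andP[t0 tL]; have h1 := AC_int Hk (lexx 0) t0 tL.
  have h2 := AC_int (AC_FTC L0' ck (derive_angw nu s0 p1 q0 q1)) (lexx 0) t0 tL.
  by rewrite -h1 in h2; lra.
Qed.

End Necessity.

(** * Minimality of circles and figure eights *)

Section Sufficiency.
Context {R : realType}.
Implicit Types (f k : R -> R) (p q nu L s t x y e d : R).

Lemma young_npow p x d : 1 < p -> 0 < d -> `|x| <= d + d * (d^-1) `^ p * `|x| `^ p.
Proof.
move=> p1 d0; have := @le_1_npow _ p (x / d) (ltW p1).
rewrite normrM (gtr0_norm (_ : 0 < d^-1)) ?invr_gt0// powRM ?invr_ge0 ?(ltW d0)//.
rewrite ler_pdivrMr// => h; apply: le_trans h _.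
by rewrite mulrDl mul1r lerD2l mulrC [_ `^ p * _]mulrC mulrA.
Qed.

(** Smallness in the mean from smallness of the [p]-th power: in [young_npow] the constant [d]
    contributes [eta / 2] over the length, and the threshold makes the power term contribute less
    than [eta / 2]. *)
Lemma itg_small p L eta : 0 < L -> 1 < p -> 0 < eta -> exists2 e, 0 < e &
  forall f, measurable_fun setT f -> itb 0 L (fun t => `|f t| `^ p) ->
  itg 0 L (fun t => `|f t| `^ p) < e `^ p -> itb 0 L f /\ itg 0 L (fun t => `|f t|) < eta.
Proof.
move=> L0 p1 eta0; have p0 : 0 < p by exact: lt_trans p1.
pose d := eta / (2 * L).
have d0 : 0 < d by rewrite divr_gt0// mulr_gt0.
pose c := d * (d^-1) `^ p.
have c0 : 0 < c by rewrite mulr_gt0// powR_gt0// invr_gt0.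
exists ((eta / (2 * c)) `^ p^-1); first by rewrite powR_gt0// divr_gt0// mulr_gt0.
move=> f mf ifp; rewrite -powRrM mulVf ?gt_eqF// powRr1; last by apply: ltW; rewrite divr_gt0// mulr_gt0.
move=> h.
have hf x : `|f x| <= d + c * `|f x| `^ p by exact: young_npow.
have ib : itb 0 L (fun t => d + c * `|f t| `^ p) by apply: itbD; [exact: itb_cst|exact: itbZ].
have i1 : itb 0 L f by apply: itb_le ib => //; exact: measurable_funTS.
split => //.
apply: (@le_lt_trans _ _ (itg 0 L (fun t => d + c * `|f t| `^ p))).
  by apply: le_itg => //; exact: itb_abs.
rewrite (itgD (itb_cst 0 L d) (itbZ c ifp)) (itgZ c ifp) (itg_cst d (ltW L0)).
rewrite subr0 (_ : d * L = eta / 2); last by rewrite /d; field; rewrite gt_eqF.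
have : c * itg 0 L (fun t => `|f t| `^ p) < c * (eta / (2 * c)) by rewrite ltr_pM2l.
rewrite (_ : c * (eta / (2 * c)) = eta / 2); last by field; rewrite gt_eqF.
by lra.
Qed.

(** The velocities agree at 0, so their difference is the integral of the difference of the
    accelerations. *)
Lemma vel_close L p (g h : curve L p) eta : 0 < L -> 1 < p -> vel g 0 = vel h 0 ->
  itb 0 L (fun t => enorm (S2 g.1 t - S2 h.1 t, S2 g.2 t - S2 h.2 t)) ->
  itg 0 L (fun t => `|enorm (S2 g.1 t - S2 h.1 t, S2 g.2 t - S2 h.2 t)|) < eta ->
  forall t, 0 <= t <= L -> `|(vel h t).1 - (vel g t).1| < eta /\ `|(vel h t).2 - (vel g t).2| < eta.
Proof.
move=> L0 p1 e0 ib hI t tL; have /andP[t0 tL'] := tL; have L0' := ltW L0.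
have [e01 e02] : sob1 g.1 0 = sob1 h.1 0 /\ sob1 g.2 0 = sob1 h.2 0 by case: e0.
have pr0 : pr 0 L 0 = 0 :> R by rewrite pr_id// lexx.
have key (u v u' v' : R -> R) : AC 0 L u u' -> AC 0 L v v' -> u 0 = v 0 ->
    (forall x, `|u' x - v' x| <= enorm (S2 g.1 x - S2 h.1 x, S2 g.2 x - S2 h.2 x)) ->
    `|v t - u t| < eta.
  move=> Hu Hv uv hle; have H := AC_B Hu Hv.
  have := AC_int H (lexx 0) t0 tL'; rewrite uv subrr subr0 => e.
  rewrite distrC e; apply: le_lt_trans (itg_abs (AC_itb_sub H (lexx 0) tL')) _.
  apply: le_lt_trans hI; have ia := itb_abs ib.
  have ia' := itb_sub (lexx 0) tL' ia.
  apply: (@le_trans _ _ (itg 0 t (fun t => `|enorm (S2 g.1 t - S2 h.1 t, S2 g.2 t - S2 h.2 t)|))).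
    apply: le_itg => //; first by apply: itb_abs; exact: AC_itb_sub H (lexx 0) tL'.
    by move=> x _; apply: le_trans (hle x) (ler_norm _).
  rewrite [leRHS](itg_split t0 tL' ia) lerDl; apply: itg_ge0 => x _; exact: normr_ge0.
rewrite /vel /=; split.
- have := key _ _ _ _ (S1_AC g.1 L0 p1) (S1_AC h.1 L0 p1).
  rewrite /S1 pr0 pr_id//; apply; first exact: e01.
  by move=> x; exact: (@enorm_ge1 _ (_, _)).
- have := key _ _ _ _ (S1_AC g.2 L0 p1) (S1_AC h.2 L0 p1).
  rewrite /S1 pr0 pr_id//; apply; first exact: e02.
  by move=> x; exact: (@enorm_ge2 _ (_, _)).
Qed.

Lemma W2p_dist_acc L p (g h : curve L p) e : 0 < L -> 1 < p -> 0 < e -> (W2p_dist g h < e%:E)%E ->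
  itb 0 L (fun t => `|enorm (S2 g.1 t - S2 h.1 t, S2 g.2 t - S2 h.2 t)| `^ p) /\
  itg 0 L (fun t => `|enorm (S2 g.1 t - S2 h.1 t, S2 g.2 t - S2 h.2 t)| `^ p) < e `^ p.
Proof.
move=> L0 p1 e0 hd.
have hacc : (Lp_norm L p (fun t => enorm (acc g t - acc h t)%R) < e%:E)%E.
  apply: le_lt_trans hd; apply: leeDr; apply: adde_ge0; exact: Lp_norm_ge0.
pose F := (fun t => enorm (acc g t - acc h t)) \_ `]0, L[.
have FE : F = fun t => enorm (S2 g.1 t - S2 h.1 t, S2 g.2 t - S2 h.2 t).
  apply/funext => t; rewrite /F /S2 !patchE; case: ifP => _ //.
  by rewrite !subrr /enorm/= expr0n/= addr0 sqrtr0.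
have mF : measurable_fun setT F.
  rewrite FE; apply: measurable_enorm; apply: measurable_funB; exact: S2_meas.
have mf : measurable_fun `]0, L[ (fun t => enorm (acc g t - acc h t)).
  by apply/(measurable_restrictT _ (measurable_itv _)).
have [h1 h2] := Lp_norm_lt_itg L0 p1 (ltW e0) mf hacc.
rewrite -/F FE in h1; rewrite -/F FE in h2.
by split.
Qed.

(** Velocities within [1 / 2] in each coordinate make the difference [D] of the angles have positive
    cosine. As [D] starts at 0, its absolute value never reaches [pi / 2]; at [L] it is a multiple
    of [2 pi], hence 0. *)
Lemma near_rotation L p P V (g : curve L p) th k : 0 < L -> 1 < p -> clamped P P V V g ->
  tangent g th k -> exists2 e, 0 < e & forall h, clamped P P V V h -> (W2p_dist g h < e%:E)%E ->
    exists th' k', [/\ tangent h th' k', th' 0 = th 0, th' L = th L & closed_curve L th'].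
Proof.
move=> L0 p1 hg T; have L0' := ltW L0.
have [e e0 he] := @itg_small p L (1 / 2) L0 p1 ltac:(lra).
exists e => // h hh hd; have pi0 := pi_gt0 R.
have [_ _ _ gv0 gvL] := hg; have [h1 hp0 hpL hv0 hvL] := hh.
have i0 : (0 : R) <= 0 <= L by rewrite lexx L0'.
have iL : (0 : R) <= L <= L by rewrite lexx L0'.
have [H hv] := T.
have hvel0 : vel h 0 = (cos (th 0), sin (th 0)) by rewrite hv0 -gv0 hv.
have [th' [k' [T' th0]]] := exists_tangent L0 p1 h1 hvel0.
have [H' hv'] := T'.
have [ib hI] := W2p_dist_acc L0 p1 e0 hd.
have mE : measurable_fun setT (fun t => enorm (S2 g.1 t - S2 h.1 t, S2 g.2 t - S2 h.2 t)).
  by apply: measurable_enorm; apply: measurable_funB; exact: S2_meas.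
have [ibE hE] := he _ mE ib hI.
have close := vel_close L0 p1 (etrans gv0 (esym hv0)) ibE hE.
pose D t := th' t - th t.
have cD' : continuous D by apply: cB; [exact: AC_cont H'|exact: AC_cont H].
have cosD0 t : 0 <= t <= L -> 0 < cos (D t).
  move=> tL; have [] := close t tL; rewrite hv// hv'//= => c1 c2.
  have e1 : (cos (th' t) - cos (th t)) ^+ 2 < 1 / 4.
    by rewrite -real_normK ?num_real// (_ : 1 / 4 = (1 / 2) ^+ 2); [rewrite ltr_pXn2r ?nnegrE|field].
  have e2 : (sin (th' t) - sin (th t)) ^+ 2 < 1 / 4.
    by rewrite -real_normK ?num_real// (_ : 1 / 4 = (1 / 2) ^+ 2); [rewrite ltr_pXn2r ?nnegrE|field].
  have := cos2Dsin2 (th t); have := cos2Dsin2 (th' t); rewrite /D cosB.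
  move: e1 e2; rewrite !sqrrB; clear; lra.
have D0 : D 0 = 0 by rewrite /D th0 subrr.
have Dlt t : 0 <= t <= L -> `|D t| < pi / 2.
  move=> tL; rewrite ltNge; apply/negP => hge; have /andP[t0 tL'] := tL.
  have [|c /andP[c0 ct] hc] := @ivt _ 0 t (fun t => `|D t|) (pi / 2) t0 (cnorm cD').
    by rewrite D0 normr0 ge_min le_max hge orbT andbT; apply/orP; left; lra.
  have cL : 0 <= c <= L by rewrite c0 (le_trans ct).
  by have := cosD0 c cL; rewrite -cos_norm hc cos_pihalf ltxx.
have vL := hv L iL; have vL' := hv' L iL.
have [eqc eqs] : cos (th' L) = cos (th L) /\ sin (th' L) = sin (th L).
  by move: hvL; rewrite -gvL vL vL' => -[].
exists th', k'; split => //.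
- apply: eq_ccos_small => //; have := Dlt L iL; rewrite /D; clear -pi0; lra.
- have := tangent_pos L0 p1 T' iL; rewrite hp0 hpL => /eqP.
  by rewrite -subr_eq0 opprD addNKr oppr_eq0 => /eqP[g1 g2]; split.
Qed.

Lemma pos_vel L p (g : curve L p) (X Y X' Y' : R -> R) : 0 < L ->
  (forall t : R, is_derive t 1 X (X' t)) -> (forall t : R, is_derive t 1 Y (Y' t)) ->
  continuous X' -> continuous Y' ->
  (forall t, 0 <= t <= L -> pos g t = (X t, Y t)) ->
  forall t, 0 <= t <= L -> vel g t = (X' t, Y' t).
Proof.
move=> L0 dX dY cX cY hp t tL; have L0' := ltW L0.
have key (s : sobolev2 L p) (Z Z' : R -> R) : (forall t : R, is_derive t 1 Z (Z' t)) -> continuous Z' ->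
    (forall t, 0 <= t <= L -> sob0 s t = Z t) -> sob1 s t = Z' t.
  move=> dZ cZ hs; have H1 := AC_FTC L0' cZ dZ.
  have cS1 : continuous (S1 s) by apply: cont_pr L0' _; exact: sob1_continuous.
  have H2 : AC 0 L Z (S1 s).
    apply: AC_eqf (S0_AC s L0); first exact: AC_cont H1.
    by move=> x xL; rewrite /S0 pr_id// hs.
  by have := AC_uniq_cont H2 H1 L0 cS1 cZ tL; rewrite /S1 pr_id.
rewrite /vel; congr (_, _).
- by apply: (key _ X) => // x xL; have := hp x xL => -[].
- by apply: (key _ Y) => // x xL; have := hp x xL => -[].
Qed.

Lemma circle_tangent L p m (g : curve L p) : 0 < L ->
  m_fold_circle L m (pos g) -> exists th c, tangent g th (fun=> c).
Proof.
move=> L0 [z [r [a [b [r0 hr hg]]]]]; have L0' := ltW L0.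
pose w : R := (-1) ^+ b * (2 * pi * m%:R / L).
pose th t := a + w * t.
have dth (t : R) : is_derive t 1 th w.
  by apply: (is_derive_eq (dD (dcst t a) (dZ w (did t)))); ring.
have cth : continuous th by apply: cD; [exact: ccst|apply: cZ; exact: cid].
have d1 (t : R) : is_derive t 1 (fun t => z.1 + r * cos (th t)) (- (r * w) * sin (th t)).
  by apply: (is_derive_eq (dD (dcst t _) (dZ r (dcos (dth t))))); ring.
have d2 (t : R) : is_derive t 1 (fun t => z.2 + r * sin (th t)) ((r * w) * cos (th t)).
  by apply: (is_derive_eq (dD (dcst t _) (dZ r (dsin (dth t))))); ring.
have hp t : 0 <= t <= L -> pos g t = (z.1 + r * cos (th t), z.2 + r * sin (th t)).
  move=> tL; rewrite (hg t tL); cbv zeta.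
  have -> : a + (-1) ^+ b * (2 * pi * m%:R * t / L) = th t by rewrite /th /w; ring.
  by [].
have hv := pos_vel L0 d1 d2 (cZ (c := - (r * w)) (csin cth)) (cZ (c := r * w) (ccos cth)) hp.
have rw : r * w = (-1) ^+ b.
  by rewrite /w mulrCA -[r * _]mulrC mulrAC hr divff ?gt_eqF// mulr1.
(* The tangent is the radius turned by a quarter in the direction of travel; the length condition
   makes [r * w] equal to 1 or -1. *)
exists (fun t => th t + (-1) ^+ b * (pi / 2)), w; split.
  apply: AC_FTC => //; first exact: ccst.
  by move=> t; apply: (is_derive_eq (dD (dth t) (dcst t _))); rewrite addr0.
move=> t tL; rewrite (hv t tL) rw.
move: (th t) => x; case: b {w th dth cth hv rw hg d1 d2 hp} => /=.
  by rewrite expr1 mulN1r cosD sinD cosN sinN cos_pihalf sin_pihalf; congr (_, _); ring.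
by rewrite expr0 mul1r cosD sinD cos_pihalf sin_pihalf; congr (_, _); ring.
Qed.

Lemma circle_sufficient L p P V m (g : curve L p) : 0 < L -> 1 < p -> clamped P P V V g ->
  m_fold_circle L m (pos g) ->
  local_minimizer (@bending_energy R L p) (clamped P P V V) g.
Proof.
move=> L0 p1 hg hm; split; [exact: hg|have L0' := ltW L0].
have [th [c T]] := circle_tangent L0 hm.
have [e e0 he] := near_rotation L0 p1 hg T.
exists e; first exact: e0.
move=> h hh hd; have [th' [k' [T' th0 thL _]]] := he h hh hd.
rewrite (tangent_energy L0 p1 T) (tangent_energy L0 p1 T') lee_fin.
have ik' := tangent_npow L0 p1 T'; have [H' _] := T'; have [H _] := T.
(* Both integrals are the common total rotation, so the linear term of the tangent inequality at [c]
   integrates to 0. *)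
have e1 : itg 0 L k' = itg 0 L (fun=> c).
  by rewrite -(AC_int H' (lexx 0) L0' (lexx L)) -(AC_int H (lexx 0) L0' (lexx L)) th0 thL.
have i0 := itb_cst 0 L (`|c| `^ p).
have i1 := itbZ (p * spow (p - 1) c) (itbB (AC_itb H') (itb_cst 0 L c)).
rewrite [leLHS](_ : _ = itg 0 L (fun t => `|c| `^ p + p * spow (p - 1) c * (k' t - c))).
  apply: le_itg ik' _; first exact: itbD i0 i1.
  by move=> t _; exact: convex_npow.
rewrite (itgD i0 i1) (itgZ _ (itbB (AC_itb H') (itb_cst 0 L c))) (itgB (AC_itb H') (itb_cst 0 L c)).
by rewrite e1 subrr mulr0 addr0.
Qed.

End Sufficiency.

(** * The action of the pendulum as a function of the modulus *)

Section Comparison.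
Context {R : realType}.
Implicit Types (k : R -> R) (p q nu L s t x y z : R).

(** The positive part, in a form whose continuity is immediate; it lets [speed] be defined beyond
    the turning points. *)
Definition ramp z : R := (z + `|z|) / 2.

Lemma ramp_ge0 z : 0 <= ramp z.
Proof. by rewrite /ramp; have := ler_norm (- z); rewrite normrN; lra. Qed.

Lemma ramp_id z : 0 <= z -> ramp z = z.
Proof. by move=> h; rewrite /ramp ger0_norm//; lra. Qed.

Lemma ramp_le y z : y <= z -> ramp y <= ramp z.
Proof.
move=> yz; rewrite /ramp; case: (leP 0 y) => y0.
  by rewrite !ger0_norm; lra.
by rewrite (ltr0_norm y0); have := ler_norm (- z); rewrite normrN; lra.
Qed.

(* The tangential speed of the pendulum with turning points [cos x = c], up to
   a power and a constant factor. *)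
Definition speed p c x : R := `|ramp (cos x - c)| `^ (1 - p^-1).

Lemma kap_gt0 p : 1 < p -> 0 < 1 - p^-1.
Proof. by move=> p1; rewrite subr_gt0 invf_lt1//; exact: lt_trans p1. Qed.

Lemma cont_ramp f : continuous f -> continuous (fun x => ramp (f x)).
Proof.
move=> cf; have h := cZ (c := 2^-1) (cD cf (cnorm cf)).
have -> : (fun x => ramp (f x)) = (fun x => 2^-1 * (f x + `|f x|)); last exact: h.
by apply/funext => x; rewrite /ramp mulrC.
Qed.

Lemma cont_speed p c : 1 < p -> continuous (speed p c).
Proof.
move=> p1; apply: (ccomp (f := fun x => ramp (cos x - c)) _ (cnpow (kap_gt0 p1))).
by apply: cont_ramp; apply: cB; [exact: continuous_cos|exact: ccst].
Qed.

Lemma speed_ge0 p c x : 0 <= speed p c x. Proof. exact: powR_ge0. Qed.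

Lemma cpowD2 r x : r + 2 != 0 -> cpow (r + 2) x = cos x ^+ 2 * cpow r x.
Proof.
move=> r2; rewrite /cpow; have [->|c0] := eqVneq (cos x) 0.
  by rewrite normr0 powR0// expr0n/= mul0r.
rewrite powRD; last by rewrite normr_eq0 c0 implybT.
by rewrite powR_mulrn// real_normK ?num_real// mulrC.
Qed.

Lemma expo p : 1 - 2 / p + 2 = 2 * (1 - p^-1) + 1. Proof. by ring. Qed.

(** The substitution contributes a factor [cos^2], and the exponent becomes [3 - 2 / p]; so this
    weight is continuous even when the one in [F1] is singular. *)
Definition wgt p x : R := cpow (1 - 2 / p + 2) x.

Lemma cont_wgt p : 1 < p -> continuous (wgt p).
Proof.
move=> p1; apply: (ccomp (f := cos) _ (cnpow _)); first exact: continuous_cos.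
by have := a_gt p1; lra.
Qed.

Lemma wgtE p x : 1 < p -> wgt p x = cos x ^+ 2 * cpow (1 - 2 / p) x.
Proof. by move=> p1; apply: cpowD2; have h := a_gt p1; rewrite gt_eqF//; lra. Qed.

Lemma wgt_ge0 p x : 0 <= wgt p x. Proof. exact: powR_ge0. Qed.

(** With [sin (x / 2) = q sin phi] the turning points correspond to [phi = - pi / 2] and [pi / 2],
    and [cos x - c] becomes [2 q^2 cos^2 phi]. The domain of integration no longer depends on the
    amplitude, so different moduli can be compared pointwise. *)
Lemma action_sub p q : 1 < p -> 0 < q -> q < 1 ->
  integral0 (speed p (1 - 2 * q ^+ 2)) (2 * asin q) - integral0 (speed p (1 - 2 * q ^+ 2)) (- (2 * asin q)) =
  itg (- (pi / 2)) (pi / 2) (fun x => (2 * q ^+ 2) `^ (1 - p^-1) * (2 * q) * (wgt p x * (Del q x)^-1)).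
Proof.
move=> p1 q0 q1; set c := 1 - 2 * q ^+ 2; have q0' := ltW q0; have pi0 := pi_gt0 R.
have kp := kap_gt0 p1.
pose X x := 2 * asin (q * sin x); pose X' x := 2 * q * cos x * (Del q x)^-1.
have dX (x : R) : is_derive x 1 X (X' x).
  have h := dZ 2 (dcomp (dZ q (is_derive_sin x)) (is_derive1_asin (qsin_bnd q0 q1 x))).
  by apply: (is_derive_eq h); rewrite exprMn -/(Del q x) /X'; ring.
have cX0 : continuous X := cont_asinq q0 q1.
have cS : continuous (speed p c) by exact: cont_speed.
have cI : continuous (fun x => speed p c (X x) * X' x).
  apply: cM; first exact: ccomp cX0 cS.
  apply: cM; last exact: cont_DelV.
  by apply: cZ; exact: continuous_cos.
have dGX (x : R) : is_derive x 1 (fun x => integral0 (speed p c) (X x)) (speed p c (X x) * X' x).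
  exact: dcomp (dX x) (derive_integral0_cont cS _).
have pm : - (pi / 2) <= pi / 2 :> R by lra.
have h := AC_int (AC_FTC pm cI dGX) (lexx _) pm (lexx _).
have Xp : X (pi / 2) = 2 * asin q by rewrite /X sin_pihalf mulr1.
have Xm : X (- (pi / 2)) = - (2 * asin q).
  rewrite /X sinN sin_pihalf mulrN1.
  have q1' : (- q) \in `[(-1 : R), 1] by rewrite in_itv/=; apply/andP; split; lra.
  have qq : q \in `[(-1 : R), 1] by rewrite in_itv/=; apply/andP; split; lra.
  rewrite -(asinK qq) -sinN sinK ?asinK//; first by ring.
  have := @asin_geNpi2 _ q; have := @asin_lepi2 _ q; move: qq; rewrite !in_itv/= => qq h1 h2.
  by rewrite lerN2 h1// lerNl h2.
rewrite -Xm -Xp h; apply: eq_itg => x hx; have cx := cos_ge0_pihalf hx.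
have e1 : cos (X x) - c = 2 * q ^+ 2 * cos x ^+ 2.
  have qx := qsin_bnd' q0 q1 x.
  rewrite double_cos /X mulrAC divff ?mul1r// asinK ?in_itv// exprMn /c.
  by rewrite sin2cos2; ring.
have q20 : 0 <= 2 * q ^+ 2 by rewrite mulr_ge0// sqr_ge0.
rewrite /speed e1 ramp_id; last by rewrite mulr_ge0// sqr_ge0.
rewrite normrM (ger0_norm q20) (powRM _ q20 (normr_ge0 _)) /X' -!mulrA; congr (_ * _).
rewrite (_ : wgt p x = `|cos x ^+ 2| `^ (1 - p^-1) * cos x); first by ring.
rewrite /wgt /cpow expo; have [->|c0] := eqVneq (cos x) 0.
  by rewrite normr0 powR0 ?mulr0// gt_eqF//; lra.
rewrite powRD; last by rewrite normr_eq0 c0 implybT.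
by rewrite powRr1// (ger0_norm cx) normrX powRrM powR_mulrn// (ger0_norm cx).
Qed.

Lemma powRV x r : 0 <= x -> x^-1 `^ r = (x `^ r)^-1.
Proof. by move=> h; rewrite -(powR_inv1 h) -powRrM mulN1r powRN. Qed.

(** The right side is the exponential of a combination of logarithms; [expR t >= 1 + t] and
    [ln z <= z - 1] give its tangent plane at [(1, 1)] as a lower bound. This is the form in which
    log-convexity is used. *)
Lemma pow_tangent z1 z2 r : 0 < z1 -> 0 < z2 -> 0 <= r ->
  1 - 2^-1 * (z1 - 1) - r * (z2 - 1) <= (Num.sqrt z1)^-1 * z2 `^ (- r).
Proof.
move=> h1 h2 r0.
have l1 (z : R) : 0 < z -> ln z <= z - 1.
  by move=> z0; have := @expR_ge1Dx _ (ln z); rewrite lnK ?posrE//; lra.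
have -> : (Num.sqrt z1)^-1 * z2 `^ (- r) = expR (- (2^-1) * ln z1 - r * ln z2).
  rewrite expRD; congr (_ * _).
    rewrite mulNr expRN; congr (_^-1).
    by rewrite -powR12_sqrt ?(ltW h1)// /powR gt_eqF// mulrC.
  by rewrite /powR gt_eqF// mulNr.
apply: le_trans (expR_ge1Dx _).
have g1 := l1 _ h1; have g2 : r * ln z2 <= r * (z2 - 1) by apply: ler_wpM2l => //; exact: l1.
lra.
Qed.

Section Optimal.
Context (p q : R) (p1 : 1 < p) (q0 : 0 < q) (q1 : q < 1) (EK : 2 * E1c p q = K1c p q).

Let q0' : 0 <= q := ltW q0.
Let mp : - (pi / 2) <= pi / 2 :> R. Proof. by have := pi_gt0 R; lra. Qed.
Let DV x : Del q x != 0. Proof. by rewrite gt_eqF// Del_gt0. Qed.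
Let qV : q != 0. Proof. by rewrite gt_eqF. Qed.

Lemma itg_dF1 : itg (- (pi / 2)) (pi / 2) (dF1 p q) = 2 * K1c p q.
Proof.
rewrite -(integral0B (itb_dF1 p1 q0' q1) mp) -!/(F1 p _ q).
by have := F1N p1 q0' q1 (pi / 2); rewrite /K1c !F1E => ->; ring.
Qed.

Lemma itg_dE1 : itg (- (pi / 2)) (pi / 2) (dE1 p q) = K1c p q.
Proof.
rewrite -(integral0B (itb_dE1 q p1) mp) -EK.
by have := E1N q p1 (pi / 2); rewrite /E1c !E1E => ->; ring.
Qed.

(** With [y = q^-2] one has [q / Del q = (y - sin^2)^(-1/2)]. So [q * moment1] has derivative
    [- q^3 / 2 * moment3] in [y], and the two moments are the value and slope needed for the tangent
    of the action. *)
Definition moment1 := itg (- (pi / 2)) (pi / 2) (fun x => wgt p x * (Del q x)^-1).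
Definition moment3 := itg (- (pi / 2)) (pi / 2) (fun x => wgt p x * (Del q x)^-1 ^+ 3).

(** [q^2 cos^2 = q^2 - 1 + Del^2] splits the integrand into those of [F1] and [E1]; the relation
    [2 E = K] then leaves a multiple of [K]. *)
Lemma moment1E : q ^+ 2 * moment1 = (2 * q ^+ 2 - 1) * K1c p q.
Proof.
have i1 : itb (- (pi / 2)) (pi / 2) (fun x => wgt p x * (Del q x)^-1).
  by apply: itb_cont; apply: cM; [exact: cont_wgt|exact: cont_DelV].
have iF := itb_dF1 p1 q0' q1 (- (pi / 2)) (pi / 2).
have iE := itb_dE1 q p1 (- (pi / 2)) (pi / 2).
rewrite -(itgZ _ i1).
transitivity (itg (- (pi / 2)) (pi / 2) (fun x => (q ^+ 2 - 1) * dF1 p q x + dE1 p q x)).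
  apply: eq_itg => x _; rewrite wgtE// /dF1 /dE1 cos2sin2.
  have := Del_sqr q0' q1 x; have D0 := DV x.
  set D := Del q x in D0 *; move=> h.
  have -> : q ^+ 2 * ((1 - sin x ^+ 2) * cpow (1 - 2 / p) x * D^-1) =
     (q ^+ 2 - q ^+ 2 * sin x ^+ 2) * cpow (1 - 2 / p) x * D^-1 by ring.
  by rewrite (_ : q ^+ 2 * sin x ^+ 2 = 1 - D ^+ 2); [field|rewrite h; ring].
rewrite (itgD (itbZ _ iF) iE) (itgZ _ iF) itg_dF1 itg_dE1; ring.
Qed.

(* Integrating the derivative of [sin * |cos|^(2 - 2/p) / Del]. *)
Lemma moment3E : q ^+ 2 * moment3 = (2 - 2 / p) * K1c p q.
Proof.
have i3 : itb (- (pi / 2)) (pi / 2) (fun x => wgt p x * (Del q x)^-1 ^+ 3).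
  by apply: itb_cont; apply: cM; [exact: cont_wgt|apply: cX; exact: cont_DelV].
have iF := itb_dF1 p1 q0' q1 (- (pi / 2)) (pi / 2).
have iE := itb_dE1 q p1 (- (pi / 2)) (pi / 2).
pose N x := sin x * spow (2 - 2 / p) (cos x) * (Del q x)^-1.
have r0 := conj_two_gt0 p1.
pose f x := q ^+ 2 * (wgt p x * (Del q x)^-1 ^+ 3) - (2 - 2 / p) * (dF1 p q x - dE1 p q x).
have cN' : continuous N.
  apply: cM; last exact: cont_DelV.
  by apply: cM; [exact: continuous_sin|apply: ccomp; [exact: continuous_cos|exact: cspow]].
have fi : itb (- (pi / 2)) (pi / 2) f by apply: itbB; [exact: itbZ|apply: itbZ; exact: itbB].
have h : itg (- (pi / 2)) (pi / 2) f = q ^+ 2 * N (pi / 2) - q ^+ 2 * N (- (pi / 2)).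
  apply: (FTC_sing (F := fun x => q ^+ 2 * N x) mp fi).
  - move=> x hx; have cx : cos x != 0 by rewrite gt_eqF// cos_gt0_pihalf.
    apply: cvgB.
      apply: cvgM; first exact: cvg_cst.
      by apply: cM; [exact: cont_wgt|apply: cX; exact: cont_DelV].
    apply: cvgM; first exact: cvg_cst.
    by apply: cvgB; [exact: cont_dF1|exact: cont_dE1].
  - by apply: continuous_subspaceT; exact: cZ.
  - move=> x hx; have cx0 := cos_gt0_pihalf hx; have cx : cos x != 0 by rewrite gt_eqF.
    have h1 := dM (dM (is_derive_sin x) (dcomp (is_derive_cos x) (dspow r0 cx))) (dV (DV x) (dDel q0' q1 x)).
    apply: (is_derive_eq (dZ (q ^+ 2) h1)); rewrite /f wgtE// /dF1 /dE1.
    have -> : spow (2 - 2 / p) (cos x) = cos x * cpow (1 - 2 / p) x.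
      by rewrite /spow /cpow mulrC; congr (_ * _ `^ _); ring.
    rewrite (_ : `|cos x| `^ (2 - 2 / p - 1) = cpow (1 - 2 / p) x); last by rewrite /cpow; congr (_ `^ _); ring.
    have := Del_sqr q0' q1 x; have D0 := DV x.
    move: (cpow _ x) (cos x) (sin x) (Del q x) D0 (2 - 2 / p) => C c s D D0 r Ds.
    apply/eqP; rewrite -subr_eq0; apply/eqP.
    transitivity ((D ^+ 2 + q ^+ 2 * s ^+ 2 - 1) * (q ^+ 2 * c ^+ 2 * C / D ^+ 3 - r * C / D)).
      by field.
    by rewrite Ds; ring.
have N0 : N (pi / 2) = 0 by rewrite /N cos_pihalf spow0 mulr0 mul0r.
have N1 : N (- (pi / 2)) = 0 by rewrite /N cosN cos_pihalf spow0 mulr0 mul0r.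
move: h; rewrite N0 N1 !mulr0 subrr /f.
rewrite (itgB (itbZ _ i3) (itbZ _ (itbB iF iE))) (itgZ _ i3) (itgZ _ (itbB iF iE)) (itgB iF iE) itg_dF1 itg_dE1.
by rewrite -/moment3 => /eqP; rewrite subr_eq0 => /eqP ->; ring.
Qed.

Lemma K_gt0 : 0 < K1c p q. Proof. exact: K1c_gt0. Qed.

Lemma itb_moment1 (k : R) : 0 <= k -> k < 1 -> itb (- (pi / 2)) (pi / 2) (fun x => wgt p x * (Del k x)^-1).
Proof. by move=> k0 k1; apply: itb_cont; apply: cM; [exact: cont_wgt|exact: cont_DelV]. Qed.

(** In [moment1E] the left side and [K] are positive. *)
Lemma optimal_gt : 0 < 2 * q ^+ 2 - 1.
Proof.
have I10 : 0 < moment1.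
  have pi0 := pi_gt0 R; have D0 := Del_gt0 q0' q1.
  apply: (@itg_pos _ _ _ 0); [lra|exact: itb_moment1| | |].
  - by move=> x _; rewrite mulr_ge0 ?wgt_ge0// invr_ge0 ltW.
  - by apply: cM; [exact: cont_wgt|exact: cont_DelV].
  - by rewrite mulr_gt0 ?invr_gt0// powR_gt0// normr_gt0 cos0 oner_eq0.
have h : 0 < q ^+ 2 * moment1 by rewrite mulr_gt0// exprn_gt0.
by move: h; rewrite moment1E pmulr_lgt0 ?K_gt0.
Qed.

(** The mean of [|cnp|^p] over a period of the figure eight, as the computation in [curw_energy]
    shows. *)
Definition slack := (2 * q ^+ 2 - 1) / (2 * q ^+ 2).
(* Twice the action of the figure eight divided by [(2 q^2 - 1) ^ (1 - 1/p)]. *)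
Definition least_action := 8 * q * K1c p q * slack `^ p^-1.

Lemma slack_gt0 : 0 < slack.
Proof. by rewrite divr_gt0 ?optimal_gt// mulr_gt0// exprn_gt0. Qed.

Lemma least_action_gt0 : 0 < least_action.
Proof. by rewrite mulr_gt0 ?powR_gt0 ?slack_gt0// mulr_gt0 ?K_gt0// mulr_gt0. Qed.

Lemma least_actionE : 2 * (2 `^ (1 - p^-1) * 2 * (q * (q ^+ 2 / (2 * q ^+ 2 - 1)) `^ (1 - p^-1) * moment1)) = least_action.
Proof.
have o0 := optimal_gt; have D0 := slack_gt0; have q2 : 0 < q ^+ 2 by rewrite exprn_gt0.
have -> : q ^+ 2 / (2 * q ^+ 2 - 1) = 2^-1 / slack.
  by rewrite /slack; field; rewrite qV gt_eqF.
have -> : moment1 = 2 * slack * K1c p q.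
  apply: (mulfI (lt0r_neq0 q2)); rewrite moment1E /slack; field; exact: qV.
rewrite /least_action.
have -> : slack `^ p^-1 = slack * slack^-1 `^ (1 - p^-1).
  have DV' : slack `^ (1 - p^-1) != 0 by rewrite gt_eqF// powR_gt0.
  rewrite (powRV _ (ltW D0)); apply: (mulIf DV'); rewrite divfK// -powRD ?(gt_eqF D0) ?implybT//.
  by rewrite subrKC powRr1// ltW.
have e : 2 `^ (1 - p^-1) * (2^-1 / slack) `^ (1 - p^-1) = slack^-1 `^ (1 - p^-1).
  by rewrite -powRM ?mulr_ge0 ?invr_ge0 ?(ltW D0)// mulrA divff ?mul1r.
rewrite -e; ring.
Qed.

(* The reduced action is log-convex in [q ^- 2]; its tangent at the optimal
   modulus is horizontal by the two integral identities above. *)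
Lemma action_bound (k : R) : 0 < k -> k < 1 -> 0 < 2 * k ^+ 2 - 1 ->
  least_action * (2 * k ^+ 2 - 1) `^ (1 - p^-1) <=
  2 * (integral0 (speed p (1 - 2 * k ^+ 2)) (2 * asin k) -
       integral0 (speed p (1 - 2 * k ^+ 2)) (- (2 * asin k))).
Proof.
move=> k0 k1 o'; have o0 := optimal_gt; have D0 := slack_gt0; have K0 := K_gt0.
have kp := kap_gt0 p1; set kap := 1 - p^-1 in kp *.
have q2 : 0 < q ^+ 2 by rewrite exprn_gt0.
have k2 : 0 < k ^+ 2 by rewrite exprn_gt0.
rewrite action_sub// -/kap itgZ; last by apply: itb_moment1 => //; exact: ltW.
set I1' := itg _ _ _.
pose M := (q ^+ 2 / (2 * q ^+ 2 - 1)) `^ kap; pose M' := (k ^+ 2 / (2 * k ^+ 2 - 1)) `^ kap.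
have M0 : 0 < M by rewrite powR_gt0// divr_gt0.
have M'0 : 0 < M' by rewrite powR_gt0// divr_gt0.
pose dy := k ^- 2 - q ^- 2.
have i1 := itb_moment1 q0' q1.
have i3 : itb (- (pi / 2)) (pi / 2) (fun x => wgt p x * (Del q x)^-1 ^+ 3).
  by apply: itb_cont; apply: cM; [exact: cont_wgt|apply: cX; exact: cont_DelV].
have main : q * M * moment1 <= k * M' * I1'.
  rewrite -(itgZ (k * M') (itb_moment1 (ltW k0) k1)).
  pose a := q * M * (1 + kap * dy * (q ^+ 2 / (2 * q ^+ 2 - 1))).
  pose b := q * M * (2^-1 * dy * q ^+ 2).
  (* The tangent is horizontal: by [moment1E] and [moment3E] the two terms in [dy] are [kap * K] and
     half of [(2 - 2 / p) * K], with a common factor, and cancel. *)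
  have e : q * M * moment1 = itg (- (pi / 2)) (pi / 2)
      (fun x => a * (wgt p x * (Del q x)^-1) - b * (wgt p x * (Del q x)^-1 ^+ 3)).
    rewrite (itgB (itbZ _ i1) (itbZ _ i3)) (itgZ _ i1) (itgZ _ i3) -/moment1 -/moment3.
    have e3 : b * moment3 = q * M * 2^-1 * dy * ((2 - 2 / p) * K1c p q) by rewrite -moment3E /b; ring.
    have e1 : a * moment1 = q * M * moment1 + q * M * kap * dy * K1c p q.
      have -> : K1c p q = q ^+ 2 * moment1 / (2 * q ^+ 2 - 1) by rewrite moment1E mulrC mulKf// gt_eqF.
      by rewrite /a; ring.
    rewrite e1 e3 /kap; field.
    by rewrite gt_eqF// (lt_trans _ p1).
  rewrite e; apply: le_itg.
  - by apply: itbB; exact: itbZ.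
  - by apply: itbZ; apply: itb_moment1 => //; exact: ltW.
  move=> x _; have D1 := Del_gt0 q0' q1 x; have D2 := Del_gt0 (ltW k0) k1 x.
  have s1 := Del_sqr q0' q1 x; have s2 := Del_sqr (ltW k0) k1 x.
  (* With [y = q^-2] and [y' = k^-2], [z1] is the ratio of [y' - sin^2] to [y - sin^2] and [z2] that
     of [2 - y'] to [2 - y]. Both are affine in [y'], so their distances from 1 are multiples of
     [dy]. *)
  pose z1 := (q / k * (Del k x / Del q x)) ^+ 2.
  pose z2 := (2 * k ^+ 2 - 1) / k ^+ 2 * (q ^+ 2 / (2 * q ^+ 2 - 1)).
  have z10 : 0 < z1 by rewrite exprn_gt0// mulr_gt0 ?divr_gt0.
  have z20 : 0 < z2 by rewrite mulr_gt0 ?divr_gt0.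
  have := pow_tangent z10 z20 (ltW kp).
  have -> : (Num.sqrt z1)^-1 = k / q * (Del q x / Del k x).
    rewrite sqrtr_sqr gtr0_norm; last by rewrite mulr_gt0 ?divr_gt0.
    by field; rewrite qV !gt_eqF.
  have -> : z2 `^ (- kap) = M' / M.
    have a0 : 0 <= k ^+ 2 / (2 * k ^+ 2 - 1) by rewrite divr_ge0// ltW.
    have b0 : 0 <= q ^+ 2 / (2 * q ^+ 2 - 1) by rewrite divr_ge0// ltW.
    have -> : z2 = (k ^+ 2 / (2 * k ^+ 2 - 1))^-1 * (q ^+ 2 / (2 * q ^+ 2 - 1)) by rewrite invf_div.
    by rewrite powRN powRM ?invr_ge0// (powRV _ a0) invfM invrK.
  have -> : z1 - 1 = dy * q ^+ 2 / Del q x ^+ 2.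
    apply/eqP; rewrite -subr_eq0; apply/eqP.
    transitivity ((q ^+ 2 * Del k x ^+ 2 - k ^+ 2 * Del q x ^+ 2 - (q ^+ 2 - k ^+ 2)) / (k ^+ 2 * Del q x ^+ 2)).
      by rewrite /z1 /dy; field; rewrite qV !gt_eqF.
    by rewrite s1 s2; apply/eqP; rewrite mulf_eq0; apply/orP; left; apply/eqP; ring.
  have -> : z2 - 1 = - (dy * (q ^+ 2 / (2 * q ^+ 2 - 1))).
    by rewrite /z2 /dy; field; rewrite qV !gt_eqF.
  move=> h; have w0 := wgt_ge0 p x.
  have c0 : 0 <= q * M * (wgt p x / Del q x) by apply: mulr_ge0; [apply: mulr_ge0; exact: ltW|rewrite divr_ge0// ltW].
  have := ler_wpM2l c0 h.
  rewrite [X in _ <= X -> _](_ : _ = k * M' * (wgt p x / Del k x)); last first.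
    by field; rewrite qV !gt_eqF.
  rewrite [X in X <= _ -> _](_ : _ = a * (wgt p x / Del q x) - b * (wgt p x * (Del q x)^-1 ^+ 3))//.
  rewrite /a /b; move: (q ^+ 2 / (2 * q ^+ 2 - 1)) => y; field.
  by rewrite gt_eqF.
have e1 : (2 * k ^+ 2) `^ kap = 2 `^ kap * M' * (2 * k ^+ 2 - 1) `^ kap.
  rewrite /M' -mulrA -powRM ?divfK ?gt_eqF ?powRM ?ltW ?divr_gt0//.
rewrite e1 -least_actionE -/kap -/M.
have P0 : 0 < (2 * k ^+ 2 - 1) `^ kap by rewrite powR_gt0.
have T0 : 0 < 2 `^ kap :> R by rewrite powR_gt0.
have := ler_wpM2l (ltW (mulr_gt0 (mulr_gt0 (ltr0Sn R 3) T0) P0)) main.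
move=> h; apply: le_trans (le_trans h _).
  by rewrite le_eqVlt; apply/orP; left; apply/eqP; ring.
by rewrite le_eqVlt; apply/orP; left; apply/eqP; ring.
Qed.

End Optimal.

End Comparison.

(** * Energy bound for closed curves of rotation zero *)

Section LowerBound.
Context {R : realType}.
Implicit Types (f k : R -> R) (p q nu L s t u x y z : R).

(** A function with equal end values that moves from [u s] to [u t] has to make up the same distance
    on the rest of the interval. *)
Lemma variation L (u k : R -> R) s t : 0 <= s -> s <= t -> t <= L -> AC 0 L u k -> u L = u 0 ->
  2 * `|u t - u s| <= itg 0 L (fun x => `|k x|).
Proof.
move=> s0 st tL H uL; have sL := le_trans st tL; have t0 := le_trans s0 st.
have ik := AC_itb H; have ia := itb_abs ik.
have e1 : `|u t - u s| <= itg s t (fun x => `|k x|).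
  by rewrite (AC_int H s0 st tL); apply: itg_abs; exact: itb_sub ik.
have e2 : `|u s - u 0| <= itg 0 s (fun x => `|k x|).
  by rewrite (AC_int H (lexx 0) s0 sL); apply: itg_abs; exact: itb_sub (lexx 0) sL ik.
have e3 : `|u L - u t| <= itg t L (fun x => `|k x|).
  by rewrite (AC_int H t0 tL (lexx L)); apply: itg_abs; exact: itb_sub t0 (lexx L) ik.
rewrite (itg_split s0 sL ia) (itg_split st tL (itb_sub s0 (lexx L) ia)).
have e4 : `|u t - u s| <= `|u s - u 0| + `|u L - u t|.
  rewrite -normrN (_ : - (u t - u s) = (u s - u 0) + (u L - u t)); last by rewrite uL; ring.
  exact: ler_normD.
lra.
Qed.

Lemma cos_lt0 x : pi / 2 < x -> x <= pi -> cos x < 0.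
Proof.
move=> h1 h2; have pi0 := pi_gt0 R.
have -> : x = (x - pi / 2) + pi / 2 by ring.
by rewrite cosDpihalf oppr_lt0; apply: sin_gt0_pi; lra.
Qed.

Lemma cos_le_abs x y : `|x| <= y -> y <= pi -> cos y <= cos x.
Proof.
move=> xy yp; have x0 := normr_ge0 x; rewrite -(cos_norm x).
move: xy; rewrite le_eqVlt => /predU1P[->//|xy].
by apply: ltW; rewrite ltr_cos// in_itv/=; apply/andP; split; lra.
Qed.

(** The tangent inequality of the power at [n * F^(1/p)], the value for which the estimate is an
    equality; along a pendulum this is its speed. *)
Lemma young_density p n F y : 1 < p -> 0 <= n -> 0 <= F -> 0 <= y ->
  p * n `^ (p - 1) * (F `^ (1 - p^-1) * y) - (p - 1) * n `^ p * F <= y `^ p.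
Proof.
move=> p1 n0 F0 y0; have p0 : 0 < p by exact: lt_trans p1.
have x0 : 0 <= n * F `^ p^-1 by rewrite mulr_ge0// powR_ge0.
have := @convex_npow _ p (n * F `^ p^-1) y p1.
rewrite (ger0_norm x0) (ger0_norm y0) spow_ge0 ?subr_gt0//.
have e1 : (n * F `^ p^-1) `^ p = n `^ p * F.
  by rewrite powRM ?powR_ge0// -powRrM mulVf ?gt_eqF// powRr1.
have e2 : (n * F `^ p^-1) `^ (p - 1) = n `^ (p - 1) * F `^ (1 - p^-1).
  by rewrite powRM ?powR_ge0// -powRrM (_ : p^-1 * (p - 1) = 1 - p^-1)//; field; rewrite gt_eqF.
have e3 : (n * F `^ p^-1) `^ (p - 1) * (n * F `^ p^-1) = n `^ p * F.
  rewrite -e1 -{2}(powRr1 x0) -powRD; last by rewrite subrK gt_eqF.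
  by rewrite subrK.
rewrite e1; move: e2 e3; set S := (_ * _) `^ (p - 1); set X := n * _ => e2 e3 h.
apply: le_trans h; rewrite le_eqVlt; apply/orP; left; apply/eqP.
transitivity (n `^ p * F + p * (S * y) - p * (S * X)); last by ring.
by rewrite e3 e2; ring.
Qed.

(** The primitive of [speed] along [b] takes equal end values and both extreme values, so
    [variation] counts the action between the extremes twice. *)
Lemma speed_variation p L (b : R -> R) k c u0 t1 t2 : 1 < p -> 0 <= u0 -> 0 <= t1 <= L -> 0 <= t2 <= L ->
  AC 0 L b k -> b L = b 0 -> b t1 = u0 -> b t2 = - u0 ->
  2 * (integral0 (speed p c) u0 - integral0 (speed p c) (- u0)) <=
  itg 0 L (fun t => speed p c (b t) * `|k t|).
Proof.
move=> p1 u00 /andP[t10 t1L] /andP[t20 t2L] H bL e1 e2.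
have cS : continuous (speed p c) by exact: cont_speed.
have L0 := le_trans t10 t1L.
have H1 := AC_C1 H L0 (derive_integral0_cont cS) cS.
rewrite -e2 -e1.
have -> : itg 0 L (fun t => speed p c (b t) * `|k t|) = itg 0 L (fun t => `|speed p c (b t) * k t|).
  by apply: eq_itg => t _; rewrite normrM (ger0_norm (speed_ge0 _ _ _)).
have GL : integral0 (speed p c) (b L) = integral0 (speed p c) (b 0) by rewrite bL.
case: (leP t1 t2) => t12.
  apply: le_trans (variation t10 t12 t2L H1 GL).
  by rewrite ler_wpM2l// distrC ler_norm.
apply: le_trans (variation t20 (ltW t12) t1L H1 GL).
by rewrite ler_wpM2l// ler_norm.
Qed.

(** If the angle stayed in [[- pi / 2, pi / 2]], the cosine would be nonnegative with zero mean and
    vanish inside the interval; but at a zero of [sin b] it equals 1, and by continuity it is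
    positive nearby. *)
Lemma closed_range L (b : R -> R) k u0 : 0 < L -> AC 0 L b k -> closed_curve L b ->
  (forall t, 0 <= t <= L -> `|b t| <= u0) -> pi / 2 < u0.
Proof.
move=> L0 H [hc hs] hb; rewrite ltNge; apply/negP => hu; have L0' := ltW L0.
have cb := AC_cont H; have cc := ccos cb.
have c0 t : 0 <= t <= L -> 0 <= cos (b t).
  by move=> /hb h; apply: cos_ge0_pihalf; rewrite -ler_norml; exact: le_trans hu.
have z t : 0 < t < L -> cos (b t) = 0.
  move=> tL; apply/eqP; rewrite eq_le c0 ?andbT; last by case/andP: tL => /ltW -> /ltW ->.
  rewrite leNgt; apply/negP => h.
  by have := itg_pos tL (itb_cont 0 L cc) c0 (cc t) h; rewrite hc ltxx.
have [t tL st] := itg0_zero L0 (csin cb) hs.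
have ct : 0 < cos (b t).
  rewrite lt_neqAle eq_sym c0// andbT; apply/eqP => h.
  by have := cos2Dsin2 (b t); rewrite h st expr0n/= addr0 => /eqP; rewrite eq_sym oner_eq0.
have [d d0 hd] := proj1 (cont_ed _ t) (cc t) _ ct.
pose e := Num.min d L.
have e0 : 0 < e by rewrite lt_min d0.
have [ed eL] : e <= d /\ e <= L by rewrite /e !ge_min !lexx orbT.
have [y yL yt] : exists2 y, 0 < y < L & `|y - t| < d.
  have /andP[t0 tL'] := tL; case: (leP t (L / 2)) => ht.
    by exists (t + e / 4); [apply/andP; split; lra|rewrite ltr_norml; apply/andP; split; lra].
  by exists (t - e / 4); [apply/andP; split; lra|rewrite ltr_norml; apply/andP; split; lra].
by have := hd y yt; rewrite z// sub0r normrN gtr0_norm// ltxx.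
Qed.

(** Young's inequality is integrated with the density [(cos b + c0) / c0], whose integral is [L]
    because the curve is closed. What remains is the action along [b], bounded below through the
    range of [b] alone; the power of [c0] in that bound cancels the one from the density, so the
    result does not depend on the range. *)
Lemma energy_lower_bound p q L th k : 1 < p -> 0 < q -> q < 1 -> 2 * E1c p q = K1c p q -> 0 < L ->
  AC 0 L th k -> itb 0 L (fun t => `|k t| `^ p) -> closed_curve L th -> th L = th 0 ->
  L * (least_action p q / L) `^ p <= itg 0 L (fun t => `|k t| `^ p).
Proof.
move=> p1 q0 q1 EK L0 H ik [hc hs] thL; have L0' := ltW L0; have pi0 := pi_gt0 R.
have p0 : 0 < p by exact: lt_trans p1.
have kp := kap_gt0 p1; have C0 := least_action_gt0 p1 q0 q1 EK.
have cth := AC_cont H.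
have [tM tML hM] := EVT_max L0' (continuous_subspaceT cth).
have [tm tmL hm] := EVT_min L0' (continuous_subspaceT cth).
rewrite in_itv/= in tML; rewrite in_itv/= in tmL.
(* Rotating by the midpoint of its range makes the angle oscillate symmetrically between [- u0] and
   [u0]; closing is invariant under rotation. *)
pose mid := (th tM + th tm) / 2; pose u0 := (th tM - th tm) / 2.
pose b t := th t + - mid.
have Hb : AC 0 L b k.
  have := AC_D H (AC_cst 0 L (- mid)).
  by under [X in AC _ _ _ X]eq_fun do rewrite addr0.
have cb := AC_cont Hb.
have hb t : 0 <= t <= L -> `|b t| <= u0.
  move=> tL; have := hM t; have := hm t; rewrite in_itv/= tL => /(_ isT) h1 /(_ isT) h2.
  by rewrite ler_norml /b /mid /u0; apply/andP; split; lra.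
have b1 : b tM = u0 by rewrite /b /mid /u0; field.
have b2 : b tm = - u0 by rewrite /b /mid /u0; field.
have hcl : closed_curve L b := itg_rotate (- mid) cth hc hs.
have bL : b L = b 0 by rewrite /b thL.
have hu0 := closed_range L0 Hb hcl hb.
have u00 : 0 <= u0 by lra.
(* Amplitude [pi] is the top position of the comparison pendulum; beyond it [- cos] would decrease
   again. *)
pose u1 := Num.min u0 pi.
have hu1 : pi / 2 < u1 by rewrite lt_min hu0; lra.
have [u1p u10] : u1 <= pi /\ u1 <= u0 by rewrite /u1 !ge_min !lexx orbT.
pose c0 := - cos u1.
have c00 : 0 < c0 by rewrite oppr_gt0 cos_lt0.
have fb t : 0 <= t <= L -> 0 <= cos (b t) + c0.
  move=> tL; rewrite subr_ge0; have h := hb t tL.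
  rewrite /u1; case: (leP u0 pi) => hp; first exact: cos_le_abs.
  by rewrite cospi; exact: cos_geN1.
pose A := itg 0 L (fun t => (cos (b t) + c0) `^ (1 - p^-1) * `|k t|).
have ia : itb 0 L (fun t => (cos (b t) + c0) `^ (1 - p^-1) * `|k t|).
  apply: (@eq_itb _ _ _ (fun t => `|cos (b t) + c0| `^ (1 - p^-1) * `|k t|)).
    by move=> t tL; rewrite ger0_norm// fb.
  apply: itb_contM; first exact: itb_abs (AC_itb H).
  apply: (ccomp (f := fun t => cos (b t) + c0) _ (cnpow kp)).
  by apply: cD; [exact: ccos|exact: ccst].
(* For [u < pi] the modulus [sin (u / 2)] is below 1, as [action_bound] requires, and the speed with
   turning point [u] is at most the weight built from [c0]. *)
have hA u : pi / 2 < u -> u < u1 -> least_action p q * (- cos u) `^ (1 - p^-1) <= A.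
  move=> hu hu'; have up : u < pi by lra.
  pose r := sin (u / 2).
  have s2 : u / 2 \in `[(- (pi / 2) : R), pi / 2] by rewrite in_itv/=; apply/andP; split; lra.
  have ar : 2 * asin r = u by rewrite /r sinK//; field.
  have r0 : 0 < r by apply: sin_gt0_pi; lra.
  have cu : cos u = 1 - 2 * r ^+ 2 by rewrite double_cos.
  have r1 : r < 1.
    have c2 : 0 < cos (u / 2) by apply: cos_gt0_pihalf; lra.
    have := cos2Dsin2 (u / 2); rewrite -/r => h.
    have c22 : 0 < cos (u / 2) ^+ 2 by rewrite exprn_gt0.
    by rewrite -(@ltr_pXn2r _ 2) ?nnegrE ?(ltW r0)// expr1n; lra.
  have cneg := cos_lt0 hu (ltW up).
  have rr : 0 < 2 * r ^+ 2 - 1 by lra.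
  have := action_bound p1 q0 q1 EK r0 r1 rr; rewrite ar -cu.
  rewrite (_ : 2 * r ^+ 2 - 1 = - cos u); last by rewrite cu; ring.
  move=> h; apply: (le_trans h).
  have cS : continuous (speed p (cos u)) by exact: cont_speed.
  have mono y z : y <= z -> integral0 (speed p (cos u)) y <= integral0 (speed p (cos u)) z.
    move=> yz; rewrite -subr_ge0 (integral0B (fun x y => itb_cont x y cS) yz).
    by apply: itg_ge0 => x _; exact: speed_ge0.
  have uu0 : u <= u0 by exact: ltW (lt_le_trans hu' u10).
  have g1 : integral0 (speed p (cos u)) u <= integral0 (speed p (cos u)) u0 by exact: mono.
  have g2 : integral0 (speed p (cos u)) (- u0) <= integral0 (speed p (cos u)) (- u) by apply: mono; rewrite lerN2.
  have := speed_variation (cos u) p1 u00 tML tmL Hb bL b1 b2.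
  move=> h2; apply: le_trans (le_trans h2 _); first by apply: ler_wpM2l; [exact: ler0n|exact: lerB].
  apply: le_itg ia _.
    by apply: itb_contM; [exact: itb_abs (AC_itb H)|exact: ccomp cb cS].
  move=> t tL; apply: ler_wpM2r; first exact: normr_ge0.
  rewrite /speed ger0_norm ?ramp_ge0//; apply: ge0_ler_powR; rewrite ?nnegrE ?ramp_ge0 ?fb ?(ltW kp)//.
  rewrite -(ramp_id (fb t tL)); apply: ramp_le; rewrite lerD2l lerN2.
  by apply: cos_le_abs u1p; rewrite gtr0_norm ?(ltW hu')// (lt_trans _ hu)// divr_gt0.
(* The limit of [u] increasing to [u1]; it includes [u1 = pi], where the modulus is 1. *)
have hA1 : least_action p q * c0 `^ (1 - p^-1) <= A.
  rewrite leNgt; apply/negP => h.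
  have ch : continuous (fun u => least_action p q * `|- cos u| `^ (1 - p^-1)).
    apply: cZ; apply: (ccomp (f := fun u => - cos u) _ (cnpow kp)).
    by apply: cN; exact: continuous_cos.
  have e0 : 0 < least_action p q * c0 `^ (1 - p^-1) - A by rewrite subr_gt0.
  have [d d0 hd] := proj1 (cont_ed _ u1) (ch u1) _ e0.
  pose m := Num.min d (u1 - pi / 2).
  have m0 : 0 < m by rewrite lt_min d0 subr_gt0.
  have [md mu1] : m <= d /\ m <= u1 - pi / 2 by rewrite /m !ge_min !lexx orbT.
  pose u := u1 - m / 2.
  have hu : pi / 2 < u by rewrite /u; lra.
  have hu' : u < u1 by rewrite /u; lra.
  have := hA u hu hu'; have := hd u; rewrite -/c0 (ger0_norm (ltW c00)).
  have cneg : 0 <= - cos u by rewrite oppr_ge0 ltW// cos_lt0// ltW//; lra.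
  rewrite (ger0_norm cneg) => hh.
  have /hh : `|u - u1| < d by rewrite ltr_norml /u; apply/andP; split; lra.
  by rewrite ltr_norml => /andP[h1 _] h2; lra.
(* With [S] the least action, [p * n^(p-1) * S - (p-1) * n^p * L] is largest at this [n], with value
   [n^p * L]. *)
pose n := least_action p q / L.
have n0 : 0 < n by rewrite divr_gt0.
have cp0 : 0 < c0 `^ (1 - p^-1) by rewrite powR_gt0.
have ic : itb 0 L (fun t => cos (b t)) by apply: itb_cont; exact: ccos.
have ifc := itbD ic (itb_cst 0 L c0).
pose a1 := p * n `^ (p - 1) * (c0 `^ (1 - p^-1))^-1.
pose a2 := (p - 1) * n `^ p * c0^-1.
have low : itg 0 L (fun t => a1 * ((cos (b t) + c0) `^ (1 - p^-1) * `|k t|) - a2 * (cos (b t) + c0)) <=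
    itg 0 L (fun t => `|k t| `^ p).
  apply: le_itg ik _; first by apply: itbB; exact: itbZ.
  move=> t tL; have F0 := fb t tL.
  apply: le_trans (young_density p1 (ltW n0) (divr_ge0 F0 (ltW c00)) (normr_ge0 (k t))).
  rewrite (powRM _ F0) ?invr_ge0 ?(ltW c00)// (powRV _ (ltW c00)) /a1 /a2.
  by rewrite le_eqVlt; apply/orP; left; apply/eqP; ring.
apply: le_trans low.
rewrite (itgB (itbZ _ ia) (itbZ _ ifc)) (itgZ _ ia) (itgZ _ ifc) -/A (itgD ic (itb_cst 0 L c0)) hcl.1 itg_cst// add0r subr0.
have e1 : a2 * (c0 * L) = (p - 1) * n `^ p * L by rewrite /a2; field; rewrite gt_eqF.
have e2 : p * n `^ (p - 1) * least_action p q <= a1 * A.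
  have -> : p * n `^ (p - 1) * least_action p q = a1 * (least_action p q * c0 `^ (1 - p^-1)).
    by rewrite /a1; field; rewrite gt_eqF.
  apply: ler_wpM2l hA1; rewrite /a1 mulr_ge0 ?invr_ge0 ?(ltW cp0)// mulr_ge0 ?powR_ge0// ltW//.
have e3 : n `^ (p - 1) * least_action p q = n `^ p * L.
  have -> : least_action p q = n * L by rewrite /n divfK// gt_eqF.
  by rewrite (nu_pow p1 n0); ring.
rewrite e1; apply: le_trans (lerB e2 (lexx _)).
rewrite -mulrA e3 -/n.
by rewrite le_eqVlt; apply/orP; left; apply/eqP; ring.
Qed.

End LowerBound.

(** * Similarities and recovery of the unit speed parameter *)

Section FigureEightSufficient.
Context {R : realType}.
Implicit Types (k : R -> R) (p q nu L r s t x y z : R) (v w : R * R).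

Lemma enorm_sqr v : enorm v ^+ 2 = v.1 ^+ 2 + v.2 ^+ 2.
Proof. by rewrite /enorm sqr_sqrtr// addr_ge0// sqr_ge0. Qed.

Lemma enorm_ge0 v : 0 <= enorm v. Proof. exact: sqrtr_ge0. Qed.

(** After removing scale and translation, the preserved distances give, by polarization, the inner
    products of [S v] with the images [a] and [b] of the basis vectors, and these determine [S v].
    The number [d] is the determinant, 1 or -1, so reflections are included. *)
Lemma similarity_form (T : R * R -> R * R) : similarity T ->
  exists r (be d : R), [/\ 0 < r, forall v w, enorm (T v - T w) = r * enorm (v - w), d ^+ 2 = 1 &
    forall v, T v = ((T 0).1 + r * (v.1 * cos be - d * v.2 * sin be),
                     (T 0).2 + r * (v.1 * sin be + d * v.2 * cos be))].
Proof.
move=> [r r0 hT]; have rV : r != 0 by rewrite gt_eqF.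
pose S v := (((T v).1 - (T 0).1) / r, ((T v).2 - (T 0).2) / r).
have hS v w : ((S v).1 - (S w).1) ^+ 2 + ((S v).2 - (S w).2) ^+ 2 =
    (v.1 - w.1) ^+ 2 + (v.2 - w.2) ^+ 2.
  have := congr1 (fun x => x ^+ 2) (hT v w); rewrite exprMn !enorm_sqr /= => h.
  apply: (mulfI (_ : r ^+ 2 != 0)); first by rewrite expf_neq0.
  by rewrite -h /S /=; field.
have S0 : S 0 = (0, 0) by rewrite /S !subrr !mul0r.
pose a := S (1, 0); pose b := S (0, 1).
have nS v : (S v).1 ^+ 2 + (S v).2 ^+ 2 = v.1 ^+ 2 + v.2 ^+ 2.
  by have := hS v 0; rewrite S0 /= !subr0.
have na := nS (1, 0); have nb := nS (0, 1); rewrite -/a /= in na; rewrite -/b /= in nb.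
have ia v : (S v).1 * a.1 + (S v).2 * a.2 = v.1.
  have := hS v (1, 0); have := nS v; rewrite -/a /= => h1 h2.
  move: h2 h1 na; clear; rewrite !sqrrB => h2 h1 h3; lra.
have ib v : (S v).1 * b.1 + (S v).2 * b.2 = v.2.
  have := hS v (0, 1); have := nS v; rewrite -/b /= => h1 h2.
  move: h2 h1 nb; clear; rewrite !sqrrB => h2 h1 h3; lra.
have [|be [_ _ a1 a2]] := @polar _ a.1 a.2; first by rewrite na; ring.
have ab := ib (1, 0); rewrite -/a /= in ab.
pose d := a.1 * b.2 - a.2 * b.1.
have na1 : a.1 ^+ 2 + a.2 ^+ 2 = 1 by rewrite na; ring.
have nb1 : b.1 ^+ 2 + b.2 ^+ 2 = 1 by rewrite nb; ring.
have bd1 : b.1 = - d * a.2.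
  transitivity (b.1 * (a.1 ^+ 2 + a.2 ^+ 2) - a.1 * (a.1 * b.1 + a.2 * b.2)); first by rewrite na1 ab; ring.
  by rewrite /d; ring.
have bd2 : b.2 = d * a.1.
  transitivity (b.2 * (a.1 ^+ 2 + a.2 ^+ 2) - a.2 * (a.1 * b.1 + a.2 * b.2)); first by rewrite na1 ab; ring.
  by rewrite /d; ring.
have d1 : d ^+ 2 = 1.
  transitivity ((a.1 ^+ 2 + a.2 ^+ 2) * (b.1 ^+ 2 + b.2 ^+ 2) - (a.1 * b.1 + a.2 * b.2) ^+ 2); first by rewrite /d; ring.
  by rewrite na1 nb1 ab; ring.
exists r, be, d; split => // v.
have Sp : (S v).1 * - a.2 + (S v).2 * a.1 = d * v.2.
  transitivity (d ^+ 2 * ((S v).1 * - a.2 + (S v).2 * a.1)); first by rewrite d1 mul1r.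
  by rewrite -(ib v) bd1 bd2; ring.
have s1 : (S v).1 = v.1 * a.1 - d * v.2 * a.2.
  by rewrite -Sp -(ia v); transitivity ((S v).1 * (a.1 ^+ 2 + a.2 ^+ 2)); [rewrite na1 mulr1|ring].
have s2 : (S v).2 = v.1 * a.2 + d * v.2 * a.1.
  by rewrite -Sp -(ia v); transitivity ((S v).2 * (a.1 ^+ 2 + a.2 ^+ 2)); [rewrite na1 mulr1|ring].
rewrite -a1 -a2 -s1 -s2 /S /= ![r * _]mulrC !divfK//.
by rewrite !subrKC -surjective_pairing.
Qed.

Definition chord (th : R -> R) s t : R * R :=
  (itg s t (fun x => cos (th x)), itg s t (fun x => sin (th x))).

Lemma chord_proj (th : R -> R) s t al : continuous th ->
  cos al * (chord th s t).1 + sin al * (chord th s t).2 = itg s t (fun x => cos (th x - al)).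
Proof.
move=> ct; have i1 : itb s t (fun x => cos (th x)) by apply: itb_cont; exact: ccos.
have i2 : itb s t (fun x => sin (th x)) by apply: itb_cont; exact: csin.
rewrite /chord /= -(itgZ _ i1) -(itgZ _ i2) -(itgD (itbZ _ i1) (itbZ _ i2)).
by apply: eq_itg => x _; rewrite cosB; ring.
Qed.

(** The chord is measured in its own direction, where every unit tangent has component at most 1. *)
Lemma chord_le (th : R -> R) s t : continuous th -> s <= t -> enorm (chord th s t) <= t - s.
Proof.
move=> ct st; have [h|h] := eqVneq ((chord th s t).1 ^+ 2 + (chord th s t).2 ^+ 2) 0.
  by rewrite /enorm h sqrtr0 subr_ge0.
have [r [al [r0 e1 e2]]] := polar_radius h.
have -> : enorm (chord th s t) = r.
  rewrite /enorm e1 e2 !exprMn -mulrDr cos2Dsin2 mulr1 sqrtr_sqr; exact: gtr0_norm.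
have <- : cos al * (chord th s t).1 + sin al * (chord th s t).2 = r.
  by rewrite e1 e2; transitivity (r * (cos al ^+ 2 + sin al ^+ 2)); [ring|rewrite cos2Dsin2 mulr1].
have cth' : continuous (fun x => th x - al) by apply: cB => //; exact: ccst.
rewrite chord_proj// -[leRHS]mul1r -itg_cst//; apply: le_itg; [|exact: itb_cst|].
  by apply: itb_cont; exact: ccos.
by move=> x _; exact: cos_le1.
Qed.

(** A vector is at least as long as its component in the direction [al]. *)
Lemma chord_ge (th : R -> R) s t al c : continuous th -> s <= t ->
  (forall x, s <= x <= t -> c <= cos (th x - al)) -> c * (t - s) <= enorm (chord th s t).
Proof.
move=> ct st h.
have cth' : continuous (fun x => th x - al) by apply: cB => //; exact: ccst.
apply: (@le_trans _ _ (itg s t (fun x => cos (th x - al)))).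
  by rewrite -itg_cst//; apply: le_itg => //; [exact: itb_cst|apply: itb_cont; exact: ccos].
rewrite -chord_proj//; set v := chord th s t.
have cs := cos2Dsin2 al.
have : (cos al * v.1 + sin al * v.2) ^+ 2 <= enorm v ^+ 2.
  rewrite enorm_sqr -subr_ge0.
  have -> : v.1 ^+ 2 + v.2 ^+ 2 - (cos al * v.1 + sin al * v.2) ^+ 2 = (cos al * v.2 - sin al * v.1) ^+ 2.
    by rewrite -[v.1 ^+ 2 + _]mul1r -cs; ring.
  exact: sqr_ge0.
move=> h2; apply: le_trans (ler_norm _) _.
by rewrite -(@ler_pXn2r _ 2) ?nnegrE ?enorm_ge0// real_normK ?num_real.
Qed.

Lemma chord_local (th : R -> R) x e : continuous th -> 0 < e -> exists2 d, 0 < d &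
  forall s t, x - d < s -> s <= t -> t < x + d -> (1 - e) * (t - s) <= enorm (chord th s t).
Proof.
move=> ct e0.
have cth' : continuous (fun y => cos (th y - th x)) by apply: ccos; apply: cB => //; exact: ccst.
have [d d0 hd] := proj1 (cont_ed _ x) (cth' x) _ e0.
exists d => // s t ds st td; apply: (@chord_ge _ _ _ (th x)) => // y /andP[sy yt].
have : `|y - x| < d by rewrite ltr_norml; apply/andP; split; lra.
by move=> /hd; rewrite subrr cos0 ltr_norml => /andP[h _]; lra.
Qed.

(* Comparing arc length with chord length on both sides forces a monotone
   change of parameter between unit speed curves to be affine. *)
Lemma unit_speed_affine L r (th tw sg : R -> R) : 0 < L -> 0 < r ->
  continuous th -> continuous tw -> {within `[0, L], continuous sg} ->
  (forall s t, 0 <= s -> s <= t -> t <= L -> sg s <= sg t /\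
     enorm (chord th s t) = r * enorm (chord tw (sg s) (sg t))) ->
  forall t, 0 <= t <= L -> r * (sg t - sg 0) = t.
Proof.
move=> L0 r0 cth ctw csg h t /andP[t0 tL]; have L0' := ltW L0.
have csg' : continuous (fun t => sg (pr 0 L t)) by exact: cont_pr.
suff key e : 0 < e -> e < 1 -> (1 - e) * t <= r * (sg t - sg 0) /\ (1 - e) * (r * (sg t - sg 0)) <= t.
  have m0 : 0 <= sg t - sg 0 by rewrite subr_ge0; exact: (h 0 t (lexx 0) t0 tL).1.
  have m0' : 0 <= r * (sg t - sg 0) by rewrite mulr_ge0// ltW.
  move: m0' key t0; set z := r * _; clear => z0 key t0.
  have lim (a b : R) : 0 <= a -> (forall e, 0 < e -> e < 1 -> (1 - e) * a <= b) -> a <= b.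
    move=> a0 hab; rewrite leNgt; apply/negP => ba.
    pose e := Num.min (1 / 2) ((a - b) / (2 * (a + 1))).
    have a1 : 0 < 2 * (a + 1) by lra.
    have e0 : 0 < e by rewrite lt_min divr_gt0//; [rewrite divr_gt0// subr_gt0].
    have [e1 e2] : e <= 1 / 2 /\ e <= (a - b) / (2 * (a + 1)) by rewrite /e !ge_min !lexx orbT.
    have := hab e e0 ltac:(lra).
    have : e * (2 * (a + 1)) <= a - b by rewrite -ler_pdivlMr.
    have : 0 <= e * a by rewrite mulr_ge0// ltW.
    by lra.
  apply/eqP; rewrite eq_le; apply/andP; split; apply: lim => //.
  - by move=> e e0 e1; exact: (key e e0 e1).2.
  - by move=> e e0 e1; exact: (key e e0 e1).1.
move=> e0 e1.
pose P a b := (1 - e) * (b - a) <= r * (sg b - sg a) /\ (1 - e) * (r * (sg b - sg a)) <= b - a.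
have : P 0 t; last by rewrite /P subr0.
apply: (@creep _ 0 t P) => //; last first.
  by move=> a b c _ ab bc _ [h1 h2] [h3 h4]; rewrite /P; split; lra.
move=> x /andP[x0 xt].
have [d1 d10 hd1] := chord_local x cth e0.
have [d2 d20 hd2] := chord_local (sg (pr 0 L x)) ctw e0.
have [d3 d30 hd3] := proj1 (cont_ed _ x) (csg' x) _ d20.
exists (Num.min d1 d3); first by rewrite lt_min d10.
move=> a b a0 ax xb bt da db.
have {da}[da1 da3] : x - d1 < a /\ x - d3 < a by move: da; clear; case: (leP d1 d3); lra.
have {db}[db1 db3] : b < x + d1 /\ b < x + d3 by move: db; clear; case: (leP d1 d3); lra.
have ab := le_trans ax xb; have bL := le_trans bt tL; have aL := le_trans ab bL; have b0 := le_trans a0 ab.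
have [mab eab] := h a b a0 ab bL.
have g1 := hd1 a b da1 ab db1.
have g2 := chord_le cth ab.
have g3 := chord_le ctw mab.
have ha := hd3 a; have hb := hd3 b.
rewrite !(pr_id (t := a)) ?a0// in ha; rewrite !(pr_id (t := b)) ?b0// in hb.
have /ha {}ha : `|a - x| < d3 by rewrite ltr_norml; apply/andP; split; lra.
have /hb {}hb : `|b - x| < d3 by rewrite ltr_norml; apply/andP; split; lra.
have g4 := hd2 (sg a) (sg b).
move: ha hb; rewrite !ltr_norml => /andP[ha1 ha2] /andP[hb1 hb2].
have {}g4 := g4 ltac:(clear -ha1; lra) mab ltac:(clear -hb2; lra).
have g5 : r * enorm (chord tw (sg a) (sg b)) <= r * (sg b - sg a) by rewrite ler_pM2l.
have g6 : r * ((1 - e) * (sg b - sg a)) <= r * enorm (chord tw (sg a) (sg b)) by rewrite ler_pM2l.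
rewrite eab in g1 g2.
move: g1 g2 g5 g6; set n := r * enorm _; clear => g1 g2 g5 g6.
by split; [lra|rewrite mulrCA; lra].
Qed.

End FigureEightSufficient.

(** * Minimality of the figure eight *)

Section FigureEightMinimal.
Context {R : realType}.
Implicit Types (k : R -> R) (p q nu L r s t x y z : R) (v w : R * R).

Lemma am_opp p q s : 1 < p -> 0 <= q -> q < 1 -> am1 p (- s) q = - am1 p s q.
Proof. by move=> p1 q0 q1; apply: (F1_inj p1 q0 q1); rewrite (F1N p1 q0 q1) !F1_am. Qed.

Lemma gamma_opp p q s : 1 < p -> 0 <= q -> q < 1 ->
  gamma_w p (- s) q = (- (gamma_w p s q).1, (gamma_w p s q).2).
Proof.
move=> p1 q0 q1; rewrite /gamma_w /cnp am_opp// (E1N _ p1) cosN; congr (_, _).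
by rewrite /=; ring.
Qed.

(** Treats the default value 0 of [qstar]: the profile is then a straight line. *)
Lemma gamma_straight p s : 1 < p -> gamma_w p s 0 = (s, 0).
Proof.
move=> p1; rewrite /gamma_w !mul0r oppr0.
have -> : E1 p (am1 p s 0) 0 = F1 p (am1 p s 0) 0.
  rewrite /E1 /F1; congr integral0; apply/funext => x.
  by rewrite expr0n/= mul0r subr0 sqrtr1 mul1r divr1.
by rewrite F1_am//; congr (_, _); ring.
Qed.

Lemma tangent_chord L p (g : curve L p) th k s t : 0 < L -> 1 < p -> tangent g th k ->
  0 <= s -> s <= t -> t <= L -> pos g t - pos g s = chord th s t.
Proof.
move=> L0 p1 T s0 st tL; have sL := le_trans st tL; have t0 := le_trans s0 st.
have [H _] := T; have ct := AC_cont H.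
rewrite (tangent_pos (t := t) L0 p1 T) ?t0// (tangent_pos (t := s) L0 p1 T) ?s0//.
have i1 : itb 0 t (fun x => cos (th x)) by apply: itb_cont; exact: ccos.
have i2 : itb 0 t (fun x => sin (th x)) by apply: itb_cont; exact: csin.
rewrite (itg_split s0 st i1) (itg_split s0 st i2) /chord.
by apply: injective_projections => /=; ring.
Qed.

Lemma gamma_chord p q s t : 1 < p -> 0 < q -> q < 1 -> s <= t ->
  gamma_w p t q - gamma_w p s q = chord (thw p q) s t.
Proof.
move=> p1 q0 q1 st; have ct : continuous (thw p q) by exact: cont_thw.
have h1 := AC_int (AC_FTC st (ccos ct) (derive_gamma1 p1 q0 q1)) (lexx s) st (lexx t).
have h2 := AC_int (AC_FTC st (csin ct) (derive_gamma2 p1 q0 q1)) (lexx s) st (lexx t).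
by rewrite /chord -h1 -h2.
Qed.

(** [|cnp|^p] is the squared cosine of the amplitude, hence affine in the cosine of the tangent
    angle, and the latter integrates to 0. The result is exactly the value in
    [energy_lower_bound]. *)
Lemma curw_energy p q nu s0 L : 1 < p -> 0 < q -> q < 1 -> 0 < nu -> 0 < L ->
  2 * E1c p q = K1c p q -> nu / (2 * q) * L = 4 * K1c p q ->
  itg 0 L (fun t => `|curw p q nu s0 t| `^ p) = L * (least_action p q / L) `^ p.
Proof.
move=> p1 q0 q1 nu0 L0 EK cL; have p0 : 0 < p by exact: lt_trans p1.
have qV : q != 0 by rewrite gt_eqF.
have [hc _] : itg 0 (0 + L) (fun t => cos (angw p q nu s0 t)) = 0 /\
    itg 0 (0 + L) (fun t => sin (angw p q nu s0 t)) = 0.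
  by apply: (@closed_period _ p q nu s0 1) => //; [exact: ltW|rewrite mulr1].
rewrite add0r in hc.
have cB : continuous (angw p q nu s0) by exact: cont_angw.
have i1 := itb_cont 0 L (ccos cB).
transitivity (itg 0 L (fun t => nu `^ p / (2 * q ^+ 2) * (cos (angw p q nu s0 t) + (2 * q ^+ 2 - 1)))).
  apply: eq_itg => t _; rewrite /curw /cosp normrM (gtr0_norm nu0) norm_spow ?two_div_gt0//.
  rewrite powRM ?powR_ge0 ?ltW// -powRrM divfK ?gt_eqF// powR_mulrn// real_normK ?num_real//.
  rewrite /angw cos_thw// cos2sin2; field; exact: qV.
have ic := itb_cst 0 L (2 * q ^+ 2 - 1).
rewrite (itgZ _ (itbD i1 ic)) (itgD i1 ic) hc itg_cst ?ltW// add0r subr0.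
have nuE : nu = 8 * q * K1c p q / L.
  have -> : K1c p q = nu / (2 * q) * L / 4 by rewrite cL; field.
  by field; rewrite qV gt_eqF.
have D0 := slack_gt0 p1 q0 q1 EK.
have -> : least_action p q / L = nu * slack q `^ p^-1 by rewrite /least_action nuE; ring.
rewrite powRM ?powR_ge0 ?ltW// -powRrM mulVf ?gt_eqF// powRr1 ?ltW// /slack.
by field; exact: qV.
Qed.

(** Chords of the curve are [r] times chords of the profile, so [unit_speed_affine] makes [sg]
    affine of slope [1 / r]. The explicit angle [d * B + be] then shows both rotation 0 and the
    energy; a reflection only changes the sign of the curvature. *)
Lemma figure_eight_tangent L p q (g : curve L p) th k (T : R * R -> R * R) (sg : R -> R) :
  0 < L -> 1 < p -> 0 < q -> q < 1 -> 2 * E1c p q = K1c p q ->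
  tangent g th k -> similarity T -> {within `[0, L], continuous sg} ->
  (forall s t, 0 <= s -> s <= t -> t <= L -> sg s <= sg t) -> sg L - sg 0 = 4 * K1c p q ->
  (forall t, 0 <= t <= L -> pos g t = T (gamma_w p (sg t) q)) ->
  exists th' k', [/\ tangent g th' k', th' L = th' 0 &
    itg 0 L (fun t => `|k' t| `^ p) = L * (least_action p q / L) `^ p].
Proof.
move=> L0 p1 q0 q1 EK Tg simT csg msg sgL hT; have L0' := ltW L0.
have [r [be [d [r0 hr d1 TE]]]] := similarity_form simT.
have [H _] := Tg; have cth := AC_cont H.
have rV : r != 0 by rewrite gt_eqF.
have qV : q != 0 by rewrite gt_eqF.
have ctw : continuous (thw p q) by exact: cont_thw.
have aff : forall t, 0 <= t <= L -> r * (sg t - sg 0) = t.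
  apply: (unit_speed_affine L0 r0 cth ctw csg) => s t s0 st tL; split; first exact: msg.
  rewrite -(tangent_chord L0 p1 Tg s0 st tL) -gamma_chord ?msg// !hT ?hr//.
  - by rewrite s0 (le_trans st).
  - by rewrite (le_trans s0 st).
(* Chosen so that the parameter speed [nu / (2 * q)] equals the slope [1 / r] of [sg]. *)
pose nu := 2 * q / r; pose s1 := sg 0.
have nu0 : 0 < nu by rewrite divr_gt0// mulr_gt0.
have nuV : nu / (2 * q) = r^-1 by rewrite /nu; field; rewrite qV rV.
have sgE t : 0 <= t <= L -> sg t = par q nu s1 t.
  by move=> tL; rewrite /par nuV -{2}(aff t tL) mulKf// subrK.
have cL : nu / (2 * q) * L = 4 * K1c p q.
  by rewrite nuV -sgL -{1}(aff L) ?L0' ?lexx// mulKf.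
set B := angw p q nu s1; set K := curw p q nu s1.
have cBw : continuous B by exact: cont_angw.
have cK : continuous K by exact: cont_curw.
have dB' (x : R) : is_derive x 1 B (K x) by exact: derive_angw.
have dg1 (x : R) : is_derive x 1 (fun t => (gamma_w p (par q nu s1 t) q).1) (cos (B x) * r^-1).
  by rewrite -nuV; exact: (derive_par (U := fun s => (gamma_w p s q).1) (derive_gamma1 p1 q0 q1 (par q nu s1 x))).
have dg2 (x : R) : is_derive x 1 (fun t => (gamma_w p (par q nu s1 t) q).2) (sin (B x) * r^-1).
  by rewrite -nuV; exact: (derive_par (U := fun s => (gamma_w p s q).2) (derive_gamma2 p1 q0 q1 (par q nu s1 x))).
have dX (x : R) : is_derive x 1 (fun t => (T 0).1 + r * (cos be * (gamma_w p (par q nu s1 t) q).1 -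
    d * sin be * (gamma_w p (par q nu s1 t) q).2)) (cos be * cos (B x) - sin be * (d * sin (B x))).
  apply: (is_derive_eq (dD (dcst x _) (dZ r (dB (dZ (cos be) (dg1 x)) (dZ (d * sin be) (dg2 x)))))).
  by field.
have dY (x : R) : is_derive x 1 (fun t => (T 0).2 + r * (sin be * (gamma_w p (par q nu s1 t) q).1 +
    d * cos be * (gamma_w p (par q nu s1 t) q).2)) (sin be * cos (B x) + cos be * (d * sin (B x))).
  apply: (is_derive_eq (dD (dcst x _) (dZ r (dD (dZ (sin be) (dg1 x)) (dZ (d * cos be) (dg2 x)))))).
  by field.
have cX : continuous (fun x => cos be * cos (B x) - sin be * (d * sin (B x))).
  by apply: cB; [apply: cZ; exact: ccos|apply: cZ; apply: cZ; exact: csin].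
have cY : continuous (fun x => sin be * cos (B x) + cos be * (d * sin (B x))).
  by apply: cD; [apply: cZ; exact: ccos|apply: cZ; apply: cZ; exact: csin].
have hpos t : 0 <= t <= L -> pos g t =
    ((T 0).1 + r * (cos be * (gamma_w p (par q nu s1 t) q).1 - d * sin be * (gamma_w p (par q nu s1 t) q).2),
     (T 0).2 + r * (sin be * (gamma_w p (par q nu s1 t) q).1 + d * cos be * (gamma_w p (par q nu s1 t) q).2)).
  move=> tL; rewrite (hT t tL) (sgE t tL) TE; move: (gamma_w _ _ _) => v.
  by congr (_, _); ring.
have hv := pos_vel L0 dX dY cX cY hpos.
have dcs x : cos (d * x) = cos x /\ sin (d * x) = d * sin x.
  move/eqP : d1; rewrite sqrf_eq1 => /orP[] /eqP ->; first by rewrite !mul1r.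
  by rewrite !mulN1r cosN sinN.
have BL : B L = B 0.
  rewrite /B /angw -[X in par q nu s1 X]add0r.
  have -> : par q nu s1 (0 + L) = par q nu s1 0 + 4 * 1%:R * K1c p q.
    by rewrite mulr1 -cL /par; ring.
  by have [-> _] := thw_shift p1 q0 q1 (par q nu s1 0) 1.
exists (fun t => d * B t + be), (fun t => d * K t); split.
- split; last first.
    move=> t tL; rewrite (hv t tL); have [h1 h2] := dcs (B t).
    by rewrite cosD sinD h1 h2; congr (_, _); ring.
  apply: AC_FTC L0' (cZ cK) _ => x.
  by apply: (is_derive_eq (dD (dZ d (dB' x)) (dcst x be))); rewrite addr0.
- by rewrite BL.
- rewrite -(curw_energy s1 p1 q0 q1 nu0 L0 EK cL); apply: eq_itg => t _.
  have dn : `|d| = 1 by apply/eqP; rewrite -(@eqrXn2 _ 2)// real_normK ?num_real// d1 expr1n.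
  by rewrite normrM dn mul1r.
Qed.

Lemma qstar_or p : (0 < qstar p < 1 /\ 2 * E1c p (qstar p) = K1c p (qstar p)) \/ qstar p = 0 :> R.
Proof.
rewrite /qstar; case: xgetP => [q _ h|_]; [left; exact: h|by right].
Qed.

Lemma figure_eight_sufficient L p P V (g : curve L p) : 0 < L -> 1 < p -> clamped P P V V g ->
  m_fold_figure_eight L p 1 (pos g) ->
  local_minimizer (@bending_energy R L p) (clamped P P V V) g.
Proof.
move=> L0 p1 hg [T [phi [s0 [simT cphi [bphi iphi sphi] hT]]]]; have L0' := ltW L0.
have i0 : (0 : R) <= 0 <= L by rewrite lexx L0'.
have iL : (0 : R) <= L <= L by rewrite lexx L0'.
have inj x y : 0 <= x <= L -> 0 <= y <= L -> phi x = phi y -> x = y.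
  by move=> hx hy; apply: iphi; rewrite inE/= in_itv.
have [_ hg0 hgL _ _] := hg.
have [th [k [Tg _ _ _]]] := clamped_tangent L0 p1 hg.
have [[/andP[q0 q1] EK]|q0] := qstar_or p; last first.
  (* a straight profile cannot close up *)
  exfalso; have := simT => -[r r0 hr].
  have := hr (gamma_w p (phi 0 + s0) (qstar p)) (gamma_w p (phi L + s0) (qstar p)).
  rewrite -!hT// hg0 hgL subrr q0 !gamma_straight// => /esym/eqP.
  rewrite {2}/enorm !expr0n/= addr0 sqrtr0 mulf_eq0 (gt_eqF r0)/= => /eqP h.
  have := enorm_sqr ((phi 0 + s0, 0) - (phi L + s0, 0)); rewrite h /= subrr !expr0n/= addr0.
  move=> /esym/eqP; rewrite sqrf_eq0 subr_eq0 => /eqP/addIr/(inj _ _ i0 iL) h0.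
  by move: L0; rewrite -h0 ltxx.
set q := qstar p in q0 q1 EK hT bphi sphi.
have K0 := K1c_gt0 p1 (ltW q0) q1.
have bp x : 0 <= x <= L -> 0 <= phi x <= 4 * K1c p q.
  by move=> hx; have := bphi x; rewrite /= !in_itv/= mulr1; apply.
have sp y : 0 <= y <= 4 * K1c p q -> exists2 x, 0 <= x <= L & phi x = y.
  move=> hy; have := sphi y; rewrite /= in_itv/= mulr1 => /(_ hy)[x hx <-].
  by exists x => //; move: hx; rewrite /= in_itv.
have inj' : {in `[0, L] &, injective phi}.
  by move=> x y; rewrite !in_itv/= => hx hy; exact: inj.
have o0 : (0 : R) \in `[0, L] by rewrite in_itv.
have oL : L \in `[0, L] by rewrite in_itv.
have [y0 hy0 e0] := sp 0 ltac:(rewrite lexx/=; lra).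
have [y4 hy4 e4] := sp (4 * K1c p q) ltac:(rewrite lexx andbT; lra).
have q0' := ltW q0.
have [th' [k' [T' thL E]]] : exists th' k', [/\ tangent g th' k', th' L = th' 0 &
    itg 0 L (fun t => `|k' t| `^ p) = L * (least_action p q / L) `^ p].
  (* A continuous injection of a segment is monotone, and surjectivity sends its ends to the ends of
     the period. *)
  case: (leP (phi 0) (phi L)) => hphi.
  - have mono := segment_continuous_inj_le hphi cphi inj'.
    have f0 : phi 0 = 0.
      apply/eqP; rewrite eq_le; have /andP[-> _] := bp 0 i0; rewrite andbT -[X in _ <= X]e0 mono ?in_itv//.
      by case/andP: hy0.
    have fL : phi L = 4 * K1c p q.
      apply/eqP; rewrite eq_le; have /andP[_ ->] := bp L iL; rewrite /= -[X in X <= _]e4 mono ?in_itv//.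
      by case/andP: hy4.
    apply: (figure_eight_tangent L0 p1 q0 q1 EK Tg simT (sg := fun t => phi t + s0)) => //.
    + move=> x; apply: cvgD; [exact: cphi|exact: cvg_cst].
    + move=> s t s0' st tL; rewrite lerD2r mono ?in_itv//=; first by rewrite s0' (le_trans st).
      by rewrite (le_trans s0').
    + by rewrite f0 fL; ring.
  - have mono := segment_continuous_inj_ge (ltW hphi) cphi inj'.
    have f0 : phi 0 = 4 * K1c p q.
      apply/eqP; rewrite eq_le; have /andP[_ ->] := bp 0 i0; rewrite /= -[X in X <= _]e4 mono ?in_itv//.
      by case/andP: hy4.
    have fL : phi L = 0.
      apply/eqP; rewrite eq_le; have /andP[-> _] := bp L iL; rewrite andbT -[X in _ <= X]e0 mono ?in_itv//.
      by case/andP: hy0.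
    (* reverse the parameter: [gamma_w (- s)] is a reflection of [gamma_w s] *)
    have simT' : similarity (fun v => T (- v.1, v.2)).
      have [r r0 hr] := simT; exists r => // v w; rewrite hr /enorm /=; congr (_ * Num.sqrt _); ring.
    apply: (figure_eight_tangent L0 p1 q0 q1 EK Tg simT' (sg := fun t => - (phi t + s0))).
    + move=> x; apply: cvgN; apply: cvgD; [exact: cphi|exact: cvg_cst].
    + move=> s t s0' st tL; rewrite lerN2 lerD2r mono ?in_itv//=; last by rewrite s0' (le_trans st).
      by rewrite (le_trans s0').
    + by rewrite f0 fL; ring.
    + by move=> t tL; rewrite hT// gamma_opp//; case: (gamma_w _ _ _) => a b /=; rewrite opprK.
split; first exact: hg.
have [e e0' he] := near_rotation L0 p1 hg T'.
exists e; first exact: e0'.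
move=> h hh hd; have [th2 [k2 [T2 th0 thL2 hc]]] := he h hh hd.
have [H2 _] := T2; have ik2 := tangent_npow L0 p1 T2.
rewrite (tangent_energy L0 p1 T') (tangent_energy L0 p1 T2) lee_fin E.
by apply: (energy_lower_bound p1 q0 q1 EK L0 H2 ik2 hc); rewrite thL2 thL th0.
Qed.

End FigureEightMinimal.

Theorem theorem2p9 (R : realType) (L p : R) (P0 P1 V0 V1 : R * R)
    (hL : 0 < L) (hP : enorm (P0 - P1) < L)
    (hV0 : enorm V0 = 1) (hV1 : enorm V1 = 1) (hp : 1 < p)
    (g : curve L p) (hg : clamped P0 P1 V0 V1 g)
    (hP01 : P0 = P1) (hV01 : V0 = V1) :
  local_minimizer (@bending_energy R L p) (clamped P0 P1 V0 V1) g <->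
  ((exists m : nat, (1 <= m)%N /\ m_fold_circle L m (pos g)) \/
   m_fold_figure_eight L p 1 (pos g)).
Proof.
subst P1 V1; split; first exact: necessity.
case=> [[m [_ hm]]|h]; first exact: circle_sufficient hm.
exact: figure_eight_sufficient h.
Qed.
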